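(* Let $n\ge1$ and let $\Omega\subset\mathbb{R}^{n+1}$ be a bounded convex domain whose boundary $\Sigma=\partial\Omega$ is a smooth, closed convex hypersurface. Then $$n\,\delta_2\left(\Omega,B_0\left(\frac{I_{n-1}}{\omega_n}\right)\right)^2\le\int_\Sigma H_n|X|^2\,d\mu-\frac{n+1}{\omega_n}I_{n-1}^2+nI_{n-2}.$$ Equality holds if and only if $\Sigma$ is a sphere centered at the origin.
   Context: $X$ is the position vector, $d\mu$ the induced area measure, $\kappa_1,\dots,\kappa_n$ the principal curvatures of $\Sigma$ with respect to the outward unit normal (positive for round spheres), $H_j=\binom{n}{j}^{-1}\sigma_j(\kappa)$ with $\sigma_j$ the $j$-th elementary symmetric polynomial ($H_0=1$). $I_{-1}=(n+1)|\Omega|$, $I_j=\int_\Sigma H_j\,d\mu$ for $0\le j\le n$. $\omega_n=|\mathbb{S}^n|$ is the area of the unit sphere. $B_0(r)$ is the ball of radius $r$ centered at the origin. For convex bodies $K_1,K_2$ in $\mathbb{R}^{n+1}$ with support functions $u_{K_1},u_{K_2}:\mathbb{S}^n\to\mathbb{R}$, $\delta_2(K_1,K_2)=\left(\int_{\mathbb{S}^n}(u_{K_1}-u_{K_2})^2\,d\theta\right)^{1/2}$, with $d\theta$ the standard measure on $\mathbb{S}^n$. *)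

(* Defs.v *)
From HB Require Import structures.
From mathcomp Require Import all_boot all_order all_algebra.
From mathcomp Require Import all_classical all_reals all_analysis.

Set Implicit Arguments.
Unset Strict Implicit.
Unset Printing Implicit Defensive.

Import Order.TTheory GRing.Theory Num.Theory.
Import numFieldNormedType.Exports.

Local Open Scope classical_set_scope.
Local Open Scope ring_scope.

(* 'rV[R]_n carries the sigma-algebra generated by the coordinates, as
   n.-tuple R does in the library; it is the Borel sigma-algebra of R^n. *)
Section measurable_rV.
Context {R : realType} (n : nat).

Let coors : 'I_n -> 'rV[R]_n -> R := fun i x => x ord0 i.

Let rV_set0 : g_sigma_preimage coors set0.
Proof. exact: sigma_algebra0. Qed.

Let rV_setC A : g_sigma_preimage coors A -> g_sigma_preimage coors (~` A).
Proof. exact: sigma_algebraC. Qed.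

Let rV_bigcup (F : _^nat) : (forall i, g_sigma_preimage coors (F i)) ->
  g_sigma_preimage coors (\bigcup_i (F i)).
Proof. exact: sigma_algebra_bigcup. Qed.

HB.instance Definition _ :=
  @isMeasurable.Build (measure_tuple_display default_measure_display)
    'rV[R]_n (g_sigma_preimage coors) rV_set0 rV_setC rV_bigcup.

End measurable_rV.

Lemma measurable_rV_coord (R : realType) n (i : 'I_n) :
  measurable_fun [set: 'rV[R]_n] (fun x => x ord0 i).
Proof.
move=> _ Y mY; rewrite setTI; apply: sub_sigma_algebra => /=.
rewrite -bigcup_seq/=; exists i => /=; first by rewrite mem_index_enum.
by exists Y => //; rewrite setTI.
Qed.

Lemma measurable_to_rV d (T : measurableType d) (R : realType) n
    (f : T -> 'rV[R]_n) :
  (forall i, measurable_fun setT (fun x => f x ord0 i)) -> measurable_fun setT f.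
Proof.
move=> mf; rewrite /measurable_fun => _ A mA; rewrite setTI.
pose G : set (set 'rV[R]_n) := image_set_system setT f measurable.
suff : G A by rewrite /G/= /image_set_system/= setTI.
have sG : sigma_algebra setT G.
  exact/sigma_algebra_image/sigma_algebra_measurable.
move: A mA; apply: smallest_sub => // B.
rewrite -bigcup_seq => -[i /= _ [Y mY <-]].
rewrite /G /image_set_system/= !setTI.
rewrite -[X in measurable X]setTI; exact: mf.
Qed.

Section rV_cons.
Context {R : realType} (n : nat).

Definition rV_cons (p : R * 'rV[R]_n) : 'rV[R]_n.+1 :=
  \row_i oapp (p.2 ord0) p.1 (unlift ord0 i).

Definition rV_uncons (x : 'rV[R]_n.+1) : R * 'rV[R]_n :=
  (x ord0 ord0, \row_j x ord0 (lift ord0 j)).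

Lemma rV_consK : cancel rV_cons rV_uncons.
Proof.
move=> [a v]; congr pair; first by rewrite mxE unlift_none.
by apply/rowP => j; rewrite !mxE liftK.
Qed.

Lemma measurable_rV_cons : measurable_fun setT rV_cons.
Proof.
apply: measurable_to_rV => i; case: (unliftP ord0 i) => [j|] ->.
  rewrite (_ : (fun _ => _) = (fun x : 'rV[R]_n => x ord0 j) \o snd).
    by apply: measurableT_comp => //; exact: measurable_rV_coord.
  by apply/funext => p; rewrite mxE liftK.
rewrite (_ : (fun _ => _) = fst)//.
by apply/funext => p; rewrite mxE unlift_none.
Qed.

Lemma measurable_rV_uncons : measurable_fun setT rV_uncons.
Proof.
apply/measurable_fun_pairP; split; first exact: measurable_rV_coord.
apply: measurable_to_rV => i.
rewrite (_ : (fun _ => _) = (fun x : 'rV[R]_n.+1 => x ord0 (lift ord0 i))); last first.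
  by apply/funext => x; rewrite mxE.
exact: measurable_rV_coord.
Qed.

End rV_cons.

Section lebesgue_rV.
Local Open Scope ereal_scope.
Context {R : realType}.

Section succ.
Context (n : nat) (m : {sigma_finite_measure set 'rV[R]_n -> \bar R}).

Definition lebesgue_rV_succ : set 'rV[R]_n.+1 -> \bar R :=
  pushforward (@lebesgue_measure R \x m) (@rV_cons R n).

Let mcons A : measurable A -> measurable (@rV_cons R n @^-1` A).
Proof. by move=> mA; rewrite -[X in measurable X]setTI; exact: measurable_rV_cons. Qed.

Let succ0 : lebesgue_rV_succ set0 = 0.
Proof. by rewrite /lebesgue_rV_succ /pushforward preimage_set0 measure0. Qed.

Let succ_ge0 A : 0 <= lebesgue_rV_succ A.
Proof. exact: (measure_ge0 (@lebesgue_measure R \x m)%E). Qed.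

Let succ_sigma_additive : semi_sigma_additive lebesgue_rV_succ.
Proof.
move=> F mF tF mUF; rewrite /lebesgue_rV_succ /pushforward preimage_bigcup.
apply: measure_semi_sigma_additive.
- by move=> k; exact: mcons.
- apply/trivIsetP => /= i j _ _ ij; rewrite -preimage_setI.
  by move/trivIsetP : tF => /(_ _ _ _ _ ij) ->//; rewrite preimage_set0.
- by rewrite -preimage_bigcup; exact: mcons.
Qed.

Let succ_sigma_finite : sigma_finite setT lebesgue_rV_succ.
Proof.
have /sigma_finiteP[F [TF ndF Foo]] := sigma_finiteT (@lebesgue_measure R).
have /sigma_finiteP[G [TG ndG Goo]] := sigma_finiteT m.
exists (fun k => @rV_uncons R n @^-1` (F k `*` G k)).
  rewrite -preimage_bigcup -[LHS](preimage_setT (@rV_uncons R n)).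
  congr (_ @^-1` _); rewrite -setXTT TF TG predeqE => -[x y]; split.
    move=> [/= [i _ Fix] [j _ Gjy]]; exists (maxn i j) => //; split.
    - by move: x Fix; exact/subsetPset/ndF/leq_maxl.
    - by move: y Gjy; exact/subsetPset/ndG/leq_maxr.
  by move=> [i _ []/= ? ?]; split; exists i.
move=> k; have [? ?] := Foo k; have [? ?] := Goo k; split.
  rewrite -[X in measurable X]setTI; apply: measurable_rV_uncons => //.
  exact: measurableX.
rewrite /lebesgue_rV_succ /pushforward -comp_preimage.
rewrite (_ : _ \o _ = id); last by apply/funext => p; exact: rV_consK.
by rewrite preimage_id product_measure1E// lte_mul_pinfty// ge0_fin_numE.
Qed.

HB.instance Definition _ := isMeasure.Build _ _ _ lebesgue_rV_succ
  succ0 succ_ge0 succ_sigma_additive.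

HB.instance Definition _ := Measure_isSigmaFinite.Build _ _ _ lebesgue_rV_succ
  succ_sigma_finite.


End succ.

(* Lebesgue measure on R^n, as an iterated product measure. *)
Fixpoint lebesgue_rV (n : nat) : {sigma_finite_measure set 'rV[R]_n -> \bar R} :=
  match n with
  | 0 => \d_(0%R : 'rV[R]_0)
  | k.+1 => lebesgue_rV_succ (lebesgue_rV k)
  end.

End lebesgue_rV.

Section euclidean.
Context {R : realType} {n : nat}.
Implicit Types (x y : 'rV[R]_n) (A : set 'rV[R]_n).

Definition dot x y : R := (x *m y^T) ord0 ord0.

(* The library's norm on 'rV[R]_n is the maximum norm. *)
Definition enorm x : R := Num.sqrt (dot x x).

Definition sphere (r : R) : set 'rV[R]_n := [set x | enorm x = r].

Definition eball (r : R) : set 'rV[R]_n := [set x | enorm x <= r].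

Definition boundary A : set 'rV[R]_n := closure A `\` interior A.

Definition support_function A (x : 'rV[R]_n) : R := sup [set dot y x | y in A].

End euclidean.

Section smooth.
Context {R : realType} {n : nat} {W : normedModType R}.

Fixpoint Ck (k : nat) (U : set 'rV[R]_n) (f : 'rV[R]_n -> W) : Prop :=
  match k with
  | 0 => forall x, U x -> {for x, continuous f}
  | k'.+1 => (forall x, U x -> differentiable f x) /\
             (forall v, Ck k' U ('D_v f))
  end.

Definition smooth_on (U : set 'rV[R]_n) (f : 'rV[R]_n -> W) : Prop :=
  forall k, Ck k U f.

End smooth.

(* Hypersurfaces of R^(n+1); points and vectors are row vectors, so that the
   differential of f at p sends v to v *m 'J f p. *)
Section hypersurface.
Context {R : realType} {n : nat}.
Local Notation E := 'rV[R]_n.+1.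
Implicit Types (S U Omega : set E) (f : E -> R) (p : E).

Definition gradient f p : E := \row_i 'D_(delta_mx ord0 i) f p.

Definition defining_function S U f : Prop :=
  [/\ open U, smooth_on U f,
      (forall x, U x -> gradient f x != 0) &
      S `&` U = [set x | U x /\ f x = 0]].

Definition smooth_hypersurface S : Prop :=
  forall p, S p -> exists U f, U p /\ defining_function S U f.

(* The unit normal field of the level sets of f; on {f = 0} it is a Gauss map. *)
Definition unit_normal f p : E := (enorm (gradient f p))^-1 *: gradient f p.

(* f is negative inside Omega, so that unit_normal f points outwards. *)
Definition outward_defining_function Omega U f : Prop :=
  defining_function (boundary Omega) U f /\
  (forall x, Omega x -> U x -> f x < 0).

(* The rows of e are an orthonormal basis of the tangent space at p, consisting
   of eigenvectors of the differential of the outward unit normal; the principal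
   curvatures are the eigenvalues, with multiplicity and in any order. *)
Definition is_principal_curvatures Omega p (kappa : 'rV[R]_n) : Prop :=
  exists U f (e : 'M[R]_(n, n.+1)),
    [/\ U p, outward_defining_function Omega U f,
        e *m e^T = 1%:M, e *m (unit_normal f p)^T = 0 &
        e *m 'J (unit_normal f) p = diag_mx kappa *m e].

Definition principal_curvatures Omega p : 'rV[R]_n :=
  xget 0 [set kappa | is_principal_curvatures Omega p kappa].

Definition elementary_symmetric (j : nat) (kappa : 'rV[R]_n) : R :=
  \sum_(A : {set 'I_n} | #|A| == j) \prod_(i in A) kappa ord0 i.

Definition mean_curvature Omega (j : nat) p : R :=
  ('C(n, j)%:R)^-1 * elementary_symmetric j (principal_curvatures Omega p).

Definition local_parametrization S (V : set 'rV[R]_n) (phi : 'rV[R]_n -> E)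
    : Prop :=
  [/\ open V, smooth_on V phi, {in V &, injective phi},
      (forall x, V x -> row_free ('J phi x)) &
      phi @` V `<=` S].

Definition area_density (phi : 'rV[R]_n -> E) (x : 'rV[R]_n) : R :=
  Num.sqrt (\det ('J phi x *m ('J phi x)^T)).

(* mu restricted to S is the Riemannian measure of the induced metric; the
   values of mu off S are left free, they never matter. *)
Definition is_area_measure S (mu : {measure set E -> \bar R}) : Prop :=
  forall V phi (A : set E), local_parametrization S V phi ->
    measurable A -> A `<=` phi @` V ->
    mu A = (\int[@lebesgue_rV R n]_(x in V `&` phi @^-1` A)
              (area_density phi x)%:E)%E.

(* I_j for j >= -1; the values for j < -1 are irrelevant. *)
Definition curvature_integral Omega (mu : {measure set E -> \bar R}) (j : int)
    : R :=
  match j with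
  | Posz k => \int[mu]_(x in boundary Omega) mean_curvature Omega k x
  | Negz _ => n.+1%:R * fine (lebesgue_rV n.+1 Omega)
  end.

Definition delta2 (theta : {measure set E -> \bar R}) (K1 K2 : set E) : R :=
  Num.sqrt (\int[theta]_(x in sphere 1)
              (support_function K1 x - support_function K2 x) ^+ 2).

End hypersurface.

(* Main.v *)
(* Let K be the closure of Omega, nu its Gauss map, v(p) = <p, nu p> and e_j the
   elementary symmetric functions of the principal curvatures. In the coordinates
   y = p + s nu(p) on the exterior tube {0 < d(y, K) < t}, Lebesgue measure is
   prod_i (1 + s kappa_i) dmu ds, so integrals over the tube are polynomials in t
   whose coefficients are the curvature moments int c e_j dmu.

   Differentiating in l the integral of w(l y) (t^2 - d(l y, K)^2)_+^2, with
   w = 1 or w(y) = |y|^2, and comparing the coefficients of the powers of t gives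
   the Minkowski formulas (n - j) int e_j = (j + 1) int v e_(j+1), as well as
     int v e_(n-1) + int |X|^2 e_n = (n + 1) int v^2 e_n.
   Letting instead t tend to infinity in a rescaled tube, and comparing with the
   unit ball, shows that nu pushes e_n dmu forward to the area of the sphere.
   Hence, u being the support function and c = I_(n-1) / omega_n its mean, the
   two sides of the theorem are n W and (n + 1) W with W = int (u - c)^2 >= 0,
   and W = 0 means that u is constant on the sphere. *)
Require Import Defs.
From HB Require Import structures.
From mathcomp Require Import all_boot all_order all_algebra.
From mathcomp Require Import perm zify ring lra.
From mathcomp Require Import all_classical all_reals all_analysis.
From mathcomp Require Import measurable_realfun.
Set Implicit Arguments.
Unset Strict Implicit.
Unset Printing Implicit Defensive.
Import Order.TTheory GRing.Theory Num.Theory.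
Import numFieldNormedType.Exports.
Local Open Scope classical_set_scope.
Local Open Scope ring_scope.

(** * Lebesgue measure on row vectors *)

(** Convexity keeps the geometry elementary. The projection onto the closure is 1-Lipschitz on the
    whole space, so normal coordinates have an explicit Lipschitz inverse, given by distance and
    projection, and the change of variables needs no inverse function theorem. Moreover the squared
    distance is differentiable everywhere, with gradient 2 (y - proj y) and a quadratic error,
    whatever the boundary; squaring the positive part of t^2 - d^2 then gives a cutoff that is
    differentiable in l even across the edge of the tube. The scaling identities are thus volume
    statements that replace the divergence theorem on the boundary. The main obstacle is that
    [principal_curvatures] is an arbitrary pointwise choice: regularity is obtained only for its
    symmetric functions, through tube determinants. Since [mu] is known only through charts, local
    facts are glued by finite unions over the compact boundary. In the identity with |X|^2 a top
    coefficient is used, because there the unwanted moment of |X|^2 v vanishes. For large tubes only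
    e_n survives, since e_j carries the factor t^(j - n) after rescaling. *)

Section epsilon_delta.
Context {R : realType} {V W : normedModType R}.
Implicit Types (f : V -> W) (x : V).

Lemma nbhs_norm_ball x (P : set V) :
  nbhs x P -> exists2 d : R, 0 < d & forall y, `|y - x| < d -> P y.
Proof.
move=> /nbhs_ballP[d /= d0 h]; exists d => // y yx; apply: h.
by rewrite -ball_normE/= distrC.
Qed.

Lemma norm_ball_nbhs x (P : set V) (d : R) : 0 < d ->
  (forall y, `|y - x| < d -> P y) -> nbhs x P.
Proof.
move=> d0 h; apply/nbhs_ballP; exists d => //= y.
by rewrite -ball_normE/= distrC => /h.
Qed.

Lemma continuous_epsP f x : {for x, continuous f} <->
  forall e : R, 0 < e -> exists2 d : R, 0 < d &
    forall y, `|y - x| < d -> `|f y - f x| < e.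
Proof.
split=> [cf e e0|h].
  have /cvgrPdist_lt/(_ e e0)/nbhs_norm_ball[d d0 hd] := cf.
  by exists d => // y /hd; rewrite distrC.
apply/cvgrPdist_lt => e e0; have [d d0 hd] := h e e0.
by apply: (norm_ball_nbhs d0) => y /hd; rewrite distrC.
Qed.

End epsilon_delta.

Section norm_rV.
Context {R : realType} {n : nat}.
Implicit Types x : 'rV[R]_n.

Lemma norm_coord_le x i : `|x ord0 i| <= `|x|.
Proof.
rewrite [leRHS]/Num.Def.normr/= mx_normrE; apply/bigmax_geP; right => /=.
by exists (ord0, i).
Qed.

Lemma norm_leP x (e : R) : 0 <= e ->
  reflect (forall i, `|x ord0 i| <= e) (`|x| <= e).
Proof.
move=> e0; apply: (iffP idP) => [h i|h]; first exact: (le_trans (norm_coord_le x i)).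
rewrite [leLHS]/Num.Def.normr/= mx_normrE; apply/bigmax_leP; split => //.
by move=> [i j] _ /=; rewrite ord1.
Qed.

Lemma norm_ltP x (e : R) : 0 < e ->
  reflect (forall i, `|x ord0 i| < e) (`|x| < e).
Proof.
move=> e0; apply: (iffP idP) => [h i|h]; first exact: (le_lt_trans (norm_coord_le x i)).
rewrite [ltLHS]/Num.Def.normr/= mx_normrE; apply/bigmax_ltP; split => //.
by move=> [i j] _ /=; rewrite ord1.
Qed.

End norm_rV.

Section box.
Context {R : realType} {n : nat}.
Implicit Types a b : 'rV[R]_n.

(* Half-open, to match the intervals ]a, b] generating the Borel sets of R. *)
Definition box a b : set 'rV[R]_n :=
  [set x | forall i, a ord0 i < x ord0 i <= b ord0 i].

Definition boxes : set (set 'rV[R]_n) := [set box p.1 p.2 | p in setT].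

Lemma measurable_coord_preimage (i : 'I_n) (Y : set R) :
  measurable Y -> measurable [set x : 'rV[R]_n | Y (x ord0 i)].
Proof.
by move=> mY; rewrite -[X in measurable X]setTI; exact: measurable_rV_coord.
Qed.

Lemma box_bigcap a b : box a b = \bigcap_(i in [set: 'I_n])
  [set x | x ord0 i \in `]a ord0 i, b ord0 i]].
Proof.
apply/seteqP; split => x /= h i; first by move=> _ /=; rewrite in_itv/= h.
by have := h i Logic.I; rewrite /= in_itv.
Qed.

Lemma measurable_box a b : measurable (box a b).
Proof.
rewrite box_bigcap; apply: fin_bigcap_measurable => [//|i _].
exact: (@measurable_coord_preimage i `]a ord0 i, b ord0 i]%classic).
Qed.

Lemma boxI a b c d : box a b `&` box c d =
  box (\row_i Num.max (a ord0 i) (c ord0 i)) (\row_i Num.min (b ord0 i) (d ord0 i)).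
Proof.
apply/seteqP; split => x /=.
  move=> [h1 h2] i; rewrite !mxE gt_max le_min.
  by have /andP[-> ->] := h1 i; have /andP[-> ->] := h2 i.
move=> h; split => i; have := h i; rewrite !mxE gt_max le_min;
  by case/andP => /andP[? ?] /andP[? ?]; apply/andP.
Qed.

Definition unit_boxN (k : nat) : set 'rV[R]_n := box (const_mx (- k%:R)) (const_mx k%:R).

Lemma rV_bounded_coord (x : 'rV[R]_n) : exists k : nat, forall i, `|x ord0 i| < k%:R.
Proof.
exists (Num.truncn `|x|).+1 => i; apply: le_lt_trans (truncnS_gt _).
exact: norm_coord_le.
Qed.

Lemma bigcup_boxN : \bigcup_k unit_boxN k = setT.
Proof.
apply/seteqP; split => // x _; have [k xk] := rV_bounded_coord x.
by exists k => // i; rewrite !mxE; have := xk i; rewrite ltr_norml => /andP[-> /ltW ->].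
Qed.

Lemma boxes_setI_closed : setI_closed boxes.
Proof.
move=> _ _ [[a b] _ <-] [[c d] _ <-]; rewrite boxI/=.
by eexists (_, _).
Qed.

(** The preimage of []a, b]] under one coordinate is the union of boxes whose other sides []-k, k]]
    exhaust the line, so boxes generate the same sigma-algebra as the coordinates. They are moreover
    closed under intersection, hence determine measures. *)
Lemma measurable_boxes : @measurable _ 'rV[R]_n = <<s boxes >>.
Proof.
apply/seteqP; split; last first.
  apply: smallest_sub; first exact: sigma_algebra_measurable.
  by move=> _ [[a b] _ <-]; exact: measurable_box.
apply: smallest_sub; first exact: smallest_sigma_algebra.
move=> B; rewrite -bigcup_seq => -[i /= _ [Y mY <-]]; rewrite setTI.
pose coor (x : 'rV[R]_n) := x ord0 i.
pose G : set (set R) := image_set_system setT coor <<s boxes >>.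
suff : G Y by rewrite /G/= /image_set_system/= setTI.
move: Y mY; apply: smallest_sub.
  exact/sigma_algebra_image/smallest_sigma_algebra.
move=> _ [[a b] _ <-]; rewrite /G /image_set_system/= setTI.
rewrite (_ : _ @^-1` _ = \bigcup_k box (\row_j if j == i then a else - k%:R)
    (\row_j if j == i then b else k%:R)); last first.
  apply/seteqP; split => x /=.
    rewrite in_itv/= => /andP[ax xb]; have [k xk] := rV_bounded_coord x.
    exists k => // j; rewrite !mxE; case: eqP => [->|_]; first by rewrite ax xb.
    by have := xk j; rewrite ltr_norml => /andP[-> /ltW ->].
  by move=> [k _ h]; have := h i; rewrite !mxE eqxx in_itv.
apply: sigma_algebra_bigcup => k; apply: sub_sigma_algebra.
by eexists (_, _).
Qed.

Lemma rV_measure_unique (m1 m2 : {measure set 'rV[R]_n -> \bar R}) :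
  (forall a b, m1 (box a b) = m2 (box a b)) ->
  (forall a b, (m1 (box a b) < +oo)%E) ->
  forall A, measurable A -> m1 A = m2 A.
Proof.
move=> m12 m1oo A mA; apply: (measure_unique boxes unit_boxN) => //.
- exact: measurable_boxes.
- exact: boxes_setI_closed.
- by move=> k; eexists (_, _).
- exact: bigcup_boxN.
- by move=> _ [[a b] _ <-]; exact: m12.
- by move=> k; exact: m1oo.
Qed.

End box.

Section lebesgue_rV_box.
Context {R : realType}.

Lemma lebesgue_oc (a b : R) :
  lebesgue_measure (`]a, b] : set R) = (Num.max 0 (b - a))%:E.
Proof.
rewrite lebesgue_measure_itv/= lte_fin; case: ltP => ab.
  by rewrite max_r ?subr_ge0 1?ltW.
by rewrite max_l// subr_le0.
Qed.

Lemma rV_cons_box n (a b : 'rV[R]_n.+1) :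
  @rV_cons R n @^-1` box a b =
  (`]a ord0 ord0, b ord0 ord0] : set R) `*`
  box (rV_uncons a).2 (rV_uncons b).2.
Proof.
apply/seteqP; split => -[s x] /=.
  move=> h; split; first by have := h ord0; rewrite !mxE unlift_none/= in_itv.
  by move=> i; have := h (lift ord0 i); rewrite !mxE liftK.
move=> [/= s01 h] i; case: (unliftP ord0 i) => [j|] ->.
  by have := h j; rewrite !mxE liftK.
by rewrite !mxE unlift_none; move: s01; rewrite in_itv.
Qed.

Lemma lebesgue_rV_box n (a b : 'rV[R]_n) :
  lebesgue_rV n (box a b) = (\prod_i Num.max 0 (b ord0 i - a ord0 i))%:E.
Proof.
elim: n a b => [|n ih] a b.
  rewrite /= diracE big_ord0 mem_set//.
  by move=> [].
rewrite -[LHS]/((lebesgue_measure \x lebesgue_rV n)%E (@rV_cons R n @^-1` box a b)) rV_cons_box.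
rewrite [LHS]product_measure1E//; last exact: measurable_box.
rewrite big_ord_recl EFinM ih; congr (_ * _)%E; first exact: lebesgue_oc.
by congr (_%:E); apply: eq_bigr => i _; rewrite !mxE.
Qed.

Lemma lebesgue_rV_box_lty n (a b : 'rV[R]_n) : (lebesgue_rV n (box a b) < +oo)%E.
Proof. by rewrite lebesgue_rV_box ltry. Qed.

Lemma measurable_rV_lin m n (M : 'M[R]_(m, n)) (c : 'rV[R]_n) :
  measurable_fun setT (fun x : 'rV[R]_m => x *m M + c).
Proof.
apply: measurable_to_rV => i.
rewrite (_ : (fun _ => _) = fun x : 'rV[R]_m =>
    \sum_j x ord0 j * M j i + c ord0 i); last first.
  by apply/funext => x; rewrite !mxE.
apply: measurable_funD => //.
apply: measurable_sum => j; apply: measurable_funM => //.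
exact: measurable_rV_coord.
Qed.

End lebesgue_rV_box.

(** * Linear changes of variables *)

Section linear_change.
Context {R : realType}.

(** Arbitrary measurable factors are needed for diagonal matrices: a negative entry pulls []a, b]]
    back to an interval closed on the left, which is not the side of a [box]. *)
Lemma lebesgue_rV_prod n (J : 'I_n -> set R) (r : 'I_n -> R) :
  (forall i, measurable (J i)) ->
  (forall i, lebesgue_measure (J i : set (measurableTypeR R)) = (r i)%:E) ->
  lebesgue_rV n [set x | forall i, J i (x ord0 i)] = (\prod_i r i)%:E.
Proof.
elim: n J r => [|n ih] J r mJ Jr.
  by rewrite /= diracE big_ord0 mem_set// => -[].
rewrite -[LHS]/((lebesgue_measure \x lebesgue_rV n)%E (@rV_cons R n @^-1`
  [set x | forall i, J i (x ord0 i)])).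
have -> : @rV_cons R n @^-1` [set x | forall i, J i (x ord0 i)] =
    J ord0 `*` [set x : 'rV[R]_n | forall i, J (lift ord0 i) (x ord0 i)].
  apply/seteqP; split => -[s x] /=.
    move=> h; split; first by have := h ord0; rewrite !mxE unlift_none.
    by move=> i; have := h (lift ord0 i); rewrite !mxE liftK.
  move=> [/= s01 h] i; case: (unliftP ord0 i) => [j|] ->.
    by have := h j; rewrite !mxE liftK.
  by rewrite !mxE unlift_none.
rewrite [LHS]product_measure1E//; last first.
  rewrite [X in measurable X](_ : _ = \bigcap_(i in [set: 'I_n])
    [set x : 'rV[R]_n | J (lift ord0 i) (x ord0 i)]); last first.
    by apply/seteqP; split => x /= h i; [move=> _|have := h i Logic.I].
  by apply: fin_bigcap_measurable => // i _; exact: measurable_coord_preimage.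
  exact: mJ.
rewrite big_ord_recl EFinM; congr (_ * _)%E; first exact: Jr.
exact: (ih (fun i => J (lift ord0 i)) (fun i => r (lift ord0 i))).
Qed.

Lemma lebesgue_rV_translate n (c : 'rV[R]_n) B : measurable B ->
  lebesgue_rV n [set x | B (x + c)] = lebesgue_rV n B.
Proof.
move=> mB.
have mf : measurable_fun setT (fun x : 'rV[R]_n => x + c).
  rewrite (_ : (fun _ => _) = fun x : 'rV[R]_n => x *m 1%:M + c).
    exact: measurable_rV_lin.
  by apply/funext => x; rewrite mulmx1.
have preim a b : (fun x : 'rV[R]_n => x + c) @^-1` box a b = box (a - c) (b - c).
  apply/seteqP; split => x /= h i; have := h i; rewrite !mxE.
    by rewrite ltrBlDr lerBrDr.
  by rewrite ltrBlDr lerBrDr.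
pose m2 := measure_function_pushforward__canonical__measure_function_Measure
  (lebesgue_rV n) mf.
have -> : lebesgue_rV n B = m2 B; last by [].
apply: rV_measure_unique => // a b; last exact: lebesgue_rV_box_lty.
rewrite /m2/= /pushforward preim !lebesgue_rV_box; congr (_%:E).
by apply: eq_bigr => i _; rewrite !mxE; congr Num.max; ring.
Qed.

(** With the determinant on the side of the preimage, the property is multiplicative in [M] and can
    be checked on the factors of a decomposition. *)
Definition scales_lebesgue n (M : 'M[R]_n) := forall B, measurable B ->
  (`|\det M|%:E * lebesgue_rV n [set x | B (x *m M)] = lebesgue_rV n B)%E.

Lemma measurable_rV_mulmx m n (M : 'M[R]_(m, n)) (B : set 'rV[R]_n) :
  measurable B -> measurable [set x | B (x *m M)].
Proof.
move=> mB; have := measurable_rV_lin M 0 => /(_ measurableT _ mB).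
by rewrite setTI; congr measurable; apply/seteqP; split => x /=; rewrite addr0.
Qed.

Lemma scales_mul n (M N : 'M[R]_n) :
  scales_lebesgue M -> scales_lebesgue N -> scales_lebesgue (M *m N).
Proof.
move=> sM sN B mB; have mNB := measurable_rV_mulmx N mB.
rewrite -(sN _ mB) -(sM _ mNB) det_mulmx normrM mulrC EFinM -muleA.
by congr (_ * (_ * _))%E; congr (lebesgue_rV n _); apply/seteqP; split => x /=;
  rewrite mulmxA.
Qed.

Lemma scales_boxes n (M : 'M[R]_n) : M \in unitmx ->
  (forall a b, (`|\det M|%:E * lebesgue_rV n [set x | box a b (x *m M)]
    = lebesgue_rV n (box a b))%E) -> scales_lebesgue M.
Proof.
move=> uM h B mB.
have mf : measurable_fun setT (fun x : 'rV[R]_n => x *m M).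
  rewrite (_ : (fun _ => _) = fun x : 'rV[R]_n => x *m M + 0).
    exact: measurable_rV_lin.
  by apply/funext => x; rewrite addr0.
have d0 : 0 <= `|\det M| by [].
pose m1 := measure_function_pushforward__canonical__measure_function_Measure
  (lebesgue_rV n) mf.
pose m2 := mscale (NngNum d0) m1.
suff -> : lebesgue_rV n B = m2 B by [].
apply: rV_measure_unique => // a b; last exact: lebesgue_rV_box_lty.
exact/esym/h.
Qed.

Lemma scales_perm n (s : 'S_n) : scales_lebesgue (perm_mx s : 'M[R]_n).
Proof.
apply: scales_boxes; first exact: unitmx_perm.
move=> a b; rewrite det_perm normrX normrN normr1 expr1n mul1e.
rewrite [X in lebesgue_rV n X](_ : _ =
    box (\row_i a ord0 (s i)) (\row_i b ord0 (s i))); last first.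
  have xs (x : 'rV[R]_n) i : (x *m perm_mx s) ord0 i = x ord0 ((s^-1)%g i).
    by rewrite -[s in perm_mx s]invgK -col_permE mxE.
  apply/seteqP; split => x /= h i.
    by have := h (s i); rewrite xs permK !mxE.
  by have := h ((s^-1)%g i); rewrite xs !mxE permKV.
rewrite !lebesgue_rV_box; congr (_%:E).
rewrite [RHS](reindex_inj (@perm_inj _ s)).
by apply: eq_bigr => i _; rewrite !mxE.
Qed.

Lemma lebesgue_scale (d a b : R) : d != 0 ->
  lebesgue_measure ([set s | a < s * d <= b] : set (measurableTypeR R)) =
  (Num.max 0 (b - a) / `|d|)%:E.
Proof.
rewrite neq_lt => /orP[d0|d0].
- have dn : d^-1 < 0 by rewrite invr_lt0.
  rewrite (_ : [set s | _] = `[b / d, a / d[%classic); last first.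
    apply/seteqP; split => s /=; rewrite in_itv/=.
      by rewrite ler_ndivrMr// ltr_ndivlMr// andbC.
    by rewrite ler_ndivrMr// ltr_ndivlMr// andbC.
  rewrite lebesgue_measure_itv/= lte_fin ltr_nM2r// ltr0_norm//.
  case: ltP => ab; last by rewrite max_l ?mul0r// subr_le0.
  rewrite max_r ?subr_ge0 1?ltW// -EFinB; congr (_%:E).
  by field; rewrite lt_eqF.
- rewrite (_ : [set s | _] = `]a / d, b / d]%classic); last first.
    apply/seteqP; split => s /=; rewrite in_itv/=.
      by rewrite ltr_pdivrMr// ler_pdivlMr.
    by rewrite ltr_pdivrMr// ler_pdivlMr.
  rewrite lebesgue_measure_itv/= lte_fin ltr_pM2r ?invr_gt0// gtr0_norm//.
  case: ltP => ab; last by rewrite max_l ?mul0r// subr_le0.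
  rewrite max_r ?subr_ge0 1?ltW// -EFinB; congr (_%:E).
  by field; rewrite gt_eqF.
Qed.

Lemma scales_diag n (d : 'rV[R]_n) : (forall i, d ord0 i != 0) ->
  scales_lebesgue (diag_mx d).
Proof.
move=> d0; apply: scales_boxes.
  by rewrite unitmxE det_diag unitfE; apply/prodf_neq0 => i _.
move=> a b; rewrite lebesgue_rV_box det_diag normr_prod.
rewrite [X in lebesgue_rV n X](_ : _ = [set x : 'rV[R]_n | forall i,
    [set s | a ord0 i < s * d ord0 i <= b ord0 i] (x ord0 i)]); last first.
  by apply/seteqP; split => x /= h i; have := h i; rewrite mul_mx_diag !mxE.
rewrite (@lebesgue_rV_prod _
    (fun i => [set s | a ord0 i < s * d ord0 i <= b ord0 i])
    (fun i => Num.max 0 (b ord0 i - a ord0 i) / `|d ord0 i|)); last 2 first.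
- move=> i.
  have mf : measurable_fun setT (fun s : R => s * d ord0 i).
    exact: measurable_funM.
  have := mf measurableT `]a ord0 i, b ord0 i]%classic.
  rewrite setTI => /(_ (measurable_itv _)).
  by congr measurable; apply/seteqP; split => s /=; rewrite in_itv.
- by move=> i; exact: lebesgue_scale.
rewrite -EFinM -big_split/=; congr (_%:E); apply: eq_bigr => i _.
by rewrite mulrC divfK// normr_eq0.
Qed.

(** A shear acts on the slice at first coordinate [s] by the smaller unit upper matrix [U'] followed
    by the translation by [s *: c]. Both preserve the measure of the slice, and the product measure
    integrates the slices. *)
Lemma scales_unit_upper n (U : 'M[R]_n) :
  (forall i j : 'I_n, (j < i)%N -> U i j = 0) -> (forall i, U i i = 1) ->
  scales_lebesgue U.
Proof.
elim: n U => [|n ih] U Ulow Udiag B mB.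
  rewrite det_mx00 normr1 mul1e; congr (lebesgue_rV 0 _).
  by apply/seteqP; split => x /=; rewrite (_ : x *m U = x)//; apply/rowP => -[].
have -> : \det U = 1.
  rewrite -det_tr det_trig; first by rewrite big1// => i _; rewrite mxE.
  by apply/is_trig_mxP => i j ij; rewrite mxE Ulow.
rewrite normr1 mul1e.
pose U' := \matrix_(i, j) U (lift ord0 i) (lift ord0 j).
pose c : 'rV[R]_n := \row_j U ord0 (lift ord0 j).
have U'1 : \det U' = 1.
  rewrite -det_tr det_trig; first by rewrite big1// => i _; rewrite !mxE.
  by apply/is_trig_mxP => i j ij; rewrite !mxE Ulow.
have consU s v : rV_cons (s, v) *m U = rV_cons (s, v *m U' + s *: c).
  apply/rowP => i; rewrite !mxE big_ord_recl !mxE unlift_none/=.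
  case: (unliftP ord0 i) => [j|] ->.
    rewrite /= !mxE addrC; congr (_ + _); apply: eq_bigr => k _.
    by rewrite !mxE liftK.
  rewrite /= Udiag mulr1 big1 ?addr0// => k _.
  by rewrite Ulow ?mulr0.
rewrite -[LHS]/((lebesgue_measure \x lebesgue_rV n)%E (@rV_cons R n @^-1` _)).
rewrite -[RHS]/((lebesgue_measure \x lebesgue_rV n)%E (@rV_cons R n @^-1` _)).
rewrite /product_measure1; apply: eq_integral => s _ /=.
have mC : measurable (xsection (@rV_cons R n @^-1` B) s).
  apply: measurable_xsection; rewrite -[X in measurable X]setTI.
  exact: measurable_rV_cons.
rewrite (_ : xsection _ s = [set v | xsection (@rV_cons R n @^-1` B) s
    (v *m U' + s *: c)]); last first.
  apply/seteqP; split => v; rewrite /xsection/= !inE/= consU//.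
pose D := [set v | xsection (@rV_cons R n @^-1` B) s (v + s *: c)].
have mD : measurable D.
  have := measurable_rV_lin 1%:M (s *: c) measurableT mC.
  by rewrite setTI; congr measurable; apply/seteqP; split => x /=; rewrite mulmx1.
have := @ih U' _ _ D mD; rewrite U'1 normr1 mul1e => ->.
- exact: lebesgue_rV_translate.
- by move=> i j ij; rewrite mxE Ulow.
- by move=> i; rewrite mxE.
Qed.

(** Conjugation by the permutation that reverses the coordinates exchanges lower and upper
    triangular matrices. *)
Lemma scales_unit_lower n (L : 'M[R]_n) :
  (forall i j : 'I_n, (i < j)%N -> L i j = 0) -> (forall i, L i i = 1) ->
  scales_lebesgue L.
Proof.
move=> Lup Ldiag.
pose rv : 'S_n := perm (@rev_ord_inj n).
pose P : 'M[R]_n := perm_mx rv.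
have rvV : (rv^-1)%g = rv.
  by apply/permP => i; apply: (@perm_inj _ rv); rewrite permKV !permE rev_ordK.
have PP : P *m P = 1%:M.
  by rewrite /P -perm_mxM -{1}rvV mulVg perm_mx1.
have -> : L = P *m (P *m L *m P) *m P.
  by rewrite !mulmxA PP mul1mx -mulmxA PP mulmx1.
have PLP i j : (P *m L *m P) i j = L (rev_ord i) (rev_ord j).
  by rewrite /P -row_permE -{2}rvV -col_permE !mxE !permE.
apply: scales_mul; last exact: scales_perm.
apply: scales_mul; first exact: scales_perm.
apply: scales_unit_upper => [i j ij|i]; rewrite PLP ?Ldiag// Lup//.
by have := ltn_ord i; rewrite /=; lia.
Qed.

(** The LUP decomposition reduces the claim to a permutation, a unit lower and an upper factor; the
    last one splits into its diagonal, invertible because [M] is, and a unit upper matrix. *)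
Lemma lebesgue_rV_linear n (M : 'M[R]_n.+1) : M \in unitmx -> scales_lebesgue M.
Proof.
move=> uM; have := cormen_lup_correct M.
have := @cormen_lup_perm _ _ M; have := @cormen_lup_lower _ _ M.
have := @cormen_lup_upper _ _ M; have := cormen_lup_detL M.
case: (cormen_lup M) => -[P L] U /= detL Ulow Llow /is_perm_mxP[s ->] PM.
have ML : M = perm_mx (s^-1)%g *m (L *m U).
  by rewrite -[L *m U]PM mulmxA -perm_mxM mulVg perm_mx1 mul1mx.
have dU : \det U != 0.
  have : \det M != 0 by rewrite -unitfE -unitmxE.
  by rewrite ML !det_mulmx detL mul1r mulf_eq0 negb_or => /andP[].
have Uii i : U i i != 0.
  move: dU; rewrite -det_tr det_trig; last first.
    by apply/is_trig_mxP => k l kl; rewrite mxE Ulow.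
  by move=> /prodf_neq0/(_ i isT); rewrite mxE.
rewrite ML; apply: scales_mul; first exact: scales_perm.
apply: scales_mul.
  apply: scales_unit_lower => [i j ij|i]; last by rewrite Llow ?eqxx.
  by rewrite Llow ?(ltnW ij)//; case: eqP ij => // ->; rewrite ltnn.
have -> : U = diag_mx (\row_i U i i) *m \matrix_(i, j) (U i j / U i i).
  by apply/matrixP => i j; rewrite mul_diag_mx !mxE mulrC divfK.
apply: scales_mul; first by apply: scales_diag => i; rewrite mxE.
apply: scales_unit_upper => [i j ij|i]; rewrite mxE; first by rewrite Ulow ?mul0r.
by rewrite divff.
Qed.

(* Affine images are described through the inverse map, so that no image has to
   be shown measurable. *)
Lemma lebesgue_rV_affine n (M : 'M[R]_n.+1) (x0 y0 : 'rV[R]_n.+1) B :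
  M \in unitmx -> measurable B ->
  lebesgue_rV n.+1 [set y | B (x0 + (y - y0) *m invmx M)] =
  (`|\det M|%:E * lebesgue_rV n.+1 B)%E.
Proof.
move=> uM mB.
have uM' : invmx M \in unitmx by rewrite unitmx_inv.
have M0 : `|\det M| != 0.
  by rewrite normr_eq0 -unitfE -unitmxE.
have mC : measurable [set x | B (x + (x0 - y0 *m invmx M))].
  have := measurable_rV_lin 1%:M (x0 - y0 *m invmx M) measurableT mB.
  by rewrite setTI; congr measurable; apply/seteqP; split => x /=; rewrite mulmx1.
have := lebesgue_rV_linear uM' mC; rewrite lebesgue_rV_translate// => <-.
rewrite muleA -EFinM det_inv normfV divff// mul1e.
congr (lebesgue_rV n.+1 _); apply/seteqP; split => y /=;
  by rewrite mulmxBl addrCA.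
Qed.

Lemma lebesgue_rV_scale n (c : R) (B : set 'rV[R]_n.+1) : 0 < c -> measurable B ->
  lebesgue_rV n.+1 [set x | B (c *: x)] = ((c ^+ n.+1)^-1%:E * lebesgue_rV n.+1 B)%E.
Proof.
move=> c0 mB.
have := @lebesgue_rV_affine n (c^-1)%:M 0 0 _ _ mB.
rewrite det_scalar normrX normfV gtr0_norm// exprVn => <-.
  congr (lebesgue_rV n.+1 _); apply/seteqP; split => y /=;
    by rewrite add0r subr0 invmx_scalar invrK mul_mx_scalar.
by rewrite unitmxE det_scalar unitfE expf_neq0// invr_eq0 gt_eqF.
Qed.

End linear_change.

(** * Borel sets and densities *)

Section open_measurable.
Context {R : realType} {n : nat}.

Definition cbox (a b : 'rV[R]_n) : set 'rV[R]_n :=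
  [set x | forall i, a ord0 i <= x ord0 i <= b ord0 i].

Lemma ballP_rV (x y : 'rV[R]_n) (e : R) : 0 < e ->
  (forall i, `|x ord0 i - y ord0 i| < e) -> ball x e y.
Proof.
move=> e0 h; rewrite -ball_normE/=; apply/norm_ltP => // i.
by rewrite !mxE.
Qed.

(** Boxes with rational corners are countable, and every point of [U] lies in one whose closed hull
    stays in [U]. The closed hull matters later: a continuous density is bounded on it, and
    bisection can be run in it. *)
Lemma open_bigcup_box (U : set 'rV[R]_n) : open U ->
  exists F : (set 'rV[R]_n)^nat, U = \bigcup_k F k /\
    forall k, F k = set0 \/ exists a b, F k = box a b /\ cbox a b `<=` U.
Proof.
move=> oU.
pose Q (p : 'rV[rat]_n * 'rV[rat]_n) : set 'rV[R]_n :=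
  let a := map_mx ratr p.1 in let b := map_mx ratr p.2 in
  if `[< cbox a b `<=` U >] then box a b else set0.
pose F k := oapp Q set0 (unpickle k).
exists F; split; last first.
  move=> k; rewrite /F; case: unpickle => [p|]/=; last by left.
  by rewrite /Q; case: asboolP => h; [right; do 2 eexists|left].
apply/seteqP; split => [x Ux|x [k _]]; last first.
  rewrite /F; case: unpickle => [p|]//=; rewrite /Q; case: asboolP => // h xb.
  by apply: h => i; have /andP[/ltW -> ->] := xb i.
have /nbhs_ballP[e /= e0 xeU] : nbhs x U by exact: open_nbhs_nbhs.
have ha i : exists q : rat, x ord0 i - e < ratr q < x ord0 i.
  have [q] := @rat_in_itvoo R (x ord0 i - e) (x ord0 i) ltac:(by rewrite ltrBlDr ltrDl).
  by rewrite in_itv/=; exists q.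
have hb i : exists q : rat, x ord0 i < ratr q < x ord0 i + e.
  have [q] := @rat_in_itvoo R (x ord0 i) (x ord0 i + e) ltac:(by rewrite ltrDl).
  by rewrite in_itv/=; exists q.
have /choice[fa fa_] := ha; have /choice[fb fb_] := hb.
exists (pickle (\row_i fa i : 'rV_n, \row_i fb i : 'rV_n)) => //.
rewrite /F pickleK/= /Q; case: asboolP => [_|[]] /=.
  by move=> i; rewrite !mxE; have /andP[_ ->] := fa_ i; have /andP[/ltW -> _] := fb_ i.
move=> y yab; apply: xeU; apply: ballP_rV => // i.
have := yab i; rewrite !mxE => /andP[ay yb].
have /andP[a1 _] := fa_ i; have /andP[_ b1] := fb_ i.
by rewrite ltr_norml; apply/andP; split; lra.
Qed.

Lemma open_measurable_rV (U : set 'rV[R]_n) : open U -> measurable U.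
Proof.
move=> /open_bigcup_box[F [-> hF]]; apply: bigcup_measurable => k _.
by case: (hF k) => [->|[a [b [-> _]]]]; [exact: measurable0|exact: measurable_box].
Qed.

Lemma closed_measurable_rV (A : set 'rV[R]_n) : closed A -> measurable A.
Proof.
move=> cA; rewrite -[A]setCK; apply: measurableC.
by apply: open_measurable_rV; rewrite openC.
Qed.

End open_measurable.

Section continuous_measurable.
Context {R : realType}.

Lemma continuous_on_open_measurable n (U : set 'rV[R]_n) (f : 'rV[R]_n -> R) :
  open U -> (forall x, U x -> {for x, continuous f}) -> measurable_fun U f.
Proof.
move=> oU cf.
apply: (measurability _ (RGenOpens.measurableE R)).
move=> _ [_ [a [b ->] <-]].
apply: open_measurable_rV; rewrite openE => x [Ux fx].
apply: filterI; first exact: open_nbhs_nbhs.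
by apply: cf => //; apply: open_nbhs_nbhs; split => //; exact: interval_open.
Qed.

Lemma measurable_to_rV_on d (T : measurableType d) n (D : set T) (f : T -> 'rV[R]_n) :
  (forall i, measurable_fun D (fun x => f x ord0 i)) -> measurable_fun D f.
Proof.
move=> mf mD A mA.
pose G : set (set 'rV[R]_n) := image_set_system D f measurable.
suff : G A by [].
have sG : sigma_algebra setT G.
  apply: sigma_algebra_image; split.
  - exact: measurable0.
  - by move=> B mB; exact: measurableD.
  - by move=> F mF; exact: bigcup_measurable.
move: A mA; apply: smallest_sub => // B.
rewrite -bigcup_seq => -[i /= _ [Y mY <-]].
by rewrite /G /image_set_system/= setTI; exact: mf.
Qed.

Lemma continuous_on_open_measurable_rV n m (U : set 'rV[R]_n) (f : 'rV[R]_n -> 'rV[R]_m) :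
  open U -> (forall x, U x -> {for x, continuous f}) -> measurable_fun U f.
Proof.
move=> oU cf; apply: measurable_to_rV_on => i.
apply: continuous_on_open_measurable => // x Ux.
apply: (@continuous_comp _ _ _ f (fun y : 'rV[R]_m => y ord0 i)); first exact: cf.
exact: coord_continuous.
Qed.

End continuous_measurable.

Section linear_bound.
Context {R : realType}.

Lemma mulmx_bound m n (M : 'M[R]_(m, n)) :
  exists2 K : R, 0 < K & forall v : 'rV[R]_m, `|v *m M| <= K * `|v|.
Proof.
exists (1 + \sum_i \sum_j `|M i j|).
  by rewrite ltr_pwDl// sumr_ge0// => i _; rewrite sumr_ge0.
move=> v; apply/norm_leP.
  by rewrite mulr_ge0// addr_ge0// sumr_ge0// => i _; rewrite sumr_ge0.
move=> j; rewrite mxE (le_trans (ler_norm_sum _ _ _))//.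
rewrite mulrDl mul1r ler_wpDl// mulr_suml ler_sum// => i _.
rewrite normrM mulrC ler_pM ?norm_coord_le//.
by rewrite (bigD1 j)//= lerDl sumr_ge0.
Qed.

End linear_bound.

Section density.
Local Open Scope ereal_scope.
Context d (T : measurableType d) (R : realType) (mu : {measure set T -> \bar R}).
Context (D : set T) (mD : measurable D) (f : T -> \bar R)
  (mf : measurable_fun D f) (f0 : forall x, D x -> 0 <= f x).

(** The three proofs are carried as arguments so that the measure structure declared below can be
    inferred from the term. *)
Definition density_measure (_ : measurable D) (_ : measurable_fun D f)
    (_ : forall x, D x -> 0 <= f x) (A : set T) : \bar R :=
  \int[mu]_(x in D `&` A) f x.

Let density0 : density_measure mD mf f0 set0 = 0.
Proof. by rewrite /density_measure setI0 integral_set0. Qed.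

Let density_ge0 A : 0 <= density_measure mD mf f0 A.
Proof. by apply: integral_ge0 => x [Dx _]; exact: f0. Qed.

Let density_sigma_additive : semi_sigma_additive (density_measure mD mf f0).
Proof.
move=> F mF tF mUF; rewrite /density_measure setI_bigcupr.
rewrite ge0_integral_bigcup.
- apply: is_cvg_ereal_nneg_natsum_cond => k _ _.
  by apply: integral_ge0 => x [Dx _]; exact: f0.
- by move=> k; exact: measurableI.
- by apply: (measurable_funS mD) => // x [k _ []].
- by move=> x [k _ [Dx _]]; exact: f0.
- exact: trivIset_setIl.
Qed.

HB.instance Definition _ := isMeasure.Build _ _ _ (density_measure mD mf f0)
  density0 density_ge0 density_sigma_additive.

End density.

Section density_integral.
Local Open Scope ereal_scope.
Context d1 d2 (X : measurableType d1) (Y : measurableType d2) (R : realType).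
Context (m1 : {measure set X -> \bar R}) (m2 : {measure set Y -> \bar R}).
Context (D : set X) (V : set Y) (phi : Y -> X) (rho : Y -> R).
Hypotheses (mD : measurable D) (mV : measurable V).
Hypothesis mphi : measurable_fun V phi.
Hypothesis mrho : measurable_fun V rho.
Hypothesis rho0 : forall y, V y -> (0 <= rho y)%R.
Hypothesis m1E : forall A, measurable A -> A `<=` D ->
  m1 A = \int[m2]_(y in V `&` phi @^-1` A) (rho y)%:E.

Let VD := V `&` phi @^-1` D.
Let mVD : measurable VD. Proof. exact: mphi. Qed.

Import HBNNSimple.

(** Equality of measures on subsets of [D] passes to integrals through simple functions and monotone
    convergence. It serves the change of variables, with Lebesgue measure as [m1], and the area
    measure, whose definition is the hypothesis [m1E] for a chart. *)
Lemma ge0_integral_density (G : X -> \bar R) : measurable_fun D G ->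
  (forall x, D x -> 0 <= G x) ->
  \int[m1]_(x in D) G x = \int[m2]_(y in VD) (G (phi y) * (rho y)%:E).
Proof.
move=> mG G0.
pose g := nnsfun_approx mD mG.
have mgphi n : measurable_fun VD (fun y => g n (phi y)).
  apply: (@measurableT_comp _ _ _ _ _ _ (g n) _ phi) => //.
  by apply: (measurable_funS mV) => // y [].
have mrho' : measurable_fun VD rho by apply: (measurable_funS mV) => // y [].
transitivity (limn (fun n => \int[m1]_(x in D) (g n x)%:E)).
  rewrite -monotone_convergence//.
  - apply: eq_integral => y /[!inE] yD; apply/esym/cvg_lim => //.
    exact: cvg_nnsfun_approx.
  - by move=> n; exact/measurable_EFinP/measurable_funTS/measurable_funP.
  - by move=> n y _; rewrite lee_fin.
  - by move=> y _ m n mn; rewrite lee_fin; exact/lefP/nd_nnsfun_approx.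
transitivity (limn (fun n => \int[m2]_(y in VD) ((g n (phi y))%:E * (rho y)%:E))).
  congr (lim (_ @ \oo)); apply/funext => n.
  transitivity (\sum_(k \in range (g n)) \int[m1]_(x in D) (k * \1_(g n @^-1` [set k]) x)%:E).
    under eq_integral do rewrite fimfunE -fsumEFin//.
    rewrite ge0_integral_fsum//.
    - by move=> y; exact/measurable_EFinP/measurable_funTS/measurable_funM.
    - by move=> y x _; rewrite nnfun_muleindic_ge0.
  transitivity (\sum_(k \in range (g n)) \int[m2]_(y in VD)
      ((k * \1_(g n @^-1` [set k]) (phi y)) * rho y)%:E).
    apply: eq_fsbigr => k /set_mem[x _ gk].
    have k0 : (0 <= k)%R by rewrite -gk.
    under eq_integral do rewrite EFinM.
    rewrite ge0_integralZl//; last by apply/measurable_EFinP/measurable_funTS.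
      rewrite integral_indic// setIC m1E; last 2 first.
      - exact: measurableI.
      - by move=> ? [].
      under [RHS]eq_integral do rewrite -mulrA EFinM.
      rewrite [RHS]ge0_integralZl//; last 2 first.
      - apply/measurable_EFinP/measurable_funM => //.
        by apply: measurableT_comp => //; apply: (measurable_funS mV) => // y [].
      - by move=> y [Vy _]; rewrite lee_fin mulr_ge0// rho0.
      congr (_ * _).
      rewrite (_ : V `&` _ = VD `&` (fun y => g n (phi y)) @^-1` [set k]); last first.
        by apply/seteqP; split => y /=; [move=> [? []]|move=> [[]]].
      rewrite integral_mkcondr; apply: eq_integral => y yVD.
      rewrite /patch indicE; case: ifPn => /= h.
        by rewrite mem_set ?mul1r//; exact: (set_mem h).
      rewrite memNset ?mul0r//= => h'; move/negP: h; apply.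
      by rewrite inE.
  rewrite -ge0_integral_fsum//.
  - apply: eq_integral => y _; rewrite -EFinM [in RHS]fimfunE fsumEFin//.
    by rewrite mulr_fsuml.
  - move=> k; apply/measurable_EFinP/measurable_funM => //.
    apply: measurable_funM => //.
    by apply: measurableT_comp => //; apply: (measurable_funS mV) => // y [].
  - move=> k y [Vy _]; rewrite EFinM mule_ge0//; first by rewrite nnfun_muleindic_ge0.
    by rewrite lee_fin rho0.
rewrite -monotone_convergence//.
- apply: eq_integral => y /[!inE] -[Vy Dy]; apply/cvg_lim => //.
  apply: cvgeZr => //; exact: cvg_nnsfun_approx.
- move=> n; apply/measurable_EFinP; exact: measurable_funM.
- by move=> n y [Vy _]; rewrite lee_fin mulr_ge0// rho0.
- move=> y [Vy _] m n mn; rewrite lee_fin ler_wpM2r ?rho0//.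
  exact/lefP/nd_nnsfun_approx.
Qed.

End density_integral.

(** * Change of variables *)

Section bisection.
Context {R : realType} {n : nat}.
Local Notation E := 'rV[R]_n.
Implicit Types a b w : E.

Definition upd (i : 'I_n) (c : R) a : E := \row_j if j == i then c else a ord0 j.

Variable P : E -> E -> Prop.
Hypothesis Pjoin : forall a b i c, a ord0 i <= c <= b ord0 i ->
  P a (upd i c b) -> P (upd i c a) b -> P a b.

Definition halved (s : seq 'I_n) (p q : E * E) := forall i : 'I_n,
  [/\ p.1 ord0 i <= q.1 ord0 i, q.2 ord0 i <= p.2 ord0 i &
      q.2 ord0 i - q.1 ord0 i =
        (if i \in s then 2^-1 else 1) * (p.2 ord0 i - p.1 ord0 i)].

Lemma halve_coords (s : seq 'I_n) (p : E * E) : uniq s ->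
  (forall i, p.1 ord0 i <= p.2 ord0 i) -> ~ P p.1 p.2 ->
  exists q, ~ P q.1 q.2 /\ halved s p q.
Proof.
elim: s p => [|i s ih] p /=.
  by move=> _ pp nP; exists p; split => // i; split; rewrite // in_nil mul1r.
move=> /andP[is_ us] pp nP.
set c := 2^-1 * (p.1 ord0 i + p.2 ord0 i).
have cp : p.1 ord0 i <= c <= p.2 ord0 i by have := pp i; rewrite /c; lra.
have [q [nPq pq]] : exists q, ~ P q.1 q.2 /\ halved [:: i] p q.
  have [P1|P1] := pselect (P p.1 (upd i c p.2)).
    exists (upd i c p.1, p.2); split => /=.
      by move=> P2; apply: nP; exact: Pjoin cp P1 P2.
    move=> j; rewrite inE /= !mxE; case: eqP => [->|_]; split => //.
    - by case/andP : cp.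
    - by rewrite /c; lra.
    - by rewrite mul1r.
  exists (p.1, upd i c p.2); split => //=.
  move=> j; rewrite inE /= !mxE; case: eqP => [->|_]; split => //.
  - by case/andP : cp.
  - by rewrite /c; lra.
  - by rewrite mul1r.
have qq j : q.1 ord0 j <= q.2 ord0 j.
  rewrite -subr_ge0; case: (pq j) => _ _ ->.
  by rewrite mulr_ge0 ?subr_ge0//; case: ifP => _; rewrite ?invr_ge0.
have [r [nPr qr]] := ih q us qq nPq.
exists r; split => // j; have [h1 h2 h3] := pq j; have [g1 g2 g3] := qr j.
split; [exact: le_trans g1|exact: (le_trans g2)|].
rewrite g3 h3 !inE mulrA; congr (_ * _).
by case: eqP => [->|_] /=; [rewrite (negbTE is_) mul1r|rewrite mulr1].
Qed.

(** Compactness by nested boxes: halving every side of a box where [P] fails leaves a smaller one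
    where [P] fails, and these shrink to a point [w] at which the local hypothesis is contradicted.
    The exponent [k] records that all boxes met are homothetic to the first one. *)
Lemma bisection a0 b0 : (forall i, a0 ord0 i <= b0 ord0 i) ->
  (forall w, cbox a0 b0 w -> exists2 d : R, 0 < d & forall k a b,
     b - a = 2^-1 ^+ k *: (b0 - a0) -> cbox a b w -> cbox a b `<=` cbox a0 b0 ->
     `|b - a| < d -> P a b) ->
  P a0 b0.
Proof.
move=> ab0 Ploc; apply: contrapT => nP.
pose good (p : E * E) := (forall i, p.1 ord0 i <= p.2 ord0 i) /\ ~ P p.1 p.2.
have hnext (p : E * E) : exists q, good p -> good q /\ halved (enum 'I_n) p q.
  have [gp|gp] := pselect (good p); last by exists p.
  have [q [nPq pq]] := halve_coords (enum_uniq 'I_n) gp.1 gp.2.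
  exists q => _; split => //; split => // j.
  rewrite -subr_ge0; case: (pq j) => _ _ ->.
  by rewrite mulr_ge0 ?subr_ge0 ?gp.1//; case: ifP => _; rewrite ?invr_ge0.
have /choice[nxt nxtP] := hnext.
pose q k := iter k nxt (a0, b0).
have gq k : good (q k).
  by elim: k => [//|k ih]; have [] := nxtP _ ih.
have qS k : halved (enum 'I_n) (q k) (q k.+1) by have [] := nxtP _ (gq k).
have qD k i : (q k).2 ord0 i - (q k).1 ord0 i = 2^-1 ^+ k * (b0 ord0 i - a0 ord0 i).
  elim: k => [|k ih]; first by rewrite expr0 mul1r.
  by have [_ _] := qS k i; rewrite mem_enum/= => ->; rewrite ih mulrA -exprS.
have mono i k l : (k <= l)%N ->
    (q k).1 ord0 i <= (q l).1 ord0 i /\ (q l).2 ord0 i <= (q k).2 ord0 i.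
  move=> /subnK <-; elim: (l - k)%N => [//|j [h1 h2]].
  by have [g1 g2 _] := qS (j + k)%N i; split; [exact: le_trans g1|exact: le_trans h2].
have cross i k l : (q k).1 ord0 i <= (q l).2 ord0 i.
  have [h1 _] := mono i _ _ (leq_maxl k l); have [_ h2] := mono i _ _ (leq_maxr k l).
  exact: (le_trans h1 (le_trans ((gq (maxn k l)).1 i) h2)).
(* Lower corners increase and stay below all upper corners, so their supremum lies in every box of
   the sequence. *)
pose w : E := \row_i sup (range (fun k => (q k).1 ord0 i)).
have wq k : cbox (q k).1 (q k).2 w.
  move=> i; rewrite mxE; apply/andP; split.
    apply: ub_le_sup; last by exists k.
    by exists ((q 0%N).2 ord0 i) => _ [l _ <-]; exact: cross.
  apply: ge_sup; first by exists ((q 0%N).1 ord0 i), 0%N.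
  by move=> _ [l _ <-]; exact: cross.
have [d d0 Pd] := Ploc w (wq 0%N).
have /cvgrPdist_lt/(_ d d0)[k _ kP] : 2^-1 ^+ k * `|b0 - a0| @[k --> \oo] --> (0 : R).
  rewrite -(mul0r `|b0 - a0|); apply: cvgMl; apply: cvg_expr.
  by rewrite ger0_norm ?invr_ge0// invf_lt1 ?ltr1n.
have qE : (q k).2 - (q k).1 = 2^-1 ^+ k *: (b0 - a0).
  by apply/rowP => i; have := qD k i; rewrite !mxE.
apply: (gq k).2; apply: (Pd k) => //.
  move=> x xq i; have := xq i; have [h1 h2] := mono i 0%N k (leq0n _).
  by move=> /andP[x1 x2]; rewrite (le_trans h1 x1) (le_trans x2 h2).
by rewrite qE normrZ; have := kP k (leqnn k); rewrite /= sub0r normrN normrM normr_id.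
Qed.

End bisection.

Lemma cbox_dist {R : realType} n (a b x w : 'rV[R]_n) :
  cbox a b x -> cbox a b w -> `|x - w| <= `|b - a|.
Proof.
move=> xab wab; apply/norm_leP => // i; apply: le_trans (norm_coord_le _ i).
rewrite !mxE; have /andP[? ?] := xab i; have /andP[? ?] := wab i.
by rewrite (ger0_norm (_ : 0 <= b ord0 i - a ord0 i)) ?ler_norml ?subr_ge0;
  [apply/andP; split; lra|lra].
Qed.

Section change_of_variables.
Context {R : realType} {n : nat}.
Local Notation E := 'rV[R]_n.+1.
Local Notation leb := (lebesgue_rV n.+1).
Variables (O : set E) (T S : E -> E) (J : E -> 'M[R]_n.+1).
Hypothesis oO : open O.
Hypothesis dT : forall w, O w -> forall e : R, 0 < e ->
  \forall w' \near w, `|T w' - T w - (w' - w) *m J w| <= e * `|w' - w|.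
Hypothesis uJ : forall w, O w -> J w \in unitmx.
Hypothesis cJ : forall w, O w -> {for w, continuous (fun w => \det (J w))}.
Let D := [set y | O (S y) /\ T (S y) = y].
Hypothesis TO : forall w, O w -> \forall y \near T w, D y.
Hypothesis LS : forall w, O w ->
  exists2 C : R, 0 < C & \forall y \near T w, `|S y - w| <= C * `|y - T w|.

Lemma cov_open : open D.
Proof.
rewrite openE => y [Oy Ty]; have := TO Oy; rewrite Ty.
by [].
Qed.

Lemma cov_inv_continuous y : D y -> {for y, continuous S}.
Proof.
move=> [Oy Ty]; have [C C0] := LS Oy; rewrite Ty => nS.
have [d d0 hd] := nbhs_norm_ball (V := E) nS.
apply/(continuous_epsP (V := E) (W := E)) => e e0.
exists (Num.min d (e / C)); first by rewrite lt_min d0 divr_gt0.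
move=> z; rewrite lt_min => /andP[/hd zS zy]; apply: (le_lt_trans zS).
by rewrite mulrC -ltr_pdivlMr.
Qed.

Let mD : measurable D. Proof. exact: open_measurable_rV cov_open. Qed.
Let mO : measurable O. Proof. exact: open_measurable_rV oO. Qed.
Let mS : measurable_fun D S.
Proof. exact: continuous_on_open_measurable_rV cov_open cov_inv_continuous. Qed.

Let absdet w : R := `|\det (J w)|.
Let mdet : measurable_fun O absdet.
Proof.
apply: continuous_on_open_measurable => // w Ow.
by apply: continuous_comp; [exact: cJ|exact: norm_continuous].
Qed.
Let mdetE : measurable_fun O (fun w => (absdet w)%:E).
Proof. exact/measurable_EFinP. Qed.
Let det0 w : O w -> (0 <= (absdet w)%:E)%E.
Proof. by move=> _; exact: normr_ge0. Qed.

Let lam1 B := leb (D `&` S @^-1` B).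
Let lam2 B := (\int[leb]_(w in O `&` B) (absdet w)%:E)%E.

(** Applying [invmx (J w)] to the differentiability estimate at [S y] shows that the affine
    coordinate of [y] is within [eta * |b - a|] of [S y]; enlarging the box absorbs this
    linearization error. *)
Lemma cov_upper_inclusion w eta : O w -> 0 < eta ->
  exists2 d : R, 0 < d & forall a b, cbox a b w -> `|b - a| < d ->
  D `&` S @^-1` box a b `<=`
    [set y | box (a - const_mx (eta * `|b - a|)) (b + const_mx (eta * `|b - a|))
      (w + (y - T w) *m invmx (J w))].
Proof.
move=> Ow eta0; have [K K0 hK] := mulmx_bound (invmx (J w)).
have e0 : 0 < eta / K by rewrite divr_gt0.
have [d d0 hd] := nbhs_norm_ball (V := E) (dT Ow e0).
exists d => // a b wab abd y [[Oy Ty] yab].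
have yab' : cbox a b (S y) by move=> i; have /andP[/ltW -> ->] := yab i.
have yw := cbox_dist yab' wab.
have := hd _ (le_lt_trans yw abd); rewrite Ty => hT.
have : `|w + (y - T w) *m invmx (J w) - S y| <= eta * `|b - a|.
  have -> : w + (y - T w) *m invmx (J w) - S y =
      (y - T w - (S y - w) *m J w) *m invmx (J w).
    by rewrite [RHS]mulmxBl mulmxK ?uJ// opprB addrCA addrA.
  apply: (le_trans (hK _)); rewrite -ler_pdivlMl//.
  apply: (le_trans hT); rewrite mulrA [K^-1 * _]mulrC ler_wpM2l//.
  exact: ltW.
move=> hh i; have := le_trans (norm_coord_le _ i) hh.
have /andP[] := yab i; rewrite !mxE ler_norml => h1 h2 /andP[h3 h4].
by apply/andP; split; lra.
Qed.

(** The reverse inclusion has to produce a preimage of [y]: near [T w] it is [S y], and the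
    Lipschitz bound keeps it close enough to [w] for the differentiability estimate to apply. *)
Lemma cov_lower_inclusion w eta : O w -> 0 < eta ->
  exists2 d : R, 0 < d & forall a b, cbox a b w -> `|b - a| < d ->
    [set y | box (a + const_mx (eta * `|b - a|)) (b - const_mx (eta * `|b - a|))
      (w + (y - T w) *m invmx (J w))] `<=` D `&` S @^-1` box a b.
Proof.
move=> Ow eta0; have [K K0 hK] := mulmx_bound (invmx (J w)).
have [K' K'0 hK'] := mulmx_bound (J w).
have [C C0 hC] := LS Ow.
have [d1 d10 h1] := nbhs_norm_ball (V := E) hC.
have [d2 d20 h2] := nbhs_norm_ball (V := E) (TO Ow).
have CK0 : 0 < C * K' by rewrite mulr_gt0.
(* [K'] bounds the step in [y], [C] the resulting step of [S], and [K] the return through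
   [invmx (J w)]; with this quotient the total error is [eta * r]. *)
have e0 : 0 < eta / (K * (C * K')) by rewrite divr_gt0// mulr_gt0.
have [d d0 hd] := nbhs_norm_ball (V := E) (dT Ow e0).
exists (Num.min (d / (C * K')) (Num.min (d1 / K') (d2 / K'))).
  by rewrite !lt_min !divr_gt0.
move=> a b wab; rewrite !lt_min => /andP[abd /andP[abd1 abd2]] y /= yab.
have [x xE] : exists x, x = w + (y - T w) *m invmx (J w) by eexists.
rewrite -xE in yab.
set r := `|b - a| in yab abd abd1 abd2 *.
have r0 : 0 <= r by exact: normr_ge0.
have er0 : 0 <= eta * r by rewrite mulr_ge0// ltW.
have xab : cbox a b x.
  move=> i; have := yab i; rewrite !mxE => /andP[h3 h4].
  by apply/andP; split; lra.
have xw := cbox_dist xab wab.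
have yT : y - T w = (x - w) *m J w.
  by rewrite xE addrAC subrr add0r mulmxKV ?uJ.
have yTr : `|y - T w| <= K' * r.
  by rewrite yT (le_trans (hK' _))// ler_pM2l.
have Dy : D y by apply: h2; apply: (le_lt_trans yTr); rewrite mulrC -ltr_pdivlMr.
split => //; have [Oy Ty] := Dy.
have Syw : `|S y - w| <= C * K' * r.
  apply: (le_trans (h1 _ _)); last by rewrite -mulrA ler_pM2l.
  by apply: (le_lt_trans yTr); rewrite mulrC -ltr_pdivlMr.
have : `|T (S y) - T w - (S y - w) *m J w| <= eta / (K * (C * K')) * `|S y - w|.
  by apply: hd; apply: (le_lt_trans Syw); rewrite mulrC -ltr_pdivlMr.
rewrite Ty => hT.
have : `|x - S y| <= eta * r.
  have -> : x - S y = (y - T w - (S y - w) *m J w) *m invmx (J w).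
    by rewrite xE [RHS]mulmxBl mulmxK ?uJ// opprB addrCA addrA.
  apply: (le_trans (hK _)); rewrite -ler_pdivlMl//.
  apply: (le_trans hT).
  have -> : K^-1 * (eta * r) = eta / (K * (C * K')) * (C * K' * r).
    by field; rewrite !gt_eqF.
  by rewrite ler_pM2l.
move=> hh i; have := le_trans (norm_coord_le _ i) hh.
have := yab i; rewrite !mxE ler_norml => /andP[h3 h4] /andP[h5 h6].
by apply/andP; split; lra.
Qed.

(* This closeness adds up when a box is cut in two, so by repeated bisection it
   only has to be checked on small boxes. *)
Definition cov_close (e : R) (a b : E) :=
  (lam1 (box a b) <= lam2 (box a b) + e%:E * leb (box a b))%E /\
  (lam2 (box a b) <= lam1 (box a b) + e%:E * leb (box a b))%E.

Lemma lebesgue_rV_boxE m (a b : 'rV[R]_m) : (forall i, a ord0 i <= b ord0 i) ->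
  lebesgue_rV m (box a b) = (\prod_i (b ord0 i - a ord0 i))%:E.
Proof.
move=> ab; rewrite lebesgue_rV_box; congr (_%:E); apply: eq_bigr => i _.
by rewrite max_r// subr_ge0.
Qed.

Lemma lam2_close (w : E) (e : R) : O w -> 0 < e ->
  exists2 d : R, 0 < d & forall a b, cbox a b w -> cbox a b `<=` O -> `|b - a| < d ->
  ((absdet w - e)%:E * leb (box a b) <= lam2 (box a b))%E /\
  (lam2 (box a b) <= (absdet w + e)%:E * leb (box a b))%E.
Proof.
move=> Ow e0; have /(continuous_epsP (V := E) (W := R))/(_ e e0)[d d0 hd] := cJ Ow.
exists d => // a b wab abO abd.
have bO : box a b `<=` O.
  by move=> x xab; apply: abO => i; have /andP[/ltW -> ->] := xab i.
have mb := @measurable_box R n.+1 a b.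
rewrite /lam2 (setIidr bO).
have hx x : box a b x -> absdet w - e <= absdet x <= absdet w + e.
  move=> xab; have := hd x; have xab' : cbox a b x.
    by move=> i; have /andP[/ltW -> ->] := xab i.
  move=> /(_ (le_lt_trans (cbox_dist xab' wab) abd)) /ltW h.
  have h1 := ler_dist_dist (\det (J x)) (\det (J w)).
  by have := le_trans h1 h; rewrite ler_norml /absdet => /andP[? ?]; apply/andP; split; lra.
have mdb : measurable_fun (box a b) (fun x => (absdet x)%:E).
  exact: measurable_funS mdetE.
split; rewrite -integral_cst//.
- have [we|we] := leP 0 (absdet w - e).
    apply: ge0_le_integral => //.
    by move=> x xab; rewrite lee_fin; have /andP[] := hx x xab.
  apply: (@le_trans _ _ 0%E); last by apply: integral_ge0 => x _; exact: normr_ge0.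
  by rewrite integral_cst// mule_le0_ge0// lee_fin ltW.
- apply: ge0_le_integral => //.
  + by move=> x _; exact: normr_ge0.
  + by move=> x xab; rewrite lee_fin; have /andP[] := hx x xab.
Qed.

Lemma power_close (c e : R) (m : nat) : 0 < e ->
  exists2 t : R, 0 < t < 1 & c * (1 + t) ^+ m <= c + e /\ c - e <= c * (1 - t) ^+ m.
Proof.
move=> e0.
have cf : {for 0, continuous (fun t : R => c * (1 + t) ^+ m)}.
  apply: cvgM; first exact: cvg_cst.
  by apply: (@continuous_comp _ _ _ (fun t : R => 1 + t) (fun t => t ^+ m));
    [apply: cvgD; [exact: cvg_cst|exact: cvg_id]|exact: exprn_continuous].
have /(continuous_epsP (V := R) (W := R))/(_ e e0)[d d0 hd] := cf.
pose t := Num.min (d / 2) 2^-1.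
have t0 : 0 < t by rewrite lt_min invr_gt0 divr_gt0/=.
have td : t < d by rewrite (@le_lt_trans _ _ (d / 2))// ?ge_min ?lexx//; lra.
exists t; first by rewrite t0/= (@le_lt_trans _ _ 2^-1)// ?ge_min ?lexx ?orbT//; lra.
split.
  have := hd t; rewrite subr0 gtr0_norm// => /(_ td).
  by rewrite addr0 expr1n mulr1 ltr_norml => /andP[_ /ltW]; lra.
have := hd (- t); rewrite subr0 normrN gtr0_norm// => /(_ td).
by rewrite addr0 expr1n mulr1 ltr_norml => /andP[/ltW + _]; lra.
Qed.

(** Boxes homothetic to the first one have sides comparable up to [c], so an error proportional to
    the longest side is a small fraction of every side. The volume then changes by a factor between
    [(1 - t) ^+ n.+1] and [(1 + t) ^+ n.+1]. *)
Lemma cov_local (a0 b0 w : E) (e : R) : (forall i, a0 ord0 i < b0 ord0 i) ->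
  O w -> 0 < e -> exists2 d : R, 0 < d & forall k a b,
    b - a = 2^-1 ^+ k *: (b0 - a0) -> cbox a b w -> cbox a b `<=` O ->
    `|b - a| < d -> cov_close e a b.
Proof.
move=> ab0 Ow e0.
have e20 : 0 < e / 2 by rewrite divr_gt0.
have [c c0 hc] : exists2 c : R, 0 < c & forall i, `|b0 - a0| <= c * (b0 ord0 i - a0 ord0 i).
  exists (1 + \sum_i `|b0 - a0| / (b0 ord0 i - a0 ord0 i)).
    by rewrite ltr_pwDl// sumr_ge0// => i _; rewrite divr_ge0// subr_ge0 ltW.
  move=> i; have bi : 0 < b0 ord0 i - a0 ord0 i by rewrite subr_gt0.
  rewrite -ler_pdivrMr// (bigD1 i)//= addrCA lerDl addr_ge0// sumr_ge0// => j _.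
  by rewrite divr_ge0// subr_ge0 ltW.
have [t /andP[t0 t1] [tup tlow]] := power_close (absdet w) n.+1 e20.
(* A side moves at both of its ends, hence the [2]; [c] compares the longest side with the given
   one. *)
pose eta := t / (2 * c).
have eta0 : 0 < eta by rewrite divr_gt0// mulr_gt0.
have [d1 d10 h1] := lam2_close Ow e20.
have [d2 d20 h2] := cov_upper_inclusion Ow eta0.
have [d3 d30 h3] := cov_lower_inclusion Ow eta0.
exists (Num.min d1 (Num.min d2 d3)); first by rewrite !lt_min d10 d20.
move=> k a b abk wab abO; rewrite !lt_min => /andP[abd1 /andP[abd2 abd3]].
have abE i : b ord0 i - a ord0 i = 2^-1 ^+ k * (b0 ord0 i - a0 ord0 i).
  by have /rowP/(_ i) := abk; rewrite !mxE.
have ab i : 0 < b ord0 i - a ord0 i.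
  by rewrite abE mulr_gt0 ?subr_gt0// exprn_gt0// invr_gt0.
have eab i : eta * `|b - a| <= t / 2 * (b ord0 i - a ord0 i).
  rewrite abE abk normrZ normrX normfV gtr0_norm//.
  rewrite [leRHS]mulrCA [leLHS]mulrCA ler_pM2l ?exprn_gt0 ?invr_gt0//.
  have -> : eta * `|b0 - a0| = t / 2 * (c^-1 * `|b0 - a0|).
    by rewrite /eta; field; rewrite gt_eqF.
  by rewrite ler_pM2l ?divr_gt0// ler_pdivrMl.
have Hbox : leb (box a b) = (\prod_i (b ord0 i - a ord0 i))%:E.
  by apply: lebesgue_rV_boxE => i; rewrite -subr_ge0 ltW.
set H := \prod_i (b ord0 i - a ord0 i) in Hbox.
have Hs (u : R) : u ^+ n.+1 * H = \prod_i (u * (b ord0 i - a ord0 i)).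
  by rewrite big_split/= prodr_const card_ord.
have H0 : 0 <= H by apply: prodr_ge0 => i _; exact: ltW.
have [l1 l2] := h1 a b wab abO abd1.
have m1 : (lam1 (box a b) <= (absdet w * (1 + t) ^+ n.+1 * H)%:E)%E.
  have ms := measurable_box (a - const_mx (eta * `|b - a|)) (b + const_mx (eta * `|b - a|)).
  apply: (@le_trans _ _ (leb [set y |
      box (a - const_mx (eta * `|b - a|)) (b + const_mx (eta * `|b - a|))
      (w + (y - T w) *m invmx (J w))])).
    apply: le_measure; rewrite ?inE.
    - by apply: mS => //; exact: measurable_box.
    - have := measurable_rV_lin (invmx (J w)) (w - T w *m invmx (J w)) measurableT ms.
      rewrite setTI; congr measurable; apply/seteqP; split => y /=;
        by rewrite mulmxBl addrCA.
    - exact: h2.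
  rewrite lebesgue_rV_affine ?uJ// -mulrA EFinM lee_pmul2l//; last first.
    by rewrite lte_fin normr_gt0 -unitfE -unitmxE uJ.
  rewrite lebesgue_rV_boxE; last first.
    by move=> i; rewrite !mxE; have := ab i; have := normr_ge0 (b - a);
      move: eta0; rewrite -subr_ge0 => *; nra.
  rewrite lee_fin Hs.
  apply: ler_prod => i _; rewrite !mxE; have := eab i; have := ab i.
  by move=> ? ?; apply/andP; split; [have := normr_ge0 (b - a); nra|lra].
have m2 : ((absdet w * (1 - t) ^+ n.+1 * H)%:E <= lam1 (box a b))%E.
  have ms := measurable_box (a + const_mx (eta * `|b - a|)) (b - const_mx (eta * `|b - a|)).
  apply: (@le_trans _ _ (leb [set y |
      box (a + const_mx (eta * `|b - a|)) (b - const_mx (eta * `|b - a|))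
      (w + (y - T w) *m invmx (J w))])); last first.
    apply: le_measure; rewrite ?inE.
    - have := measurable_rV_lin (invmx (J w)) (w - T w *m invmx (J w)) measurableT ms.
      rewrite setTI; congr measurable; apply/seteqP; split => y /=;
        by rewrite mulmxBl addrCA.
    - by apply: mS => //; exact: measurable_box.
    - exact: h3.
  rewrite lebesgue_rV_affine ?uJ// -mulrA EFinM lee_pmul2l//; last first.
    by rewrite lte_fin normr_gt0 -unitfE -unitmxE uJ.
  rewrite lebesgue_rV_boxE; last first.
    by move=> i; rewrite !mxE; have := eab i; have := ab i; nra.
  rewrite lee_fin Hs.
  apply: ler_prod => i _; rewrite !mxE; have := eab i; have := ab i.
  by move=> ? ?; apply/andP; split; [nra|lra].
rewrite /cov_close; rewrite Hbox in l1 l2 *; split.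
- apply: (le_trans m1); apply: (@le_trans _ _ ((absdet w - e / 2)%:E * H%:E + e%:E * H%:E)%E).
    by rewrite -!EFinM -EFinD lee_fin; nra.
  by rewrite leeD2r.
- apply: (le_trans l2); apply: (@le_trans _ _ ((absdet w * (1 - t) ^+ n.+1 * H)%:E + e%:E * H%:E)%E).
    by rewrite -!EFinM -EFinD lee_fin; nra.
  by rewrite leeD2r.
Qed.

Lemma box_split (a b : E) i c : a ord0 i <= c <= b ord0 i ->
  box a b = box a (upd i c b) `|` box (upd i c a) b.
Proof.
move=> /andP[ac cb]; apply/seteqP; split => x /=.
  move=> xab; have [xc|cx] := leP (x ord0 i) c; [left|right] => j;
    have /andP[h1 h2] := xab j; rewrite !mxE; apply/andP; split => //;
    by case: eqP => [->|].
move=> [] xab j; have := xab j; rewrite !mxE; case: eqP => [->|_ //] /andP[h1 h2].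
  by rewrite h1 (le_trans h2 cb).
by rewrite h2 (le_lt_trans ac h1).
Qed.

Lemma box_split_disj (a b : E) i c : box a (upd i c b) `&` box (upd i c a) b = set0.
Proof.
apply/seteqP; split => // x [h1 h2].
have := h1 i; have := h2 i; rewrite !mxE eqxx => /andP[h _] /andP[_ h'].
by move: (lt_le_trans h h'); rewrite ltxx.
Qed.

(** Extending [S] by a default value off [D] makes [lam1] the pushforward of a restricted Lebesgue
    measure, so that additivity on split boxes comes from the measure structure. *)
Let S' : E -> E := S \_ D.
Let mS' : measurable_fun setT S'.
Proof. by apply/(measurable_restrictT S mD). Qed.

Let m1 : {measure set E -> \bar R} :=
  measure_function_pushforward__canonical__measure_function_Measure (mrestr leb mD) mS'.
Let m2 : {measure set E -> \bar R} := density_measure leb mO mdetE det0.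

Let m1E B : m1 B = lam1 B.
Proof.
rewrite /m1/= /pushforward /mrestr/= /lam1; congr (leb _).
apply/seteqP; split => y /=; first by move=> [+ Dy]; rewrite /S' /patch mem_set.
by move=> [Dy By]; rewrite /S' /patch mem_set.
Qed.

Let m2E B : m2 B = lam2 B. Proof. by []. Qed.

Lemma cov_join e (a b : E) i c : a ord0 i <= c <= b ord0 i ->
  cov_close e a (upd i c b) -> cov_close e (upd i c a) b -> cov_close e a b.
Proof.
move=> acb [h1 h2] [h3 h4].
have ms := @measurable_box R n.+1.
have aux (x x' y y' u v : \bar R) : (x <= y + u -> x' <= y' + v ->
    x + x' <= y + y' + (u + v))%E.
  by move=> xy xy'; rewrite addeACA leeD.
have add (m : {measure set E -> \bar R}) :
    (m (box a b) = m (box a (upd i c b)) + m (box (upd i c a) b))%E.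
  by rewrite (box_split acb) measureU//; exact: box_split_disj.
rewrite /cov_close -!m1E -!m2E !add !m1E !m2E muleDr ?ge0_adde_def ?inE//.
by split; exact: aux.
Qed.

Lemma cov_box (a b : E) : cbox a b `<=` O -> lam1 (box a b) = lam2 (box a b).
Proof.
move=> abO; have [[i ba]|nba] := pselect (exists i, b ord0 i <= a ord0 i).
  have -> : box a b = set0.
    apply/seteqP; split => // x /(_ i) /andP[h1 h2].
    by have := lt_le_trans h1 (le_trans h2 ba); rewrite ltxx.
  by rewrite -m1E -m2E !measure0.
have ab i : a ord0 i < b ord0 i.
  by rewrite ltNge; apply/negP => h; apply: nba; exists i.
have cl e : 0 < e -> cov_close e a b.
  move=> e0; apply: (@bisection _ _ (cov_close e)).
  - by move=> *; apply: cov_join; eassumption.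
  - by move=> i; exact: ltW.
  - move=> w wab; have [d d0 hd] := cov_local ab (abO _ wab) e0.
    exists d => // k a' b' h1 h2 h3; apply: (hd k) => //.
    exact: subset_trans abO.
have HE : leb (box a b) = (\prod_i (b ord0 i - a ord0 i))%:E.
  by apply: lebesgue_rV_boxE => i; exact: ltW.
have H0 : 0 <= \prod_i (b ord0 i - a ord0 i).
  by apply: prodr_ge0 => i _; rewrite subr_ge0 ltW.
set H := \prod_i _ in HE H0.
have key x y : (forall e : R, (0 < e)%R -> x <= y + e%:E * leb (box a b))%E -> (x <= y)%E.
  move=> h; apply/lee_addgt0Pr => e e0.
  have e'0 : 0 < e / (H + 1) by rewrite divr_gt0// ltr_wpDl.
  apply: (le_trans (h _ e'0)); rewrite HE leeD2l// -EFinM lee_fin.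
  by rewrite mulrAC ler_pdivrMr ?ltr_wpDl// ler_pM2l// lerDl.
by apply/eqP; rewrite eq_le; apply/andP; split; apply: key => e /cl[].
Qed.

Lemma compact_cbox (a b : E) : compact (cbox a b).
Proof.
rewrite (_ : cbox a b = [set v | forall i, `[a ord0 i, b ord0 i]%classic (v ord0 i)]).
  apply: (@rV_compact _ _ (fun i => `[a ord0 i, b ord0 i]%classic)) => i.
  exact: segment_compact.
by apply/seteqP; split => x /= h i; have := h i; rewrite in_itv.
Qed.

Lemma lam2_lty (a b : E) : cbox a b `<=` O -> (lam2 (box a b) < +oo)%E.
Proof.
move=> abO; have [ab0|/set0P ab0] := eqVneq (cbox a b) set0.
  rewrite (_ : box a b = set0) ?[lam2 _]measure0//.
  rewrite -m2E measure0//.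
  apply/seteqP; split => // x xab; rewrite -ab0 => i.
  by have /andP[/ltW -> ->] := xab i.
have bO : box a b `<=` cbox a b by move=> x xab i; have /andP[/ltW -> ->] := xab i.
have [|c _ hc] := @EVT_max_rV R n.+1 absdet (cbox a b) ab0 (@compact_cbox a b).
  apply: continuous_in_subspaceT => w /set_mem/abO Ow.
  by apply: (@continuous_comp _ _ _ (fun w => \det (J w)) (fun t : R => `|t|));
    [exact: cJ|exact: norm_continuous].
have mb := @measurable_box R n.+1 a b.
apply: (@le_lt_trans _ _ (\int[leb]_(w in box a b) (absdet c)%:E)%E).
  rewrite /lam2 (setIidr (subset_trans bO abO)); apply: ge0_le_integral => //.
  - by move=> x _; exact: normr_ge0.
  - by apply: measurable_funS mdetE => //; exact: subset_trans abO.
  - by move=> x /bO xab; rewrite lee_fin hc// inE.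
by rewrite integral_cst// lte_mul_pinfty// ?lebesgue_rV_box_lty// lee_fin normr_ge0.
Qed.

(** Agreement on boxes whose closed hull lies in [O] identifies the two measures restricted to one
    such box, where the finiteness required by uniqueness holds. Countably many of these boxes, made
    disjoint, exhaust [O]. *)
Lemma cov_measure B : measurable B -> B `<=` O -> lam1 B = lam2 B.
Proof.
move=> mB BO; have [F [OF hF]] := open_bigcup_box oO.
have mF k : measurable (F k).
  by case: (hF k) => [->|[a [b [-> _]]]]; [exact: measurable0|exact: measurable_box].
have eqF k C : measurable C -> lam1 (C `&` F k) = lam2 (C `&` F k).
  move=> mC; case: (hF k) => [->|[a [b [Fk abO]]]].
    by rewrite setI0 -m1E -m2E !measure0.
  have mk := mF k; rewrite -m1E -m2E.
  have := @rV_measure_unique R n.+1 (mrestr m1 mk) (mrestr m2 mk).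
  have sub a' b' : cbox (\row_i Num.max (a' ord0 i) (a ord0 i))
      (\row_i Num.min (b' ord0 i) (b ord0 i)) `<=` O.
    move=> x xab; apply: abO => i; have := xab i; rewrite !mxE ge_max le_min.
    by move=> /andP[/andP[_ ->] /andP[_ ->]].
  apply => //.
  - by move=> a' b'; rewrite /= /mrestr m1E m2E Fk boxI cov_box.
  - move=> a' b'; rewrite /= /mrestr m1E Fk boxI cov_box//.
    exact: lam2_lty.
have BE : B = \bigcup_k (B `&` seqDU F k).
  by rewrite -setI_bigcupr -seqDU_bigcup_eq -OF; exact/esym/setIidl.
have msD k : measurable (seqDU F k).
  by apply: measurableD => //; apply: bigsetU_measurable.
have mBk k : measurable (B `&` seqDU F k) by exact: measurableI.
have tB : trivIset setT (fun k => B `&` seqDU F k).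
  by apply: trivIset_setIl; exact: trivIset_seqDU.
rewrite -m1E -m2E BE !measure_bigcup//.
apply: eq_eseriesr => k _.
have -> : B `&` seqDU F k = (B `&` seqDU F k) `&` F k.
  by apply/esym/setIidl => x [_]; exact: subset_seqDU.
by rewrite m1E m2E eqF.
Qed.

Lemma cov_continuous w : O w -> {for w, continuous T}.
Proof.
move=> Ow; have [K K0 hK] := mulmx_bound (J w).
have [d d0 hd] := nbhs_norm_ball (V := E) (dT Ow ltr01).
apply/(continuous_epsP (V := E) (W := E)) => e e0.
exists (Num.min d (e / (1 + K))); first by rewrite lt_min d0 divr_gt0// addr_gt0.
move=> z; rewrite lt_min => /andP[/hd zT]; rewrite ltr_pdivlMr ?addr_gt0// => zw.
rewrite (le_lt_trans _ zw)// mulrDr mulr1.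
rewrite -[T z - T w](subrK ((z - w) *m J w)) (le_trans (ler_normD _ _))// lerD//.
  by rewrite mul1r in zT.
by rewrite mulrC.
Qed.

(** The inverse [S] and its Lipschitz bounds are data. Injectivity of [T] on [O] is contained in
    them: the bound at [y = T w] forces [S (T w) = w]. *)
Theorem ge0_integral_cov (A : set E) (G : E -> \bar R) :
  measurable A -> A `<=` D -> measurable_fun A G -> (forall y, A y -> (0 <= G y)%E) ->
  (\int[leb]_(y in A) G y =
   \int[leb]_(w in O `&` T @^-1` A) (G (T w) * `|\det (J w)|%:E))%E.
Proof.
move=> mA AD mG G0.
have mT : measurable_fun O T.
  exact: continuous_on_open_measurable_rV oO cov_continuous.
apply: (ge0_integral_density mA mO mT mdet) => // C mC CA.
have mOC : measurable (O `&` T @^-1` C) by exact: mT.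
have OCO : O `&` T @^-1` C `<=` O by move=> w [].
rewrite -[RHS]/(\int[leb]_(w in _) (absdet w)%:E)%E -(setIidr OCO).
rewrite -[RHS]/(lam2 _) -cov_measure//; congr (leb _).
apply/seteqP; split => y /=; last by move=> [[Oy ->] []].
by move=> Cy; have [Oy Ty] := AD _ (CA _ Cy); rewrite Ty.
Qed.

End change_of_variables.

(** * Dot product and orthonormal frames *)

Section continuous_bigop.
Context {R : realType} {V W : normedModType R}.
Implicit Types (x : V).

Lemma for_continuous_cst (c : W) x : {for x, continuous (fun _ : V => c)}.
Proof. exact: cvg_cst. Qed.

Lemma for_continuousD (f g : V -> W) x : {for x, continuous f} ->
  {for x, continuous g} -> {for x, continuous (fun y => f y + g y)}.
Proof. exact: cvgD. Qed.

Lemma for_continuousM (f g : V -> R) x : {for x, continuous f} ->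
  {for x, continuous g} -> {for x, continuous (fun y => f y * g y)}.
Proof. exact: cvgM. Qed.

Lemma for_continuousZ (f : V -> R) (g : V -> W) x : {for x, continuous f} ->
  {for x, continuous g} -> {for x, continuous (fun y => f y *: g y)}.
Proof. exact: cvgZ. Qed.

Lemma for_continuous_sum (I : Type) (r : seq I) (P : pred I) (f : I -> V -> W) x :
  (forall i, P i -> {for x, continuous (f i)}) ->
  {for x, continuous (fun y => \sum_(i <- r | P i) f i y)}.
Proof.
move=> cf; elim: r => [|i r ih].
  rewrite (_ : (fun _ => _) = fun=> 0); first exact: for_continuous_cst.
  by apply/funext => y; rewrite big_nil.
have [Pi|nPi] := boolP (P i); last first.
  by rewrite (_ : (fun _ => _) = (fun y => \sum_(i <- r | P i) f i y))//;
    apply/funext => y; rewrite big_cons (negbTE nPi).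
rewrite (_ : (fun _ => _) = (fun y => f i y + \sum_(i <- r | P i) f i y)); last first.
  by apply/funext => y; rewrite big_cons Pi.
by apply: for_continuousD => //; exact: cf.
Qed.

Lemma for_continuous_prod (I : Type) (r : seq I) (P : pred I) (f : I -> V -> R) x :
  (forall i, P i -> {for x, continuous (f i)}) ->
  {for x, continuous (fun y => \prod_(i <- r | P i) f i y)}.
Proof.
move=> cf; elim: r => [|i r ih].
  rewrite (_ : (fun _ => _) = fun=> 1); first exact: cvg_cst.
  by apply/funext => y; rewrite big_nil.
have [Pi|nPi] := boolP (P i); last first.
  by rewrite (_ : (fun _ => _) = (fun y => \prod_(i <- r | P i) f i y))//;
    apply/funext => y; rewrite big_cons (negbTE nPi).
rewrite (_ : (fun _ => _) = (fun y => f i y * \prod_(i <- r | P i) f i y)); last first.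
  by apply/funext => y; rewrite big_cons Pi.
by apply: for_continuousM => //; exact: cf.
Qed.

End continuous_bigop.

Section dot.
Context {R : realType} {n : nat}.
Implicit Types x y z : 'rV[R]_n.

Lemma dotE x y : dot x y = \sum_i x ord0 i * y ord0 i.
Proof. by rewrite /dot mxE; apply: eq_bigr => i _; rewrite mxE. Qed.

Lemma dot_mx x y : x *m y^T = (dot x y)%:M.
Proof. by apply/matrixP => i j; rewrite !ord1 [RHS]mxE eqxx mulr1n. Qed.

Lemma dotC x y : dot x y = dot y x.
Proof. by rewrite !dotE; apply: eq_bigr => i _; rewrite mulrC. Qed.

Lemma dotDl x y z : dot (x + y) z = dot x z + dot y z.
Proof. by rewrite /dot mulmxDl mxE. Qed.

Lemma dotZl a x y : dot (a *: x) y = a * dot x y.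
Proof. by rewrite /dot -scalemxAl mxE. Qed.

Lemma dotNl x y : dot (- x) y = - dot x y.
Proof. by rewrite -scaleN1r dotZl mulN1r. Qed.

Lemma dotBl x y z : dot (x - y) z = dot x z - dot y z.
Proof. by rewrite dotDl dotNl. Qed.

Lemma dotDr x y z : dot z (x + y) = dot z x + dot z y.
Proof. by rewrite !(dotC z) dotDl. Qed.

Lemma dotZr a x y : dot y (a *: x) = a * dot y x.
Proof. by rewrite !(dotC y) dotZl. Qed.

Lemma dotNr x y : dot y (- x) = - dot y x.
Proof. by rewrite !(dotC y) dotNl. Qed.

Lemma dotBr x y z : dot z (x - y) = dot z x - dot z y.
Proof. by rewrite !(dotC z) dotBl. Qed.

Lemma dot0l x : dot 0 x = 0.
Proof. by rewrite -(scale0r 0) dotZl mul0r. Qed.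

Lemma dot0r x : dot x 0 = 0. Proof. by rewrite dotC dot0l. Qed.

Lemma dot_ge0 x : 0 <= dot x x.
Proof. by rewrite dotE sumr_ge0// => i _; rewrite -expr2 sqr_ge0. Qed.

Lemma dot_eq0 x : (dot x x == 0) = (x == 0).
Proof.
apply/eqP/eqP => [|->]; last exact: dot0l.
rewrite dotE => /eqP; rewrite psumr_eq0; last by move=> i _; rewrite -expr2 sqr_ge0.
move=> /allP h; apply/rowP => i; have := h i (mem_index_enum _).
by rewrite -expr2 sqrf_eq0 mxE => /eqP.
Qed.

Lemma dot_gt0 x : x != 0 -> 0 < dot x x.
Proof. by move=> x0; rewrite lt_neqAle dot_ge0 eq_sym dot_eq0 x0. Qed.

Lemma enorm_ge0 x : 0 <= enorm x. Proof. exact: sqrtr_ge0. Qed.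

Lemma enorm_sqr x : enorm x ^+ 2 = dot x x.
Proof. by rewrite sqr_sqrtr ?dot_ge0. Qed.

Lemma enorm_eq0 x : (enorm x == 0) = (x == 0).
Proof. by rewrite -sqrf_eq0 enorm_sqr dot_eq0. Qed.

Lemma enorm0 : enorm (0 : 'rV[R]_n) = 0.
Proof. by apply/eqP; rewrite enorm_eq0. Qed.

Lemma enorm_gt0 x : x != 0 -> 0 < enorm x.
Proof. by move=> x0; rewrite lt_neqAle enorm_ge0 eq_sym enorm_eq0 x0. Qed.

Lemma enormZ a x : enorm (a *: x) = `|a| * enorm x.
Proof.
by rewrite /enorm dotZl dotZr mulrA -expr2 sqrtrM ?sqr_ge0// sqrtr_sqr.
Qed.

Lemma enormN x : enorm (- x) = enorm x.
Proof. by rewrite -scaleN1r enormZ normrN normr1 mul1r. Qed.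

Lemma dot_le x y : dot x y <= enorm x * enorm y.
Proof.
have [->|y0] := eqVneq y 0; first by rewrite dot0r enorm0 mulr0.
have [->|x0] := eqVneq x 0; first by rewrite dot0l enorm0 mul0r.
have ex := enorm_gt0 x0; have ey := enorm_gt0 y0.
have := dot_ge0 (enorm y *: x - enorm x *: y).
rewrite dotBl !dotBr !dotZl !dotZr -!enorm_sqr (dotC y x) => h.
have : 0 <= 2 * (enorm x * enorm y) * (enorm x * enorm y - dot x y) by lra.
by rewrite pmulr_rge0 ?subr_ge0// mulr_gt0// mulr_gt0.
Qed.

Lemma abs_dot_le x y : `|dot x y| <= enorm x * enorm y.
Proof.
rewrite ler_norml dot_le andbT lerNl -dotNl.
by rewrite (le_trans (dot_le _ _))// enormN.
Qed.

Lemma enormD x y : enorm (x + y) <= enorm x + enorm y.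
Proof.
rewrite -(@ler_pXn2r _ 2)// ?nnegrE ?addr_ge0 ?enorm_ge0//.
rewrite enorm_sqr dotDl !dotDr (dotC y x) sqrrD !enorm_sqr.
by have := dot_le x y; lra.
Qed.

Lemma enormB x y : enorm (x - y) = enorm (y - x).
Proof. by rewrite -enormN opprB. Qed.

Lemma norm_le_enorm x : `|x| <= enorm x.
Proof.
apply/norm_leP; first exact: enorm_ge0.
move=> i; rewrite -(@ler_pXn2r _ 2)// ?nnegrE ?enorm_ge0// enorm_sqr.
rewrite real_normK ?num_real// dotE (bigD1 i)//= expr2 lerDl sumr_ge0// => j _.
by rewrite -expr2 sqr_ge0.
Qed.

Lemma enorm_le_norm x : enorm x <= n%:R * `|x|.
Proof.
rewrite -(@ler_pXn2r _ 2)// ?nnegrE ?enorm_ge0 ?mulr_ge0//.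
rewrite enorm_sqr dotE (@le_trans _ _ (\sum_(i < n) `|x| ^+ 2))//.
  apply: ler_sum => i _; rewrite -expr2 -real_normK ?num_real//.
  by rewrite ler_pXn2r// ?nnegrE// norm_coord_le.
rewrite sumr_const card_ord -[_ *+ n]mulr_natl exprMn ler_wpM2r ?sqr_ge0//.
case: n => [|k]; first by rewrite expr2 mul0r.
by rewrite expr2 ler_peMl// ler1n.
Qed.

End dot.

Lemma enorm_continuous {R : realType} n : continuous (@enorm R n).
Proof.
move=> x; apply/(continuous_epsP (V := 'rV[R]_n) (W := R)) => e e0.
exists (e / (n%:R + 1)); first by rewrite divr_gt0// ltr_wpDl.
move=> y; rewrite ltr_pdivlMr ?ltr_wpDl// => yx.
have yxe : enorm (y - x) < e.
  apply: le_lt_trans yx; rewrite mulrC; apply: (le_trans (enorm_le_norm _)).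
  by rewrite ler_wpM2r// lerDl.
apply: le_lt_trans yxe; rewrite ler_norml lerNl opprB !lerBlDr.
apply/andP; split; first by rewrite enormB (le_trans _ (enormD _ _))// subrK.
by rewrite (le_trans _ (enormD _ _))// subrK.
Qed.

Lemma compact_sphere {R : realType} n (r : R) : compact (@sphere R n r).
Proof.
apply: bounded_closed_compact.
  exists r; split; first exact: num_real.
  move=> M rM x /= xr; rewrite (le_trans (norm_le_enorm x))//.
  by move: xr; rewrite /sphere/= => ->; exact: ltW.
rewrite (_ : sphere r = @enorm R n @^-1` [set r])//.
apply: preimage_closed; first by move=> x _; exact: enorm_continuous.
exact/accessible_closed_set1/hausdorff_accessible/norm_hausdorff.
Qed.

Section orthonormal.
Context {R : realType}.

(** The Householder reflection along [w = N - e0] exchanges [e0] and [N]. Its rows are orthonormal,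
    the first one is [N], and the others form the frame; for [w = 0] the identity matrix does. *)
Lemma orthogonal_completion n (N : 'rV[R]_n.+1) : dot N N = 1 ->
  exists e : 'M[R]_(n, n.+1), e *m e^T = 1%:M /\ e *m N^T = 0.
Proof.
move=> N1; pose e0 : 'rV[R]_n.+1 := delta_mx 0 0.
have [w wdef] : exists w, w = N - e0 by eexists.
suff [H [HH H0]] : exists H : 'M[R]_(1 + n, n.+1), H *m H^T = 1%:M /\ usubmx H = N.
  exists (dsubmx H); move: HH; rewrite -(vsubmxK H) tr_col_mx mul_col_row.
  rewrite (scalar_mx_block 1 n 1) => /eq_block_mx[_ _ h1 h2].
  by rewrite !col_mxKd; split => //; rewrite -H0.
have row0 (H : 'M[R]_(1 + n, n.+1)) : usubmx H = e0 *m H.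
  rewrite -rowE; apply/rowP => j; rewrite !mxE; congr (H _ j).
  by apply/val_inj.
have e01 : dot e0 e0 = 1.
  by rewrite /dot /e0 trmx_delta mul_delta_mx mxE !eqxx.
have [w0|w0] := eqVneq w 0.
  exists 1%:M; rewrite trmx1 mulmx1; split => //.
  by rewrite row0 mulmx1; apply/eqP; rewrite eq_sym -subr_eq0 -wdef w0.
have ww := dot_gt0 w0.
have wE : dot w w = 2 * (1 - dot e0 N).
  by rewrite wdef dotBl !dotBr N1 e01 (dotC N e0); ring.
pose c := 2 / dot w w; exists (1%:M - c *: (w^T *m w)).
split; last first.
  rewrite row0 mulmxBr mulmx1 -scalemxAr mulmxA dot_mx mul_scalar_mx scalerA.
  have -> : c * dot e0 w = -1.
    rewrite /c wE wdef dotBr e01; field.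
    by move: (lt0r_neq0 ww); rewrite wE mulf_eq0 negb_or => /andP[_].
  by rewrite scaleN1r opprK wdef addrC subrK.
have -> : (1%:M - c *: (w^T *m w))^T = 1%:M - c *: (w^T *m w).
  by rewrite linearB/= trmx1 linearZ/= trmx_mul trmxK.
rewrite mulmxBl mul1mx !mulmxBr mulmx1.
rewrite -!scalemxAl -!scalemxAr !mulmxA -[w^T *m w *m w^T]mulmxA dot_mx.
rewrite mul_mx_scalar -scalemxAl !scalerA.
have -> : c * (c * dot w w) = c + c.
  by rewrite /c divfK ?lt0r_neq0//; ring.
by rewrite scalerDl -addrA -opprB; apply/matrixP => i j; rewrite !mxE; ring.
Qed.

Lemma quadratic_le0 (a b : R) : (forall t, t * a + t ^+ 2 * b <= 0) -> a = 0.
Proof.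
move=> h; apply/eqP; apply: contraT => a0.
have c0 : 0 < `|b| + 1 by rewrite ltr_wpDl.
have := h (a / (`|b| + 1)).
have -> : a / (`|b| + 1) * a + (a / (`|b| + 1)) ^+ 2 * b =
    a ^+ 2 / (`|b| + 1) ^+ 2 * (`|b| + 1 + b) by field; rewrite gt_eqF.
rewrite leNgt mulr_gt0//.
  by apply: divr_gt0; [rewrite exprn_even_gt0|rewrite exprn_gt0].
by have := ler_norm (- b); rewrite normrN; lra.
Qed.

(** A maximizer [v] of the quadratic form on the unit sphere is an eigenvector: along the residual
    [z = v *m B - f v *: v] the first variation of [f x - f v * |x|^2] is [2 |z|^2], and it vanishes
    at a maximum. *)
Lemma symmetric_eigenvector n (B : 'M[R]_n.+1) : B^T = B ->
  exists v a, dot v v = 1 /\ v *m B = a *: v.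
Proof.
move=> Bs; pose f (x : 'rV[R]_n.+1) := dot (x *m B) x.
have fB x y : dot (x *m B) y = dot (y *m B) x.
  by rewrite dotC /dot trmx_mul Bs mulmxA.
have cf : continuous f.
  move=> x; rewrite (_ : f = fun x => \sum_i (\sum_j x ord0 j * B j i) * x ord0 i).
    apply: (@for_continuous_sum _ 'rV[R]_n.+1 R) => i _.
    apply: (@for_continuousM _ 'rV[R]_n.+1); last exact: coord_continuous.
    apply: (@for_continuous_sum _ 'rV[R]_n.+1 R) => j _.
    apply: (@for_continuousM _ 'rV[R]_n.+1); first exact: coord_continuous.
    exact: (@for_continuous_cst _ 'rV[R]_n.+1 R).
  by apply/funext => y; rewrite /f dotE; apply: eq_bigr => i _; rewrite mxE.
have [||v] := @EVT_max_rV R n.+1 f (sphere 1) _ (@compact_sphere R n.+1 1).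
- exists (delta_mx 0 0); rewrite /sphere/= /enorm /dot trmx_delta mul_delta_mx mxE !eqxx.
  by rewrite sqrtr1.
- exact: continuous_subspaceT.
rewrite inE /sphere/= => v1 vmax.
have vv : dot v v = 1 by rewrite -enorm_sqr v1 expr1n.
exists v, (f v); split => //.
have fle y : f y <= f v * dot y y.
  have [->|y0] := eqVneq y 0; first by rewrite /f mul0mx dot0l mulr0.
  have := vmax ((enorm y)^-1 *: y); rewrite inE /sphere/= enormZ normfV.
  rewrite ger0_norm ?enorm_ge0// mulVf ?enorm_eq0// => /(_ erefl).
  rewrite /f -scalemxAl dotZl dotZr mulrA -expr2 exprVn enorm_sqr mulrC.
  by rewrite ler_pdivrMr// dot_gt0.
apply/eqP; rewrite -subr_eq0 -dot_eq0; apply/eqP.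
have [z zdef] : exists z, z = v *m B - f v *: v by eexists.
have vz : dot (v *m B) z - f v * dot v z = dot z z.
  by rewrite -dotZl -dotBl -zdef.
rewrite -zdef; suff : 2 * (dot (v *m B) z - f v * dot v z) = 0 by rewrite vz; lra.
apply: (@quadratic_le0 _ (f z - f v * dot z z)) => t.
have fE : f (v + t *: z) = f v + t * (2 * dot (v *m B) z) + t ^+ 2 * f z.
  rewrite /f mulmxDl -scalemxAl dotDl !dotDr !dotZl !dotZr (fB z v).
  by ring.
have dE : dot (v + t *: z) (v + t *: z) = 1 + t * (2 * dot v z) + t ^+ 2 * dot z z.
  by rewrite dotDl !dotDr !dotZl !dotZr (dotC z v) vv; ring.
by have := fle (v + t *: z); rewrite fE dE; lra.
Qed.

(** Deflation: the orthogonal complement of an eigenvector is invariant, and an orthonormal frame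
    [e] of it compresses [B] to the smaller symmetric matrix [e *m B *m e^T]. *)
Lemma symmetric_diagonalization n (B : 'M[R]_n) : B^T = B ->
  exists (Q : 'M[R]_n) (k : 'rV[R]_n), Q *m Q^T = 1%:M /\ Q *m B = diag_mx k *m Q.
Proof.
elim: n B => [|n ih] B Bs.
  by exists 1%:M, 0; split; apply/matrixP => -[].
have [v [a [vv vB]]] := symmetric_eigenvector Bs.
have [e [ee ev]] := orthogonal_completion vv.
have ve : v *m e^T = 0 by rewrite -[v *m _]trmxK trmx_mul trmxK ev trmx0.
have EE : col_mx v e *m (col_mx v e)^T = 1%:M.
  by rewrite tr_col_mx mul_col_row dot_mx vv ev ve ee -scalar_mx_block.
have EE' : v^T *m v + e^T *m e = 1%:M.
  by rewrite -mul_row_col -tr_col_mx; exact: (@mulmx1C _ n.+1 _ _ EE).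
have [Q [k [QQ QB]]] := ih (e *m B *m e^T) ltac:(by rewrite !trmx_mul trmxK Bs mulmxA).
exists (col_mx v (Q *m e)), (row_mx a%:M k : 'rV[R]_(1 + n)); split.
  suff : @mulmx _ (1 + n) n.+1 (1 + n) (col_mx v (Q *m e)) (col_mx v (Q *m e))^T = 1%:M by [].
  rewrite tr_col_mx mul_col_row dot_mx vv trmx_mul mulmxA ve mul0mx -!mulmxA ev mulmx0.
  by rewrite (mulmxA e) ee mul1mx QQ -scalar_mx_block.
suff : @mulmx _ (1 + n) n.+1 n.+1 (col_mx v (Q *m e)) B =
  @mulmx _ (1 + n) (1 + n) n.+1 (diag_mx (row_mx a%:M k)) (col_mx v (Q *m e)) by [].
rewrite mul_col_mx vB diag_mx_row mul_block_col !mul0mx addr0 add0r.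
congr col_mx.
  rewrite -mul_scalar_mx; congr (_ *m v); apply/matrixP => i j.
  by rewrite !ord1 !mxE eqxx mulr1n.
rewrite mulmxA -QB -[LHS]mulmx1 -EE' mulmxDr !mulmxA.
have -> : Q *m e *m B *m v^T = 0.
  by rewrite -!mulmxA -[B in B *m v^T]Bs -trmx_mul vB linearZ/= -scalemxAr ev scaler0 mulmx0.
by rewrite mul0mx add0r.
Qed.

(** In the orthonormal frame [(N, e)] the tangent rows become [J = A *m e], and the tube matrix is
    block diagonal with blocks [1] and [A *m D], where [D] holds the factors [1 + s * k_i]. The
    frame has determinant of modulus one, and [J *m J^T] has determinant [(det A)^2]. *)
Lemma tube_det n (J K : 'M[R]_(n, n.+1)) (N : 'rV[R]_n.+1) (e : 'M[R]_(n, n.+1))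
    (M : 'M[R]_n.+1) (k : 'rV[R]_n) (s : R) :
  e *m e^T = 1%:M -> e *m N^T = 0 -> dot N N = 1 -> J *m N^T = 0 ->
  K = J *m M -> e *m M = diag_mx k *m e ->
  `|\det (col_mx N (J + s *: K) : 'M[R]_n.+1)| =
  Num.sqrt (\det (J *m J^T)) * \prod_i `|1 + s * k ord0 i|.
Proof.
move=> ee eN NN JN KJ eM.
have Ne : N *m e^T = 0 by rewrite -[N *m _]trmxK trmx_mul trmxK eN trmx0.
have EE : col_mx N e *m (col_mx N e)^T = 1%:M.
  by rewrite tr_col_mx mul_col_row dot_mx NN eN Ne ee -scalar_mx_block.
have EE' : N^T *m N + e^T *m e = 1%:M.
  by rewrite -mul_row_col -tr_col_mx; exact: (@mulmx1C _ n.+1 _ _ EE).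
pose A := J *m e^T.
have JA : J = A *m e by rewrite -[J]mulmx1 -EE' mulmxDr !mulmxA JN mul0mx add0r.
have -> : J *m J^T = A *m A^T.
  by rewrite JA trmx_mul mulmxA -[A *m e *m _]mulmxA ee mulmx1.
rewrite det_mulmx det_tr -expr2 sqrtr_sqr.
pose D : 'M[R]_n := diag_mx (\row_i (1 + s * k ord0 i)).
have DE : 1%:M + s *: diag_mx k = D.
  by apply/matrixP => i j; rewrite !mxE; case: eqP => _; rewrite ?mulr1n ?mulr0n ?mulr0 ?addr0.
have E : col_mx N (J + s *: K) = block_mx 1%:M 0 0 (A *m D) *m col_mx N e.
  rewrite mul_block_col mul1mx !mul0mx addr0 add0r; congr col_mx.
  rewrite KJ JA -[A *m e *m M]mulmxA eM -DE mulmxDr mulmx1 mulmxDl; congr (_ + _).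
  by rewrite -scalemxAr -scalemxAl !mulmxA.
have -> : \det (col_mx N (J + s *: K) : 'M[R]_n.+1) =
    \det (block_mx 1%:M 0 0 (A *m D) : 'M[R]_(1 + n)) * \det (col_mx N e : 'M[R]_n.+1).
  by rewrite -det_mulmx; congr (\det _); exact: E.
rewrite det_ublock det1 mul1r det_mulmx det_diag !normrM.
have -> : `|\det (col_mx N e : 'M[R]_n.+1)| = 1.
  have := congr1 (fun M => \det M) EE; rewrite det_mulmx det_tr det1 -expr2 => /eqP.
  by rewrite sqrf_eq1 => /orP[]/eqP->; rewrite ?normrN normr1.
rewrite mulr1 normr_prod; congr (_ * _); apply: eq_bigr => i _.
by rewrite mxE.
Qed.

Lemma prod_elementary_symmetric n (k : 'rV[R]_n) (s : R) :
  \prod_i (1 + s * k ord0 i) = \sum_(j < n.+1) s ^+ j * elementary_symmetric j k.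
Proof.
under eq_bigr do rewrite addrC.
rewrite bigA_distr/=.
rewrite (partition_big (fun A : {set 'I_n} => inord #|A| : 'I_n.+1) xpredT)//=.
apply: eq_bigr => j _; rewrite /elementary_symmetric mulr_sumr.
apply: eq_big => [A|A /eqP Aj].
  rewrite -val_eqE/= inordK// ltnS -[X in (_ <= X)%N](card_ord n).
  by rewrite max_card.
have {}Aj : #|A| = j.
  rewrite -Aj inordK// ltnS -[X in (_ <= X)%N](card_ord n).
  by rewrite max_card.
rewrite (bigID (mem A))/= [X in _ * X]big1 ?mulr1; last by move=> i /negbTE ->.
transitivity (\prod_(i in A) (s * k ord0 i)); first by apply: eq_bigr => i ->.
by rewrite big_split/= prodr_const Aj.
Qed.

End orthonormal.

(** * Differential calculus on row vectors *)

Section differentiable_eps.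
Context {R : realType} {V W : normedModType R}.
Implicit Types (f g : V -> W) (x : V).

Lemma differentiable_eps f x : differentiable f x -> forall e : R, 0 < e ->
  exists2 d : R, 0 < d &
    forall y, `|y - x| < d -> `|f y - f x - 'd f x (y - x)| <= e * `|y - x|.
Proof.
move=> /diff_locally /eqaddoP df e e0.
have /nbhs_norm_ball[d d0 hd] := df e e0.
exists d => // y yx; have := hd (y - x); rewrite subr0 => /(_ yx) /=.
by rewrite !fctE/= subrK opprD addrA.
Qed.

Lemma eps_differentiable f (L : {linear V -> W}) x : continuous L ->
  (forall e : R, 0 < e -> exists2 d : R, 0 < d &
    forall y, `|y - x| < d -> `|f y - f x - L (y - x)| <= e * `|y - x|) ->
  differentiable f x /\ 'd f x = L :> (V -> W).
Proof.
move=> cL h.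
have fE : f \o shift x = cst (f x) + L +o_ 0 id.
  apply/eqaddoP => e e0; have [d d0 hd] := h e e0.
  apply: (norm_ball_nbhs d0) => y; rewrite subr0 => yd.
  by have := hd (y + x); rewrite addrK => /(_ yd); rewrite !fctE/= opprD addrA.
have dE := diff_unique cL fE; split => //.
apply/diff_locallyP; rewrite dE; split => //.
Qed.

Lemma open_norm_ball (U : set V) x : open U -> U x ->
  exists2 d : R, 0 < d & forall y, `|y - x| < d -> U y.
Proof. by move=> oU Ux; apply: nbhs_norm_ball; exact: open_nbhs_nbhs. Qed.

Lemma eq_open_differentiable (U : set V) f g x : open U -> U x ->
  (forall y, U y -> f y = g y) -> differentiable f x -> differentiable g x.
Proof.
move=> oU Ux fg df.
have [] // := @eps_differentiable g ('d f x) x _ _; first exact: diff_continuous.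
move=> e e0; have [d d0 hd] := differentiable_eps df e0.
have [d' d'0 hU] := open_norm_ball oU Ux.
exists (Num.min d d'); first by rewrite lt_min d0.
by move=> y; rewrite lt_min => /andP[/hd + /hU Uy]; rewrite !fg.
Qed.

Lemma eq_open_derive (U : set V) f g x v : open U -> U x ->
  (forall y, U y -> f y = g y) -> 'D_v f x = 'D_v g x.
Proof.
move=> oU Ux fg; apply: near_eq_derive.
by have [d d0 hU] := open_norm_ball oU Ux; apply: (norm_ball_nbhs d0) => y /hU/fg.
Qed.

End differentiable_eps.

Section chain_rule.
Context {R : realType} {U V W : normedModType R}.

Lemma comp_differentiable (f : U -> V) (g : V -> W) x :
  differentiable f x -> differentiable g (f x) ->
  differentiable (fun y => g (f y)) x.
Proof. exact: differentiable_comp. Qed.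

Lemma comp_diff (f : U -> V) (g : V -> W) x v :
  differentiable f x -> differentiable g (f x) ->
  'd (fun y => g (f y)) x v = 'd g (f x) ('d f x v).
Proof. by move=> df dg; rewrite (@diff_comp R U V W f g x df dg). Qed.

Lemma comp_derive (f : U -> V) (g : V -> W) x v :
  differentiable f x -> differentiable g (f x) ->
  'D_v (fun y => g (f y)) x = 'd g (f x) ('D_v f x).
Proof.
move=> df dg; have dfg := comp_differentiable df dg.
by rewrite (deriveE _ dfg) (deriveE _ df) (comp_diff v df dg).
Qed.

Lemma lin_derive (L : {linear V -> W}) x v : continuous L -> 'D_v L x = L v.
Proof.
by move=> cL; rewrite (deriveE v (linear_differentiable x cL)) diff_lin.
Qed.

Lemma lin_comp_derive (f : U -> V) (L : {linear V -> W}) x v : continuous L ->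
  differentiable f x -> 'D_v (fun y => L (f y)) x = L ('D_v f x).
Proof.
move=> cL df; rewrite (comp_derive v df (linear_differentiable _ cL)).
by rewrite diff_lin.
Qed.

End chain_rule.

Section sqrt_derive.
Context {R : realType} {V : normedModType R}.

Lemma sqrt_differentiable (r : R) : 0 < r -> differentiable (Num.sqrt : R -> R) r.
Proof. by move=> r0; apply/derivable1_diffP; have [] := is_derive1_sqrt r0. Qed.

Lemma sqrt_comp_derive (f : V -> R) x v : differentiable f x -> 0 < f x ->
  'D_v (fun y => Num.sqrt (f y)) x = (2 * Num.sqrt (f x))^-1 * 'D_v f x.
Proof.
move=> df f0; rewrite (comp_derive v df (sqrt_differentiable f0)).
have [dsr dsE] := is_derive1_sqrt f0.
by rewrite (deriv1E dsr) /= derive1E dsE; exact: mulrC.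
Qed.

End sqrt_derive.

Lemma matrix_ext {R : realType} m p (A B : 'M[R]_(m, p)) :
  (forall v : 'rV[R]_m, v *m A = v *m B) -> A = B.
Proof. by move=> h; apply/row_matrixP => i; rewrite !rowE. Qed.

Section Ck_theory.
Context {R : realType} {n : nat}.
Local Notation V := 'rV[R]_n.
Implicit Types (U : set V) (k : nat) (x v : V).

Lemma Ck_eq {W : normedModType R} k U (f g : V -> W) : open U ->
  (forall x, U x -> f x = g x) -> Ck k U f -> Ck k U g.
Proof.
move=> oU; elim: k f g => [|k ih] f g fg /=.
  move=> cf x Ux; have [d d0 hU] := open_norm_ball (V := V) oU Ux.
  apply/(continuous_epsP (V := V)) => e e0.
  have /(continuous_epsP (V := V))/(_ e e0)[d' d'0 hf] := cf x Ux.
  exists (Num.min d d'); first by rewrite lt_min d0.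
  by move=> y; rewrite lt_min => /andP[/hU Uy /hf]; rewrite !fg.
move=> [df Df]; split.
  by move=> x Ux; apply: (eq_open_differentiable (V := V) oU Ux fg); exact: df.
move=> v; apply: ih (Df v) => x Ux.
exact: (eq_open_derive (V := V) v oU Ux fg).
Qed.

Lemma Ck_differentiable {W : normedModType R} k U (f : V -> W) x :
  Ck k.+1 U f -> U x -> differentiable f x.
Proof. by move=> [+ _]; exact. Qed.

Lemma CkW {W : normedModType R} k U (f : V -> W) : Ck k.+1 U f -> Ck k U f.
Proof.
elim: k f => [|k ih] f.
  by move=> [df _] x Ux; apply: (@differentiable_continuous _ V W); exact: df.
by move=> [df Df]; split => // v; apply: ih; exact: Df.
Qed.

Lemma Ck_sub {W : normedModType R} k U U' (f : V -> W) : U' `<=` U ->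
  Ck k U f -> Ck k U' f.
Proof.
move=> UU; elim: k f => [|k ih] f /=; first by move=> cf x /UU; exact: cf.
by move=> [df Df]; split => [x /UU|v]; [exact: df|exact: ih].
Qed.

Lemma Ck_cst {W : normedModType R} k U (c : W) : Ck k U (fun _ : V => c).
Proof.
elim: k c => [|k ih] c /=; first by move=> x _; exact: (for_continuous_cst (V := V)).
split => [x _|v]; first exact: (@differentiable_cst _ V).
rewrite (_ : 'D_v _ = (fun=> 0))//.
by apply/funext => x; exact: (@derive_cst _ V).
Qed.

Lemma CkD {W : normedModType R} k U (f g : V -> W) : open U ->
  Ck k U f -> Ck k U g -> Ck k U (fun x => f x + g x).
Proof.
move=> oU; elim: k f g => [|k ih] f g /=.
  by move=> cf cg x Ux; apply: (for_continuousD (V := V)); [exact: cf|exact: cg].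
move=> [df Df] [dg Dg]; split.
  by move=> x Ux; apply: (@differentiableD _ V W); [exact: df|exact: dg].
move=> v; apply: (@Ck_eq _ k U (fun x => 'D_v f x + 'D_v g x)) => //.
  move=> x Ux; apply/esym/(@deriveD _ V W); apply: diff_derivable;
    [exact: df|exact: dg].
by apply: ih; [exact: Df|exact: Dg].
Qed.

Lemma Ck_lin {W W' : normedModType R} (L : {linear W -> W'}) k U (f : V -> W) :
  open U -> continuous L -> Ck k U f -> Ck k U (fun x => L (f x)).
Proof.
move=> oU cL; elim: k f => [|k ih] f /=.
  by move=> cf x Ux; apply: continuous_comp; [exact: cf|exact: cL].
move=> [df Df]; split.
  move=> x Ux; apply: (@comp_differentiable _ V W W'); first exact: df.
  exact: linear_differentiable.
move=> v; apply: (@Ck_eq _ k U (fun x => L ('D_v f x))) => //.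
  by move=> x Ux; rewrite (@lin_comp_derive _ V W W')//; exact: df.
exact/ih/Df.
Qed.

Lemma CkM k U (f g : V -> R) : open U ->
  Ck k U f -> Ck k U g -> Ck k U (fun x => f x * g x).
Proof.
move=> oU; elim: k f g => [|k ih] f g.
  by move=> cf cg x Ux; apply: (for_continuousM (V := V)); [exact: cf|exact: cg].
move=> Cf Cg; have [df Df] := Cf; have [dg Dg] := Cg; split.
  by move=> x Ux; apply: (@differentiableM _ V); [exact: df|exact: dg].
move=> v; apply: (@Ck_eq _ k U (fun x => f x * 'D_v g x + g x * 'D_v f x)) => //.
  move=> x Ux; apply/esym/(@deriveM _ V); apply: diff_derivable;
    [exact: df|exact: dg].
by apply: CkD => //; apply: ih => //; first [exact: CkW|exact: Df|exact: Dg].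
Qed.

Lemma Ck_sum {W : normedModType R} (I : Type) (r : seq I) (f : I -> V -> W) k U :
  open U -> (forall i, Ck k U (f i)) -> Ck k U (fun x => \sum_(i <- r) f i x).
Proof.
move=> oU Cf; elim: r => [|i r ih].
  rewrite (_ : (fun _ => _) = fun=> 0); first exact: Ck_cst.
  by apply/funext => x; rewrite big_nil.
rewrite (_ : (fun _ => _) = (fun y => f i y + \sum_(i <- r) f i y)).
  exact: CkD.
by apply/funext => y; rewrite big_cons.
Qed.

Lemma CkV k U (f : V -> R) : open U -> (forall x, U x -> f x != 0) ->
  Ck k U f -> Ck k U (fun x => (f x)^-1).
Proof.
move=> oU f0; elim: k => [|k ih].
  by move=> cf x Ux; apply: (@cvgV _ _ (nbhs (x : V))); [exact: f0|exact: cf].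
move=> Cf; have [df Df] := Cf; split.
  by move=> x Ux; apply: (@differentiableV _ V); [exact: df|exact: f0].
move=> v; apply: (@Ck_eq _ k U (fun x => -1 * ((f x)^-1 * (f x)^-1) * 'D_v f x)) => //.
  move=> x Ux; rewrite (@deriveV _ V) ?f0//; last exact/diff_derivable/df.
  by rewrite mulN1r -expr2 exprVn.
have Ci := ih (CkW Cf).
apply: CkM; [exact: oU| |exact: Df].
by apply: CkM; [exact: oU|exact: Ck_cst|exact: CkM].
Qed.

Lemma Ck_sqrt k U (f : V -> R) : open U -> (forall x, U x -> 0 < f x) ->
  Ck k U f -> Ck k U (fun x => Num.sqrt (f x)).
Proof.
move=> oU f0; elim: k => [|k ih].
  move=> cf x Ux; apply: (@continuous_comp _ _ _ f Num.sqrt); first exact: cf.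
  exact: sqrt_continuous.
move=> Cf; have [df Df] := Cf; split.
  move=> x Ux; apply: (@comp_differentiable _ V R R f Num.sqrt); first exact: df.
  exact/sqrt_differentiable/f0.
move=> v; apply: (@Ck_eq _ k U (fun x => (2 * Num.sqrt (f x))^-1 * 'D_v f x)) => //.
  by move=> x Ux; rewrite (@sqrt_comp_derive _ V)//; [exact: df|exact: f0].
apply: CkM; [exact: oU| |exact: Df]; apply: CkV => //.
  by move=> x Ux; rewrite mulf_neq0// gt_eqF// sqrtr_gt0 f0.
by apply: CkM => //; [exact: Ck_cst|exact/ih/CkW].
Qed.

End Ck_theory.

Section coordinates.
Context {R : realType}.

Definition coordf {m} (i : 'I_m) (y : 'rV[R]_m) : R := y ord0 i.

Lemma coordf_linear m (i : 'I_m) : linear (coordf i).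
Proof. by move=> a u v; rewrite /coordf !mxE. Qed.

HB.instance Definition _ m (i : 'I_m) :=
  GRing.isLinear.Build R 'rV[R]_m R _ (coordf i) (coordf_linear i).

Definition scalev {W : normedModType R} (w : W) (c : R) : W := c *: w.

Lemma scalev_linear (W : normedModType R) (w : W) : linear (scalev w).
Proof. by move=> a u v; rewrite /scalev scalerDl scalerA. Qed.

HB.instance Definition _ (W : normedModType R) (w : W) :=
  GRing.isLinear.Build R R W _ (scalev w) (scalev_linear w).

Lemma scalev_continuous (W : normedModType R) (w : W) : continuous (scalev w).
Proof. by move=> c; apply: cvgZl; exact: cvg_id. Qed.

Lemma coordf_continuous m (i : 'I_m) : continuous (coordf i).
Proof. exact: coord_continuous. Qed.

Lemma rV_sum_coord m (y : 'rV[R]_m) :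
  y = \sum_i scalev (delta_mx ord0 i : 'rV[R]_m) (coordf i y).
Proof. exact: row_sum_delta. Qed.

Lemma linear_rV_continuous m (W : normedModType R) (L : {linear 'rV[R]_m -> W}) :
  continuous L.
Proof.
rewrite (_ : L = (fun y => \sum_i y ord0 i *: L (delta_mx ord0 i)) :> (_ -> _)).
  move=> y; apply: (@for_continuous_sum _ 'rV[R]_m) => i _.
  apply: (@for_continuousZ _ 'rV[R]_m); first exact: coord_continuous.
  exact: (@for_continuous_cst _ 'rV[R]_m).
apply/funext => y; rewrite {1}(row_sum_delta y) linear_sum.
by apply: eq_bigr => i _; rewrite linearZ.
Qed.

Section Ck_rV.
Context {n : nat}.
Implicit Type U : set 'rV[R]_n.

Lemma Ck_coord m k U (f : 'rV[R]_n -> 'rV[R]_m) i : open U ->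
  Ck k U f -> Ck k U (fun x => f x ord0 i).
Proof. by move=> oU; apply: (Ck_lin (L := coordf i)) => //; exact: coordf_continuous. Qed.

Lemma Ck_rV m k U (f : 'rV[R]_n -> 'rV[R]_m) : open U ->
  (forall i, Ck k U (fun x => f x ord0 i)) -> Ck k U f.
Proof.
move=> oU Cf.
rewrite (_ : f = fun x => \sum_i scalev (delta_mx ord0 i : 'rV_m) (coordf i (f x))).
  apply: Ck_sum => // i; apply: Ck_lin => //; first exact: scalev_continuous.
  exact: Cf.
by apply/funext => x; exact: rV_sum_coord.
Qed.

Lemma Ck_comp m k U (U' : set 'rV[R]_m) (f : 'rV[R]_m -> R)
    (phi : 'rV[R]_n -> 'rV[R]_m) :
  open U -> open U' -> (forall x, U x -> U' (phi x)) ->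
  Ck k U' f -> Ck k U phi -> Ck k U (fun x => f (phi x)).
Proof.
move=> oU oU' UU; elim: k f phi UU => [|k ih] f phi UU.
  move=> cf cp x Ux; apply: (@continuous_comp _ _ _ phi f); first exact: cp.
  by apply: cf; exact: UU.
move=> Cf Cp; have [df Df] := Cf; have [dp Dp] := Cp; split.
  move=> x Ux; apply: (@comp_differentiable _ 'rV[R]_n 'rV[R]_m R phi f).
    exact: dp.
  exact/df/UU.
(* The derivative of the composite is written with partial derivatives of [f], to which the
   induction hypothesis applies with the same [phi]. *)
move=> v; apply: (@Ck_eq _ _ _ k U (fun x => \sum_i ('D_v phi x) ord0 i *
    'D_(delta_mx ord0 i : 'rV_m) f (phi x))) => //.
  move=> x Ux; have dpx := dp x Ux; have dfx := df _ (UU x Ux).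
  rewrite (@comp_derive _ 'rV[R]_n 'rV[R]_m R phi f x v dpx dfx).
  rewrite [in RHS](row_sum_delta ('D_v phi x)) linear_sum; apply: eq_bigr => i _.
  by rewrite linearZ (@deriveE _ 'rV[R]_m R f (phi x) _ dfx).
apply: Ck_sum => // i; apply: CkM => //.
  by apply: Ck_coord => //; exact: Dp.
by apply: (ih ('D_(delta_mx ord0 i : 'rV_m) f)) => //; [exact: Df|exact: CkW].
Qed.

Lemma Ck_comp_rV m p k U (U' : set 'rV[R]_m) (f : 'rV[R]_m -> 'rV[R]_p)
    (phi : 'rV[R]_n -> 'rV[R]_m) :
  open U -> open U' -> (forall x, U x -> U' (phi x)) ->
  Ck k U' f -> Ck k U phi -> Ck k U (fun x => f (phi x)).
Proof.
move=> oU oU' UU Cf Cp; apply: Ck_rV => // i.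
apply: (Ck_comp oU oU' UU (f := fun y => f y ord0 i)) => //.
have : Ck k U' (fun y => coordf i (f y)); last by [].
by apply: Ck_lin => //; exact: coordf_continuous.
Qed.

Lemma Ck_linear (W : normedModType R) (L : {linear 'rV[R]_n -> W}) k U :
  open U -> Ck k U L.
Proof.
move=> oU; have cL := @linear_rV_continuous n W L.
case: k => [|k]; first by move=> x _; exact: cL.
split => [x _|v]; first exact: linear_differentiable.
rewrite (_ : 'D_v L = fun=> L v); first exact: Ck_cst.
by apply/funext => x; rewrite (@lin_derive _ 'rV[R]_n).
Qed.

Lemma differentiable_coordE m (f : 'rV[R]_n -> 'rV[R]_m) x v i :
  differentiable f x -> 'D_v (fun y => f y ord0 i) x = ('D_v f x) ord0 i.
Proof.
exact: (@lin_comp_derive _ 'rV[R]_n 'rV[R]_m R f (coordf i) x v (@coordf_continuous m i)).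
Qed.

Lemma derive_jacobian m (f : 'rV[R]_n -> 'rV[R]_m) x v :
  differentiable f x -> 'D_v f x = v *m 'J f x.
Proof. by move=> df; rewrite (@deriveEjacobian _ _ _ f x v df). Qed.

Lemma jacobianE m (f : 'rV[R]_n -> 'rV[R]_m) x i j : differentiable f x ->
  'J f x i j = 'D_(delta_mx ord0 i) (fun y => f y ord0 j) x.
Proof.
move=> df; rewrite (differentiable_coordE _ _ df) (derive_jacobian _ df).
by rewrite -rowE [RHS]mxE.
Qed.

Lemma diff_jacobian m (f : 'rV[R]_n -> 'rV[R]_m) x v :
  'd f x v = v *m 'J f x.
Proof. by rewrite /jacobian mul_rV_lin1. Qed.

Lemma jacobian_comp m p (f : 'rV[R]_m -> 'rV[R]_p) (phi : 'rV[R]_n -> 'rV[R]_m) x :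
  differentiable phi x -> differentiable f (phi x) ->
  'J (fun y => f (phi y)) x = 'J phi x *m 'J f (phi x).
Proof.
move=> dp df; apply: matrix_ext => v; rewrite mulmxA.
have dfp := @comp_differentiable _ 'rV[R]_n 'rV[R]_m 'rV[R]_p _ _ _ dp df.
rewrite -(derive_jacobian v dfp).
rewrite (@comp_derive _ 'rV[R]_n 'rV[R]_m 'rV[R]_p phi f x v dp df).
rewrite (derive_jacobian v dp).
by rewrite /jacobian !mul_rV_lin1.
Qed.

Lemma eq_open_jacobian m U (f g : 'rV[R]_n -> 'rV[R]_m) x : open U -> U x ->
  (forall y, U y -> f y = g y) -> differentiable f x -> 'J f x = 'J g x.
Proof.
move=> oU Ux fg df; apply: matrix_ext => v.
have dg := @eq_open_differentiable _ 'rV[R]_n _ _ _ _ _ oU Ux fg df.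
have fgE := @eq_open_derive _ 'rV[R]_n _ _ _ _ _ v oU Ux fg.
exact: (eq_trans (esym (derive_jacobian v df)) (eq_trans fgE (derive_jacobian v dg))).
Qed.

End Ck_rV.
End coordinates.

(** * Implicit functions *)

Section line.
Context {R : realType} {V : normedModType R}.
Implicit Types (F : V -> R) (q v : V).

Lemma line_is_derive F q v (s : R) : differentiable F (q + s *: v) ->
  is_derive s 1 (fun s : R => F (q + s *: v)) ('D_v F (q + s *: v)).
Proof.
move=> dF; have E : (fun h : R => h^-1 *: (F (q + (h *: 1 + s) *: v) - F (q + s *: v))) =
    (fun h : R => h^-1 *: (F (h *: v + (q + s *: v)) - F (q + s *: v))).
  apply/funext => h; congr (_ *: (F _ - _)).
  by rewrite scalerDl [h *: 1]mulr1 addrCA.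
apply: DeriveDef; last by rewrite /derive E.
by rewrite /derivable E; exact: (@diff_derivable _ _ _ F (q + s *: v) v dF).
Qed.

Lemma line_MVT F q v (a b : R) : a < b ->
  (forall s, a <= s <= b -> differentiable F (q + s *: v)) ->
  exists2 c, a < c < b & F (q + b *: v) - F (q + a *: v) = 'D_v F (q + c *: v) * (b - a).
Proof.
move=> ab dF.
have [||c cab h] := @MVT R (fun s => F (q + s *: v)) (fun s => 'D_v F (q + s *: v)) a b ab.
- move=> x; rewrite in_itv/= => /andP[ax xb]; apply: line_is_derive.
  by apply: dF; rewrite (ltW ax) (ltW xb).
- apply: derivable_within_continuous => x; rewrite in_itv/= => xab.
  by have [] := line_is_derive (dF x xab).
- by exists c => //; move: cab; rewrite in_itv.
Qed.

End line.

(** * Symmetry of second derivatives *)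

Section symmetric_second_derivative.
Context {R : realType} {V : normedModType R}.
Implicit Types (U : set V) (f : V -> R) (p v w : V).

Lemma shift_differentiable f (a y : V) : differentiable f (y + a) ->
  differentiable (fun y => f (y + a)) y /\
  forall u, 'D_u (fun y => f (y + a)) y = 'D_u f (y + a).
Proof.
move=> df.
have [] // := @eps_differentiable _ V R (fun y => f (y + a)) ('d f (y + a)) y.
- exact/diff_continuous/df.
- move=> e' e'0; have [d d0 hd] := differentiable_eps df e'0.
  exists d => // z zy; have := hd (z + a).
  by rewrite opprD addrACA subrr addr0; apply.
- by move=> dfy dE; split => // u; rewrite (deriveE u dfy) dE (deriveE u df).
Qed.

(** Two mean value steps, in direction [v] for [f (y + h *: w) - f y] and then in direction [w] for
    ['D_v f], turn the second difference into [h ^+ 2] times a mixed derivative at a nearby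
    point. *)
Lemma second_difference U f p v w (e : R) : open U ->
  (forall x, U x -> differentiable f x) ->
  (forall x, U x -> differentiable ('D_v f) x) ->
  {for p, continuous ('D_w ('D_v f))} -> U p -> 0 < e ->
  exists2 d : R, 0 < d & forall h : R, 0 < h < d ->
    `|f (p + h *: v + h *: w) - f (p + h *: v) - f (p + h *: w) + f p
      - h ^+ 2 * 'D_w ('D_v f) p| <= h ^+ 2 * e.
Proof.
move=> oU df ddf cD Up e0.
have [d1 d10 hU] := open_norm_ball oU Up.
have /(continuous_epsP (V := V) (W := R))/(_ e e0)[d2 d20 hD] := cD.
have K0 : 0 < `|v| + `|w| + 1 by rewrite ltr_wpDl// addr_ge0.
exists (Num.min d1 d2 / (`|v| + `|w| + 1)); first by rewrite divr_gt0// lt_min d10.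
move=> h /andP[h0]; rewrite ltr_pdivlMr// lt_min => /andP[hd1 hd2].
have small (s t : R) : 0 <= s <= h -> 0 <= t <= h ->
    `|p + s *: v + t *: w - p| <= h * (`|v| + `|w| + 1).
  move=> /andP[s0 sh] /andP[t0 th].
  have -> : p + s *: v + t *: w - p = s *: v + t *: w.
    by rewrite addrC !addrA addNr add0r.
  rewrite (le_trans (ler_normD _ _))// !normrZ !ger0_norm// mulrDr mulr1 mulrDr.
  by have := ler_wpM2r (normr_ge0 v) sh; have := ler_wpM2r (normr_ge0 w) th; lra.
have inU (s t : R) : 0 <= s <= h -> 0 <= t <= h -> U (p + s *: v + t *: w).
  by move=> sh th; apply: hU; exact: le_lt_trans (small s t sh th) _.
have h00 : 0 <= (0 : R) <= h by rewrite lexx ltW.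
have h0h : 0 <= h <= h by rewrite lexx ltW.
have inU0 (s : R) : 0 <= s <= h -> U (p + s *: v).
  by move=> sh; have := inU s 0 sh h00; rewrite scale0r addr0.
pose F (y : V) : R := f (y + h *: w) - f y.
have [|xi xih E1] := @line_MVT _ V F p v 0 h h0.
  move=> s sh; have [dd _] := shift_differentiable (df _ (inU s h sh h0h)).
  by apply: differentiableB => //; exact/df/inU0.
have {}xih : 0 <= xi <= h by case/andP: xih => /ltW -> /ltW ->.
have [|et eth E2] := @line_MVT _ V ('D_v f) (p + xi *: v) w 0 h h0.
  by move=> t th; exact/ddf/inU.
have {}eth : 0 <= et <= h by case/andP: eth => /ltW -> /ltW ->.
have [dd1 dd2] := shift_differentiable (df _ (inU xi h xih h0h)).
have dfx := df _ (inU0 xi xih).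
have DF : 'D_v F (p + xi *: v) = 'D_v f (p + xi *: v + h *: w) - 'D_v f (p + xi *: v).
  by rewrite -dd2; apply: deriveB; exact: diff_derivable.
rewrite scale0r addr0 subr0 in E1; rewrite scale0r addr0 subr0 in E2.
rewrite DF E2 /F in E1.
have -> : f (p + h *: v + h *: w) - f (p + h *: v) - f (p + h *: w) + f p =
    'D_w ('D_v f) (p + xi *: v + et *: w) * h * h by rewrite -E1; ring.
move: (hD (p + xi *: v + et *: w)) => {}hD.
set D1 := 'D_w ('D_v f) (p + xi *: v + et *: w) in hD *.
set D0 := 'D_w ('D_v f) p in hD *.
rewrite (_ : D1 * h * h - h ^+ 2 * D0 = h ^+ 2 * (D1 - D0)); last by clearbody D1 D0; ring.
rewrite normrM normrX gtr0_norm// ler_pM2l ?exprn_gt0//.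
by apply/ltW/hD; exact: le_lt_trans (small xi et xih eth) _.
Qed.

Lemma close_scaled (D A B h e : R) : 0 < h -> `|D - h ^+ 2 * A| <= h ^+ 2 * e ->
  `|D - h ^+ 2 * B| <= h ^+ 2 * e -> `|A - B| <= e + e.
Proof.
move=> h0; have hh : 0 < h ^+ 2 by rewrite exprn_gt0.
rewrite !ler_norml => /andP[a1 a2] /andP[b1 b2].
have [u1 u2] : h ^+ 2 * (A - B) <= h ^+ 2 * (e + e) /\
    h ^+ 2 * - (e + e) <= h ^+ 2 * (A - B) by split; lra.
by move: u1 u2; rewrite !(ler_pM2l hh) => -> ->.
Qed.

(** The second difference is symmetric in [v] and [w], so both mixed derivatives lie within [e / 2]
    of the same difference quotient. *)
Lemma derive_swap U f p v w : open U ->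
  (forall x, U x -> differentiable f x) ->
  (forall v x, U x -> differentiable ('D_v f) x) ->
  (forall v w, {for p, continuous ('D_w ('D_v f))}) -> U p ->
  'D_w ('D_v f) p = 'D_v ('D_w f) p.
Proof.
move=> oU df ddf cD Up; apply/eqP; rewrite -subr_eq0 -normr_le0.
apply/ler_addgt0Pr => e e0; rewrite add0r.
have e20 : 0 < e / 2 by rewrite divr_gt0.
have [d1 d10 h1] := second_difference oU df (ddf v) (cD v w) Up e20.
have [d2 d20 h2] := second_difference oU df (ddf w) (cD w v) Up e20.
have m0 : 0 < Num.min d1 d2 by rewrite lt_min d10.
have [h h0 hm] : exists2 h : R, 0 < h & h < Num.min d1 d2.
  by exists (Num.min d1 d2 / 2); [rewrite divr_gt0|lra].
move: hm; rewrite lt_min => /andP[hd1 hd2].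
have := h1 h; rewrite h0 hd1 => /(_ isT) H1.
have := h2 h; rewrite h0 hd2 => /(_ isT) H2.
rewrite [e]splitr; apply: (close_scaled h0 H1).
have -> : f (p + h *: v + h *: w) - f (p + h *: v) - f (p + h *: w) + f p =
  f (p + h *: w + h *: v) - f (p + h *: w) - f (p + h *: v) + f p.
  by rewrite (addrAC p); ring.
exact: H2.
Qed.

End symmetric_second_derivative.

Section insert_coordinate.
Context {R : realType} {n : nat} (i : 'I_n.+1).
Implicit Types (x : 'rV[R]_n) (y : 'rV[R]_n.+1) (t : R).

Definition ins t x : 'rV[R]_n.+1 := \row_j oapp (x ord0) t (unlift i j).
Definition del y : 'rV[R]_n := \row_j y ord0 (lift i j).

Lemma ins_at t x : ins t x ord0 i = t. Proof. by rewrite mxE unlift_none. Qed.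

Lemma ins_lift t x j : ins t x ord0 (lift i j) = x ord0 j.
Proof. by rewrite mxE liftK. Qed.

Lemma insK t x : del (ins t x) = x.
Proof. by apply/rowP => j; rewrite mxE ins_lift. Qed.

Lemma delK y : ins (y ord0 i) (del y) = y.
Proof.
by apply/rowP => j; rewrite mxE; case: unliftP => [k|] -> //=; rewrite mxE.
Qed.

Lemma insB t t' x x' : ins t x - ins t' x' = ins (t - t') (x - x').
Proof. by apply/rowP => j; rewrite !mxE; case: unliftP => [k|] _ //=; rewrite !mxE. Qed.

Lemma insD t t' x x' : ins t x + ins t' x' = ins (t + t') (x + x').
Proof. by apply/rowP => j; rewrite !mxE; case: unliftP => [k|] _ //=; rewrite !mxE. Qed.

Lemma insZ a t x : a *: ins t x = ins (a * t) (a *: x).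
Proof. by apply/rowP => j; rewrite !mxE; case: unliftP => [k|] _ //=; rewrite !mxE. Qed.

Lemma ins_delta : ins 1 0 = delta_mx ord0 i.
Proof.
apply/rowP => j; rewrite !mxE eqxx/=; case: unliftP => [k|] ->; last by rewrite eqxx.
by rewrite /= mxE eq_sym eqE/= (negbTE (neq_bump _ _)).
Qed.

Lemma ins_split t x : ins t x = ins 0 x + t *: delta_mx ord0 i.
Proof. by rewrite -ins_delta insZ insD add0r mulr1 scaler0 addr0. Qed.

Lemma norm_ins_lt t x (e : R) : 0 < e -> `|t| < e -> `|x| < e -> `|ins t x| < e.
Proof.
move=> e0 te /(norm_ltP _ e0) xe; apply/norm_ltP => // j; rewrite mxE.
by case: unliftP => [k|] _ //=; exact: xe.
Qed.

Lemma norm_ins_le t x : `|ins t x| <= `|t| + `|x|.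
Proof.
apply/norm_leP; first by rewrite addr_ge0.
move=> j; rewrite mxE; case: unliftP => [k|] _ /=; last by rewrite lerDl.
by rewrite (le_trans (norm_coord_le x k))// lerDr.
Qed.

Lemma norm_del y : `|del y| <= `|y|.
Proof. by apply/norm_leP => // j; rewrite mxE norm_coord_le. Qed.

Lemma delB y y' : del y - del y' = del (y - y').
Proof. by apply/rowP => j; rewrite !mxE. Qed.

Lemma ins0_linear : linear (ins 0).
Proof. by move=> a u v; rewrite insZ insD mulr0 addr0. Qed.

HB.instance Definition _ :=
  GRing.isLinear.Build R 'rV[R]_n 'rV[R]_n.+1 _ (ins 0) ins0_linear.

Lemma Ck_ins k (U : set 'rV[R]_n) (g : 'rV[R]_n -> R) : open U ->
  Ck k U g -> Ck k U (fun x => ins (g x) x).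
Proof.
move=> oU Cg; rewrite (_ : (fun _ => _) =
  fun x => ins 0 x + scalev (delta_mx ord0 i : 'rV[R]_n.+1) (g x)).
  apply: CkD => //; first exact: (@Ck_linear _ _ _ (ins 0)).
  by apply: Ck_lin => //; exact: scalev_continuous.
by apply/funext => x; exact: ins_split.
Qed.

End insert_coordinate.

Section implicit_function.
Context {R : realType} {n : nat} (i : 'I_n.+1).
Local Notation E := 'rV[R]_n.+1.
Local Notation ei := (delta_mx ord0 i : E).
Variables (U : set E) (f : E -> R) (p : E).
Hypotheses (oU : open U) (sf : smooth_on U f) (Up : U p) (fp : f p = 0).
Hypothesis fi : 0 < 'D_ei f p.

Let df y : U y -> differentiable f y. Proof. exact: (sf 1).1. Qed.

Lemma implicit_cube : exists2 d : R, 0 < d & forall y, `|y - p| < d ->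
  U y /\ 0 < 'D_ei f y.
Proof.
have [d1 d10 hU] := open_norm_ball (V := E) oU Up.
have cD : {for p, continuous ('D_ei f)} := (sf 1).2 ei p Up.
have /(continuous_epsP (V := E) (W := R))/(_ _ fi)[d2 d20 hD] := cD.
exists (Num.min d1 d2); first by rewrite lt_min d10.
move=> y; rewrite lt_min => /andP[/hU Uy /hD].
by rewrite ltr_norml => /andP[h _]; split => //; lra.
Qed.

Lemma ins_line (t s : R) x : ins i (t + s) x = ins i t x + s *: ei.
Proof. by rewrite -ins_delta insZ insD mulr1 scaler0 addr0. Qed.

Lemma implicit_increasing (d : R) x (a b : R) :
  (forall y, `|y - p| < d -> U y /\ 0 < 'D_ei f y) ->
  (forall t, a <= t <= b -> `|ins i t x - p| < d) ->
  a < b -> f (ins i a x) < f (ins i b x).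
Proof.
move=> hd hx ab; have ab0 : 0 < b - a by rewrite subr_gt0.
have hs s : 0 <= s <= b - a -> `|ins i a x + s *: ei - p| < d.
  by rewrite -ins_line => sab; apply: hx; lra.
have [|c /andP[c0 c1] E1] := @line_MVT _ E f (ins i a x) ei 0 (b - a) ab0.
  by move=> s /hs/hd[Us _]; exact: df.
have [_ fc] : U (ins i a x + c *: ei) /\ 0 < 'D_ei f (ins i a x + c *: ei).
  by apply/hd/hs; rewrite (ltW c0) (ltW c1).
move: E1; rewrite -!ins_line addr0 subr0 (addrC a) subrK => E1.
by rewrite -subr_gt0 E1 mulr_gt0// ins_line.
Qed.

(** Along [ei] the function increases strictly and changes sign between [p_i - eta] and [p_i + eta],
    which gives a unique zero [g x]. Comparing signs at [g x - c] and [g x + c] gives continuity,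
    and linearizing [f] gives the derivative. *)
Lemma implicit_graph : exists (eta eps : R) (g : 'rV[R]_n -> R),
  [/\ 0 < eta, 0 < eps,
      (forall y : E, `|y ord0 i - p ord0 i| < eta -> `|del i y - del i p| < eps -> U y),
      (forall x : 'rV[R]_n, `|x - del i p| < eps ->
         `|g x - p ord0 i| < eta /\ f (ins i (g x) x) = 0) &
      (forall y : E, `|y ord0 i - p ord0 i| < eta -> `|del i y - del i p| < eps ->
         f y = 0 -> y = ins i (g (del i y)) (del i y)) /\
      smooth_on [set x | `|x - del i p| < eps] g].
Proof.
have [d d0 hd] := implicit_cube.
pose p0 := p ord0 i; pose q := del i p.
have pE : p = ins i p0 q by rewrite delK.
pose eta := d / 2.
have eta0 : 0 < eta by rewrite divr_gt0.
have eta_d : eta < d by rewrite /eta; lra.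
have inc := implicit_increasing hd.
have near_p t x : `|t - p0| <= eta -> `|x - q| < d -> `|ins i t x - p| < d.
  by move=> tp xq; rewrite pE insB norm_ins_lt// (le_lt_trans tp).
have cf y : U y -> {for y, continuous f}.
  by move=> Uy; apply: (@differentiable_continuous _ E R); exact: df.
have cins (t : R) x (e : R) : U (ins i t x) -> 0 < e ->
    exists2 dl : R, 0 < dl & forall x', `|x' - x| < dl -> `|f (ins i t x') - f (ins i t x)| < e.
  move=> Ut e0; have /(continuous_epsP (V := E) (W := R))/(_ e e0)[dl dl0 hdl] := cf _ Ut.
  exists dl => // x' x'x; apply: hdl.
  by rewrite insB subrr norm_ins_lt// normr0.
have Up_ t : `|t - p0| <= eta -> U (ins i t q).
  by move=> tp; apply: (hd _ (near_p t q tp _)).1; rewrite subrr normr0.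
have fplus : 0 < f (ins i (p0 + eta) q).
  rewrite -fp {1}pE; apply: inc; last by rewrite ltrDl.
  move=> t tp; apply: near_p; last by rewrite subrr normr0.
  by rewrite ler_norml; apply/andP; split; lra.
have fminus : f (ins i (p0 - eta) q) < 0.
  rewrite -fp [in ltRHS]pE; apply: inc; last by rewrite ltrBlDr ltrDl.
  move=> t tp; apply: near_p; last by rewrite subrr normr0.
  by rewrite ler_norml; apply/andP; split; lra.
have Upl : U (ins i (p0 + eta) q) by apply: Up_; rewrite addrAC subrr add0r gtr0_norm.
have Umi : U (ins i (p0 - eta) q).
  by apply: Up_; rewrite addrAC subrr add0r normrN gtr0_norm.
have [d1 d10 h1] := cins _ _ _ Upl fplus.
have fm' : 0 < - f (ins i (p0 - eta) q) by rewrite oppr_gt0.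
have [d2 d20 h2] := cins _ _ _ Umi fm'.
pose eps := Num.min d (Num.min d1 d2).
have eps0 : 0 < eps by rewrite !lt_min d0 d10.
have epsd x : `|x - q| < eps -> [/\ `|x - q| < d, `|x - q| < d1 & `|x - q| < d2].
  by rewrite !lt_min => /andP[? /andP[? ?]].
have inU t x : `|t - p0| <= eta -> `|x - q| < eps -> U (ins i t x).
  by move=> tp /epsd[xd _ _]; exact: (hd _ (near_p t x tp xd)).1.
have itvE t : (p0 - eta <= t <= p0 + eta) = (`|t - p0| <= eta).
  by rewrite ler_norml; apply/idP/idP => /andP[? ?]; apply/andP; split; lra.
have incx x t t' : `|x - q| < eps -> `|t - p0| <= eta -> `|t' - p0| <= eta -> t < t' ->
    f (ins i t x) < f (ins i t' x).
  move=> /epsd[xd _ _] tp t'p; apply: inc => s /andP[ts st']; apply: near_p => //.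
  by rewrite -itvE; move: tp t'p; rewrite -!itvE => /andP[? ?] /andP[? ?]; lra.
have fpx x : `|x - q| < eps -> 0 < f (ins i (p0 + eta) x).
  by move=> /epsd[_ /h1 + _]; rewrite ltr_norml => /andP[h _]; lra.
have fmx x : `|x - q| < eps -> f (ins i (p0 - eta) x) < 0.
  by move=> /epsd[_ _ /h2]; rewrite ltr_norml => /andP[_ h]; lra.
have hg x : exists t, `|x - q| < eps -> `|t - p0| < eta /\ f (ins i t x) = 0.
  have [xq|xq] := boolP (`|x - q| < eps); last by exists 0.
  have le_pm : p0 - eta <= p0 + eta by lra.
  have cpath : {within `[p0 - eta, p0 + eta], continuous (fun t => f (ins i t x))}.
    apply: derivable_within_continuous => t; rewrite in_itv/= itvE => tp.
    rewrite (_ : (fun _ => _) = fun s => f (ins i 0 x + s *: ei)); last first.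
      by apply/funext => s; rewrite -ins_line add0r.
    have dft : differentiable f (ins i 0 x + t *: ei).
      by rewrite -ins_line add0r; apply: df; exact: inU.
    by have [] := @line_is_derive _ E f (ins i 0 x) ei t dft.
  have [|t] := @IVT R (fun t => f (ins i t x)) _ _ 0 le_pm cpath.
    have lt_pm : f (ins i (p0 - eta) x) < f (ins i (p0 + eta) x).
      exact: (lt_trans (fmx x xq) (fpx x xq)).
    rewrite (min_l (ltW lt_pm)) (max_r (ltW lt_pm)).
    by rewrite (ltW (fmx x xq)) (ltW (fpx x xq)).
  rewrite in_itv/= => /andP[t1 t2] ft; exists t => _; split => //.
  have tm : t != p0 - eta.
    by apply/eqP => tE; have := fmx x xq; rewrite -tE ft ltxx.
  have tpl : t != p0 + eta.
    by apply/eqP => tE; have := fpx x xq; rewrite -tE ft ltxx.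
  have : p0 - eta < t by rewrite lt_neqAle eq_sym tm.
  have : t < p0 + eta by rewrite lt_neqAle tpl.
  by rewrite ltr_norml => *; apply/andP; split; lra.
have /choice[g gP] := hg.
pose V := [set x | `|x - q| < eps].
have oV : open V.
  rewrite openE => x Vx; apply: (@norm_ball_nbhs _ 'rV[R]_n _ _ (eps - `|x - q|)).
    by rewrite subr_gt0.
  move=> y; rewrite ltrBrDr => h; apply: le_lt_trans h.
  by rewrite -[y - q](subrKA x) ler_normD.
have cg x : V x -> {for x, continuous g}.
  move=> Vx; have [gx fgx] := gP x Vx.
  apply/(continuous_epsP (V := 'rV[R]_n) (W := R)) => e e0.
  have [c c0 [ce ceta]] : exists2 c : R, 0 < c & c <= e /\ `|g x - p0| + c <= eta.
    exists (Num.min e (eta - `|g x - p0|)); first by rewrite lt_min e0 subr_gt0.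
    split; first by rewrite ge_min lexx.
    by rewrite -lerBrDl ge_min lexx orbT.
  have gpl : `|g x + c - p0| <= eta.
    rewrite addrAC; apply: (le_trans (ler_normD _ _)); by rewrite (gtr0_norm c0).
  have gmi : `|g x - c - p0| <= eta.
    by rewrite addrAC; apply: (le_trans (ler_normD _ _)); rewrite normrN (gtr0_norm c0).
  have g0 : `|g x - p0| <= eta by exact: ltW.
  have f1 : 0 < f (ins i (g x + c) x) by rewrite -fgx; apply: incx => //; rewrite ltrDl.
  have f2 : 0 < - f (ins i (g x - c) x).
    by rewrite oppr_gt0 -fgx; apply: incx => //; rewrite ltrBlDr ltrDl.
  have [e1 e10 k1] := cins _ _ _ (inU _ _ gpl Vx) f1.
  have [e2 e20 k2] := cins _ _ _ (inU _ _ gmi Vx) f2.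
  have [e3 e30 k3] := open_norm_ball (V := 'rV[R]_n) oV Vx.
  exists (Num.min e1 (Num.min e2 e3)); first by rewrite !lt_min e10 e20.
  move=> y; rewrite !lt_min => /andP[/k1 y1 /andP[/k2 y2 /k3 Vy]].
  have [gy fgy] := gP y Vy; have gy' : `|g y - p0| <= eta by exact: ltW.
  apply: lt_le_trans ce; rewrite ltr_norml; apply/andP; split.
    rewrite ltrBrDl; apply: contraT; rewrite -leNgt => h.
    have : f (ins i (g y) y) <= f (ins i (g x - c) y).
      move: h; rewrite le_eqVlt => /predU1P[->//|h]; apply/ltW/incx => //.
    by rewrite fgy; move: y2; rewrite ltr_norml => /andP[_]; lra.
  rewrite ltrBlDl; apply: contraT; rewrite -leNgt => h.
  have : f (ins i (g x + c) y) <= f (ins i (g y) y).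
    move: h; rewrite le_eqVlt => /predU1P[->//|h]; apply/ltW/incx => //.
  by rewrite fgy; move: y1; rewrite ltr_norml => /andP[+ _]; lra.
pose A x : R := 'D_ei f (ins i (g x) x).
have UA x : V x -> U (ins i (g x) x) /\ 0 < A x.
  move=> Vx; have [gx _] := gP x Vx; have [xd _ _] := epsd x Vx.
  exact: hd (near_p _ _ (ltW gx) xd).
have dg x : V x -> differentiable g x /\
    forall v, 'D_v g x = - ((A x)^-1 * 'D_(ins i 0 v) f (ins i (g x) x)).
  move=> Vx; have [Ux Ax] := UA x Vx; have dfx := df Ux.
  set y0 := ins i (g x) x in Ux dfx *.
  (* The derivative predicted by differentiating [f (ins i (g x) x) = 0]. *)
  pose L : 'rV[R]_n -> R := fun v => - ((A x)^-1 * 'd f y0 (ins i 0 v)).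
  have Llin : linear L.
    move=> a u v; rewrite /L linearP linearP/= mulrDr opprD; congr (_ + _).
    have sE (c b : R^o) : c *: b = c * b by [].
    by rewrite !sE mulrN mulrCA.
  pose LL := HB.pack_for {linear 'rV[R]_n -> R} L (GRing.isLinear.Build _ _ _ _ L Llin).
  have cL : continuous LL := @linear_rV_continuous _ _ _ LL.
  have [K K0 hK] := linear_lipschitz cL.
  have key : forall e : R, 0 < e -> exists2 dl : R, 0 < dl &
      forall y, `|y - x| < dl -> `|g y - g x - LL (y - x)| <= e * `|y - x|.
    move=> e e0.
    (* The constraint [e' <= A x / 2] first bounds the increment of [g] linearly,
       [|G| + |h| <= M * |h|]; the constraint [e' * M <= e * A x] then yields the required
       accuracy. *)
    pose M := 2 * K + 2.
    have M0 : 0 < M by rewrite addr_gt0// mulr_gt0.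
    pose e' := Num.min (A x / 2) (e * A x / M).
    have e'0 : 0 < e' by rewrite lt_min !divr_gt0// mulr_gt0.
    have [d3 d30 h3] := @differentiable_eps _ E R f y0 dfx e' e'0.
    have d320 : 0 < d3 / 2 by rewrite divr_gt0.
    have /(continuous_epsP (V := 'rV[R]_n) (W := R))/(_ _ d320)[d4 d40 h4] := cg x Vx.
    have [d5 d50 h5] := open_norm_ball (V := 'rV[R]_n) oV Vx.
    exists (Num.min (d3 / 2) (Num.min d4 d5)); first by rewrite !lt_min d320 d40.
    move=> y; rewrite !lt_min => /andP[yd3 /andP[/h4 gyd3 /h5 Vy]].
    set G := g y - g x in gyd3 *; set h := y - x in yd3 *.
    have yyE : ins i (g y) y - y0 = ins i G h by rewrite insB.
    have yyn : `|ins i G h| <= `|G| + `|h| by exact: norm_ins_le.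
    have := h3 (ins i (g y) y); rewrite yyE => /(_ ltac:(lra)).
    have [_ ->] := gP y Vy; have [_ fy0] := gP x Vx; rewrite /y0 fy0 subr0 sub0r -/y0.
    rewrite normrN ins_split linearD linearZ/= => hh.
    have AE : 'd f y0 ei = A x by rewrite -deriveE.
    have {}hh : `|G - LL h| * A x <= e' * (`|G| + `|h|).
      apply: le_trans (ler_wpM2l (ltW e'0) yyn).
      rewrite -ins_split in hh; rewrite -[A x in leLHS](gtr0_norm Ax) -normrM.
      apply: le_trans hh; rewrite le_eqVlt; apply/orP; left; apply/eqP.
      congr (`|_|); rewrite AE /LL/= /L opprK mulrDl mulrAC mulVf ?gt_eqF// mul1r.
      by rewrite addrC.
    have hLK := hK h.
    have GL : `|G| <= `|G - LL h| + `|LL h| by rewrite -{1}[G](subrK (LL h)) ler_normD.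
    have e'A : e' <= A x / 2 by rewrite /e' ge_min lexx.
    have e'M : e' * M <= e * A x.
      by rewrite -ler_pdivlMr// /e' ge_min lexx orbT.
    have nG := normr_ge0 G; have nh := normr_ge0 h.
    have nGL := normr_ge0 (G - LL h).
    have GM : `|G| + `|h| <= M * `|h|.
      have : `|G - LL h| * A x <= A x / 2 * (`|G| + `|h|).
        by apply: (le_trans hh); rewrite ler_wpM2r// addr_ge0.
      rewrite mulrC -mulrA ler_pM2l// => h6.
      by rewrite /M mulrDl; lra.
    rewrite -(ler_pM2r Ax); apply: (le_trans hh).
    apply: (le_trans (ler_wpM2l (ltW e'0) GM)).
    by rewrite mulrA [leRHS]mulrAC ler_wpM2r.
  have [dgx dgE] := @eps_differentiable _ 'rV[R]_n R g LL x cL key.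
  split => // v.
  rewrite (@deriveE _ 'rV[R]_n R g x v dgx) dgE /LL/= /L.
  by rewrite (@deriveE _ E R f y0 _ dfx).
exists eta, eps, g; split => //.
- move=> y yp ydel; rewrite -(delK i y); apply: inU => //; exact: ltW.
- split.
    move=> y yp ydel fy; have [gd fgd] := gP _ ydel.
    rewrite -{1}(delK i y); congr ins; apply/eqP.
    have [h|h|h] := ltgtP (y ord0 i) (g (del i y)); last exact/eqP.
      have := incx _ _ _ ydel (ltW yp) (ltW gd) h.
      by rewrite delK fy fgd ltxx.
    have := incx _ _ _ ydel (ltW gd) (ltW yp) h.
    by rewrite delK fy fgd ltxx.
  (* Bootstrap: the formula for ['D_v g] involves [g] only through the graph map, so if [g] is of
     class [Ck k] its derivatives are too. *)
  elim=> [|k ih]; first exact: cg.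
  split=> [x Vx|v]; first exact: (dg x Vx).1.
  have Ci : Ck k V (fun x => ins i (g x) x) by exact: Ck_ins.
  have CD w : Ck k V (fun x => 'D_w f (ins i (g x) x)).
    apply: (Ck_comp oV oU (f := 'D_w f)) => //; first by move=> x /UA[].
    exact: (sf k.+1).2.
  apply: (@Ck_eq _ _ _ k V (fun x => -1 * ((A x)^-1 * 'D_(ins i 0 v) f (ins i (g x) x)))) => //.
    by move=> x Vx; rewrite (dg x Vx).2 mulN1r.
  apply: CkM => //; first exact: Ck_cst.
  apply: CkM => //; apply: CkV => //; last exact: CD.
  by move=> x /UA[_ /gt_eqF ->].
Qed.

End implicit_function.

(** * Nearest-point projection onto a convex body *)

Section nearest_point.
Context {R : realType} {n : nat}.
Local Notation E := 'rV[R]_n.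
Variable K : set E.

(** The obtuse-angle inequality is taken as definition instead of minimality of the distance,
    because uniqueness and the Lipschitz bound follow from adding two instances of it. *)
Definition proj (y : E) : E :=
  xget 0 [set a | K a /\ forall z, K z -> dot (y - a) (z - a) <= 0].

Definition edist (y : E) : R := enorm (y - proj y).

Definition normal_at (p N : E) : Prop := forall z, K z -> dot (z - p) N <= 0.

Hypothesis cK : compact K.
Hypothesis K0 : K !=set0.
Hypothesis cvxK : forall x y t, K x -> K y -> 0 <= t <= 1 -> K (x + t *: (y - x)).

Lemma dot_sub_sqr (a b : E) : dot (a - b) (a - b) = dot a a - 2 * dot a b + dot b b.
Proof. by rewrite dotBl !dotBr (dotC b a); ring. Qed.

Lemma linear_le0 (a b : R) : (forall t, 0 < t <= 1 -> a <= t * b) -> a <= 0.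
Proof.
move=> h; rewrite leNgt; apply/negP => a0.
have b0 : 0 < b by have := h 1; rewrite mul1r ltr01 lexx => /(_ isT); exact: lt_le_trans.
have ab : a <= b by have := h 1; rewrite mul1r ltr01 lexx; exact.
have := h (a / (2 * b)).
have -> : a / (2 * b) * b = a / 2 by field; rewrite gt_eqF.
rewrite divr_gt0 ?mulr_gt0// ler_pdivrMr ?mulr_gt0//= mul1r => h'.
have h2 : a <= a / 2 by apply: h'; lra.
by lra.
Qed.

(** A closest point exists by compactness. Moving from it towards [z] stays in [K] and cannot
    decrease the distance; the first order of this is the inequality. *)
Lemma projP y : K (proj y) /\ forall z, K z -> dot (y - proj y) (z - proj y) <= 0.
Proof.
have cf : {within K, continuous (fun a => enorm (y - a))}.
  apply: continuous_subspaceT => a.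
  have := @continuous_comp E E R (fun a => y - a) enorm a; apply; last exact: enorm_continuous.
  by apply: (@continuousB R E E); [exact: cst_continuous|exact: cvg_id].
have [a /set_mem Ka ha'] := EVT_min_rV K0 cK cf.
have ha z : K z -> enorm (y - a) <= enorm (y - z) by move=> Kz; apply: ha'; exact: mem_set.
suff : [set a | K a /\ forall z, K z -> dot (y - a) (z - a) <= 0] a.
  by move=> h; exact: (xgetI 0 h).
split=> // z Kz; apply: (@linear_le0 _ (dot (z - a) (z - a) / 2)) => t /andP[t0 t1].
have /ha : K (a + t *: (z - a)) by apply: cvxK => //; rewrite (ltW t0).
rewrite -(@ler_pXn2r _ 2)// ?nnegrE ?enorm_ge0// !enorm_sqr opprD addrA.
rewrite (dot_sub_sqr (y - a)) dotZr dotZl dotZr => h.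
have {}h : t * dot (y - a) (z - a) <= t * (t * (dot (z - a) (z - a) / 2)) by lra.
by move: h; rewrite ler_pM2l.
Qed.

Lemma proj_in y : K (proj y). Proof. by have [] := projP y. Qed.

Lemma proj_le y z : K z -> dot (y - proj y) (z - proj y) <= 0.
Proof. by have [_] := projP y; apply. Qed.

Lemma proj_unique y a : K a -> (forall z, K z -> dot (y - a) (z - a) <= 0) ->
  proj y = a.
Proof.
move=> Ka ha; apply/eqP; rewrite -subr_eq0 -dot_eq0 eq_le dot_ge0 andbT.
have := ha _ (proj_in y); have := proj_le y Ka.
have -> : a - proj y = - (proj y - a) by rewrite opprB.
have -> : y - proj y = (y - a) - (proj y - a) by rewrite opprB addrA subrK.
by rewrite dotNr dotBl; lra.
Qed.

(** The sum of the two variational inequalities, each tested at the projection of the other point;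
    Cauchy-Schwarz then turns it into the Lipschitz bound. *)
Lemma proj_mono y y' :
  dot (proj y - proj y') (proj y - proj y') <= dot (y - y') (proj y - proj y').
Proof.
have := proj_le y (proj_in y'); have := proj_le y' (proj_in y).
have -> : y - proj y = (y - y') + (y' - proj y') - (proj y - proj y').
  by rewrite addrA subrK opprB addrA subrK.
have -> : proj y' - proj y = - (proj y - proj y') by rewrite opprB.
set u := y - y'; set v := y' - proj y'; set w := proj y - proj y'.
by rewrite dotNr (dotBl (u + v)) (dotDl u); lra.
Qed.

Lemma proj_lipschitz y y' : enorm (proj y - proj y') <= enorm (y - y').
Proof.
have [->|/eqP h] := eqVneq (proj y) (proj y'); first by rewrite subrr enorm0 enorm_ge0.
have h0 : 0 < enorm (proj y - proj y') by rewrite enorm_gt0// subr_eq0; exact/eqP.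
rewrite -(ler_pM2r h0) -expr2 enorm_sqr.
exact: le_trans (proj_mono _ _) (dot_le _ _).
Qed.

Lemma edist_ge0 y : 0 <= edist y. Proof. exact: enorm_ge0. Qed.

Lemma edist_sqr y : edist y ^+ 2 = dot (y - proj y) (y - proj y).
Proof. exact: enorm_sqr. Qed.

Lemma edist_le y z : K z -> edist y <= enorm (y - z).
Proof.
move=> Kz; rewrite -(@ler_pXn2r _ 2)// ?nnegrE ?enorm_ge0// !enorm_sqr.
have -> : y - z = (y - proj y) - (z - proj y) by rewrite opprB addrA subrK.
rewrite (dot_sub_sqr (y - proj y)); have := proj_le y Kz.
by have := dot_ge0 (z - proj y); lra.
Qed.

Lemma proj_id y : K y -> proj y = y.
Proof. by move=> Ky; apply: proj_unique => // z Kz; rewrite subrr dot0l. Qed.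

Lemma edist_eq0 y : edist y = 0 <-> K y.
Proof.
split=> [/eqP|Ky]; last by rewrite /edist proj_id// subrr enorm0.
by rewrite enorm_eq0 subr_eq0 => /eqP ->; exact: proj_in.
Qed.

Lemma edist_gt0 y : ~ K y -> 0 < edist y.
Proof.
by move=> Ky; rewrite lt_neqAle edist_ge0 andbT eq_sym; apply/eqP => /edist_eq0.
Qed.

Lemma edist_lipschitz y y' : `|edist y - edist y'| <= enorm (y - y').
Proof.
have h a b : edist a - edist b <= enorm (a - b).
  by rewrite lerBlDr (le_trans (edist_le a (proj_in b)))// -[a - proj b](subrKA b) enormD.
by rewrite ler_norml h lerNl opprB enormB h.
Qed.

(** Testing the distance at each of the two points with the projection of the other one gives an
    upper and a lower bound; the Lipschitz bound for [proj] moves the scalar product in the lower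
    one back to [y]. *)
Lemma edist_expand y h :
  `|edist (y + h) ^+ 2 - edist y ^+ 2 - 2 * dot (y - proj y) h| <= dot h h.
Proof.
have h1 : edist (y + h) ^+ 2 <= edist y ^+ 2 + 2 * dot (y - proj y) h + dot h h.
  have := edist_le (y + h) (proj_in y).
  rewrite -(@ler_pXn2r _ 2)// ?nnegrE ?enorm_ge0// => /le_trans -> //.
  rewrite enorm_sqr.
  rewrite edist_sqr addrAC; set u := y - proj y.
  by rewrite (dotDl u) !(dotDr u h) (dotC h); lra.
have h2 : edist y ^+ 2 <= edist (y + h) ^+ 2 - 2 * dot (y + h - proj (y + h)) h + dot h h.
  have := edist_le y (proj_in (y + h)).
  rewrite -(@ler_pXn2r _ 2)// ?nnegrE ?enorm_ge0// => /le_trans -> //.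
  rewrite enorm_sqr edist_sqr.
  have -> : y - proj (y + h) = (y + h - proj (y + h)) - h by rewrite (addrAC y) addrK.
  by rewrite (dot_sub_sqr _ h) lexx.
have h3 : dot (y - proj y) h <= dot (y + h - proj (y + h)) h.
  have := proj_mono (y + h) y; have := proj_lipschitz (y + h) y.
  rewrite addrAC subrr add0r => l m.
  have -> : y + h - proj (y + h) = y - proj y + (h - (proj (y + h) - proj y)).
    by rewrite opprB addrA -!addrA; congr (_ + _); rewrite [RHS]addrCA addKr.
  rewrite (dotDl (y - proj y)) (dotBl h) lerDl subr_ge0 (le_trans (dot_le _ _))//.
  by rewrite -enorm_sqr expr2 ler_wpM2r// enorm_ge0.
move: h1 h2 h3; set A := dot _ h; set B := dot _ h; set C := dot h h.
set a := _ ^+ 2; set b := _ ^+ 2; clearbody A B C a b => h1 h2 h3.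
by rewrite ler_norml; apply/andP; split; lra.
Qed.

Lemma proj_normal y : normal_at (proj y) (y - proj y).
Proof. by move=> z Kz; rewrite dotC proj_le. Qed.

Lemma proj_ray p N (s : R) : K p -> normal_at p N -> 0 <= s -> proj (p + s *: N) = p.
Proof.
move=> Kp hN s0; apply: proj_unique => // z Kz.
by rewrite addrAC subrr add0r dotZl mulr_ge0_le0// dotC hN.
Qed.

Lemma edist_ray p N (s : R) : K p -> normal_at p N -> enorm N = 1 -> 0 <= s ->
  edist (p + s *: N) = s.
Proof.
move=> Kp hN N1 s0; rewrite /edist proj_ray// addrAC subrr add0r enormZ N1 mulr1.
exact: ger0_norm.
Qed.

(** Off [K] this is the unit normal at the projection; on [K] its value is [0], which matters when a
    bound has to hold at every point. *)
Definition outer_normal y : E := (edist y)^-1 *: (y - proj y).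

Lemma outer_normalP y : ~ K y ->
  [/\ normal_at (proj y) (outer_normal y), enorm (outer_normal y) = 1 &
      y = proj y + edist y *: outer_normal y].
Proof.
move=> Ky; have d0 := edist_gt0 Ky; split.
- by move=> z Kz; rewrite dotZr mulr_ge0_le0 ?invr_ge0 ?(ltW d0)// proj_normal.
- by rewrite enormZ ger0_norm ?invr_ge0 ?(ltW d0)// mulVf// gt_eqF.
- by rewrite scalerA mulfV ?gt_eqF// scale1r subrKC.
Qed.

Lemma normal_mono p q N M : K p -> K q -> normal_at p N -> normal_at q M ->
  0 <= dot (N - M) (p - q).
Proof.
move=> Kp Kq /(_ q Kq) hN /(_ p Kp) hM; rewrite dotBl !(dotC _ (p - q)).
by rewrite -[q - p]opprB dotNl in hN; lra.
Qed.

Lemma proj_continuous : continuous proj.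
Proof.
move=> y; apply/(continuous_epsP (V := E) (W := E)) => e e0.
have n0 : 0 < n.+1%:R :> R by rewrite ltr0n.
exists (e / n.+1%:R); first by rewrite divr_gt0.
move=> z; rewrite ltr_pdivlMr// => h; apply: le_lt_trans h.
rewrite (le_trans (norm_le_enorm _))// (le_trans (proj_lipschitz _ _))//.
by rewrite (le_trans (enorm_le_norm _))// mulrC ler_wpM2l// ler_nat.
Qed.

Lemma edist_continuous : continuous edist.
Proof.
move=> y; apply: continuous_comp; last exact: enorm_continuous.
by apply: continuousB; [exact: cvg_id|exact: proj_continuous].
Qed.

End nearest_point.

Section convex_domain.
Context {R : realType} {n : nat}.
Local Notation E := 'rV[R]_n.+1.
Variable Omega : set E.
Hypotheses (O0 : Omega !=set0) (oO : open Omega) (bO : bounded_set Omega).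
Hypothesis cO : convex_set Omega.
Local Notation K := (closure Omega).
Local Notation S := (boundary Omega).

Lemma domain_segment x y (t : R) : Omega x -> Omega y -> 0 <= t <= 1 ->
  Omega (x + t *: (y - x)).
Proof.
move=> Ox Oy /andP[t0 t1].
have -> : x + t *: (y - x) = t *: y + (1 - t) *: x.
  by rewrite scalerBl scale1r scalerBr addrCA.
exact/set_mem/(cO (Itv01 t0 t1) (mem_set Oy) (mem_set Ox)).
Qed.

Lemma domain_closure_segment x y (t : R) : K x -> K y -> 0 <= t <= 1 ->
  K (x + t *: (y - x)).
Proof.
move=> Kx Ky t01; have /andP[t0 t1] := t01.
move=> B /= /nbhs_norm_ball[e e0 hB].
have e20 : 0 < e / 2 by rewrite divr_gt0.
have [x' [Ox' xx']] := Kx _ (norm_ball_nbhs (V := E) e20 (fun _ => id)).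
have [y' [Oy' yy']] := Ky _ (norm_ball_nbhs (V := E) e20 (fun _ => id)).
exists (x' + t *: (y' - x')); split; first exact: domain_segment.
apply: hB.
have -> : x' + t *: (y' - x') - (x + t *: (y - x)) =
    (1 - t) *: (x' - x) + t *: (y' - y).
  by rewrite !scalerBr !scalerBl !scale1r; apply/rowP => j; rewrite !mxE; ring.
rewrite (le_lt_trans (ler_normD _ _))// !normrZ !ger0_norm// ?subr_ge0//.
have := ltW xx'; have := ltW yy'; move: (`|x' - x|) (`|y' - y|) => a b ha hb.
have : (1 - t) * a <= (1 - t) * (e / 2) by rewrite ler_wpM2l// subr_ge0.
have : t * b <= t * (e / 2) by rewrite ler_wpM2l.
by lra.
Qed.

Lemma compact_domain_closure : compact K.
Proof.
apply: bounded_closed_compact; last exact: closed_closure.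
have [M M0 OM] := ex_strict_bound_gt0 bO.
exists (M + 1); split; first exact: num_real.
move=> M' MM' x /(_ _ (norm_ball_nbhs (V := E) ltr01 (fun _ => id)))[y [Oy yx]].
rewrite /= -[x](subrK y); apply: le_trans (ltW MM').
rewrite (le_trans (ler_normD _ _))// addrC lerD//; first exact/ltW/OM.
by rewrite -normrN opprB ltW.
Qed.

Lemma domain_closure0 : K !=set0.
Proof. by have [x Ox] := O0; exists x; exact: subset_closure. Qed.

Lemma boundaryE p : S p <-> K p /\ ~ Omega p.
Proof. by rewrite /boundary (interior_id Omega).1. Qed.

Lemma closed_boundary : closed S.
Proof.
rewrite /boundary setDE; apply: closedI; first exact: closed_closure.
by apply: open_closedC; exact: open_interior.
Qed.

Lemma compact_boundary : compact S.
Proof.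
by apply: subclosed_compact closed_boundary compact_domain_closure _ => x [].
Qed.

End convex_domain.

(** * Outward normals and graph charts *)

(** A one-sided comparison is all that a boundary point of a convex set offers. Used for both [v]
    and [- v], it shows that a derivative vanishes. *)
Lemma derive_le0_ray {R : realType} {V : normedModType R} (f : V -> R) (p v : V) (d : R) :
  differentiable f p -> 0 < d -> (forall t : R, 0 < t < d -> f (p + t *: v) <= f p) ->
  'D_v f p <= 0.
Proof.
move=> df d0 hd; rewrite leNgt; apply/negP => D0.
have v1 : 0 < `|v| + 1 by rewrite ltr_wpDl.
have e0 : 0 < 'D_v f p / 2 / (`|v| + 1) by rewrite !divr_gt0.
have [d' d'0 hd'] := differentiable_eps df e0.
pose t := Num.min d (d' / (`|v| + 1)) / 2.
have m0 : 0 < Num.min d (d' / (`|v| + 1)) by rewrite lt_min d0 divr_gt0.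
have t0 : 0 < t by rewrite divr_gt0.
have tm : t < Num.min d (d' / (`|v| + 1)) by rewrite /t; lra.
move: tm; rewrite lt_min ltr_pdivlMr// => /andP[td td'].
have := hd' (p + t *: v); rewrite addrAC subrr add0r normrZ gtr0_norm//.
rewrite linearZ/= -(deriveE v df) => /(_ _)/wrap[].
  by apply: le_lt_trans td'; rewrite ler_pM2l// lerDl.
have h1 := hd t; rewrite t0 td in h1; have {}h1 := h1 isT.
have h2 : 'D_v f p / 2 / (`|v| + 1) * (t * `|v|) <= t * ('D_v f p / 2).
  have -> : 'D_v f p / 2 / (`|v| + 1) * (t * `|v|) =
      t * ('D_v f p / 2) * (`|v| / (`|v| + 1)) by ring.
  rewrite -[leRHS]mulr1; apply: ler_wpM2l; last by rewrite ler_pdivrMr// mul1r lerDl.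
  exact: mulr_ge0 (ltW t0) (divr_ge0 (ltW D0) (ler0n _ _)).
have sE (c b : R^o) : c *: b = c * b by [].
have tD : 0 < t * 'D_v f p by rewrite mulr_gt0.
by rewrite sE ler_norml => /andP[h3 h4]; lra.
Qed.

Section defining_functions.
Context {R : realType} {n : nat}.
Local Notation E := 'rV[R]_n.+1.
Implicit Types (S U : set E) (f : E -> R).

Lemma gradient_dot f p (v : E) : differentiable f p -> dot (gradient f p) v = 'D_v f p.
Proof.
move=> df; rewrite (@deriveE _ E R f p v df) [in RHS](row_sum_delta v) linear_sum dotE.
by apply: eq_bigr => i _; rewrite linearZ mxE mulrC (@deriveE _ E R f p _ df).
Qed.

Lemma smooth_opp U f : open U -> smooth_on U f -> smooth_on U (fun x => - f x).
Proof.
move=> oU sf k; rewrite (_ : (fun _ => _) = fun x => -1 * f x).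
  by apply: CkM => //; exact: Ck_cst.
by apply/funext => x; rewrite mulN1r.
Qed.

Lemma defining_functionN S U f : defining_function S U f ->
  defining_function S U (fun x => - f x).
Proof.
move=> [oU sf gf SU]; split => //; first exact: smooth_opp.
  move=> x Ux; have dfx := (sf 1).1 x Ux; have := gf x Ux; apply: contra => /eqP g0.
  apply/eqP/rowP => i; move/rowP/(_ i): g0; rewrite !mxE.
  rewrite (@deriveN _ E R f x (delta_mx ord0 i) (@diff_derivable _ _ _ f x _ dfx)).
  by move/eqP; rewrite oppr_eq0 => /eqP.
rewrite SU; apply/seteqP; split => x [Ux fx]; split => //; first by rewrite fx oppr0.
by rewrite -[f x]opprK fx oppr0.
Qed.

Lemma defining_functionS S U U' f : open U' -> U' `<=` U ->
  defining_function S U f -> defining_function S U' f.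
Proof.
move=> oU' UU [oU sf gf SU]; split => //.
- by move=> k; exact: Ck_sub (sf k).
- by move=> x /UU; exact: gf.
- apply/seteqP; split => [x [Sx U'x]|x [U'x fx]].
    have : (S `&` U) x by split => //; exact: UU.
    by rewrite SU => -[].
  have : [set x | U x /\ f x = 0] x by split => //; exact: UU.
  by rewrite -SU => -[].
Qed.

Lemma smooth_gradient U f : open U -> smooth_on U f -> smooth_on U (gradient f).
Proof.
move=> oU sf k; apply: Ck_rV => // i.
rewrite (_ : (fun _ => _) = 'D_(delta_mx ord0 i : E) f); first exact: (sf k.+1).2.
by apply/funext => x; rewrite mxE.
Qed.

Lemma smooth_unit_normal U f : open U -> smooth_on U f ->
  (forall x, U x -> gradient f x != 0) -> smooth_on U (unit_normal f).
Proof.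
move=> oU sf gf k; apply: Ck_rV => // i.
rewrite (_ : (fun _ => _) = fun x => (enorm (gradient f x))^-1 * gradient f x ord0 i).
  have Cg j : Ck k U (fun x => gradient f x ord0 j).
    by apply: Ck_coord => //; exact: smooth_gradient.
  apply: CkM => //; apply: CkV => //; first by move=> x Ux; rewrite enorm_eq0 gf.
  apply: Ck_sqrt => //; first by move=> x Ux; rewrite dot_gt0// gf.
  rewrite (_ : (fun _ => _) = fun x => \sum_j gradient f x ord0 j * gradient f x ord0 j).
    by apply: Ck_sum => // j; exact: CkM.
  by apply/funext => x; rewrite dotE.
by apply/funext => x; rewrite mxE.
Qed.

Lemma enorm_unit_normal f p : gradient f p != 0 -> enorm (unit_normal f p) = 1.
Proof.
move=> g0; rewrite enormZ ger0_norm ?invr_ge0 ?enorm_ge0// mulVf//.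
by rewrite enorm_eq0.
Qed.

End defining_functions.

Section outward_normals.
Context {R : realType} {n : nat}.
Local Notation E := 'rV[R]_n.+1.
Variable Omega : set E.
Hypotheses (O0 : Omega !=set0) (oO : open Omega) (bO : bounded_set Omega).
Hypothesis cO : convex_set Omega.
Local Notation K := (closure Omega).
Local Notation S := (boundary Omega).

Lemma outward_le0 U f x : outward_defining_function Omega U f -> U x -> K x -> f x <= 0.
Proof.
move=> [[oU sf _ _] f0] Ux Kx; rewrite leNgt; apply/negP => fx.
have cf : {for x, continuous f} by exact: (sf 0).
have [d1 d10 h1] := open_norm_ball (V := E) oU Ux.
have /(continuous_epsP (V := E) (W := R))/(_ _ fx)[d2 d20 h2] := cf.
have m0 : 0 < Num.min d1 d2 by rewrite lt_min d10.
have [y [Oy]] := Kx _ (norm_ball_nbhs (V := E) m0 (fun _ => id)).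
rewrite lt_min => /andP[/h1 Uy /h2]; have := f0 y Oy Uy.
by rewrite ltr_norml => fy /andP[fyx _]; lra.
Qed.

(** By continuity [f <= 0] on the part of [K] in [U], and by convexity the segment from [p] to [z]
    stays in [K]; so the derivative of [f] at its zero [p] along [z - p] is nonpositive. *)
Lemma outward_normal U f p : outward_defining_function Omega U f -> U p -> S p ->
  normal_at K p (unit_normal f p) /\ enorm (unit_normal f p) = 1.
Proof.
move=> of_ Up Sp; have [[oU sf gf SU] f0] := of_.
have dfp : differentiable f p := (sf 1).1 p Up.
split; last by rewrite enorm_unit_normal// gf.
move=> z Kz; rewrite dotZr mulr_ge0_le0 ?invr_ge0 ?enorm_ge0// dotC gradient_dot//.
have Kp : K p by case: Sp.
have fp : f p = 0 by have : (S `&` U) p by []; rewrite SU => -[].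
have [d d0 hd] := open_norm_ball (V := E) oU Up.
have zp1 : 0 < `|z - p| + 1 by rewrite ltr_wpDl.
apply: (@derive_le0_ray _ E f p (z - p) (Num.min 1 (d / (`|z - p| + 1))) dfp).
  by rewrite lt_min ltr01 divr_gt0.
move=> t /andP[t0]; rewrite lt_min ltr_pdivlMr// => /andP[t1 td]; rewrite fp.
apply: (outward_le0 of_).
  apply: hd; rewrite addrAC subrr add0r normrZ gtr0_norm//.
  by apply: le_lt_trans td; rewrite ler_pM2l// lerDl.
by apply: domain_closure_segment => //; rewrite (ltW t0) (ltW t1).
Qed.

End outward_normals.

Section dotr.
Context {R : realType} {n : nat}.

Definition dotr (N v : 'rV[R]_n) : R := dot v N.

Lemma dotr_linear N : linear (dotr N : 'rV[R]_n -> R^o).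
Proof. by move=> a u v; rewrite /dotr dotDl dotZl. Qed.

HB.instance Definition _ N :=
  GRing.isLinear.Build R 'rV[R]_n R _ (dotr N) (dotr_linear N).

End dotr.

Section graph_charts.
Context {R : realType} {n : nat}.
Local Notation E := 'rV[R]_n.+1.
Variable Omega : set E.
Hypotheses (O0 : Omega !=set0) (oO : open Omega) (bO : bounded_set Omega).
Hypothesis cO : convex_set Omega.
Local Notation K := (closure Omega).
Local Notation S := (boundary Omega).

Definition cylinder (i : 'I_n.+1) (p : E) (eta eps : R) : set E :=
  [set y : E | `|y ord0 i - p ord0 i| < eta /\ `|del i y - del i p| < eps].

Lemma open_cylinder i p (eta eps : R) : open (cylinder i p eta eps).
Proof.
rewrite openE => y [yi yd].
apply: (@norm_ball_nbhs _ E _ _ (Num.min (eta - `|y ord0 i - p ord0 i|)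
  (eps - `|del i y - del i p|))); first by rewrite lt_min !subr_gt0 yi.
move=> z; rewrite lt_min !ltrBrDr => /andP[h1 h2]; split.
  apply: le_lt_trans h1; rewrite -[z ord0 i - _](subrKA (y ord0 i)).
  rewrite (le_trans (ler_normD _ _))// lerD2r.
  by have := norm_coord_le (z - y) i; rewrite !mxE.
apply: le_lt_trans h2; rewrite -[del i z - _](subrKA (del i y)).
by rewrite (le_trans (ler_normD _ _))// lerD2r delB norm_del.
Qed.

Lemma cylinder_segment i p (eta eps : R) x y (t : R) : cylinder i p eta eps x ->
  cylinder i p eta eps y -> 0 <= t <= 1 -> cylinder i p eta eps (x + t *: (y - x)).
Proof.
move=> [x1 x2] [y1 y2] /andP[t0 t1].
have key (r a b : R) : a < r -> b < r -> (1 - t) * a + t * b < r.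
  move=> ar br; have [t_0|t_0] := eqVneq t 0; first by rewrite t_0; lra.
  have : t * b < t * r by rewrite ltr_pM2l// lt_neqAle eq_sym t_0.
  have : (1 - t) * a <= (1 - t) * r by rewrite ler_wpM2l ?subr_ge0// ltW.
  by lra.
have t1' : 0 <= 1 - t by rewrite subr_ge0.
split.
  apply: le_lt_trans (key _ _ _ x1 y1).
  have -> : (x + t *: (y - x)) ord0 i - p ord0 i =
    (1 - t) * (x ord0 i - p ord0 i) + t * (y ord0 i - p ord0 i) by rewrite !mxE; ring.
  by rewrite (le_trans (ler_normD _ _))// !normrM (ger0_norm t1') (ger0_norm t0).
apply: le_lt_trans (key _ _ _ x2 y2).
have -> : del i (x + t *: (y - x)) - del i p =
  (1 - t) *: (del i x - del i p) + t *: (del i y - del i p).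
  by apply/rowP => j; rewrite !mxE; ring.
by rewrite (le_trans (ler_normD _ _))// !normrZ (ger0_norm t1') (ger0_norm t0).
Qed.

(** A segment joining points of opposite sign would contain a zero. The defining functions of a
    smooth hypersurface come without orientation; on [Omega] cut by a cylinder this decides whether
    [f] or [- f] is the outward one. *)
Lemma constant_sign (A : set E) (f : E -> R) :
  (forall x y (t : R), A x -> A y -> 0 <= t <= 1 -> A (x + t *: (y - x))) ->
  (forall x, A x -> differentiable f x) -> (forall x, A x -> f x != 0) ->
  (forall x, A x -> f x < 0) \/ (forall x, A x -> 0 < f x).
Proof.
move=> cA df f0; have [[x [Ax fx]]|h] := pselect (exists x, A x /\ 0 < f x); last first.
  by left => x Ax; rewrite lt_neqAle f0// leNgt; apply/negP => fx; apply: h; exists x.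
right => y Ay; rewrite lt_neqAle eq_sym f0// leNgt; apply/negP => fy.
have cpath : {within `[0, 1], continuous (fun s : R => f (x + s *: (y - x)))}.
  apply: derivable_within_continuous => t; rewrite in_itv/= => t01.
  have dft : differentiable f (x + t *: (y - x)) by exact/df/cA.
  by have [] := @line_is_derive _ E f x (y - x) t dft.
have [|t] := @IVT R _ 0 1 0 ler01 cpath.
  rewrite scale0r scale1r addr0 subrKC.
  have yx := lt_trans fy fx.
  by rewrite (min_r (ltW yx)) (max_l (ltW yx)) (ltW fx) (ltW fy).
rewrite in_itv/= => t01 ft.
by have := f0 _ (cA x y t Ax Ay t01); rewrite ft eqxx.
Qed.

(** Some partial derivative is nonzero at [p], and up to sign the implicit function theorem applies
    in that coordinate. The neighbourhood is a cylinder in order to be convex, so that its trace on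
    [Omega] is convex and [f] has one sign there. *)
Lemma graph_chart p : smooth_hypersurface S -> S p ->
  exists W f i V (g : 'rV[R]_n -> R),
  [/\ W p, outward_defining_function Omega W f, open V /\ smooth_on V g,
      (forall x, V x -> S (ins i (g x) x) /\ W (ins i (g x) x)) &
      (forall y, S y -> W y -> V (del i y) /\ y = ins i (g (del i y)) (del i y))].
Proof.
move=> sS Sp; have [U [f0 [Up df0]]] := sS p Sp.
have [i [f [df fi]]] : exists i f, defining_function S U f /\ 0 < 'D_(delta_mx ord0 i : E) f p.
  have [_ sf gf _] := df0.
  have /rV0Pn[i] : gradient f0 p != 0 by exact: gf.
  rewrite !mxE => Di; exists i.
  have [Dp|Dn] := ltP 0 ('D_(delta_mx ord0 i : E) f0 p); first by exists f0.
  exists (fun x => - f0 x); split; first exact: defining_functionN.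
  have dfp := (sf 1).1 p Up.
  rewrite (@deriveN _ E R f0 p _ (@diff_derivable _ _ _ f0 p _ dfp)) oppr_gt0.
  by rewrite lt_neqAle Di.
have [oU sf gf SU] := df.
have fp : f p = 0 by have : (S `&` U) p by []; rewrite SU => -[].
have [eta [eps [g [eta0 eps0 hU hg [hS sg]]]]] := implicit_graph oU sf Up fp fi.
pose W := cylinder i p eta eps.
have oW : open W by exact: open_cylinder.
have WU : W `<=` U by move=> y [y1 y2]; exact: hU.
have dfW : defining_function S W f by exact: defining_functionS df.
have [f' [df' f'0]] : exists f', outward_defining_function Omega W f'.
  have cA x y (t : R) : (Omega `&` W) x -> (Omega `&` W) y -> 0 <= t <= 1 ->
      (Omega `&` W) (x + t *: (y - x)).
    move=> [Ox Wx] [Oy Wy] t01; split; first exact: domain_segment.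
    exact: cylinder_segment.
  have [||h|h] := @constant_sign (Omega `&` W) f cA.
  - by move=> x [_ /WU Ux]; exact: (sf 1).1.
  - move=> x [Ox Wx]; apply/eqP => fx.
    have : [set x | U x /\ f x = 0] x by split => //; exact: WU.
    by rewrite -SU => -[/(boundaryE oO)[]].
  - by exists f; split => // x Ox Wx; apply: h.
  - exists (fun x => - f x); split; first exact: defining_functionN.
    by move=> x Ox Wx; rewrite oppr_lt0; apply: h.
exists W, f', i, [set x | `|x - del i p| < eps], g; split => //.
- by split; rewrite subrr normr0.
- split => //.
  rewrite openE => x Vx; apply: (@norm_ball_nbhs _ 'rV[R]_n _ _ (eps - `|x - del i p|)).
    by rewrite subr_gt0.
  move=> y; rewrite ltrBrDr => h; apply: le_lt_trans h.
  exact: ler_distD.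
- move=> x Vx; have [gx fgx] := hg x Vx.
  have Wx : W (ins i (g x) x) by split; rewrite ?ins_at ?insK.
  split => //.
  have : [set x | U x /\ f x = 0] (ins i (g x) x) by split => //; exact: WU.
  by rewrite -SU => -[].
- move=> y Sy [y1 y2]; split => //; apply: hS => //.
  have : (S `&` U) y by split => //; exact: hU.
  by rewrite SU => -[].
Qed.

Lemma graph_row_free i (V : set 'rV[R]_n) (g : 'rV[R]_n -> R) x : open V ->
  smooth_on V g -> V x -> row_free ('J (fun x => ins i (g x) x) x).
Proof.
move=> oV sg Vx; apply: inj_row_free => v vJ.
have dphi : differentiable (fun x => ins i (g x) x) x.
  by apply: (Ck_differentiable (k := 0) (U := V)) => //; apply: Ck_ins => //; exact: sg.
apply/rowP => j; rewrite mxE.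
have := @differentiable_coordE _ _ _ (fun x => ins i (g x) x) x v (lift i j) dphi.
rewrite (derive_jacobian v dphi) vJ mxE => <-.
rewrite (_ : (fun _ => _) = coordf j).
  by rewrite (@lin_derive _ 'rV[R]_n R (coordf j) x v (@coordf_continuous _ _ j)).
by apply/funext => y; rewrite ins_lift.
Qed.

Lemma graph_parametrization i (V : set 'rV[R]_n) (g : 'rV[R]_n -> R) : open V ->
  smooth_on V g -> (forall x, V x -> S (ins i (g x) x)) ->
  local_parametrization S V (fun x => ins i (g x) x).
Proof.
move=> oV sg VS; split => //.
- by move=> k; apply: Ck_ins => //; exact: sg.
- by move=> x y _ _ /(congr1 (del i)); rewrite !insK.
- by move=> x Vx; exact: graph_row_free Vx.
- by move=> _ [x Vx <-]; exact: VS.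
Qed.

(** The component of [phi] along [N] is maximal at [x], because the whole chart lies in [K]; its
    derivative is thus nonpositive along [v] and along [- v]. *)
Lemma parametrization_normal V phi x N : local_parametrization S V phi -> V x ->
  normal_at K (phi x) N -> 'J phi x *m N^T = 0.
Proof.
move=> [oV sphi _ _ VS] Vx hN.
have dphi : differentiable phi x := (sphi 1).1 x Vx.
apply: matrix_ext => v; rewrite mulmx0 mulmxA -(derive_jacobian v dphi) dot_mx.
suff -> : dot ('D_v phi x) N = 0 by apply/matrixP => a b; rewrite !mxE mul0rn.
pose F y := dotr N (phi y).
have cN : continuous (dotr N) by exact: linear_rV_continuous.
have dF : differentiable F x.
  by apply: (@comp_differentiable _ 'rV[R]_n E R phi (dotr N)) => //; exact: linear_differentiable.
have DF w : 'D_w F x = dot ('D_w phi x) N.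
  exact: (@lin_comp_derive _ 'rV[R]_n E R phi (dotr N) x w cN dphi).
have le0 w : 'D_w F x <= 0.
  have [d d0 hd] := open_norm_ball (V := 'rV[R]_n) oV Vx.
  have w1 : 0 < `|w| + 1 by rewrite ltr_wpDl.
  apply: (@derive_le0_ray _ 'rV[R]_n F x w (d / (`|w| + 1)) dF); first by rewrite divr_gt0.
  move=> t /andP[t0]; rewrite ltr_pdivlMr// => td.
  have /VS[Kp _] : (phi @` V) (phi (x + t *: w)).
    exists (x + t *: w) => //; apply: hd; rewrite addrAC subrr add0r normrZ gtr0_norm//.
    by apply: le_lt_trans td; rewrite ler_pM2l// lerDl.
  by have := hN _ Kp; rewrite dotBl subr_le0.
apply/eqP; rewrite eq_le -DF le0 /= -oppr_le0.
have := le0 (- v); rewrite (@deriveE _ 'rV[R]_n R F x (- v) dF) linearN.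
by rewrite -(@deriveE _ 'rV[R]_n R F x v dF).
Qed.

End graph_charts.

(** * Gauss map and principal curvatures *)

Section frames.
Context {R : realType} {n : nat}.
Implicit Types (N : 'rV[R]_n.+1) (e A : 'M[R]_(n, n.+1)).

Lemma orthonormal_frame N e : e *m e^T = 1%:M -> e *m N^T = 0 -> dot N N = 1 ->
  N^T *m N + e^T *m e = 1%:M.
Proof.
move=> ee eN NN.
have Ne : N *m e^T = 0 by rewrite -[N *m _]trmxK trmx_mul trmxK eN trmx0.
have EE : col_mx N e *m (col_mx N e)^T = 1%:M.
  by rewrite tr_col_mx mul_col_row dot_mx NN eN Ne ee -scalar_mx_block.
by rewrite -mul_row_col -tr_col_mx; exact: (@mulmx1C _ n.+1 _ _ EE).
Qed.

(** Both [e] and [A] have rows spanning the hyperplane orthogonal to [N]: the matrix [B] of [A] in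
    the frame [e] is square with zero kernel, and [C] is its inverse. *)
Lemma tangent_coordinates N e A : e *m e^T = 1%:M -> e *m N^T = 0 -> dot N N = 1 ->
  row_free A -> A *m N^T = 0 -> exists C : 'M[R]_n, e = C *m A.
Proof.
move=> ee eN NN rA AN; pose B := A *m e^T.
have AE : A = B *m e.
  by rewrite -[A in LHS]mulmx1 -(orthonormal_frame ee eN NN) mulmxDr !mulmxA AN mul0mx add0r.
have uB : B \in unitmx.
  rewrite -row_free_unit -kermx_eq0; apply/eqP.
  by apply: (row_free_inj rA); rewrite mul0mx AE mulmxA mulmx_ker mul0mx.
by exists (invmx B); rewrite AE mulmxA mulVmx// mul1mx.
Qed.

Lemma normal_line N (M : 'rV[R]_n.+1) A : dot N N = 1 -> row_free A -> A *m N^T = 0 ->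
  A *m M^T = 0 -> M = dot M N *: N.
Proof.
move=> NN rA AN AM; have [e [ee eN]] := orthogonal_completion NN.
have [C eE] := tangent_coordinates ee eN NN rA AN.
have eM : M *m e^T = 0 by rewrite eE trmx_mul mulmxA -[M *m _]trmxK trmx_mul trmxK AM trmx0 mul0mx.
rewrite -[M in LHS]mulmx1 -(orthonormal_frame ee eN NN) mulmxDr !mulmxA eM mul0mx addr0.
by rewrite dot_mx mul_scalar_mx.
Qed.

End frames.

Section gauss_map.
Context {R : realType} {n : nat}.
Local Notation E := 'rV[R]_n.+1.
Variable Omega : set E.
Hypotheses (O0 : Omega !=set0) (oO : open Omega) (bO : bounded_set Omega).
Hypothesis cO : convex_set Omega.
Local Notation K := (closure Omega).
Local Notation S := (boundary Omega).
Hypothesis sS : smooth_hypersurface S.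

Definition gauss (p : E) : E := xget 0 [set N | normal_at K p N /\ enorm N = 1].

Lemma normal_interior p z N : normal_at K p N -> enorm N = 1 -> Omega z ->
  dot (z - p) N < 0.
Proof.
move=> hN N1 Oz; have [d d0 hd] := open_norm_ball (V := E) oO Oz.
have n1 : 0 < `|N| + 1 by rewrite ltr_wpDl.
pose t := d / (`|N| + 1) / 2.
have t0 : 0 < t by rewrite !divr_gt0.
have Oz' : Omega (z + t *: N).
  apply: hd; rewrite addrAC subrr add0r normrZ gtr0_norm//.
  have tE : t * (`|N| + 1) = d / 2 by rewrite /t; field; rewrite gt_eqF.
  have : t * `|N| <= t * (`|N| + 1) by rewrite ler_wpM2l ?lerDl// ltW.
  by rewrite tE; lra.
have := hN _ (subset_closure Oz'); rewrite addrAC (dotDl (z - p)) dotZl -enorm_sqr N1.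
by rewrite expr1n mulr1; lra.
Qed.

Lemma normal_boundary p N : K p -> normal_at K p N -> enorm N = 1 -> S p.
Proof.
move=> Kp hN N1; apply/(boundaryE oO); split => // Op.
by have := normal_interior hN N1 Op; rewrite subrr dot0l ltxx.
Qed.

(** Both normals annihilate the tangent space of a chart, so [M = c *: N] with [|c| = 1]. A point of
    [Omega] lies strictly on the negative side of both, which excludes [c = -1]. *)
Lemma normal_unique p N M : S p -> normal_at K p N -> enorm N = 1 ->
  normal_at K p M -> enorm M = 1 -> M = N.
Proof.
move=> Sp hN N1 hM M1.
have [W [f [i [V [g [Wp oW [oV sg] VS SV]]]]]] := graph_chart oO cO sS Sp.
have [Vp pE] := SV p Sp Wp.
have lp := graph_parametrization oV sg (fun x Vx => (VS x Vx).1).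
have rA := graph_row_free i oV sg Vp.
have AN := parametrization_normal lp Vp (N := N); rewrite -pE in AN; have {}AN := AN hN.
have AM := parametrization_normal lp Vp (N := M); rewrite -pE in AM; have {}AM := AM hM.
have NN : dot N N = 1 by rewrite -enorm_sqr N1 expr1n.
have ME := normal_line NN rA AN AM; move: ME; set c := dot M N => ME.
have : `|c| = 1 by have := M1; rewrite ME enormZ N1 mulr1.
have [z Oz] := O0.
have [c0|c0] := leP 0 c; first by rewrite ger0_norm// => c1; rewrite ME c1 scale1r.
move=> _; have := normal_interior hM M1 Oz; have := normal_interior hN N1 Oz.
by rewrite ME dotZr => h1; rewrite ltNge => /negP[]; rewrite ltW// nmulr_rgt0.
Qed.

Lemma gaussP p : S p -> normal_at K p (gauss p) /\ enorm (gauss p) = 1.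
Proof.
move=> Sp; have [W [f [i [V [g [Wp oW _ _ _]]]]]] := graph_chart oO cO sS Sp.
have h := outward_normal cO oW Wp Sp.
by rewrite /gauss; case: xgetP => [N _ [] //|/(_ _ h)].
Qed.

Lemma gauss_dot p : S p -> dot (gauss p) (gauss p) = 1.
Proof. by move=> /gaussP[_ h]; rewrite -enorm_sqr h expr1n. Qed.

Lemma gauss_unique p N : S p -> normal_at K p N -> enorm N = 1 -> N = gauss p.
Proof. by move=> Sp hN N1; have [hg g1] := gaussP Sp; exact: (normal_unique Sp hg g1). Qed.

Lemma unit_normal_gauss U f p : outward_defining_function Omega U f -> U p -> S p ->
  unit_normal f p = gauss p.
Proof. by move=> oU Up Sp; have [h1 h2] := outward_normal cO oU Up Sp; exact: gauss_unique. Qed.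

Let cK : compact K := compact_domain_closure bO.
Let K0 : K !=set0 := domain_closure0 O0.
Let cvK := domain_closure_segment cO.

Lemma proj_boundary y : ~ K y -> S (proj K y) /\ gauss (proj K y) = outer_normal K y.
Proof.
move=> Ky; have [h1 h2 _] := outer_normalP cK K0 cvK Ky.
have Kp := proj_in cK K0 cvK y.
have Sp := normal_boundary Kp h1 h2; split => //.
by rewrite (gauss_unique Sp h1 h2).
Qed.

Lemma proj_gauss_ray p (s : R) : S p -> 0 <= s ->
  proj K (p + s *: gauss p) = p /\ edist K (p + s *: gauss p) = s.
Proof.
move=> Sp s0; have [h1 h2] := gaussP Sp; have [Kp _] := Sp.
by split; [exact: proj_ray|exact: edist_ray].
Qed.

Lemma gauss_proj_ray y : ~ K y -> y = proj K y + edist K y *: gauss (proj K y).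
Proof.
move=> Ky; have [_ _ yE] := outer_normalP cK K0 cvK Ky.
by have [_ ->] := proj_boundary Ky.
Qed.

End gauss_map.

(** The scalar product of the two difference quotients at step [t] is the assumed nonnegative
    quantity divided by [t ^+ 2]; its limit is the scalar product of the derivatives. *)
Lemma monotone_derivative {R : realType} {m n : nat} (f g : 'rV[R]_m -> 'rV[R]_n)
    (V : set 'rV[R]_m) x w : open V -> V x -> differentiable f x -> differentiable g x ->
  (forall y, V y -> 0 <= dot (f y - f x) (g y - g x)) ->
  0 <= dot ('D_w f x) ('D_w g x).
Proof.
move=> oV Vx df dg h.
pose F (t : R) := \sum_j (t^-1 * (f (t *: w + x) ord0 j - f x ord0 j)) *
  (t^-1 * (g (t *: w + x) ord0 j - g x ord0 j)).
have cv (k : 'rV[R]_m -> 'rV[R]_n) j : differentiable k x ->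
    t^-1 * (k (t *: w + x) ord0 j - k x ord0 j) @[t --> (0:R)^'] --> 'D_w k x ord0 j.
  move=> dk.
  have dkj : differentiable (fun y => k y ord0 j) x.
    apply: (@comp_differentiable _ 'rV[R]_m 'rV[R]_n R k (coordf j)) => //.
    by apply: linear_differentiable; exact: coordf_continuous.
  rewrite -(differentiable_coordE _ _ dk).
  exact: (@diff_derivable _ 'rV[R]_m R _ x w dkj).
have cF : F t @[t --> (0:R)^'] --> dot ('D_w f x) ('D_w g x).
  rewrite dotE; apply: cvg_big; first exact: add_continuous.
  by move=> j _; apply: cvgM; exact: cv.
apply: (cvgr_to_ge cF).
have [d d0 hd] := open_norm_ball (V := 'rV[R]_m) oV Vx.
have w1 : 0 < `|w| + 1 by rewrite ltr_wpDl.
near=> t.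
have Vt : V (t *: w + x).
  apply: hd; rewrite addrK normrZ.
  have : `|t| < d / (`|w| + 1).
    near: t; apply: dnbhs0_lt; exact: divr_gt0.
  rewrite ltr_pdivlMr//; apply: le_lt_trans.
  by rewrite ler_wpM2l// lerDl.
have := h _ Vt; rewrite dotE => h'.
rewrite /F (_ : \sum_j _ = t^-1 * t^-1 * \sum_j (f (t *: w + x) - f x) ord0 j * (g (t *: w + x) - g x) ord0 j).
  by rewrite mulr_ge0// -expr2 sqr_ge0.
rewrite mulr_sumr; apply: eq_bigr => j _; rewrite !mxE; ring.
Unshelve. all: by end_near.
Qed.

Section curvatures.
Context {R : realType} {n : nat}.
Local Notation E := 'rV[R]_n.+1.
Variable Omega : set E.
Hypotheses (O0 : Omega !=set0) (oO : open Omega) (bO : bounded_set Omega).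
Hypothesis cO : convex_set Omega.
Local Notation K := (closure Omega).
Local Notation S := (boundary Omega).
Hypothesis sS : smooth_hypersurface S.
Local Notation gauss := (gauss Omega).

Lemma open_preimage_on (V : set 'rV[R]_n) (phi : 'rV[R]_n -> E) (U : set E) :
  open V -> (forall x, V x -> {for x, continuous phi}) -> open U -> open (V `&` phi @^-1` U).
Proof.
move=> oV cphi oU; rewrite openE => x [Vx Ux]; apply: filterI.
  exact: open_nbhs_nbhs.
by apply: cphi => //; exact: open_nbhs_nbhs.
Qed.

Lemma gauss_comp U f V (phi : 'rV[R]_n -> E) x : outward_defining_function Omega U f ->
  local_parametrization S V phi -> V x -> U (phi x) ->
  differentiable (fun y => gauss (phi y)) x /\
  'J (fun y => gauss (phi y)) x = 'J phi x *m 'J (unit_normal f) (phi x).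
Proof.
move=> oUf [oV sphi _ _ VS] Vx Ux; have [[oU sf gf SU] _] := oUf.
have oVU : open (V `&` phi @^-1` U) by apply: open_preimage_on => //; exact: (sphi 0).
have eqf y : (V `&` phi @^-1` U) y -> unit_normal f (phi y) = gauss (phi y).
  by move=> [Vy Uy]; apply: (unit_normal_gauss O0 oO cO sS oUf Uy); apply: VS; exists y.
have dphi : differentiable phi x := (sphi 1).1 x Vx.
have dun : differentiable (unit_normal f) (phi x) := (smooth_unit_normal oU sf gf 1).1 _ Ux.
have duc := @comp_differentiable _ 'rV[R]_n E E phi (unit_normal f) x dphi dun.
split; first exact: (@eq_open_differentiable _ 'rV[R]_n E _ _ _ _ oVU _ eqf duc).
exact: eq_trans (esym (eq_open_jacobian oVU (conj Vx Ux) eqf duc)) (jacobian_comp dphi dun).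
Qed.

(** The scalar product of the unit normal at [y] with the one at [p] is at most one, by
    Cauchy-Schwarz, and equals one at [y = p]; its derivative there vanishes. *)
Lemma unit_normal_jacobian_normal U (f : E -> R) p : open U -> smooth_on U f ->
  (forall x, U x -> gradient f x != 0) -> U p ->
  'J (unit_normal f) p *m (unit_normal f p)^T = 0.
Proof.
move=> oU sf gf Up; have dun := (smooth_unit_normal oU sf gf 1).1 _ Up.
set N := unit_normal f p.
have cN : continuous (dotr N) by exact: linear_rV_continuous.
pose F y := dotr N (unit_normal f y).
have dF : differentiable F p.
  by apply: (@comp_differentiable _ E E R (unit_normal f) (dotr N)) => //; exact: linear_differentiable.
have DF w : 'D_w F p = dot ('D_w (unit_normal f) p) N.
  exact: (@lin_comp_derive _ E E R (unit_normal f) (dotr N) p w cN dun).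
have le0 w : 'D_w F p <= 0.
  have [d d0 hd] := open_norm_ball (V := E) oU Up.
  have w1 : 0 < `|w| + 1 by rewrite ltr_wpDl.
  apply: (@derive_le0_ray _ E F p w (d / (`|w| + 1)) dF); first by rewrite divr_gt0.
  move=> t /andP[t0]; rewrite ltr_pdivlMr// => td.
  have Uy : U (p + t *: w).
    apply: hd; rewrite addrAC subrr add0r normrZ gtr0_norm//.
    by apply: le_lt_trans td; rewrite ler_pM2l// lerDl.
  have e1 y : U y -> enorm (unit_normal f y) = 1.
    by move=> ?; rewrite enorm_unit_normal// gf.
  have := dot_le (unit_normal f (p + t *: w)) N; rewrite (e1 _ Uy) (e1 _ Up) mulr1.
  by rewrite /F /dotr -[dot (unit_normal f p) N]enorm_sqr (e1 _ Up) expr1n.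
apply: matrix_ext => v; rewrite mulmx0 mulmxA -(derive_jacobian v dun) dot_mx -DF.
suff -> : 'D_v F p = 0 by apply/matrixP => a b; rewrite !mxE mul0rn.
apply/eqP; rewrite eq_le le0 /= -oppr_le0.
have := le0 (- v); rewrite (@deriveE _ E R F p (- v) dF) linearN.
by rewrite -(@deriveE _ E R F p v dF).
Qed.

Definition hessian (f : E -> R) p : 'M[R]_n.+1 :=
  \matrix_(i, j) 'D_(delta_mx ord0 i : E) ('D_(delta_mx ord0 j : E) f) p.

Lemma hessian_sym U f p : open U -> smooth_on U f -> U p -> (hessian f p)^T = hessian f p.
Proof.
move=> oU sf Up; apply/matrixP => i j; rewrite !mxE.
apply: (@derive_swap _ E U f p _ _ oU) => //; first exact: (sf 1).1.
  by move=> v x Ux; exact: ((sf 2).2 v).1.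
by move=> v w; exact: ((sf 2).2 v).2.
Qed.

(** In the product rule for [q] times the gradient, the derivative of the normalizing factor
    contributes a multiple of the gradient. Tangent frames kill that term and leave the symmetric
    Hessian. *)
Lemma unit_normal_jacobian U f p : open U -> smooth_on U f ->
  (forall x, U x -> gradient f x != 0) -> U p ->
  exists (c : R) (d : 'cV[R]_n.+1),
    'J (unit_normal f) p = c *: hessian f p + d *m gradient f p.
Proof.
move=> oU sf gf Up; have dun := (smooth_unit_normal oU sf gf 1).1 _ Up.
pose q (y : E) : R := (enorm (gradient f y))^-1.
have dq : differentiable q p.
  suff : Ck 1 U q by move=> -[h _]; exact: h.
  apply: CkV => //; first by move=> x Ux; rewrite enorm_eq0 gf.
  apply: Ck_sqrt => //; first by move=> x Ux; rewrite dot_gt0// gf.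
  rewrite (_ : (fun _ => _) = fun x => \sum_j gradient f x ord0 j * gradient f x ord0 j).
    by apply: Ck_sum => // j; apply: CkM => //; apply: Ck_coord => //; exact: smooth_gradient.
  by apply/funext => x; rewrite dotE.
exists (q p), (\col_i 'D_(delta_mx ord0 i : E) q p).
apply/matrixP => i j; rewrite (jacobianE _ _ dun) !mxE big_ord1 !mxE.
set ei := delta_mx ord0 i; set ej := delta_mx ord0 j.
have dfj : differentiable ('D_ej f) p := ((sf 2).2 ej).1 p Up.
rewrite (_ : (fun _ => _) = q * 'D_ej f); last first.
  by apply/funext => y; rewrite !mxE.
rewrite (@deriveM _ E q ('D_ej f) p ei).
- by rewrite ![_ *: _]mulrC [in LHS]mulrC [in X in _ + X]mulrC.
- exact: (@diff_derivable _ E R).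
- exact: (@diff_derivable _ E R).
Qed.

(** Compressed to a tangent frame, the differential of the normal is a multiple of the compressed
    Hessian, hence symmetric, and its diagonalization rotates the frame into principal directions.
    Compression loses nothing, because the differential takes values orthogonal to the normal. *)
Lemma principal_curvatures_exist p : S p -> exists k, is_principal_curvatures Omega p k.
Proof.
move=> Sp; have [W [f [i [V [g [Wp oW _ _ _]]]]]] := graph_chart oO cO sS Sp.
have [[oU sf gf SU] _] := oW.
have [_ N1] := outward_normal cO oW Wp Sp.
set N := unit_normal f p in N1 *.
have NN : dot N N = 1 by rewrite -enorm_sqr N1 expr1n.
have [e [ee eN]] := orthogonal_completion NN.
have [c [d JE]] := unit_normal_jacobian oU sf gf Wp.
have JN := unit_normal_jacobian_normal oU sf gf Wp.
set J := 'J (unit_normal f) p in JE JN *.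
have ge : gradient f p *m e^T = 0.
  have g0 := gf p Wp.
  have -> : gradient f p = enorm (gradient f p) *: N.
    by rewrite scalerA mulfV ?scale1r// enorm_eq0.
  by rewrite -scalemxAl -[N *m _]trmxK trmx_mul trmxK eN trmx0 scaler0.
have BE : e *m J *m e^T = c *: (e *m hessian f p *m e^T).
  rewrite JE mulmxDr mulmxDl -!mulmxA ge !mulmx0 addr0.
  by rewrite -scalemxAl -scalemxAr.
have Bs : (e *m J *m e^T)^T = e *m J *m e^T.
  by rewrite BE linearZ /= !trmx_mul trmxK (hessian_sym oU sf Wp) mulmxA.
have [Q [k [QQ QB]]] := symmetric_diagonalization Bs.
exists k, W, f, (Q *m e); split => //.
- by rewrite trmx_mul mulmxA -[Q *m e *m _]mulmxA ee mulmx1.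
- by rewrite -mulmxA eN mulmx0.
- rewrite -/J -[LHS]mulmx1 -(orthonormal_frame ee eN NN) mulmxDr mulmxA.
  rewrite -[Q *m e *m J *m N^T]mulmxA JN mulmx0 mul0mx add0r.
  by rewrite [in RHS]mulmxA -QB !mulmxA.
Qed.

(** The defining function behind the chosen curvatures need not be the one that produced the chart.
    [M] hides it: along the boundary its unit normal is the Gauss map anyway. *)
Lemma curvature_frame V (phi : 'rV[R]_n -> E) x : local_parametrization S V phi -> V x ->
  exists (e : 'M[R]_(n, n.+1)) (M : 'M[R]_n.+1),
  [/\ e *m e^T = 1%:M, e *m (gauss (phi x))^T = 0,
      differentiable (fun y => gauss (phi y)) x,
      'J (fun y => gauss (phi y)) x = 'J phi x *m M &
      e *m M = diag_mx (principal_curvatures Omega (phi x)) *m e].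
Proof.
move=> lp Vx; have [oV sphi _ _ VS] := lp.
have Sp : S (phi x) by apply: VS; exists x.
have [U [f [e [Ux oU ee eN eM]]]] : is_principal_curvatures Omega (phi x)
    (principal_curvatures Omega (phi x)).
  have [k kP] := principal_curvatures_exist Sp.
  by rewrite /principal_curvatures; case: xgetP => [N _ //|/(_ _ kP)].
have [dg Jg] := gauss_comp oU lp Vx Ux.
exists e, ('J (unit_normal f) (phi x)); split => //.
by rewrite -(unit_normal_gauss O0 oO cO sS oU Ux Sp).
Qed.

(** Normals of a convex body are monotone. Differentiating this along the parameter direction [w]
    whose image is the [i]-th principal vector gives [0 <= kappa_i] times its squared length, which
    is one. *)
Lemma principal_curvatures_ge0 p i : S p -> 0 <= principal_curvatures Omega p ord0 i.
Proof.
move=> Sp; have [W [f [j [V [g [Wp oW [oV sg] VS SV]]]]]] := graph_chart oO cO sS Sp.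
have [Vp pE] := SV p Sp Wp; set x := del j p in Vp pE.
pose phi := fun x => ins j (g x) x.
have lp := graph_parametrization oV sg (fun x Vx => (VS x Vx).1).
have [_ sphi _ rJ _] := lp.
have [e [M [ee eN dg Jg eM]]] := curvature_frame lp Vp.
have Np := gauss_dot oO cO sS Sp.
rewrite -pE in eN eM.
have hN := (gaussP oO cO sS Sp).1.
have AN := parametrization_normal lp Vp (N := gauss p); rewrite -pE in AN; have {}AN := AN hN.
have [C eC] := tangent_coordinates ee eN Np (rJ _ Vp) AN.
pose w := row i C.
have dphi : differentiable phi x := (sphi 1).1 x Vp.
have Dphi : 'D_w phi x = row i e.
  by rewrite (derive_jacobian w dphi) eC row_mul.
have Dg : 'D_w (fun y => gauss (phi y)) x = principal_curvatures Omega p ord0 i *: row i e.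
  rewrite (derive_jacobian w dg) Jg mulmxA -row_mul -eC -row_mul eM.
  by rewrite row_mul row_diag_mx -scalemxAl -rowE.
have := @monotone_derivative _ _ _ (fun y => gauss (phi y)) phi V x w oV Vp dg dphi.
rewrite Dphi Dg dotZl.
have -> : dot (row i e) (row i e) = 1.
  have /matrixP/(_ i i) := ee; rewrite !mxE eqxx => h.
  by rewrite dotE -[RHS]h; apply: eq_bigr => l _; rewrite !mxE.
rewrite mulr1; apply=> y Vy.
have [Sy _] := VS y Vy; have [Sx _] := VS x Vp.
by apply: (@normal_mono _ _ K) => //; [case: Sy|case: Sx|exact: (gaussP oO cO sS Sy).1|exact: (gaussP oO cO sS Sx).1].
Qed.

(** Heights and curvatures being nonnegative, the absolute values in [tube_det] disappear, and the
    Jacobian becomes a polynomial in the height. *)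
Lemma tube_jacobian V (phi : 'rV[R]_n -> E) x (s : R) : local_parametrization S V phi ->
  V x -> 0 <= s ->
  `|\det (col_mx (gauss (phi x)) ('J phi x + s *: 'J (fun y => gauss (phi y)) x) : 'M[R]_n.+1)| =
  area_density phi x * \sum_(j < n.+1) s ^+ j * elementary_symmetric j (principal_curvatures Omega (phi x)).
Proof.
move=> lp Vx s0; have [oV sphi _ _ VS] := lp.
have Sp : S (phi x) by apply: VS; exists x.
have [e [M [ee eN dg Jg eM]]] := curvature_frame lp Vx.
have [hN _] := gaussP oO cO sS Sp.
rewrite (tube_det s ee eN (gauss_dot oO cO sS Sp) (parametrization_normal lp Vx hN) Jg eM).
rewrite -prod_elementary_symmetric; congr (_ * _); apply: eq_bigr => i _.
by rewrite ger0_norm// addr_ge0// mulr_ge0// principal_curvatures_ge0.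
Qed.

End curvatures.

(** * Tube formula *)

Section integral_rV_prod.
Local Open Scope ereal_scope.
Context {R : realType} {n : nat}.

Lemma ge0_integral_rV_prodT (a : R -> \bar R) (b : 'rV[R]_n -> \bar R) :
  measurable_fun setT a -> measurable_fun setT b -> (forall s, 0 <= a s) ->
  (forall x, 0 <= b x) ->
  \int[lebesgue_rV n.+1]_w (a (w ord0 ord0) * b (del ord0 w)) =
  \int[lebesgue_measure]_s a s * \int[lebesgue_rV n]_x b x.
Proof.
move=> ma mb a0 b0.
pose F (w : 'rV[R]_n.+1) := a (w ord0 ord0) * b (del ord0 w).
have mF : measurable_fun setT F.
  apply: emeasurable_funM.
    by apply: measurableT_comp => //; exact: measurable_rV_coord.
  apply: measurableT_comp => //; apply: measurable_to_rV => i.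
  rewrite (_ : (fun _ => _) = fun x : 'rV[R]_n.+1 => x ord0 (lift ord0 i)); last by apply/funext => x; rewrite mxE.
  exact: measurable_rV_coord.
have F0 w : 0 <= F w by rewrite mule_ge0.
have h := @ge0_integral_pushforward _ _ (measurableTypeR R * 'rV[R]_n)%type
  ('rV[R]_n.+1 : measurableType _) R (@rV_cons R n) (@measurable_rV_cons R n)
  ((@lebesgue_measure R \x lebesgue_rV n) : {measure set (measurableTypeR R * 'rV[R]_n) -> \bar R}) setT F measurableT mF (fun y _ => F0 y).
apply: (eq_trans h); rewrite preimage_setT.
have FE p : (F \o @rV_cons R n) p = a p.1 * b p.2.
  have := rV_consK p; rewrite /rV_uncons => pE; rewrite /F /=.
  by congr (a _ * b _); [exact: (congr1 fst pE)|exact: (congr1 snd pE)].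
pose F2 (p : measurableTypeR R * 'rV[R]_n) := a p.1 * b p.2.
have -> : F \o @rV_cons R n = F2 by apply/funext => p; exact: FE.
have mab : measurable_fun setT F2.
  by apply: emeasurable_funM; apply: measurableT_comp.
have F20 p : 0 <= F2 p by rewrite mule_ge0.
rewrite (fubini_tonelli1 F2)//.
rewrite /fubini_F /F2 /=.
under eq_integral => s _ do rewrite ge0_integralZl//.
by rewrite ge0_integralZr// integral_ge0.
Qed.

Lemma ge0_integral_rV_prod (I : set R) (B : set 'rV[R]_n) (a : R -> \bar R) (b : 'rV[R]_n -> \bar R) :
  measurable I -> measurable B ->
  measurable_fun I a -> measurable_fun B b -> (forall s, I s -> 0 <= a s) ->
  (forall x, B x -> 0 <= b x) ->
  \int[lebesgue_rV n.+1]_(w in [set w : 'rV[R]_n.+1 | I (w ord0 ord0) /\ B (del ord0 w)])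
    (a (w ord0 ord0) * b (del ord0 w)) =
  \int[lebesgue_measure]_(s in I) a s * \int[lebesgue_rV n]_(x in B) b x.
Proof.
move=> mI mB ma mb a0 b0.
rewrite integral_mkcond [in X in _ = X * _]integral_mkcond [in X in _ = _ * X]integral_mkcond.
rewrite -ge0_integral_rV_prodT.
- apply: eq_integral => w _; rewrite /patch.
  have [/set_mem[Iw Bw]|/negP h] := boolP (w \in _); first by rewrite !mem_set.
  case: ifPn => [/set_mem Iw|_]; last by rewrite mul0e.
  case: ifPn => [/set_mem Bw|_]; last by rewrite mule0.
  by exfalso; apply: h; apply/mem_set.
- exact: (measurable_restrictT a mI).1 ma.
- exact: (measurable_restrictT b mB).1 mb.
- by move=> s; apply: erestrict_ge0.
- by move=> s; apply: erestrict_ge0.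
Qed.

End integral_rV_prod.

Section block_rows.
Context {R : realType} {n : nat}.
Implicit Types (a : 'rV[R]_n.+1) (B : 'M[R]_(n, n.+1)).

Lemma col_mx_ord0 a B j : (col_mx a B : 'M[R]_n.+1) ord0 j = a ord0 j.
Proof. by rewrite -(col_mxEu a B); congr (_ _ _); apply: val_inj. Qed.

Lemma col_mx_lift a B k j : (col_mx a B : 'M[R]_n.+1) (lift ord0 k) j = B k j.
Proof. by rewrite -(col_mxEd a B); congr (_ _ _); apply: val_inj. Qed.

Lemma col_mx_liftD a A B (s : R) k j :
  (col_mx a (A + s *: B) : 'M[R]_n.+1) (lift ord0 k) j = A k j + s * B k j.
Proof. by rewrite col_mx_lift !mxE. Qed.

Lemma tube_split (p q u v A B : 'rV[R]_n) (s t : R) :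
  p + t *: u - (q + s *: v) - ((t - s) *: v + (A + s *: B)) =
  (p - q - A) + s *: (u - v - B) + (t - s) *: (u - v).
Proof. by apply/rowP => j; rewrite !mxE; ring. Qed.

End block_rows.

Lemma Ck_jacobian {R : realType} {n m : nat} (V : set 'rV[R]_n) (h : 'rV[R]_n -> 'rV[R]_m) a b :
  open V -> Ck 1 V h -> Ck 0 V (fun x => 'J h x a b).
Proof.
move=> oV Ch; apply: (@Ck_eq _ _ _ 0 V ('D_(delta_mx ord0 a) (fun y => h y ord0 b))) => //.
  by move=> x Vx; rewrite jacobianE//; exact: Ch.1.
by have [_] := Ck_coord b oV Ch; apply.
Qed.

Section tube_chart.
Context {R : realType} {n : nat}.
Local Notation E := 'rV[R]_n.+1.
Variable Omega : set E.
Hypotheses (O0 : Omega !=set0) (oO : open Omega) (bO : bounded_set Omega).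
Hypothesis cO : convex_set Omega.
Local Notation K := (closure Omega).
Local Notation S := (boundary Omega).
Hypothesis sS : smooth_hypersurface S.
Local Notation gauss := (gauss Omega).
Variables (W : set E) (f : E -> R) (i : 'I_n.+1) (V : set 'rV[R]_n) (g : 'rV[R]_n -> R).
Let phi x := ins i (g x) x.
Hypothesis oW : outward_defining_function Omega W f.
Hypotheses (oV : open V) (sg : smooth_on V g).
Hypothesis VS : forall x, V x -> S (phi x) /\ W (phi x).
Hypothesis SV : forall y, S y -> W y -> V (del i y) /\ y = phi (del i y).

Let opW : open W. Proof. by have [[]] := oW. Qed.
Let cK : compact K := compact_domain_closure bO.
Let K0 : K !=set0 := domain_closure0 O0.
Let cvK := domain_closure_segment cO.

Let lp : local_parametrization S V phi.
Proof. by apply: graph_parametrization => // x /VS[]. Qed.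

Let G x := gauss (phi x).

Lemma smooth_gauss_chart : smooth_on V G.
Proof.
have [[_ sf gf _] _] := oW; have [_ sphi _ _ _] := lp => k.
apply: (@Ck_eq _ _ _ k V (fun x => unit_normal f (phi x))) => //.
  by move=> x /VS[Sx Wx]; rewrite (unit_normal_gauss O0 oO cO sS oW Wx Sx).
apply: (Ck_comp_rV oV opW) => //; first by move=> x /VS[].
exact: smooth_unit_normal.
Qed.

Let dphi x : V x -> differentiable phi x.
Proof. by have [_ sphi _ _ _] := lp; exact: (sphi 1).1. Qed.

Let dG x : V x -> differentiable G x.
Proof. exact: (smooth_gauss_chart 1).1. Qed.

(** Index [0] of [w] is the height above the boundary and the other entries are the chart parameter.
    Hence [del ord0] on this side, but [del i] on the side of the hypersurface, where [i] is the
    coordinate that was solved for. *)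
Definition tube_dom : set E := [set w : E | 0 < w ord0 ord0 /\ V (del ord0 w)].
Definition tube_map (w : E) : E :=
  phi (del ord0 w) + w ord0 ord0 *: gauss (phi (del ord0 w)).
Definition tube_inv (y : E) : E := ins ord0 (edist K y) (del i (proj K y)).
Definition tube_diff (w : E) : 'M[R]_n.+1 :=
  col_mx (G (del ord0 w)) ('J phi (del ord0 w) + w ord0 ord0 *: 'J G (del ord0 w)).

Lemma row_col_mx0 (h : E) (a : E) (B : 'M[R]_(n, n.+1)) :
  h *m (col_mx a B : 'M[R]_n.+1) = h ord0 ord0 *: a + del ord0 h *m B.
Proof.
have hE : h = row_mx (h ord0 ord0)%:M (del ord0 h).
  apply/rowP => j; rewrite mxE; case: splitP => k jk.
    by rewrite !ord1 mxE eqxx mulr1n; congr (h _ _); apply: val_inj; rewrite /= jk ord1.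
  by rewrite mxE; congr (h _ _); apply: val_inj; rewrite /= jk.
by rewrite {1}hE; have /= := mul_row_col (h ord0 ord0)%:M (del ord0 h) a B;
  rewrite mul_scalar_mx.
Qed.

Lemma open_tube_dom : open tube_dom.
Proof.
rewrite openE => w [w0 Vw]; have [d d0 hd] := open_norm_ball (V := 'rV[R]_n) oV Vw.
apply: (@norm_ball_nbhs _ E _ _ (Num.min (w ord0 ord0) d)); first by rewrite lt_min w0.
move=> z; rewrite lt_min => /andP[h1 h2]; split.
  have := le_lt_trans (norm_coord_le (z - w) ord0) h1.
  by rewrite !mxE ltr_norml => /andP[h _]; lra.
by apply: hd; apply: le_lt_trans h2; rewrite delB norm_del.
Qed.

Lemma tube_differentiable w : tube_dom w -> forall e : R, 0 < e ->
  \forall w' \near w, `|tube_map w' - tube_map w - (w' - w) *m tube_diff w| <= e * `|w' - w|.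
Proof.
move=> [w0 Vw] e e0; set s := w ord0 ord0; set x := del ord0 w.
have s1 : 0 < s + 1 by rewrite addr_gt0.
have e1 : 0 < e / 3 by rewrite divr_gt0.
(* The error of the Gauss map enters multiplied by the height [s]. *)
have e2 : 0 < e / 3 / (s + 1) by rewrite divr_gt0.
have [d1 d10 h1] := @differentiable_eps _ 'rV[R]_n E phi x (dphi Vw) _ e1.
have [d2 d20 h2] := @differentiable_eps _ 'rV[R]_n E G x (dG Vw) _ e2.
have cG : {for x, continuous G} by apply: (@differentiable_continuous _ 'rV[R]_n E); exact: dG.
have /(continuous_epsP (V := 'rV[R]_n) (W := E))/(_ _ e1)[d3 d30 h3] := cG.
apply: (@norm_ball_nbhs _ E _ _ (Num.min d1 (Num.min d2 d3))); first by rewrite !lt_min d10 d20.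
move=> z; rewrite !lt_min => /and3P[z1 z2 z3].
have dz : `|del ord0 z - x| <= `|z - w| by rewrite /x delB norm_del.
have {}h1 := h1 _ (le_lt_trans dz z1).
have {}h2 := h2 _ (le_lt_trans dz z2).
have {}h3 := h3 _ (le_lt_trans dz z3).
rewrite diff_jacobian in h1; rewrite diff_jacobian in h2.
have zs : `|z ord0 ord0 - s| <= `|z - w| by have := norm_coord_le (z - w) ord0; rewrite !mxE.
have -> : tube_map z - tube_map w - (z - w) *m tube_diff w =
   (phi (del ord0 z) - phi x - (del ord0 z - x) *m 'J phi x) +
   s *: (G (del ord0 z) - G x - (del ord0 z - x) *m 'J G x) +
   (z ord0 ord0 - s) *: (G (del ord0 z) - G x).
  rewrite row_col_mx0 mulmxDr -scalemxAr -delB -/x -/s !mxE -/s.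
  rewrite /tube_map -/(G _) -/(G _) -/x -/s.
  exact: tube_split.
have nz := normr_ge0 (z - w).
apply: (le_trans (ler_normD _ _)); apply: (le_trans (lerD (ler_normD _ _) (lexx _))).
rewrite !normrZ (gtr0_norm (w0 : 0 < s)).
have b1 : `|phi (del ord0 z) - phi x - (del ord0 z - x) *m 'J phi x| <= e / 3 * `|z - w|.
  by apply: (le_trans h1); rewrite ler_wpM2l// ltW.
have b2 : s * `|G (del ord0 z) - G x - (del ord0 z - x) *m 'J G x| <= e / 3 * `|z - w|.
  apply: (@le_trans _ _ (s * (e / 3 / (s + 1) * `|z - w|))).
    rewrite ler_wpM2l ?(ltW (w0 : 0 < s))//; apply: (le_trans h2).
    by rewrite ler_wpM2l// ltW.
  have se : s * (e / 3 / (s + 1)) <= e / 3.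
    by rewrite mulrA ler_pdivrMr// mulrC ler_wpM2l ?(ltW e1)// lerDl.
  by rewrite mulrA ler_wpM2r.
have b3 : `|z ord0 ord0 - s| * `|G (del ord0 z) - G x| <= e / 3 * `|z - w|.
  by rewrite mulrC ler_pM// ltW.
apply: (le_trans (lerD (lerD b1 b2) b3)); rewrite -!mulrDl ler_wpM2r//.
have : (e + e + e) / 3 = e by field.
by move=> ->.
Qed.

(** At height [0] the tube determinant is the area density itself. Its matrix has no kernel: pairing
    with the normal removes the tangent part, and then the rank of ['J phi] concludes. *)
Lemma area_density_gt0 x : V x -> 0 < area_density phi x.
Proof.
move=> Vx; have [_ _ _ rJ _] := lp; have [Sx _] := VS Vx.
have [hN _] := gaussP oO cO sS Sx.
have NN := gauss_dot oO cO sS Sx.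
have JN := parametrization_normal lp Vx hN.
have := tube_jacobian O0 oO cO sS lp Vx (lexx 0).
rewrite scale0r addr0.
have -> : \sum_(j < n.+1) 0 ^+ j * elementary_symmetric j (principal_curvatures Omega (phi x)) = 1.
  rewrite -prod_elementary_symmetric big1// => j _; first by rewrite mul0r addr0.
rewrite mulr1 => <-; rewrite normr_gt0 -unitfE -unitmxE -row_free_unit.
apply: inj_row_free => v; rewrite row_col_mx0 => vE.
have v0 : v ord0 ord0 = 0.
  have := congr1 (fun u => dot u (gauss (phi x))) vE.
  rewrite dotDl dotZl dot0l NN mulr1.
  have -> : dot (del ord0 v *m 'J phi x) (gauss (phi x)) = 0.
    by rewrite /dot -mulmxA JN mulmx0 mxE.
  by rewrite addr0.
move: vE; rewrite v0 scale0r add0r => vE.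
have v1 : del ord0 v = 0 by apply: (row_free_inj (rJ _ Vx)); rewrite vE mul0mx.
by rewrite -(delK ord0 v) v0 v1; apply/rowP => j; rewrite !mxE; case: unliftP => [k|] _ //=; rewrite mxE.
Qed.

Lemma tube_unit w : tube_dom w -> tube_diff w \in unitmx.
Proof.
move=> [w0 Vw]; have [Sx _] := VS Vw.
rewrite unitmxE unitfE -normr_gt0 (tube_jacobian O0 oO cO sS lp Vw (ltW w0)).
rewrite mulr_gt0 ?area_density_gt0// -prod_elementary_symmetric prodr_gt0// => j _.
by rewrite ltr_wpDr// mulr_ge0 ?(ltW w0)// principal_curvatures_ge0.
Qed.

Lemma tube_det_continuous w : tube_dom w ->
  {for w, continuous (fun w => \det (tube_diff w))}.
Proof.
move=> [w0 Vw]; have cdel : continuous (del ord0 : E -> 'rV[R]_n).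
  move=> y; apply/(continuous_epsP (V := E) (W := 'rV[R]_n)) => e e0.
  by exists e => // z; apply: le_lt_trans; rewrite delB norm_del.
have [_ sphi _ _ _] := lp.
have cent (h : 'rV[R]_n -> R) : Ck 0 V h -> {for w, continuous (fun w : E => h (del ord0 w))}.
  by move=> Ch; apply: (@continuous_comp E 'rV[R]_n R (del ord0) h); [exact: cdel|exact: Ch].
have c0 : {for w, continuous (fun w : E => w ord0 ord0)} by exact: coord_continuous.
apply: (@for_continuous_sum _ E R) => s _; apply: (@for_continuousM _ E).
  exact: for_continuous_cst.
apply: (@for_continuous_prod _ E) => a _.
case: (unliftP ord0 a) => [a'|] ->.
  rewrite (_ : (fun _ => _) = fun y => 'J phi (del ord0 y) a' (s (lift ord0 a')) +
      y ord0 ord0 * 'J G (del ord0 y) a' (s (lift ord0 a'))).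
    apply: (@for_continuousD _ E R).
      apply: (cent (fun x => 'J phi x a' (s (lift ord0 a')))).
      by apply: Ck_jacobian => //; exact: sphi.
    apply: (@for_continuousM _ E) => //.
    apply: (cent (fun x => 'J G x a' (s (lift ord0 a')))).
    by apply: Ck_jacobian => //; exact: smooth_gauss_chart.
  by apply/funext => y; exact: col_mx_liftD.
rewrite (_ : (fun _ => _) = fun y => G (del ord0 y) ord0 (s ord0)).
  by apply: (cent (fun x => G x ord0 (s ord0))); apply: Ck_coord => //; exact: smooth_gauss_chart.
by apply/funext => y; rewrite /tube_diff col_mx_ord0.
Qed.

Lemma tube_mapP w : tube_dom w ->
  [/\ ~ K (tube_map w), edist K (tube_map w) = w ord0 ord0,
      proj K (tube_map w) = phi (del ord0 w) & tube_inv (tube_map w) = w].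
Proof.
move=> [w0 Vw]; have [Sx Wx] := VS Vw.
have [pE dE] := proj_gauss_ray O0 oO bO cO sS Sx (ltW w0).
split => //; last by rewrite /tube_inv pE dE insK delK.
by move=> /(edist_eq0 cK K0 cvK); rewrite dE => h; rewrite h ltxx in w0.
Qed.

Lemma tube_invP y : ~ K y -> W (proj K y) -> tube_dom (tube_inv y) /\ tube_map (tube_inv y) = y.
Proof.
move=> Ky Wy; have [Sy _] := proj_boundary O0 oO bO cO sS Ky.
have [Vy yE] := SV Sy Wy.
split; first by split; rewrite /tube_inv ?ins_at ?insK//; exact: edist_gt0.
rewrite /tube_map /tube_inv ins_at insK -yE.
by rewrite -(gauss_proj_ray O0 oO bO cO sS Ky).
Qed.

Lemma tube_dom_near w : tube_dom w ->
  \forall y \near tube_map w, tube_dom (tube_inv y) /\ tube_map (tube_inv y) = y.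
Proof.
move=> Ow; have [nK dE pE _] := tube_mapP Ow; have [_ Wx] := VS Ow.2.
have n1 : nbhs (tube_map w) (~` K).
  by apply: open_nbhs_nbhs; split => //; apply: closed_openC; exact: closed_closure.
have n2 : nbhs (tube_map w) (proj K @^-1` W).
  by apply: (proj_continuous cK K0 cvK); rewrite pE; exact: open_nbhs_nbhs.
by apply: filterS2 n1 n2 => y Ky Wy; exact: tube_invP.
Qed.

(** Distance and projection are 1-Lipschitz for the Euclidean norm; comparison with the maximum norm
    costs one factor [n.+1] for each of them. *)
Lemma tube_lipschitz w : tube_dom w ->
  exists2 C : R, 0 < C & \forall y \near tube_map w, `|tube_inv y - w| <= C * `|y - tube_map w|.
Proof.
move=> Ow; have [_ _ _ iE] := tube_mapP Ow.
exists (n.+1%:R + n.+1%:R); first by rewrite addr_gt0.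
apply: (@norm_ball_nbhs _ E _ _ 1) => // y _; rewrite -[w in leLHS]iE insB (le_trans (norm_ins_le _ _ _))// mulrDl lerD//.
  exact: le_trans (edist_lipschitz cK K0 cvK _ _) (enorm_le_norm _).
rewrite delB (le_trans (norm_del _ _))// (le_trans (norm_le_enorm _))//.
exact: le_trans (proj_lipschitz cK K0 cvK _ _) (enorm_le_norm _).
Qed.

Lemma ge0_integral_tube_chart (A : set E) (H : E -> \bar R) :
  measurable A -> A `<=` ~` K `&` proj K @^-1` W -> measurable_fun A H ->
  (forall y, A y -> (0 <= H y)%E) ->
  (\int[lebesgue_rV n.+1]_(y in A) H y =
   \int[lebesgue_rV n.+1]_(w in tube_dom `&` tube_map @^-1` A)
     (H (tube_map w) * `|\det (tube_diff w)|%:E))%E.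
Proof.
move=> mA AKW mH H0.
apply: (ge0_integral_cov open_tube_dom tube_differentiable tube_unit tube_det_continuous
  tube_dom_near tube_lipschitz mA _ mH H0).
by move=> y /AKW[Ky Wy]; exact: tube_invP.
Qed.

End tube_chart.

Lemma measurable_del {R : realType} {n : nat} (i : 'I_n.+1) :
  measurable_fun setT (del i : 'rV[R]_n.+1 -> 'rV[R]_n).
Proof.
apply: measurable_to_rV => j.
rewrite (_ : (fun _ => _) = fun x : 'rV[R]_n.+1 => x ord0 (lift i j)).
  exact: measurable_rV_coord.
by apply/funext => x; rewrite mxE.
Qed.

(** * Regularity of the curvature functions and the tube integral in one chart *)

Section curvature_densities.
Context {R : realType} {n : nat}.
Local Notation E := 'rV[R]_n.+1.
Variable Omega : set E.
Hypotheses (O0 : Omega !=set0) (oO : open Omega) (bO : bounded_set Omega).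
Hypothesis cO : convex_set Omega.
Local Notation K := (closure Omega).
Local Notation S := (boundary Omega).
Hypothesis sS : smooth_hypersurface S.
Local Notation gauss := (gauss Omega).

Definition sym_curv (j : nat) (p : E) : R :=
  elementary_symmetric j (principal_curvatures Omega p).

Lemma sym_curv_ge0 j p : S p -> 0 <= sym_curv j p.
Proof.
move=> Sp; apply: sumr_ge0 => A _; apply: prodr_ge0 => k _.
exact: principal_curvatures_ge0.
Qed.

Lemma sym_curv0 p : sym_curv 0 p = 1.
Proof.
rewrite /sym_curv /elementary_symmetric (big_pred1 (finset.set0 : {set 'I_n})).
  by rewrite big_pred0// => k; rewrite inE.
by move=> A; rewrite /= cards_eq0.
Qed.

Section chart.
Variables (W : set E) (f : E -> R) (i : 'I_n.+1) (V : set 'rV[R]_n) (g : 'rV[R]_n -> R).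
Let phi x := ins i (g x) x.
Hypothesis oW : outward_defining_function Omega W f.
Hypotheses (oV : open V) (sg : smooth_on V g).
Hypothesis VS : forall x, V x -> S (phi x) /\ W (phi x).
Hypothesis SV : forall y, S y -> W y -> V (del i y) /\ y = phi (del i y).

Let opW : open W. Proof. by have [[]] := oW. Qed.

Let lp : local_parametrization S V phi.
Proof. by apply: graph_parametrization => // x /VS[]. Qed.

(** The heights [k.+1] are positive, as membership in [tube_dom] requires, and distinct, so that
    [n.+1] of them determine the coefficients of the tube polynomial. *)
Let P (k : nat) x : R := `|\det (tube_diff Omega i g (ins ord0 k.+1%:R x))|.

Let PE k x : V x -> P k x = area_density phi x * \sum_(j < n.+1) k.+1%:R ^+ j * sym_curv j (phi x).
Proof.
move=> Vx; rewrite /P /tube_diff ins_at insK.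
by rewrite (tube_jacobian O0 oO cO sS lp Vx)// ler0n.
Qed.

Let cP k : Ck 0 V (P k).
Proof.
move=> x Vx; apply: (@continuous_comp 'rV[R]_n R R (fun x => \det (tube_diff Omega i g (ins ord0 k.+1%:R x))) Num.norm).
  apply: (@continuous_comp 'rV[R]_n E R (ins ord0 k.+1%:R) (fun w => \det (tube_diff Omega i g w))).
    apply/(continuous_epsP (V := 'rV[R]_n) (W := E)) => e e0.
    by exists e => // z zx; rewrite insB subrr norm_ins_lt// normr0.
  apply: (tube_det_continuous O0 oO cO sS oW oV sg VS); split.
    by rewrite ins_at ltr0Sn.
  by rewrite insK.
exact: norm_continuous.
Qed.

Let a : 'rV[R]_n.+1 := \row_k k.+1%:R.

Let Vunit : Vandermonde n.+1 a \in unitmx.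
Proof.
rewrite unitmxE unitfE det_Vandermonde; apply/prodf_neq0 => k _.
apply/prodf_neq0 => l kl; rewrite !mxE subr_eq0 eqr_nat eqSS.
by rewrite gtn_eqF.
Qed.

Let density_sym_curv j : Ck 0 V (fun x => area_density phi x * sym_curv j (phi x)).
Proof.
have [jn|jn] := ltnP j n.+1; last first.
  apply: (@Ck_eq _ _ _ 0 V (fun=> 0)) => //; last exact: Ck_cst.
  move=> x Vx; rewrite /sym_curv /elementary_symmetric big_pred0 ?mulr0// => A.
  by apply/negbTE; rewrite neq_ltn (leq_ltn_trans (max_card _))// card_ord.
pose h (x : 'rV[R]_n) : R := \sum_(k < n.+1) P k x * invmx (Vandermonde n.+1 a) k (Ordinal jn).
have Ch : Ck 0 V h by apply: Ck_sum => // k; apply: CkM => //; exact: Ck_cst.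
apply: (Ck_eq oV _ Ch); rewrite /h.
  move=> x Vx; pose u : 'rV[R]_n.+1 := \row_l (area_density phi x * sym_curv l (phi x)).
  have uE : u *m Vandermonde n.+1 a = \row_k P k x.
    apply/rowP => k; rewrite !mxE PE// mulr_sumr; apply: eq_bigr => l _.
    by rewrite !mxE; ring.
  have : u = (\row_k P k x) *m invmx (Vandermonde n.+1 a) by rewrite -uE mulmxK.
  move/rowP/(_ (Ordinal jn)); rewrite [LHS]mxE [RHS]mxE /= => ->.
  by apply: eq_bigr => k _; rewrite mxE.
Qed.

Let density_continuous : Ck 0 V (area_density phi).
Proof.
apply: (@Ck_eq _ _ _ 0 V (fun x => area_density phi x * sym_curv 0 (phi x))) => //.
by move=> x Vx; rewrite sym_curv0 mulr1.
Qed.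

(* The principal curvatures themselves are chosen pointwise, without any
   regularity; their symmetric functions are recovered from the tube determinants
   at finitely many heights by inverting a Vandermonde matrix. *)
Lemma sym_curv_continuous j : Ck 0 V (fun x => sym_curv j (phi x)).
Proof.
apply: (@Ck_eq _ _ _ 0 V (fun x => (area_density phi x)^-1 * (area_density phi x * sym_curv j (phi x)))) => //.
  move=> x Vx; rewrite mulrA mulVf ?mul1r// gt_eqF//.
  exact: (area_density_gt0 O0 oO cO sS oV sg VS Vx).
apply: CkM; [by []| |exact: density_sym_curv].
apply: CkV; [by []| |exact: density_continuous].
move=> x Vx; rewrite gt_eqF//; exact: (area_density_gt0 O0 oO cO sS oV sg VS Vx).
Qed.

(** On the boundary the chart is inverted by the linear map [del i], through which [h] factors. *)
Lemma measurable_on_chart (h : E -> R) : measurable_fun V (fun x => h (phi x)) ->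
  measurable_fun (S `&` W) h.
Proof.
move=> mh; apply: (@eq_measurable_fun _ _ _ _ _ ((fun x => h (phi x)) \o del i)).
  by move=> y /set_mem[Sy Wy]; rewrite /= -(SV Sy Wy).2.
apply: (measurable_comp _ _ mh).
- exact: open_measurable_rV.
- by move=> _ [y [Sy Wy] <-]; have [] := SV Sy Wy.
- exact: (measurable_funS measurableT _ (measurable_del i)).
Qed.

Lemma measurable_sym_curv_chart j : measurable_fun (S `&` W) (sym_curv j).
Proof.
by apply: measurable_on_chart; apply: continuous_on_open_measurable => //; exact: sym_curv_continuous.
Qed.

Lemma bounded_sym_curv_chart p : S p -> W p -> exists2 W' : set E, open W' /\ W' p &
  exists M : R, forall y j, S y -> W y -> W' y -> (j < n.+1)%N -> sym_curv j y <= M.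
Proof.
move=> Sp Wp; have [Vp pE] := SV Sp Wp.
have cdel : continuous (del i : E -> 'rV[R]_n).
  move=> y; apply/(continuous_epsP (V := E) (W := 'rV[R]_n)) => e e0.
  by exists e => // z; apply: le_lt_trans; rewrite delB norm_del.
have cs : {for del i p, continuous (fun x => \sum_(j < n.+1) sym_curv j (phi x))}.
  by have : Ck 0 V (fun x => \sum_(j < n.+1) sym_curv j (phi x)); [apply: Ck_sum => // j; exact: sym_curv_continuous|apply].
set M := \sum_(j < n.+1) sym_curv j (phi (del i p)) + 1.
have /(continuous_epsP (V := 'rV[R]_n) (W := R))/(_ _ ltr01)[d d0 hd] := cs.
exists (fun y : E => `|del i y - del i p| < d); first split.
- rewrite openE => y /= yd.
  apply: (@norm_ball_nbhs _ E _ _ (d - `|del i y - del i p|)); first by rewrite subr_gt0.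
  move=> z; rewrite ltrBrDr; apply: le_lt_trans.
  rewrite (le_trans (ler_distD (del i y) _ _))// lerD2r.
  by rewrite delB norm_del.
- by rewrite /= subrr normr0.
exists M => y j Sy Wy Wy' jn; have := hd _ Wy'; have [_ yE] := SV Sy Wy.
rewrite -yE ltr_norml => /andP[_ h].
have h2 : \sum_(j < n.+1) sym_curv j y < M by rewrite /M -ltrBlDl.
apply: le_trans (ltW h2); rewrite (bigD1 (Ordinal jn))//= lerDl.
by apply: sumr_ge0 => l _; exact: sym_curv_ge0.
Qed.

Section integrals.
Variable mu : {measure set E -> \bar R}.
Hypothesis muS : is_area_measure S mu.

(** The change of variables produces an integral over heights and parameters with a Jacobian
    polynomial in the height. Each monomial splits by Tonelli, and its parameter factor is an
    integral against [mu] by the definition of the area measure. *)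
Lemma tube_integral_chart (B : set E) (c : E -> R) (k : R -> R) :
  measurable B -> B `<=` S `&` W -> measurable_fun B c -> (forall p, B p -> 0 <= c p) ->
  measurable_fun setT k -> (forall s, 0 <= k s) ->
  (\int[lebesgue_rV n.+1]_(y in ~` K `&` proj K @^-1` B) (c (proj K y) * k (edist K y))%:E =
   \sum_(j < n.+1) \int[lebesgue_measure]_(s in `]0%R, +oo[) (k s * s ^+ j)%:E *
      \int[mu]_(p in B) (c p * sym_curv j p)%:E)%E.
Proof.
move=> mB BSW mc c0 mk k0.
have cK := compact_domain_closure bO; have K0 := domain_closure0 O0.
have cvK := domain_closure_segment cO.
have mproj : measurable_fun setT (proj K).
  apply: continuous_on_open_measurable_rV; first exact: openT.
  by move=> y _; exact: (proj_continuous cK K0 cvK).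
have medist : measurable_fun setT (edist K).
  apply: continuous_on_open_measurable; first exact: openT.
  by move=> y _; exact: (edist_continuous cK K0 cvK).
have mA : measurable (~` K `&` proj K @^-1` B).
  apply: measurableI.
    by apply: measurableC; apply: closed_measurable_rV; exact: closed_closure.
  by rewrite -[X in measurable X]setTI; exact: mproj.
set A := _ `&` _ in mA *.
have mV : measurable V by exact: open_measurable_rV.
have mphi : measurable_fun V phi.
  have [_ sphi _ _ _] := lp; exact: (continuous_on_open_measurable_rV oV (sphi 0)).
pose VB := V `&` phi @^-1` B.
have mVB : measurable VB by exact: mphi.
have mcphi : measurable_fun VB (c \o phi).
  apply: (measurable_comp mB _ mc); first by move=> _ [x [_ ?] <-].
  by apply: (measurable_funS mV) => // x [].
have msc j : measurable_fun VB (fun x => sym_curv j (phi x)).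
  apply: (measurable_funS mV); first by move=> x [].
  by apply: (continuous_on_open_measurable oV); exact: sym_curv_continuous.
have mdens : measurable_fun V (area_density phi).
  exact: (continuous_on_open_measurable oV density_continuous).
have mcA : measurable_fun A (fun y => c (proj K y)).
  apply: (measurable_comp mB _ mc); first by move=> _ [y [_ ?] <-].
  exact: (measurable_funS measurableT).
rewrite (ge0_integral_tube_chart O0 oO bO cO sS oW oV sg VS SV mA); last 3 first.
- by move=> y [Ky By]; split => //; have [] := BSW _ By.
- apply/measurable_EFinP; apply: measurable_funM => //.
  apply: (measurable_funS measurableT) => //; exact: measurableT_comp.
- by move=> y [_ By]; rewrite lee_fin mulr_ge0// c0.
pose II : set R := `]0, +oo[%classic.
have IIE s : II s = (0 < s) by rewrite /II /= in_itv/= andbT.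
have mI : measurable II by exact: measurable_itv.
have -> : tube_dom V `&` tube_map Omega i g @^-1` A =
    [set w : E | II (w ord0 ord0) /\ VB (del ord0 w)].
  apply/seteqP; split => w.
    move=> [Ow [_ Bw]]; have [_ _ pE _] := tube_mapP O0 oO bO cO sS VS Ow.
    by split; [rewrite /= IIE; case: Ow|split; [case: Ow|move: Bw; rewrite /= pE]].
  move=> [w0 [Vw Bw]]; rewrite /= IIE in w0.
  have Ow : tube_dom V w by split.
  by split => //; have [nK _ pE _] := tube_mapP O0 oO bO cO sS VS Ow; split => //=; rewrite pE.
pose aa (j : nat) (s : R) : \bar R := (k s * s ^+ j)%:E.
pose bb (j : nat) (x : 'rV[R]_n) : \bar R := (c (phi x) * sym_curv j (phi x) * area_density phi x)%:E.
have maa j : measurable_fun II (aa j).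
  apply/measurable_EFinP; apply: (measurable_funS measurableT) => //.
  by apply: measurable_funM => //; exact: exprn_measurable.
have mbb j : measurable_fun VB (bb j).
  apply/measurable_EFinP; apply: measurable_funM; first by apply: measurable_funM => //.
  by apply: (measurable_funS mV) => // x [].
have aa0 j s : II s -> (0 <= aa j s)%E.
  by rewrite /= IIE => s0; rewrite lee_fin mulr_ge0// exprn_ge0// ltW.
have bb0 j x : VB x -> (0 <= bb j x)%E.
  move=> [Vx Bx]; rewrite lee_fin !mulr_ge0 ?c0 ?sqrtr_ge0// sym_curv_ge0//.
  by have [] := VS Vx.
transitivity (\int[lebesgue_rV n.+1]_(w in [set w : E | II (w ord0 ord0) /\ VB (del ord0 w)])
   \sum_(j < n.+1) (aa j (w ord0 ord0) * bb j (del ord0 w)))%E.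
  apply: eq_integral => w /set_mem[w0 [Vw Bw]]; rewrite /= IIE in w0.
  have Ow : tube_dom V w by split.
  have [_ dE pE _] := tube_mapP O0 oO bO cO sS VS Ow.
  rewrite pE dE (_ : tube_diff _ _ _ _ = col_mx (gauss (phi (del ord0 w))) ('J phi (del ord0 w)
    + w ord0 ord0 *: 'J (fun x => gauss (phi x)) (del ord0 w)))//.
  rewrite (tube_jacobian O0 oO cO sS lp Vw (ltW w0)) -EFinM !mulr_sumr -sumEFin.
  by apply: eq_bigr => j _; rewrite -EFinM; congr EFin; rewrite /sym_curv; ring.
have mD : measurable [set w : E | II (w ord0 ord0) /\ VB (del ord0 w)].
  rewrite (_ : [set w | _] = (fun w : E => w ord0 ord0) @^-1` II `&` del ord0 @^-1` VB)//.
  apply: measurableI; rewrite -[X in measurable X]setTI.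
    exact: measurable_rV_coord.
  exact: measurable_del.
rewrite ge0_integral_sum//; last 2 first.
- move=> j; apply: emeasurable_funM.
    apply: (measurable_comp mI _ (maa j)); first by move=> _ [w [w0 _] <-].
    exact: (measurable_funS measurableT _ (measurable_rV_coord _)).
  apply: (measurable_comp mVB _ (mbb j)); first by move=> _ [w [_ Vw] <-].
  exact: (measurable_funS measurableT _ (measurable_del _)).
- by move=> j w [w0 Vw]; rewrite mule_ge0//; [exact: aa0|exact: bb0].
apply: eq_bigr => j _; rewrite ge0_integral_rV_prod//; [|by move=> s; exact: aa0|by move=> x; exact: bb0].
congr (_ * _)%E; symmetry.
rewrite (@ge0_integral_density _ _ _ _ _ mu (lebesgue_rV n) B V phi (area_density phi) mB mV mphi mdens) //.
- by move=> x _; exact: sqrtr_ge0.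
- move=> C mC CB; apply: muS => // y /CB/BSW[Sy Wy].
  by exists (del i y); [have [] := SV Sy Wy|rewrite -(SV Sy Wy).2].
- apply/measurable_EFinP; apply: measurable_funM => //.
  by apply: (measurable_funS _ _ (measurable_sym_curv_chart j)) => //; apply: measurableI; [apply: closed_measurable_rV; exact: closed_boundary|exact: open_measurable_rV].
- by move=> p Bp; rewrite lee_fin mulr_ge0 ?c0 ?sym_curv_ge0//; have [] := BSW _ Bp.
Qed.

End integrals.
End chart.
End curvature_densities.

(** Takes the place of a partition of unity: facts that hold in charts and survive unions of two
    sets reach the whole boundary through a finite subcover. *)
Lemma compact_union_induction {T : ptopologicalType} (A : set T) (P : set T -> Prop) :
  compact A -> P set0 -> (forall U U', P U -> P U' -> P (U `|` U')) ->
  (forall p, A p -> exists2 U, open U /\ U p & P U) ->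
  exists2 U, A `<=` U & P U.
Proof.
move=> cA P0 PU locP.
have h p : exists U, A p -> [/\ open U, U p & P U].
  have [Ap|nAp] := pselect (A p); last by exists set0.
  by have [U [oU Up] PUU] := locP p Ap; exists U.
have /choice[f fP] := h.
have : cover_compact A by rewrite -compact_cover.
move=> /(_ T A f)[p Ap|p Ap|D DA Acov].
- by have [] := fP p Ap.
- by exists p => //; have [] := fP p Ap.
exists (\bigcup_(p in [set` finmap.enum_fset D]) f p).
  by move=> x /Acov[p pD fx]; exists p.
have : forall p, p \in finmap.enum_fset D -> A p by move=> p pD; apply/set_mem/DA.
elim: (finmap.enum_fset D) => [|p s ih] hs.
  by rewrite bigcup_seq big_nil.
rewrite bigcup_seq big_cons -bigcup_seq; apply: PU.
  by have [] := fP p (hs p (mem_head _ _)).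
by apply: ih => q qs; apply: hs; rewrite in_cons qs orbT.
Qed.

Section tube_formula.
Context {R : realType} {n : nat}.
Local Notation E := 'rV[R]_n.+1.
Variable Omega : set E.
Hypotheses (O0 : Omega !=set0) (oO : open Omega) (bO : bounded_set Omega).
Hypothesis cO : convex_set Omega.
Local Notation K := (closure Omega).
Local Notation S := (boundary Omega).
Hypothesis sS : smooth_hypersurface S.
Variable mu : {measure set E -> \bar R}.
Hypothesis muS : is_area_measure S mu.
Local Notation ek := (sym_curv Omega).

Let mS : measurable S.
Proof. by apply: closed_measurable_rV; exact: closed_boundary. Qed.

Let cK := compact_domain_closure bO.
Let K0 := domain_closure0 O0.
Let cvK := domain_closure_segment cO.

Lemma measurable_proj : measurable_fun setT (proj K).
Proof.
apply: continuous_on_open_measurable_rV; first exact: openT.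
by move=> y _; exact: (proj_continuous cK K0 cvK).
Qed.

Lemma measurable_edist : measurable_fun setT (edist K).
Proof.
apply: continuous_on_open_measurable; first exact: openT.
by move=> y _; exact: (edist_continuous cK K0 cvK).
Qed.

Lemma measurable_domain_closure : measurable K.
Proof. by apply: closed_measurable_rV; exact: closed_closure. Qed.

Let mext B : measurable B -> measurable (~` K `&` proj K @^-1` B).
Proof.
move=> mB; apply: measurableI; first by apply: measurableC; exact: measurable_domain_closure.
by rewrite -[X in measurable X]setTI; exact: measurable_proj.
Qed.

Definition tube_formula (B : set E) : Prop :=
  forall (c : E -> R) (k : R -> R),
  measurable_fun B c -> (forall p, B p -> 0 <= c p) ->
  measurable_fun setT k -> (forall s, 0 <= k s) ->
  (\int[lebesgue_rV n.+1]_(y in ~` K `&` proj K @^-1` B) (c (proj K y) * k (edist K y))%:E =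
   \sum_(j < n.+1) \int[lebesgue_measure]_(s in `]0%R, +oo[) (k s * s ^+ j)%:E *
      \int[mu]_(p in B) (c p * ek j p)%:E)%E.

(** The formula is demanded for every measurable piece of [S] in [U], so that two patches can be
    joined by splitting a piece into its parts in and off the first one. Measurability and the bound
    of the curvature functions are glued along with it. *)
Definition tube_patch (U : set E) : Prop :=
  [/\ measurable U, (forall j, measurable_fun (S `&` U) (ek j)),
      exists M : R, forall y j, S y -> U y -> (j < n.+1)%N -> ek j y <= M &
      forall B, measurable B -> B `<=` S `&` U -> tube_formula B].

Let kint0 (k : R -> R) j : (forall s, 0 <= k s) ->
  (0 <= \int[lebesgue_measure]_(s in `]0%R, +oo[) (k s * s ^+ j)%:E)%E.
Proof.
move=> k0; apply: integral_ge0 => s; rewrite /= in_itv/= andbT => s0.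
by rewrite lee_fin mulr_ge0// exprn_ge0// ltW.
Qed.

Lemma tube_formulaU B1 B2 : measurable B1 -> measurable B2 -> [disjoint B1 & B2] ->
  B1 `|` B2 `<=` S -> (forall j, measurable_fun (B1 `|` B2) (ek j)) ->
  tube_formula B1 -> tube_formula B2 -> tube_formula (B1 `|` B2).
Proof.
move=> mB1 mB2 dB BS mek f1 f2 c k mc c0 mk k0.
have mc1 : measurable_fun B1 c by apply: measurable_funS mc => //; exact: measurableU.
have mc2 : measurable_fun B2 c by apply: measurable_funS mc => //; exact: measurableU.
rewrite preimage_setU setIUr ge0_integral_setU; first last.
- apply/disj_setPS => y [[_ y1] [_ y2]]; move/disj_setPS: dB => /(_ (proj K y)); apply.
  by split.
- move=> y; rewrite -setIUr => -[_ By]; rewrite lee_fin mulr_ge0// c0//.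
- apply/measurable_EFinP; apply: measurable_funM.
    apply: (measurable_comp _ _ mc); first exact: measurableU.
      by move=> _ [y [[_ By]|[_ By]] <-]; [left|right].
    apply: (measurable_funS measurableT) => //; exact: measurable_proj.
  apply: (measurable_funS measurableT) => //; apply: measurableT_comp => //.
  exact: measurable_edist.
- exact: mext.
- exact: mext.
rewrite f1//; last by move=> p Bp; apply: c0; left.
rewrite f2//; last by move=> p Bp; apply: c0; right.
rewrite -big_split/=; apply: eq_bigr => j _.
rewrite -ge0_muleDr//; last 2 first.
- apply: integral_ge0 => p Bp; rewrite lee_fin; apply: mulr_ge0; first by apply: c0; left.
  by apply: (sym_curv_ge0 O0 oO cO sS); apply: BS; left.
- apply: integral_ge0 => p Bp; rewrite lee_fin; apply: mulr_ge0; first by apply: c0; right.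
  by apply: (sym_curv_ge0 O0 oO cO sS); apply: BS; right.
congr (_ * _)%E; rewrite ge0_integral_setU//.
- by apply/measurable_EFinP; exact: measurable_funM.
- move=> p Bp; rewrite lee_fin; apply: mulr_ge0; first exact: c0.
  by apply: (sym_curv_ge0 O0 oO cO sS); exact: BS.
Qed.

Lemma tube_patchU U U' : tube_patch U -> tube_patch U' -> tube_patch (U `|` U').
Proof.
move=> [mU mek [M hM] fU] [mU' mek' [M' hM'] fU'].
have mekU j : measurable_fun (S `&` (U `|` U')) (ek j).
  by rewrite setIUr; apply/measurable_funU => //; exact: measurableI.
split => //; first exact: measurableU.
  exists (Num.max M M') => y j Sy [Uy|Uy] jn; rewrite le_max.
    by rewrite (hM y j).
  by rewrite (hM' y j)// orbT.
move=> B mB BU.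
have BE : B = (B `&` U) `|` (B `\` U) by rewrite setUC setDE -setIUr setUC setUv setIT.
rewrite BE; apply: tube_formulaU.
- exact: measurableI.
- exact: measurableD.
- by apply/disj_setPS => y [[_ Uy] [_ nUy]].
- by rewrite -BE => y /BU[].
- by move=> j; rewrite -BE; apply: measurable_funS (mekU j) => //; exact: measurableI (measurableU _ _ _ _).
- apply: fU; first exact: measurableI.
  by move=> y [By Uy]; split => //; have [] := BU _ By.
- apply: fU'; first exact: measurableD.
  by move=> y [By nUy]; have [Sy [Uy|Uy]] := BU _ By.
Qed.

Lemma tube_patch0 : tube_patch set0.
Proof.
split => //; first by move=> j; rewrite setI0; exact: measurable_fun_set0.
  by exists 0.
move=> B mB; rewrite setI0 subset0 => -> c k mc c0 mk k0.
rewrite preimage_set0 setI0 integral_set0 big1// => j _.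
by rewrite integral_set0 mule0.
Qed.

Lemma tube_patch_local p : S p -> exists2 U, open U /\ U p & tube_patch U.
Proof.
move=> Sp; have [W [f [i [V [g [Wp oW [oV sg] VS SV]]]]]] := graph_chart oO cO sS Sp.
have [[opW _ _ _] _] := oW.
have [W' [oW' W'p] [M hM]] := bounded_sym_curv_chart O0 oO cO sS oW oV sg VS SV Sp Wp.
have oWW : open (W `&` W') by exact: openI.
exists (W `&` W'); first by split.
split; first exact: open_measurable_rV.
- move=> j; apply: measurable_funS (measurable_sym_curv_chart O0 oO cO sS oW oV sg VS SV j).
    by apply: measurableI => //; exact: open_measurable_rV.
  by move=> y [Sy [Wy _]].
- by exists M => y j Sy [Wy W'y]; exact: hM.
- move=> B mB BS c k mc c0 mk k0.
  apply: (tube_integral_chart O0 oO bO cO sS oW oV sg VS SV muS mB) => //.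
  by move=> y /BS[Sy [Wy _]].
Qed.

Lemma tube_patch_boundary : exists2 U, S `<=` U & tube_patch U.
Proof.
apply: (compact_union_induction (compact_boundary bO)).
- exact: tube_patch0.
- exact: tube_patchU.
- exact: tube_patch_local.
Qed.

Lemma measurable_sym_curv j : measurable_fun S (ek j).
Proof.
have [U SU [_ mek _ _]] := tube_patch_boundary.
by have := mek j; rewrite setIidl.
Qed.

Lemma bounded_sym_curv : exists M : R, forall p j, S p -> (j < n.+1)%N -> ek j p <= M.
Proof.
have [U SU [_ _ [M hM] _]] := tube_patch_boundary.
by exists M => p j Sp; apply: hM => //; exact: SU.
Qed.

Theorem ge0_tube_integral (c : E -> R) (k : R -> R) :
  measurable_fun S c -> (forall p, S p -> 0 <= c p) ->
  measurable_fun setT k -> (forall s, 0 <= k s) ->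
  (\int[lebesgue_rV n.+1]_(y in ~` K) (c (proj K y) * k (edist K y))%:E =
   \sum_(j < n.+1) \int[lebesgue_measure]_(s in `]0%R, +oo[) (k s * s ^+ j)%:E *
      \int[mu]_(p in S) (c p * ek j p)%:E)%E.
Proof.
move=> mc c0 mk k0; have [U SU [_ _ _ fU]] := tube_patch_boundary.
rewrite -(fU S mS _ c k mc c0 mk k0); last by move=> y Sy; split => //; exact: SU.
congr (integral _ _ _); apply/seteqP; split => y; last by case.
by move=> Ky; split => //; have [] := proj_boundary O0 oO bO cO sS Ky.
Qed.

End tube_formula.

Section bounded_measurable.
Context {d} {T : measurableType d} {R : realType}.
Implicit Types (D : set T) (h : T -> R).

Definition bounded_measurable D h : Prop :=
  measurable_fun D h /\ exists M : R, forall x, D x -> `|h x| <= M.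

Lemma bounded_measurable_ge D h : bounded_measurable D h ->
  exists2 M : R, 0 <= M & forall x, D x -> `|h x| <= M.
Proof.
move=> [_ [M hM]]; exists (Num.max 0 M); first by rewrite le_max lexx.
by move=> x Dx; rewrite le_max hM ?orbT.
Qed.

Lemma bounded_measurable_cst D (c : R) : bounded_measurable D (fun=> c).
Proof. by split; [exact: measurable_cst|exists `|c|]. Qed.

Lemma bounded_measurableD D h1 h2 : bounded_measurable D h1 ->
  bounded_measurable D h2 -> bounded_measurable D (fun x => h1 x + h2 x).
Proof.
move=> b1 b2; have [M1 M10 hM1] := bounded_measurable_ge b1.
have [M2 M20 hM2] := bounded_measurable_ge b2.
split; first by apply: measurable_funD; [case: b1|case: b2].
by exists (M1 + M2) => x Dx; rewrite (le_trans (ler_normD _ _))// lerD ?hM1 ?hM2.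
Qed.

Lemma bounded_measurableM D h1 h2 : bounded_measurable D h1 ->
  bounded_measurable D h2 -> bounded_measurable D (fun x => h1 x * h2 x).
Proof.
move=> b1 b2; have [M1 M10 hM1] := bounded_measurable_ge b1.
have [M2 M20 hM2] := bounded_measurable_ge b2.
split; first by apply: measurable_funM; [case: b1|case: b2].
by exists (M1 * M2) => x Dx; rewrite normrM ler_pM// ?hM1 ?hM2.
Qed.

Lemma bounded_measurableN D h : bounded_measurable D h ->
  bounded_measurable D (fun x => - h x).
Proof.
move=> bh; rewrite (_ : (fun _ => _) = fun x => -1 * h x).
  by apply: bounded_measurableM => //; exact: bounded_measurable_cst.
by apply/funext => x; rewrite mulN1r.
Qed.

Lemma bounded_measurableX D h k : bounded_measurable D h ->
  bounded_measurable D (fun x => h x ^+ k).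
Proof.
move=> bh; elim: k => [|k ih].
  by rewrite (_ : (fun _ => _) = fun=> 1)//; exact: bounded_measurable_cst.
rewrite (_ : (fun _ => _) = fun x => h x * h x ^+ k); first exact: bounded_measurableM.
by apply/funext => x; rewrite exprS.
Qed.

Lemma bounded_measurable_sum D (I : Type) (r : seq I) (P : pred I) (h : I -> T -> R) :
  (forall i, P i -> bounded_measurable D (h i)) ->
  bounded_measurable D (fun x => \sum_(i <- r | P i) h i x).
Proof.
move=> bh; elim: r => [|i r ih].
  rewrite (_ : (fun _ => _) = fun=> 0); first exact: bounded_measurable_cst.
  by apply/funext => x; rewrite big_nil.
have [Pi|nPi] := boolP (P i); last first.
  by rewrite (_ : (fun _ => _) = (fun y => \sum_(i <- r | P i) h i y))//;
    apply/funext => y; rewrite big_cons (negbTE nPi).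
rewrite (_ : (fun _ => _) = (fun y => h i y + \sum_(i <- r | P i) h i y)); last first.
  by apply/funext => y; rewrite big_cons Pi.
by apply: bounded_measurableD => //; exact: bh.
Qed.

Lemma bounded_measurableS D D' h : measurable D -> D' `<=` D -> bounded_measurable D h ->
  bounded_measurable D' h.
Proof.
move=> mD DD [mh [M hM]]; split; first exact: measurable_funS mh.
by exists M => x /DD; exact: hM.
Qed.

Lemma bounded_measurable_integrable (m : {measure set T -> \bar R}) D h :
  measurable D -> (m D < +oo)%E -> bounded_measurable D h ->
  m.-integrable D (EFin \o h).
Proof.
move=> mD fD [mh [M hM]]; apply: measurable_bounded_integrable => //.
exists M; split; first exact: num_real.
by move=> M' MM' x Dx; exact: (le_trans (hM x Dx) (ltW MM')).
Qed.

End bounded_measurable.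

Lemma integral_exprn {R : realType} (m : nat) (t : R) : 0 < t ->
  (\int[@lebesgue_measure R]_(s in `[0%R, t]) (s ^+ m)%:E = (t ^+ m.+1 / m.+1%:R)%:E)%E.
Proof.
move=> t0; pose F (s : R) := m.+1%:R^-1 * s ^+ m.+1.
have dF (x : R) : derivable F x 1.
  by apply: derivableM; [exact: derivable_cst|exact: exprn_derivable].
have DF (x : R) : derive1 F x = x ^+ m.
  rewrite derive1E /F (@deriveMl _ _ (fun s : R => s ^+ m.+1) m.+1%:R^-1 x 1 (@exprn_derivable R m.+1 x 1)).
  rewrite exp_derive /= -[_ *: 1]/(_ * 1) mulr1 -[_ *: _]/(_ * _) mulrA mulVf ?mul1r//.
have cF : continuous F.
  by move=> x; apply: differentiable_continuous; exact/derivable1_diffP.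
rewrite (@continuous_FTC2 _ (fun s => s ^+ m) F) //.
- by rewrite /F expr0n/= mulr0 sube0 mulrC.
- by apply: continuous_subspaceT => x; exact: exprn_continuous.
- by split => //; [apply: cvg_at_right_filter; exact: cF|apply: cvg_at_left_filter; exact: cF].
Qed.

Section tube_integral.
Context {R : realType} {n : nat}.
Local Notation E := 'rV[R]_n.+1.
Local Notation leb := (lebesgue_rV n.+1).
Variable Omega : set E.
Hypotheses (O0 : Omega !=set0) (oO : open Omega) (bO : bounded_set Omega).
Hypothesis cO : convex_set Omega.
Local Notation K := (closure Omega).
Local Notation S := (boundary Omega).
Hypothesis sS : smooth_hypersurface S.
Variable mu : {measure set E -> \bar R}.
Hypothesis muS : is_area_measure S mu.
Local Notation ek := (sym_curv Omega).

Let mS : measurable S.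
Proof. by apply: closed_measurable_rV; exact: closed_boundary. Qed.

Let cK := compact_domain_closure bO.
Let K0 := domain_closure0 O0.
Let cvK := domain_closure_segment cO.

Definition tube (t : R) : set E := ~` K `&` [set y | edist K y < t].

Lemma measurable_tube t : measurable (tube t).
Proof.
apply: measurableI.
  by apply: measurableC; exact: measurable_domain_closure.
rewrite (_ : [set y | _] = edist K @^-1` `]-oo, t[%classic).
  by rewrite -[X in measurable X]setTI; exact: (measurable_edist O0 bO cO).
by apply/seteqP; split => y; rewrite /= in_itv.
Qed.

Lemma bounded_domain_closure : exists2 M : R, 0 < M & forall y, K y -> enorm y <= M.
Proof.
have [M M0 OM] := ex_strict_bound_gt0 (compact_bounded cK).
exists (n.+1%:R * M); first by rewrite mulr_gt0.
move=> y Ky; rewrite (le_trans (enorm_le_norm y))// ler_wpM2l//.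
exact/ltW/OM.
Qed.

Lemma bounded_tube t : exists2 M : R, 0 < M & forall y, (K `|` tube t) y -> enorm y <= M.
Proof.
have [M M0 hM] := bounded_domain_closure.
exists (M + `|t|); first by rewrite ltr_pwDl.
move=> y [Ky|[Ky yt]]; first by rewrite (le_trans (hM _ Ky))// lerDl.
rewrite -[y](subrKC (proj K y)) (le_trans (enormD _ _))// lerD//.
  by apply: hM; exact: (proj_in cK K0 cvK).
exact: le_trans (ltW yt) (ler_norm _).
Qed.

Lemma lebesgue_enorm_bounded (A : set E) (M : R) : measurable A ->
  (forall y, A y -> enorm y <= M) -> (leb A < +oo)%E.
Proof.
move=> mA AM; pose b : E := const_mx (M + 1).
apply: le_lt_trans (lebesgue_rV_box_lty (- b) b).
apply: le_measure; rewrite ?inE//; first exact: measurable_box.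
move=> y /AM yM i; have := le_trans (norm_coord_le y i) (le_trans (norm_le_enorm y) yM).
by rewrite !mxE ler_norml => /andP[h1 h2]; apply/andP; split; lra.
Qed.

Lemma lebesgue_tube_lty t : (leb (tube t) < +oo)%E.
Proof.
have [M M0 hM] := bounded_tube t.
apply: (@lebesgue_enorm_bounded _ M); first exact: measurable_tube.
by move=> y ty; apply: hM; right.
Qed.

(** The power is cut off to []0, t[], so that the kernel in [ge0_tube_integral] restricts the
    integral to the tube. *)
Let powt (t : R) (l : nat) (s : R) : R := if 0 < s < t then s ^+ l else 0.

Let mpow t l : measurable_fun setT (powt t l).
Proof.
rewrite (_ : powt t l = (fun s => s ^+ l) \_ `]0, t[%classic); last first.
  apply/funext => s; rewrite /powt /patch mem_setE in_itv/=.
  by case: ifP.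
apply/(measurable_restrictT _ _).1; first exact: measurable_itv.
by apply: (measurable_funS measurableT) => //; exact: exprn_measurable.
Qed.

Let pow0 t l s : 0 <= powt t l s.
Proof. by rewrite /powt; case: ifP => // /andP[s0 _]; rewrite exprn_ge0// ltW. Qed.

Let powint t l j : 0 < t ->
  (\int[lebesgue_measure]_(s in `]0%R, +oo[) (powt t l s * s ^+ j)%:E =
   (t ^+ (l + j).+1 / (l + j).+1%:R)%:E)%E.
Proof.
move=> t0; rewrite -(integral_exprn (l + j) t0).
rewrite -integral_itv_bndo_bndc -?integral_itv_obnd_cbnd; last 2 first.
- by apply/measurable_EFinP; apply: (measurable_funS measurableT) => //; exact: exprn_measurable.
- by apply/measurable_EFinP; apply: (measurable_funS measurableT) => //; exact: exprn_measurable.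
rewrite [LHS]integral_mkcond [RHS]integral_mkcond; apply: eq_integral => s _.
rewrite /patch !mem_setE !in_itv/= andbT /powt.
by case: (ltP 0 s) => //= s0; case: ifP => // _; [rewrite exprD|rewrite mul0r].
Qed.

Lemma tube_powE (c : E -> R) l t : 0 < t ->
  (\int[leb]_(y in tube t) (c (proj K y) * edist K y ^+ l)%:E =
   \int[leb]_(y in ~` K) (c (proj K y) * powt t l (edist K y))%:E)%E.
Proof.
move=> t0; rewrite /tube integral_mkcondr; apply: eq_integral => y /set_mem Ky.
rewrite /patch /powt (edist_gt0 cK K0 cvK Ky)/=.
have -> : (y \in [set y | edist K y < t]) = (edist K y < t) by rewrite mem_setE.
by case: ifP => //; rewrite mulr0.
Qed.

Lemma ge0_tube_pow_integral (c : E -> R) l t : 0 < t -> measurable_fun S c ->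
  (forall p, S p -> 0 <= c p) ->
  (\int[leb]_(y in tube t) (c (proj K y) * edist K y ^+ l)%:E =
   \sum_(j < n.+1) (t ^+ (l + j).+1 / (l + j).+1%:R)%:E *
      \int[mu]_(p in S) (c p * ek j p)%:E)%E.
Proof.
move=> t0 mc c0; rewrite tube_powE//.
rewrite (ge0_tube_integral O0 oO bO cO sS muS mc c0 (mpow t l) (pow0 t l)).
by apply: eq_bigr => j _; rewrite powint.
Qed.

(** The tube of radius one is bounded, and [mu S] is the term [j = 0] of the nonnegative sum that
    gives its volume. *)
Lemma area_finite : (mu S < +oo)%E.
Proof.
have mc : measurable_fun S (fun _ : E => 1 : R) by exact: measurable_cst.
have := @ge0_tube_pow_integral (fun=> 1) 0 1 ltr01 mc (fun p _ => ler01).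
under eq_integral do rewrite expr0 mulr1.
rewrite integral_cst ?mul1e; last exact: measurable_tube.
move=> tE; have := lebesgue_tube_lty 1; rewrite tE; apply: le_lt_trans.
rewrite big_ord_recl/= expr1n divr1 mul1e -[leLHS]adde0; apply: leeD.
  under eq_integral do rewrite sym_curv0 mulr1.
  by rewrite integral_cst ?mul1e.
apply: sume_ge0 => j _; rewrite mule_ge0//.
apply: integral_ge0 => p Sp; rewrite lee_fin mul1r.
exact: (sym_curv_ge0 O0 oO cO sS).
Qed.

Lemma bounded_measurable_sym_curv j : bounded_measurable S (ek j).
Proof.
split; first exact: (measurable_sym_curv O0 oO bO cO sS muS).
have [M hM] := bounded_sym_curv O0 oO bO cO sS muS.
exists (Num.max 0 M) => p Sp; rewrite ger0_norm ?(sym_curv_ge0 O0 oO cO sS)// le_max.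
have [jn|jn] := ltnP j n.+1; first by rewrite (hM p j Sp jn) orbT.
rewrite /sym_curv /elementary_symmetric big_pred0 ?lexx// => A.
by apply/negbTE; rewrite neq_ltn (leq_ltn_trans (max_card _))// card_ord.
Qed.

Lemma area_integrable (h : E -> R) : bounded_measurable S h -> mu.-integrable S (EFin \o h).
Proof. by move=> bh; apply: bounded_measurable_integrable => //; exact: area_finite. Qed.

Lemma bounded_measurable_tube (c : E -> R) l t : bounded_measurable S c ->
  bounded_measurable (tube t) (fun y => c (proj K y) * edist K y ^+ l).
Proof.
move=> [mc [M hM]]; apply: bounded_measurableM.
  split.
    apply: (measurable_comp mS _ mc).
      by move=> _ [y [Ky _] <-]; have [] := proj_boundary O0 oO bO cO sS Ky.
    by apply: (measurable_funS measurableT) => //; exact: (measurable_proj O0 bO cO).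
  by exists M => y [Ky _]; apply: hM; have [] := proj_boundary O0 oO bO cO sS Ky.
apply: bounded_measurableX; split.
  by apply: (measurable_funS measurableT) => //; exact: (measurable_edist O0 bO cO).
by exists t => y [_ yt]; rewrite ger0_norm ?edist_ge0// ltW.
Qed.

Lemma tube_integrable (h : E -> R) t : bounded_measurable (tube t) h ->
  leb.-integrable (tube t) (EFin \o h).
Proof.
move=> bh; apply: bounded_measurable_integrable => //; first exact: measurable_tube.
exact: lebesgue_tube_lty.
Qed.

Let tube_integral_ge0 (c : E -> R) l t : 0 < t -> bounded_measurable S c ->
  (forall p, S p -> 0 <= c p) ->
  \int[leb]_(y in tube t) (c (proj K y) * edist K y ^+ l) =
  \sum_(j < n.+1) t ^+ (l + j).+1 / (l + j).+1%:R * \int[mu]_(p in S) (c p * ek j p).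
Proof.
move=> t0 bc c0; rewrite /Rintegral ge0_tube_pow_integral//; last by case: bc.
rewrite -[RHS]/(fine (_%:E)) -sumEFin; congr fine; apply: eq_bigr => j _.
rewrite [RHS]EFinM fineK//; apply: integrable_fin_num => //.
apply: area_integrable; apply: bounded_measurableM => //.
exact: bounded_measurable_sym_curv.
Qed.

(** A signed bounded [c] is the difference of the nonnegative functions [c + M] and [M]. *)
Theorem tube_integral (c : E -> R) l t : 0 < t -> bounded_measurable S c ->
  \int[leb]_(y in tube t) (c (proj K y) * edist K y ^+ l) =
  \sum_(j < n.+1) t ^+ (l + j).+1 / (l + j).+1%:R * \int[mu]_(p in S) (c p * ek j p).
Proof.
move=> t0 bc; have [M M0 hM] := bounded_measurable_ge bc.
have bM : bounded_measurable S (fun _ : E => M) by exact: bounded_measurable_cst.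
have bcM : bounded_measurable S (fun p => c p + M) by exact: bounded_measurableD.
have h1 := tube_integral_ge0 l t0 bcM.
have h2 := tube_integral_ge0 l t0 bM.
rewrite (_ : \int[leb]_(y in tube t) _ = \int[leb]_(y in tube t)
   ((c (proj K y) + M) * edist K y ^+ l - M * edist K y ^+ l)); last first.
  by apply: eq_Rintegral => y _; ring.
rewrite RintegralB; last 3 first.
- exact: measurable_tube.
- by apply: tube_integrable; exact: (bounded_measurable_tube l t bcM).
- by apply: tube_integrable; exact: (bounded_measurable_tube l t bM).
rewrite h1; last by move=> p Sp; have := hM p Sp; rewrite ler_norml => /andP[]; lra.
rewrite h2// -sumrB; apply: eq_bigr => j _; rewrite -mulrBr -RintegralB//.
- by congr (_ * _); apply: eq_Rintegral => p _; ring.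
- apply: area_integrable; apply: bounded_measurableM => //.
  exact: bounded_measurable_sym_curv.
- apply: area_integrable; apply: bounded_measurableM => //.
  exact: bounded_measurable_sym_curv.
Qed.

End tube_integral.

(** * Scaling identities *)

Section quadratic_derivatives.
Context {R : realType}.

Lemma is_derive_quadratic (f : R -> R) (x c C : R) :
  (forall y, `|f y - f x - c * (y - x)| <= C * (y - x) ^+ 2) -> is_derive x 1 f c.
Proof.
move=> h.
have C1 : 0 < `|C| + 1 by rewrite ltr_wpDl.
have [||df dE] := @eps_differentiable _ R R f (scalev (c : R)) x.
- exact: scalev_continuous.
- move=> e e0; exists (e / (`|C| + 1)); first by rewrite divr_gt0.
  move=> y; rewrite ltr_pdivlMr// => yx.
  suff : `|f y - f x - c * (y - x)| <= e * `|y - x| by rewrite [c * _]mulrC.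
  apply: (le_trans (h y)); rewrite -real_normK ?num_real// expr2 mulrA ler_wpM2r//.
  apply: le_trans (ltW yx); rewrite mulrC ler_wpM2l//.
  by rewrite (le_trans (ler_norm C))// lerDl.
apply: DeriveDef; first exact: (@diff_derivable _ R R).
by rewrite (@deriveE _ R R f x 1 df) dE; exact: mul1r.
Qed.

Definition pospart (u : R) : R := Num.max 0 u.

(** The four sign cases share the quadratic error bound [(v - u) ^+ 2]. Without the square the
    cutoff would have a corner at the edge of the tube. *)
Lemma pospart_sqr_derive (u : R) : is_derive u 1 (fun v => pospart v ^+ 2) (2 * pospart u).
Proof.
apply: (@is_derive_quadratic _ u _ 1) => v; rewrite mul1r /pospart.
have u2 := sqr_ge0 u; have v2 := sqr_ge0 v; have vu2 := sqr_ge0 (v - u).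
have [u0|u0] := leP 0 u; have [v0|v0] := leP 0 v; rewrite ler_norml; apply/andP.
- by split; nra.
- by have uv := mulr_ge0_le0 u0 (ltW v0); split; nra.
- by have uv := mulr_le0_ge0 (ltW u0) v0; split; nra.
- by split; nra.
Qed.

Lemma derive_exprV (m : nat) (c : R) :
  'D_1 (fun l : R => c * (l ^+ m)^-1) 1 = - m%:R * c.
Proof.
have dX : derivable (fun l : R => l ^+ m) 1 1 by exact: exprn_derivable.
have n0 : (1 : R) ^+ m != 0 by rewrite expr1n oner_neq0.
have dV := @derivableV _ R (fun l : R => l ^+ m) 1 1 n0 dX.
rewrite (@deriveMl _ _ (fun l : R => (l ^+ m)^-1) c 1 1 dV).
rewrite (@deriveV _ R (fun l : R => l ^+ m) 1 1 n0 dX) exp_derive !expr1n.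
have sE (a b : R^o) : a *: b = a * b by [].
by rewrite !sE; field.
Qed.

End quadratic_derivatives.

Section scaling.
Context {R : realType} {n : nat}.
Local Notation E := 'rV[R]_n.+1.
Local Notation leb := (lebesgue_rV n.+1).

Lemma measurable_scale (c : R) : measurable_fun setT (fun y : E => c *: y).
Proof.
apply: measurable_to_rV => i; rewrite (_ : (fun _ => _) = fun y : E => c * y ord0 i).
  by apply: measurable_funM => //; exact: measurable_rV_coord.
by apply/funext => y; rewrite mxE.
Qed.

Lemma ge0_integral_scale (c : R) (f : E -> \bar R) : 0 < c -> measurable_fun setT f ->
  (forall y, 0 <= f y)%E ->
  (\int[leb]_y f (c *: y) = ((c ^+ n.+1)^-1)%:E * \int[leb]_y f y)%E.
Proof.
move=> c0 mf f0.
have := @ge0_integral_pushforward _ _ E E R (fun y : E => c *: y) (measurable_scale c) leb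
  setT f measurableT mf (fun y _ => f0 y).
rewrite preimage_setT => <-.
have ci : 0 <= (c ^+ n.+1)^-1 by rewrite invr_ge0 exprn_ge0// ltW.
rewrite -(ge0_integral_mscale leb measurableT (NngNum ci))//.
apply: eq_measure_integral; last first.
  by move=> ? A mA _; exact: lebesgue_rV_scale.
exact: measurable_scale.
Qed.

Lemma integral_scale_eq (c : R) (g h : E -> R) : 0 < c -> measurable_fun setT g ->
  (forall y, 0 <= g y) -> (forall y, h y = g (c *: y)) ->
  (\int[leb]_y (h y)%:E = ((c ^+ n.+1)^-1)%:E * \int[leb]_y (g y)%:E)%E.
Proof.
move=> c0 mg g0 hg; rewrite -(@ge0_integral_scale c (EFin \o g))//.
- by apply: eq_integral => y _; rewrite hg.
- exact/measurable_EFinP.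
Qed.

Variable Omega : set E.
Hypotheses (O0 : Omega !=set0) (oO : open Omega) (bO : bounded_set Omega).
Hypothesis cO : convex_set Omega.
Local Notation K := (closure Omega).

Let cK := compact_domain_closure bO.
Let K0 := domain_closure0 O0.
Let cvK := domain_closure_segment cO.

Variables (w : E -> R) (k : nat).
Hypotheses (mw : measurable_fun setT w) (w0 : forall y, 0 <= w y).
Hypothesis wZ : forall (l : R) y, 0 < l -> w (l *: y) = l ^+ k * w y.
Hypothesis wb : forall M : R, exists C : R, forall y, enorm y <= M -> w y <= C.

Lemma edist_sqr_scale_derive (y : E) (l : R) :
  is_derive l 1 (fun l => edist K (l *: y) ^+ 2) (2 * dot (l *: y - proj K (l *: y)) y).
Proof.
apply: (@is_derive_quadratic _ _ _ _ (dot y y)) => l'.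
have := edist_expand cK K0 cvK (l *: y) ((l' - l) *: y).
rewrite -scalerDl subrKC !dotZr dotZl.
set a := dot _ y; set b := dot y y => h.
rewrite (_ : 2 * a * (l' - l) = 2 * ((l' - l) * a)); last by ring.
by rewrite (_ : b * (l' - l) ^+ 2 = (l' - l) * ((l' - l) * b)); last by ring.
Qed.

(** By homogeneity this is the weighted cutoff at [l *: y]. With [l ^+ k] pulled out, the weight [w]
    itself is never differentiated. *)
Let f (t l : R) (y : E) : R := l ^+ k * w y * pospart (t ^+ 2 - edist K (l *: y) ^+ 2) ^+ 2.

Let f' (t l : R) (y : E) : R :=
  k%:R * l ^+ k.-1 * w y * pospart (t ^+ 2 - edist K (l *: y) ^+ 2) ^+ 2
  - l ^+ k * w y * (4 * pospart (t ^+ 2 - edist K (l *: y) ^+ 2) * dot (l *: y - proj K (l *: y)) y).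

Let f_derive t (l : R) y : is_derive l (1 : R) (fun l : R => f t l y) (f' t l y).
Proof.
have d1 := edist_sqr_scale_derive y l.
have d2 : is_derive l 1 (fun l => t ^+ 2 - edist K (l *: y) ^+ 2)
    (0 - 2 * dot (l *: y - proj K (l *: y)) y).
  by apply: is_deriveB.
have d3 := pospart_sqr_derive (t ^+ 2 - edist K (l *: y) ^+ 2).
have d4 := @is_derive1_comp R (fun v => pospart v ^+ 2)
  (fun l => t ^+ 2 - edist K (l *: y) ^+ 2) l _ _ d3 d2.
have d5 : is_derive l 1 (fun l : R => l ^+ k * w y) (k%:R * l ^+ k.-1 * w y).
  have dX : derivable (fun l : R => l ^+ k) l 1 by exact: exprn_derivable.
  rewrite (_ : (fun _ => _) = fun l : R => w y * l ^+ k); last first.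
    by apply/funext => z; rewrite mulrC.
  apply: DeriveDef; first by apply: derivableM; [exact: derivable_cst|].
  rewrite (@deriveMl _ _ (fun l : R => l ^+ k) (w y) l 1 dX) exp_derive.
  by rewrite -[_ *: 1]/(_ * 1) mulr1 -[_ *: _]/(_ * _) mulrC.
have d6 := is_deriveM d5 d4.
have sE (a b : R^o) : a *: b = a * b by [].
by apply: (is_derive_eq d6); rewrite /f' !sE /=; ring.
Qed.

Let t2_bound t l y : pospart (t ^+ 2 - edist K (l *: y) ^+ 2) <= t ^+ 2.
Proof.
by rewrite /pospart ge_max sqr_ge0 lerBlDr lerDl sqr_ge0.
Qed.

Let pospart_ge0 (u : R) : 0 <= pospart u. Proof. by rewrite /pospart le_max lexx. Qed.

Lemma measurable_enorm_le (M : R) : measurable [set y : E | enorm y <= M].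
Proof.
rewrite (_ : [set _ | _] = (@enorm R n.+1) @^-1` `]-oo, M]%classic).
  rewrite -[X in measurable X]setTI; apply: continuous_on_open_measurable => //.
    exact: openT.
  by move=> y _; exact: enorm_continuous.
by apply/seteqP; split => y; rewrite /= in_itv.
Qed.

Let mpart t l : measurable_fun setT (fun y : E => pospart (t ^+ 2 - edist K (l *: y) ^+ 2)).
Proof.
apply: measurable_maxr => //; apply: measurable_funB => //.
apply: measurable_funX; apply: measurableT_comp; last exact: measurable_scale.
exact: (measurable_edist O0 bO cO).
Qed.

Let mf t l : measurable_fun setT (f t l).
Proof.
apply: measurable_funM; first by apply: measurable_funM.
by apply: measurable_funX; exact: mpart.
Qed.

Let f0 t l y : 0 < l -> 0 <= f t l y.
Proof. by move=> l0; rewrite !mulr_ge0// ?sqr_ge0// exprn_ge0// ltW. Qed.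

Let fE t l y : 0 < l -> f t l y = f t 1 (l *: y).
Proof. by move=> l0; rewrite /f scale1r expr1n mul1r wZ. Qed.

(* [l ^+ (n.+1 + k)] times the integral of [f t l] does not depend on [l]; the
   identity is the vanishing of its derivative at [l = 1]. *)
Lemma scaling_identity t M : 0 < t -> (forall y, (K `|` tube Omega t) y -> enorm y <= M) ->
  \int[leb]_(y in [set y | enorm y <= 2 * M]) (w y *
    ((n.+1 + k)%:R * pospart (t ^+ 2 - edist K y ^+ 2) ^+ 2
     - 4 * pospart (t ^+ 2 - edist K y ^+ 2) * dot (y - proj K y) y)) = 0.
Proof.
move=> t0 hM; set B := [set y | _].
have mB : measurable B by exact: measurable_enorm_le.
have fB : (leb B < +oo)%E by apply: (@lebesgue_enorm_bounded _ _ B (2 * M)).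
have M0 : 0 <= M.
  by have [y Ky] := K0; apply: le_trans (enorm_ge0 y) _; apply: hM; left.
have [C hC] := wb (2 * M).
have C0 : 0 <= C by apply: le_trans (w0 0) (hC _ _); rewrite enorm0 mulr_ge0.
(* For [l > 1 / 2] a nonzero value puts [l *: y] in the closure or in the tube, hence [y] in the
   ball of radius [2 * M]: one domain serves all [l] near [1]. *)
have support (l : R) y : 1 / 2 < l -> ~ B y -> f t l y = 0.
  move=> l12 nBy; rewrite /f; have [h|h] := leP (t ^+ 2 - edist K (l *: y) ^+ 2) 0.
    by rewrite /pospart max_l// expr0n/= mulr0.
  exfalso; apply: nBy.
  have l0 : 0 < l by lra.
  have dt : edist K (l *: y) < t.
    rewrite -(@ltr_pXn2r _ 2)// ?nnegrE ?edist_ge0 ?(ltW t0)//; lra.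
  have : enorm (l *: y) <= M.
    apply: hM; have [Kl|nKl] := pselect (K (l *: y)); first by left.
    by right.
  rewrite enormZ gtr0_norm// /B /= => h2.
  have := enorm_ge0 y; nra.
have intf (l : R) : 0 < l < 2 -> bounded_measurable B (f t l).
  move=> /andP[l0 l2]; split; first exact: (measurable_funS measurableT).
  exists (2 ^+ k * C * (t ^+ 2) ^+ 2) => y By; rewrite ger0_norm ?f0//.
  rewrite ler_pM ?sqr_ge0 ?mulr_ge0 ?exprn_ge0 ?(ltW l0)//.
    by rewrite ler_pM ?exprn_ge0 ?(ltW l0)// ?hC// lerXn2r ?nnegrE ?(ltW l0)// ltW.
  by rewrite lerXn2r ?nnegrE ?pospart_ge0 ?sqr_ge0// t2_bound.
pose F l := \int[leb]_(y in B) f t l y.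
have intF (l : R) : 0 < l < 2 -> leb.-integrable B (EFin \o f t l).
  by move=> l02; apply: bounded_measurable_integrable => //; exact: intf.
have setTE (l : R) : 1 / 2 < l -> (\int[leb]_(y in B) (f t l y)%:E = \int[leb]_y (f t l y)%:E)%E.
  move=> l12; rewrite integral_mkcond; apply: eq_integral => y _; rewrite /patch.
  by case: ifPn => // /negP yB; rewrite support// => By; apply: yB; exact: mem_set.
have FE l : 1 / 2 < l < 2 -> F l = (l ^+ n.+1)^-1 * F 1.
  move=> /andP[l12 l2]; have l0 : 0 < l by lra.
  have h1 : 1 / 2 < (1 : R) by lra.
  apply: (eq_trans (congr1 fine (setTE l l12))).
  apply: (eq_trans _ (congr1 ( *%R (l ^+ n.+1)^-1) (esym (congr1 fine (setTE 1 h1))))).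
  have h2 := @integral_scale_eq l (f t 1) (f t l) l0 (mf t 1) (fun y => f0 t y ltr01)
    (fun y => @fE t l y l0).
  apply: (eq_trans (congr1 fine h2)); rewrite -(setTE 1 h1) fineM//.
  by apply: integrable_fin_num => //; apply: intF; apply/andP; split; lra.
(* A bound of [f'] on [B] for [l < 2]: there [l *: y] has norm at most [2 * (2 * M)], and its
   projection has norm at most [M]. *)
pose G : R := k%:R * 2 ^+ k.-1 * C * (t ^+ 2) ^+ 2 + 2 ^+ k * C * (4 * t ^+ 2 * ((2 * (2 * M) + M) * (2 * M))).
have hG : forall l y, 1 / 2 < l < 2 -> B y -> `|f' t l y| <= G.
  move=> l y /andP[l12 l2] By; have l0 : 0 < l by lra.
  have lk j : 0 <= l ^+ j <= 2 ^+ j.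
    by rewrite exprn_ge0 ?(ltW l0)//= lerXn2r ?nnegrE ?(ltW l0)// ltW.
  have wy : 0 <= w y <= C by rewrite w0 hC.
  have p0 := pospart_ge0 (t ^+ 2 - edist K (l *: y) ^+ 2).
  have pt := t2_bound t l y.
  rewrite /f'; move: p0 pt; set p := pospart _ => p0 pt.
  have dotB : `|dot (l *: y - proj K (l *: y)) y| <= (2 * (2 * M) + M) * (2 * M).
    rewrite (le_trans (abs_dot_le _ _))// ler_pM ?enorm_ge0//.
    rewrite (le_trans (enormD _ _))// enormN enormZ gtr0_norm// lerD//.
      by rewrite ler_pM ?enorm_ge0 ?(ltW l0)// ltW.
    by apply: hM; left; exact: (proj_in cK K0 cvK).
  rewrite (le_trans (ler_normB _ _))// lerD//.
    rewrite ger0_norm.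
      rewrite ler_pM// ?sqr_ge0//.
      - by rewrite !mulr_ge0//; case/andP: (lk k.-1).
      - case/andP: wy => wy0 wyC; rewrite ler_pM// ?mulr_ge0//; first by case/andP: (lk k.-1).
        by rewrite ler_wpM2l//; case/andP: (lk k.-1).
      - by rewrite lerXn2r ?nnegrE// sqr_ge0.
    by rewrite !mulr_ge0// ?sqr_ge0//; case/andP: (lk k.-1).
  rewrite !normrM (ger0_norm p0) (ger0_norm (w0 y)) (ger0_norm (_ : 0 <= l ^+ k)); last by case/andP: (lk k).
  rewrite (ger0_norm (_ : (0 : R) <= 4))//.
  case/andP: wy => wy0 wyC; case/andP: (lk k) => lk0 lk2.
  by rewrite ler_pM ?mulr_ge0// ler_pM// ?mulr_ge0// ler_wpM2l.
have G0 : 0 <= G.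
  by rewrite !(addr_ge0, mulr_ge0)// ?sqr_ge0// ?exprn_ge0// ?(ltW t0).
have I1 : (`]1 / 2, 2[%classic : set R) 1 by rewrite /= in_itv/=; apply/andP; split; lra.
have D1 l y : partial1of2 (f t) l y = f' t l y.
  by rewrite partial1of2E; have := f_derive t l y => ?; exact: derive_val.
have key : derive1 F 1 = \int[leb]_(y in B) partial1of2 (f t) 1 y.
  apply: (@differentiation_under_integral R _ E leb (f t) B mB 1 (1 / 2) 2 I1 _ _ (fun=> G)).
  - by move=> l; rewrite /= in_itv/= => /andP[l1 l2]; apply: intF; apply/andP; split; lra.
  - by move=> l y _ _; have [] := f_derive t l y.
  - by [].
  - by apply: bounded_measurable_integrable => //; exact: bounded_measurable_cst.
  - by move=> l y; rewrite /= in_itv/= D1 => l12 By; exact: hG.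
have F1 : derive1 F 1 = - n.+1%:R * F 1.
  rewrite derive1E (@near_eq_derive _ R R _ (fun l : R => F 1 * (l ^+ n.+1)^-1)); last first.
    have o : open (`]1 / 2, 2[%classic : set R) by exact: interval_open.
    have := open_nbhs_nbhs (conj o I1); apply: filterS => l.
    by rewrite /= in_itv/= => /FE ->; rewrite mulrC.
  exact: derive_exprV.
have If' : leb.-integrable B (EFin \o f' t 1).
  apply: bounded_measurable_integrable => //; split; last first.
    by exists G => y By; apply: hG => //; apply/andP; split; lra.
  apply: (measurable_funS measurableT) => //; apply: measurable_funB.
    apply: measurable_funM; first exact: measurable_funM.
    by apply: measurable_funX; exact: mpart.
  apply: measurable_funM; first exact: measurable_funM.
  apply: measurable_funM; first by apply: measurable_funM => //; exact: mpart.
  rewrite (_ : (fun _ => _) = fun y => \sum_i (1 *: y - proj K (1 *: y)) ord0 i * y ord0 i).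
    apply: measurable_sum => i; apply: measurable_funM; last exact: measurable_rV_coord.
    rewrite (_ : (fun _ => _) = fun y : E => y ord0 i - proj K y ord0 i); last first.
      by apply/funext => y; rewrite scale1r !mxE.
    apply: measurable_funB; first exact: measurable_rV_coord.
    apply: (measurableT_comp (measurable_rV_coord i)).
    exact: (measurable_proj O0 bO cO).
  by apply/funext => y; rewrite dotE.
have If1 : leb.-integrable B (EFin \o f t 1) by apply: intF; apply/andP; split; lra.
rewrite (_ : \int[leb]_(y in B) _ = \int[leb]_(y in B) (f' t 1 y + n.+1%:R * f t 1 y)); last first.
  apply: eq_Rintegral => y _; rewrite /f' /f scale1r !expr1n natrD; ring.
rewrite RintegralD//; last first.
  by apply: bounded_measurable_integrable => //; apply: bounded_measurableM;
    [exact: bounded_measurable_cst|apply: intf; apply/andP; split; lra].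
rewrite RintegralZl// -/(F 1).
have -> : \int[leb]_(y in B) f' t 1 y = - n.+1%:R * F 1.
  by rewrite -F1 key; apply: eq_Rintegral => y _; rewrite D1.
by rewrite mulNr addNr.
Qed.

End scaling.

Lemma bounded_measurable_eq {d} {T : measurableType d} {R : realType} (D : set T) (g h : T -> R) :
  (forall x, D x -> h x = g x) -> bounded_measurable D g -> bounded_measurable D h.
Proof.
move=> hg [mg [M hM]]; split; last by exists M => x Dx; rewrite hg// hM.
by apply: eq_measurable_fun mg => x /set_mem Dx; rewrite hg.
Qed.

Lemma bounded_measurableU {d} {T : measurableType d} {R : realType} (D D' : set T) (h : T -> R) :
  measurable D -> measurable D' -> bounded_measurable D h -> bounded_measurable D' h ->
  bounded_measurable (D `|` D') h.
Proof.
move=> mD mD' bD bD'; have [M M0 hM] := bounded_measurable_ge bD.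
have [M' M'0 hM'] := bounded_measurable_ge bD'.
split; first by apply/measurable_funU => //; split; [case: bD|case: bD'].
exists (Num.max M M') => x [Dx|Dx]; rewrite le_max; first by rewrite hM.
by rewrite hM' ?orbT.
Qed.

(** * Minkowski formulas and the identity for the squared position vector *)

Section minkowski.
Context {R : realType} {n : nat}.
Local Notation E := 'rV[R]_n.+1.
Local Notation leb := (lebesgue_rV n.+1).
Variable Omega : set E.
Hypotheses (O0 : Omega !=set0) (oO : open Omega) (bO : bounded_set Omega).
Hypothesis cO : convex_set Omega.
Local Notation K := (closure Omega).
Local Notation S := (boundary Omega).
Hypothesis sS : smooth_hypersurface S.
Variable mu : {measure set E -> \bar R}.
Hypothesis muS : is_area_measure S mu.
Local Notation ek := (sym_curv Omega).
Local Notation gauss := (gauss Omega).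

Let mS : measurable S.
Proof. by apply: closed_measurable_rV; exact: closed_boundary. Qed.

Let cK := compact_domain_closure bO.
Let K0 := domain_closure0 O0.
Let cvK := domain_closure_segment cO.

Lemma measurable_gauss i : measurable_fun S (fun p => gauss p ord0 i).
Proof.
have [U SU [mU mg]] : exists2 U, S `<=` U &
    measurable U /\ measurable_fun (S `&` U) (fun p => gauss p ord0 i).
  apply: (compact_union_induction (compact_boundary bO)).
  - by split => //; rewrite setI0; exact: measurable_fun_set0.
  - move=> U U' [mU mg] [mU' mg']; split; first exact: measurableU.
    by rewrite setIUr; apply/measurable_funU => //; exact: measurableI.
  - move=> p Sp; have [W [f [j [V [g [Wp oW [oV sg] VS SV]]]]]] := graph_chart oO cO sS Sp.
    have [[opW _ _ _] _] := oW.
    exists W => //; split; first exact: open_measurable_rV.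
    apply: (measurable_on_chart oV SV (h := fun p => gauss p ord0 i)).
    apply: (continuous_on_open_measurable oV).
    have := smooth_gauss_chart O0 oO cO sS oW oV sg VS => /(_ 0).
    by move=> /(Ck_coord i oV).
by rewrite setIidl in mg.
Qed.

Lemma bounded_measurable_gauss i : bounded_measurable S (fun p => gauss p ord0 i).
Proof.
split; first exact: measurable_gauss.
exists 1 => p Sp; have [_ <-] := gaussP oO cO sS Sp.
exact: le_trans (norm_coord_le _ _) (norm_le_enorm _).
Qed.

Lemma bounded_measurable_position i : bounded_measurable S (fun p : E => p ord0 i).
Proof.
have [M M0 hM] := bounded_domain_closure bO.
split; first exact: (measurable_funS measurableT _ (measurable_rV_coord i)).
exists M => p [Kp _]; apply: le_trans (hM _ Kp).
exact: le_trans (norm_coord_le _ _) (norm_le_enorm _).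
Qed.

Definition supp_dist (p : E) : R := dot p (gauss p).

Lemma bounded_measurable_supp : bounded_measurable S supp_dist.
Proof.
rewrite (_ : supp_dist = fun p => \sum_i p ord0 i * gauss p ord0 i).
  apply: bounded_measurable_sum => i _; apply: bounded_measurableM.
    exact: bounded_measurable_position.
  exact: bounded_measurable_gauss.
by apply/funext => p; exact: dotE.
Qed.

Lemma bounded_measurable_sqr : bounded_measurable S (fun p : E => dot p p).
Proof.
rewrite (_ : (fun _ => _) = fun p : E => \sum_i p ord0 i * p ord0 i).
  by apply: bounded_measurable_sum => i _; apply: bounded_measurableM; exact: bounded_measurable_position.
by apply/funext => p; exact: dotE.
Qed.

Definition curv_moment (c : E -> R) (j : nat) : R := \int[mu]_(p in S) (c p * ek j p).

Lemma curv_moment_big c j : (n < j)%N -> curv_moment c j = 0.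
Proof.
move=> nj; rewrite /curv_moment (_ : (fun _ => _) = fun=> 0).
  by rewrite Rintegral_cst// mul0r.
apply/funext => p; rewrite /sym_curv /elementary_symmetric big_pred0 ?mulr0// => A.
by apply/negbTE; rewrite neq_ltn (leq_ltn_trans (max_card _))// card_ord.
Qed.

(* An entry (a, e, c, l) stands for the function [a t^e c(proj y) d(y)^l]. *)
Definition tube_term : Type := (R * nat * (E -> R) * nat)%type.

Definition tube_term_eval (t : R) (T : tube_term) (y : E) : R :=
  let: (a, e, c, l) := T in a * t ^+ e * (c (proj K y) * edist K y ^+ l).

Definition tube_term_bounded (T : tube_term) : Prop := let: (_, _, c, _) := T in bounded_measurable S c.

Definition tube_term_poly (T : tube_term) : {poly R} := let: (a, e, c, l) := T in
  \sum_(j < n.+1) (a * curv_moment c j / (l + j).+1%:R) *: 'X^(e + (l + j).+1).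

(** The index [j = k - (e + l).+1] is the only one with [e + (l + j).+1 = k], and then the
    denominator [(l + j).+1] is [k - e]. No test for [j <= n] is made, because the moment vanishes
    beyond. *)
Definition tube_term_coef (k : nat) (T : tube_term) : R := let: (a, e, c, l) := T in
  if (e + l < k)%N then a * curv_moment c (k - (e + l).+1) / (k - e)%:R else 0.

Lemma tube_term_polyE k T : (tube_term_poly T)`_k = tube_term_coef k T.
Proof.
case: T => [[[a e] c] l] /=; rewrite coef_sum.
under eq_bigr do rewrite coefZ coefXn.
have [ek_|ek_] := ltnP (e + l) k; last first.
  by rewrite big1// => j _; rewrite (_ : k == _ = false) ?mulr0//; apply/negbTE; lia.
have [kn|kn] := ltnP (k - (e + l).+1) n.+1; last first.
  rewrite curv_moment_big// mulr0 mul0r big1// => j _.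
  by rewrite (_ : k == _ = false) ?mulr0//; apply/negbTE; have := ltn_ord j; lia.
rewrite (bigD1 (Ordinal kn))//= big1 ?addr0; last first.
  move=> j jk; rewrite (_ : k == _ = false) ?mulr0//; apply/negbTE.
  by move: jk; rewrite -val_eqE/=; lia.
rewrite (_ : k == _) ?mulr1; last by lia.
by congr (_ / _%:R); lia.
Qed.

Lemma tube_integral_terms t (L : seq tube_term) : 0 < t ->
  (forall T, List.In T L -> tube_term_bounded T) ->
  \int[leb]_(y in tube Omega t) (\sum_(T <- L) tube_term_eval t T y) =
  (\sum_(T <- L) tube_term_poly T).[t].
Proof.
move=> t0 bL.
have bt T : tube_term_bounded T -> bounded_measurable (tube Omega t) (tube_term_eval t T).
  case: T => [[[a e] c] l] bc; apply: bounded_measurableM.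
    exact: bounded_measurable_cst.
  exact: (bounded_measurable_tube O0 oO bO cO sS l t bc).
suff [_ //] : bounded_measurable (tube Omega t) (fun y => \sum_(T <- L) tube_term_eval t T y) /\
  \int[leb]_(y in tube Omega t) (\sum_(T <- L) tube_term_eval t T y) =
  (\sum_(T <- L) tube_term_poly T).[t].
have mt : measurable (tube Omega t) by exact: (measurable_tube O0 bO cO).
elim: L bL => [|T L ih] bL.
  rewrite big_nil horner0 (_ : (fun _ => _) = fun=> 0); last first.
    by apply/funext => y; rewrite big_nil.
  split; first exact: bounded_measurable_cst.
  by rewrite Rintegral_cst// mul0r.
have bT : tube_term_bounded T by apply: bL; left.
have [|bS ihE] := ih; first by move=> T' hT'; apply: bL; right.
rewrite (_ : (fun _ => _) = fun y => tube_term_eval t T y + \sum_(T <- L) tube_term_eval t T y); last first.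
  by apply/funext => y; rewrite big_cons.
split; first by apply: bounded_measurableD => //; exact: bt.
rewrite RintegralD//; last 2 first.
- by apply: (tube_integrable O0 bO cO); exact: bt.
- exact: (tube_integrable O0 bO cO).
rewrite ihE big_cons hornerD; congr (_ + _).
case: T bT {bL bS ih ihE} => [[[a e] c] l] bc /=.
rewrite RintegralZl//; last first.
  by apply: (tube_integrable O0 bO cO); exact: (bounded_measurable_tube O0 oO bO cO sS).
rewrite (tube_integral O0 oO bO cO sS muS l t0 bc) mulr_sumr horner_sum.
apply: eq_bigr => j _; rewrite hornerZ hornerXn /curv_moment exprD; ring.
Qed.

(** The numbers [1, ..., size p] would be more roots than a nonzero polynomial can have. *)
Lemma poly_eq0_pos (p : {poly R}) : (forall t, 0 < t -> p.[t] = 0) -> p = 0.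
Proof.
move=> h; apply/eqP/negPn/negP => p0.
pose rs := [seq k.+1%:R : R | k <- iota 0 (size p)].
have urs : uniq rs.
  by rewrite map_inj_uniq ?iota_uniq// => i j /eqP; rewrite eqr_nat => /eqP[].
have ars : all (root p) rs by apply/allP => _ /mapP[k _ ->]; apply/eqP/h; rewrite ltr0Sn.
by have := max_poly_roots p0 ars urs; rewrite size_map size_iota ltnn.
Qed.

Lemma dot_ray (y p N : E) (s : R) : dot N N = 1 -> y = p + s *: N ->
  dot (y - p) y = s * (dot p N + s).
Proof.
by move=> NN ->; rewrite addrAC subrr add0r dotZl dotDr dotZr NN mulr1 (dotC N).
Qed.

Section weight.
Variables (w : E -> R) (k : nat).
Hypotheses (mw : measurable_fun setT w) (w0 : forall y, 0 <= w y).
Hypothesis wZ : forall (l : R) y, 0 < l -> w (l *: y) = l ^+ k * w y.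
Hypothesis wb : forall M : R, exists C : R, forall y, enorm y <= M -> w y <= C.

(** On the closure the distance vanishes and the squared cutoff is [t ^+ 4]. On the tube [y] is its
    projection plus the distance times the normal there, which evaluates the scalar product. Beyond
    the tube the cutoff is zero. *)
Lemma scaling_identity_tube t : 0 < t ->
  (n.+1 + k)%:R * t ^+ 4 * \int[leb]_(y in K) w y +
  \int[leb]_(y in tube Omega t) (w y *
    ((n.+1 + k)%:R * (t ^+ 2 - edist K y ^+ 2) ^+ 2
     - 4 * (t ^+ 2 - edist K y ^+ 2) * (edist K y * (supp_dist (proj K y) + edist K y)))) = 0.
Proof.
move=> t0; have [M M0 hM] := bounded_tube O0 bO cO t.
have := scaling_identity O0 bO cO mw w0 wZ wb t0 hM.
set h := fun y => w y * _; set B := [set y | _].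
have mK : measurable K by exact: measurable_domain_closure.
have mt : measurable (tube Omega t) by exact: (measurable_tube O0 bO cO).
have PB : K `|` tube Omega t `<=` B.
  by move=> y /hM yM; rewrite /B /=; lra.
have hK y : K y -> h y = (n.+1 + k)%:R * t ^+ 4 * w y.
  move=> Ky; rewrite /h (edist_eq0 cK K0 cvK y).2// (proj_id cK K0 cvK Ky) subrr dot0l.
  rewrite expr0n/= subr0 mulr0 subr0 /pospart max_r ?sqr_ge0//; ring.
have ht y : tube Omega t y -> h y = w y *
    ((n.+1 + k)%:R * (t ^+ 2 - edist K y ^+ 2) ^+ 2
     - 4 * (t ^+ 2 - edist K y ^+ 2) * (edist K y * (supp_dist (proj K y) + edist K y))).
  move=> [Ky yt]; have e0 := edist_ge0 K y; have [Sy _] := proj_boundary O0 oO bO cO sS Ky.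
  have NN := gauss_dot oO cO sS Sy.
  rewrite /h /pospart max_r; last first.
    by rewrite subr_ge0 ler_pXn2r ?nnegrE ?(ltW t0)// ltW.
  have yE := gauss_proj_ray O0 oO bO cO sS Ky.
  rewrite (_ : dot (y - proj K y) y = edist K y * (supp_dist (proj K y) + edist K y))//.
  exact: dot_ray.
have hP : forall y, B y -> ~ (K `|` tube Omega t) y -> h y = 0.
  move=> y _ nP; have Ky : ~ K y by move=> Ky; apply: nP; left.
  have yt : t <= edist K y.
    by rewrite leNgt; apply/negP => yt; apply: nP; right.
  rewrite /h /pospart max_l; last by rewrite subr_le0 ler_pXn2r ?nnegrE ?edist_ge0 ?(ltW t0).
  by rewrite expr0n/= !mulr0 mul0r subr0 mulr0.
rewrite (_ : \int[leb]_(y in B) h y = \int[leb]_(y in K `|` tube Omega t) h y); last first.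
  rewrite -[in RHS](setIidr PB) Rintegral_mkcondr; apply: eq_Rintegral => y /set_mem By.
  by rewrite /patch; case: ifPn => // /negP nP; apply: hP => // Py; apply: nP; exact: mem_set.
have bw : bounded_measurable (K `|` tube Omega t) w.
  split; first exact: (measurable_funS measurableT).
  have [C hC] := wb M; exists C => y Py; rewrite ger0_norm//.
  by apply: hC; exact: hM.
have bd : bounded_measurable (K `|` tube Omega t) (edist K).
  split; first by apply: (measurable_funS measurableT) => //; exact: (measurable_edist O0 bO cO).
  exists t => y [Ky|[_ yt]]; rewrite ger0_norm ?edist_ge0//; last exact: ltW.
  by rewrite (edist_eq0 cK K0 cvK y).2// ltW.
have bwt : bounded_measurable (tube Omega t) w.
  by apply: (bounded_measurableS _ _ bw) => [|y Ky]; [exact: measurableU|right].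
have bwK : bounded_measurable K w.
  by apply: (bounded_measurableS _ _ bw) => [|y Ky]; [exact: measurableU|left].
have bdt : bounded_measurable (tube Omega t) (edist K).
  by apply: (bounded_measurableS _ _ bd) => [|y Ky]; [exact: measurableU|right].
have bvt : bounded_measurable (tube Omega t) (fun y => supp_dist (proj K y)).
  have := bounded_measurable_tube O0 oO bO cO sS 0 t bounded_measurable_supp.
  by apply: bounded_measurable_eq => y _; rewrite mulr1.
have bc (D : set E) (c : R) : bounded_measurable D (fun=> c).
  exact: bounded_measurable_cst.
have bh : bounded_measurable (K `|` tube Omega t) h.
  apply: bounded_measurableU => //.
    by apply: (bounded_measurable_eq hK); exact: bounded_measurableM.
  apply: (bounded_measurable_eq ht); apply: bounded_measurableM => //.
  have bq : bounded_measurable (tube Omega t) (fun y => t ^+ 2 - edist K y ^+ 2).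
    by apply: bounded_measurableD => //; apply: bounded_measurableN; exact: bounded_measurableX.
  apply: bounded_measurableD.
    by apply: bounded_measurableM => //; exact: bounded_measurableX.
  apply: bounded_measurableN; apply: bounded_measurableM; first exact: bounded_measurableM.
  by apply: bounded_measurableM => //; exact: bounded_measurableD.
have fin (A : set E) : measurable A -> A `<=` K `|` tube Omega t -> (leb A < +oo)%E.
  by move=> mA AP; apply: (lebesgue_enorm_bounded mA (M := M)) => y /AP /hM.
rewrite Rintegral_setU//; last 2 first.
- apply: bounded_measurable_integrable => //; first exact: measurableU.
  by apply: fin => //; exact: measurableU.
- by apply/disj_setPS => y [Ky [nKy _]].
move=> <-; congr (_ + _); last first.
  by apply: eq_Rintegral => y /set_mem ty; rewrite ht.
rewrite -RintegralZl//; last first.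
  by apply: bounded_measurable_integrable => //; apply: fin => // y Ky; left.
by apply: eq_Rintegral => y /set_mem Ky; rewrite hK.
Qed.

(* Both sides of the scaling identity are polynomials in the radius [t] of the
   tube; this is the equality of their coefficients of [t ^+ m]. *)
Lemma scaling_coefficients (L : seq tube_term) (m : nat) :
  (forall T, List.In T L -> tube_term_bounded T) ->
  (forall t y, 0 < t -> tube Omega t y -> w y *
    ((n.+1 + k)%:R * (t ^+ 2 - edist K y ^+ 2) ^+ 2
     - 4 * (t ^+ 2 - edist K y ^+ 2) * (edist K y * (supp_dist (proj K y) + edist K y))) =
    \sum_(T <- L) tube_term_eval t T y) ->
  (if m == 4 then (n.+1 + k)%:R * \int[leb]_(y in K) w y else 0) +
  \sum_(T <- L) tube_term_coef m T = 0.
Proof.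
move=> bL LE; set c := (n.+1 + k)%:R * _.
pose p : {poly R} := c *: 'X^4 + \sum_(T <- L) tube_term_poly T.
have p0 : p = 0.
  apply: poly_eq0_pos => t t0; rewrite hornerD hornerZ hornerXn -tube_integral_terms//.
  rewrite -[RHS](scaling_identity_tube t0); congr (_ + _); first by rewrite /c; ring.
  by apply: eq_Rintegral => y /set_mem ty; rewrite (LE t y t0 ty).
have := congr1 (fun q : {poly R} => q`_m) p0; rewrite /p coefD coefZ coefXn coef_sum coef0.
under eq_bigr do rewrite tube_term_polyE.
by move=> h; rewrite -[RHS]h; congr (_ + _); case: ifP; rewrite ?mulr1 ?mulr0.
Qed.

End weight.

Let one : E -> R := fun=> 1.
Let z (p : E) : R := dot p p.

Let bone : bounded_measurable S one. Proof. exact: bounded_measurable_cst. Qed.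
Let bv : bounded_measurable S supp_dist. Proof. exact: bounded_measurable_supp. Qed.
Let bz : bounded_measurable S z. Proof. exact: bounded_measurable_sqr. Qed.

Let mk (a : R) (e : nat) (c : E -> R) (l : nat) : tube_term := (a, e, c, l).

(** For the weight [1] the five entries are the monomials of [M (t^2 - d^2)^2 - 4 (t^2 - d^2) d (v +
    d)]. *)
Let scaling0 (m : nat) : let M : R := n.+1%:R in
  (if m == 4 then M * \int[leb]_(y in K) 1 else 0) +
  \sum_(T <- [:: mk M 4 one 0; mk (- (2 * M + 4)) 2 one 2; mk (M + 4) 0 one 4;
                 mk (- 4) 2 supp_dist 1; mk 4 0 supp_dist 3]) tube_term_coef m T = 0.
Proof.
move=> M; have m1 : measurable_fun setT (fun _ : E => 1 : R) by exact: measurable_cst.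
have := @scaling_coefficients (fun=> 1) 0 m1.
have wb1 (B : R) : exists C : R, forall y : E, enorm y <= B -> 1 <= C by exists 1.
move=> /(_ (fun _ => ler01) (fun _ _ _ => esym (mulr1 _)) wb1).
move=> /(_ [:: mk M 4 one 0; mk (- (2 * M + 4)) 2 one 2; mk (M + 4) 0 one 4;
                 mk (- 4) 2 supp_dist 1; mk 4 0 supp_dist 3] m); rewrite addn0; apply.
  by move=> T; do 5! (case=> [<-|] //).
by move=> t y t0 ty; rewrite !big_cons big_nil /= /one -/M; ring.
Qed.

(** The coefficient of [t ^+ 4] is the only one that sees the integral over the closure. Among the
    tube entries only the two with [supp_dist] have so low a degree, and they contribute [- 2 + 1]
    times the moment. *)
Lemma minkowski_volume : n.+1%:R * fine (leb K) = curv_moment supp_dist 0.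
Proof.
have := scaling0 4; rewrite /= Rintegral_cst; last exact: measurable_domain_closure.
rewrite !big_cons big_nil /= mul1r.
rewrite -[(4 - (2 + 1).+1)%N]/0%N -[(4 - 2)%N]/2%N -[(4 - 0)%N]/4%N.
by move: (curv_moment supp_dist 0) (n.+1%:R * _) => V W h; lra.
Qed.

Let add5 j l : (l <= 4)%N -> (j + 5 - l)%:R = j%:R + (5 - l)%:R :> R.
Proof. by move=> l4; rewrite -natrD; congr _%:R; lia. Qed.

Let algebra0 (N J A V : R) : 0 <= J ->
  (N + 1) * A / (J + 1) + (- (2 * (N + 1) + 4) * A / (J + 3) + ((N + 1 + 4) * A / (J + 5) +
  (- 4 * V / (J + 3) + (4 * V / (J + 5) + 0)))) = 0 -> (N - J) * A = (J + 1) * V.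
Proof.
move=> J0 h.
have n1 : J + 1 != 0 by rewrite gt_eqF// ltr_wpDl.
have n3 : J + 3 != 0 by rewrite gt_eqF// ltr_wpDl.
have n5 : J + 5 != 0 by rewrite gt_eqF// ltr_wpDl.
have : 8 * ((N - J) * A - (J + 1) * V) = (J + 1) * (J + 3) * (J + 5) * 0.
  by rewrite -h; field; rewrite n1 n3 n5.
by rewrite mulr0 => h8; lra.
Qed.

(** The coefficient of [t ^+ (j + 5)]: the entries with [one] have total degree four and the tube
    formula adds [j + 1], while those with [supp_dist] have total degree three and therefore pick
    the next moment. *)
Lemma minkowski_formula j : (n%:R - j%:R) * curv_moment one j =
  j.+1%:R * curv_moment supp_dist j.+1.
Proof.
have /= := scaling0 (j + 5); rewrite [_ == 4%N](_ : _ = false); last by apply/negbTE; lia.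
rewrite add0r.
rewrite !big_cons big_nil /mk /tube_term_coef.
do 5! (rewrite ifT; last by lia).
rewrite (_ : (j + 5 - (4 + 0).+1)%N = j); last by lia.
rewrite (_ : (j + 5 - (2 + 1).+1)%N = j.+1); last by lia.
rewrite !add5// -[n.+1%:R]natr1 -[j.+1%:R]natr1 => h.
by apply: algebra0 h.
Qed.

Let zv (p : E) : R := z p * supp_dist p.
Let vv (p : E) : R := supp_dist p * supp_dist p.
Let bzv : bounded_measurable S zv. Proof. exact: bounded_measurableM. Qed.
Let bvv : bounded_measurable S vv. Proof. exact: bounded_measurableM. Qed.

(** For the weight [|y|^2 = |p|^2 + 2 d v + d^2] these are three groups of five, the monomials of
    [scaling0] multiplied by [z], by [2 d v] and by [d^2]. The constant [Q] will be [n.+1] plus the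
    degree two of the weight. *)
Let terms2 (Q : R) : seq tube_term :=
  [:: mk Q 4 z 0; mk (- (2 * Q + 4)) 2 z 2; mk (Q + 4) 0 z 4;
      mk (- 4) 2 zv 1; mk 4 0 zv 3;
      mk (2 * Q) 4 supp_dist 1; mk (- (2 * (2 * Q + 4))) 2 supp_dist 3;
      mk (2 * (Q + 4)) 0 supp_dist 5; mk (- 8) 2 vv 2; mk 8 0 vv 4;
      mk Q 4 one 2; mk (- (2 * Q + 4)) 2 one 4; mk (Q + 4) 0 one 6;
      mk (- 4) 2 supp_dist 3; mk 4 0 supp_dist 5].

Let expand2 (Q t s a b : R) :
  (a + 2 * s * b + s ^+ 2) * (Q * (t ^+ 2 - s ^+ 2) ^+ 2 -
    4 * (t ^+ 2 - s ^+ 2) * (s * (b + s))) =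
  Q * t ^+ 4 * (a * s ^+ 0) + (- (2 * Q + 4) * t ^+ 2 * (a * s ^+ 2) +
  ((Q + 4) * t ^+ 0 * (a * s ^+ 4) + (- 4 * t ^+ 2 * (a * b * s ^+ 1) +
  (4 * t ^+ 0 * (a * b * s ^+ 3) + (2 * Q * t ^+ 4 * (b * s ^+ 1) +
  (- (2 * (2 * Q + 4)) * t ^+ 2 * (b * s ^+ 3) + (2 * (Q + 4) * t ^+ 0 * (b * s ^+ 5) +
  (- 8 * t ^+ 2 * (b * b * s ^+ 2) + (8 * t ^+ 0 * (b * b * s ^+ 4) +
  (Q * t ^+ 4 * (1 * s ^+ 2) + (- (2 * Q + 4) * t ^+ 2 * (1 * s ^+ 4) +
  ((Q + 4) * t ^+ 0 * (1 * s ^+ 6) + (- 4 * t ^+ 2 * (b * s ^+ 3) +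
  (4 * t ^+ 0 * (b * s ^+ 5) + 0)))))))))))))).
Proof. by ring. Qed.

Let scaling2 (m : nat) : m != 4%N -> \sum_(T <- terms2 (n.+1 + 2)%:R) tube_term_coef m T = 0.
Proof.
move=> m4; set Q : R := (n.+1 + 2)%:R.
have mz : measurable_fun setT (fun y : E => dot y y).
  rewrite (_ : (fun _ => _) = fun y : E => \sum_i y ord0 i * y ord0 i).
    by apply: measurable_sum => i; apply: measurable_funM; exact: measurable_rV_coord.
  by apply/funext => y; exact: dotE.
have wZ (l : R) (y : E) : 0 < l -> dot (l *: y) (l *: y) = l ^+ 2 * dot y y.
  by move=> _; rewrite dotZl dotZr mulrA expr2.
have wb (B : R) : exists C : R, forall y : E, enorm y <= B -> dot y y <= C.
  exists (`|B| ^+ 2) => y yB; rewrite -enorm_sqr lerXn2r ?nnegrE ?enorm_ge0//.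
  exact: le_trans yB (ler_norm _).
have := @scaling_coefficients (fun y => dot y y) 2 mz (@dot_ge0 _ _) wZ wb (terms2 Q) m.
rewrite (negbTE m4) add0r; apply.
  by move=> T; do 15! (case=> [<-|] //).
move=> t y t0 [Ky yt]; have [Sy _] := proj_boundary O0 oO bO cO sS Ky.
have NN := gauss_dot oO cO sS Sy.
have yE := gauss_proj_ray O0 oO bO cO sS Ky.
rewrite (_ : dot y y = z (proj K y) + 2 * edist K y * supp_dist (proj K y) + edist K y ^+ 2).
  by rewrite !big_cons big_nil; exact: expand2.
rewrite {1 2}yE dotDl !dotDr !dotZl !dotZr NN (dotC (gauss _)) /z /supp_dist.
by move: (dot _ _) (dot _ _) (edist K y) => A B C; ring.
Qed.

Let algebra2 (N O V Z VV : R) : 0 <= N ->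
  (N + 3) * Z / (N + 1) + (- (2 * (N + 3) + 4) * Z / (N + 3) + ((N + 3 + 4) * Z / (N + 5) +
  (0 + (0 + (2 * (N + 3) * V / (N + 1) + (- (2 * (2 * (N + 3) + 4)) * V / (N + 3) +
  (2 * (N + 3 + 4) * V / (N + 5) + (- 8 * VV / (N + 3) + (8 * VV / (N + 5) +
  ((N + 3) * O / (N + 1) + (- (2 * (N + 3) + 4) * O / (N + 3) + ((N + 3 + 4) * O / (N + 5) +
  (- 4 * V / (N + 3) + (4 * V / (N + 5) + 0)))))))))))))) = 0 ->
  2 * O = (N - 1) * V -> V + Z = (N + 1) * VV.
Proof.
move=> N0 h hO.
have n1 : N + 1 != 0 by rewrite gt_eqF// ltr_wpDl.
have n3 : N + 3 != 0 by rewrite gt_eqF// ltr_wpDl.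
have n5 : N + 5 != 0 by rewrite gt_eqF// ltr_wpDl.
have : 8 * (2 * O + (3 - N) * V + 2 * Z - (2 * N + 2) * VV) = (N + 1) * (N + 3) * (N + 5) * 0.
  by rewrite -h; field; rewrite n1 n3 n5.
by rewrite mulr0 => h8; lra.
Qed.

(** The coefficient of [t ^+ (n + 5)] is the highest one containing the moment of [z] with [e_n];
    the entries in [zv] would there need [e_(n+1)] and vanish. The moment of [e_(n-2)] that remains
    is removed by Minkowski's formula, and for [n = 1] it is absent and that relation reads
    [0 = 0]. *)
Lemma curvature_identity : (1 <= n)%N ->
  curv_moment supp_dist n.-1 + curv_moment z n = n.+1%:R * curv_moment vv n.
Proof.
move=> n1; pose O := if (2 <= n)%N then curv_moment one (n - 2) else 0.
have hO : 2 * O = (n%:R - 1) * curv_moment supp_dist n.-1.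
  rewrite /O; case: ifPn => n2.
    have := minkowski_formula (n - 2).
    rewrite (_ : (n - 2).+1 = n.-1); last by lia.
    rewrite natrB// opprB addrCA subrr addr0 => ->; congr (_ * _).
    by rewrite -subn1 natrB.
  have -> : n = 1%N by lia.
  by rewrite subrr mulr0 mul0r.
have := scaling2 (m := n + 5); rewrite (_ : (n + 5)%N != 4%N); last by lia.
move=> /(_ isT); rewrite !big_cons big_nil /mk /tube_term_coef.
have one_term (a : R) e l d : (e + l = 6)%N ->
   (if (e + l < n + 5)%N then a * curv_moment one (n + 5 - (e + l).+1) / d else 0) = a * O / d.
  move=> ->; rewrite /O (_ : (6 < n + 5)%N = (2 <= n)%N); last by lia.
  by case: ifP; rewrite ?mulr0 ?mul0r// => _; congr (_ * curv_moment _ _ / _); lia.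
rewrite !one_term//.
do 12! (rewrite ifT; last by lia).
rewrite (@curv_moment_big zv); last by lia.
rewrite !mulr0 !mul0r.
rewrite (_ : (n + 5 - (4 + 0).+1)%N = n); last by lia.
rewrite (_ : (n + 5 - (4 + 1).+1)%N = n.-1); last by lia.
rewrite !add5// (_ : (n.+1 + 2)%:R = n%:R + 3 :> R); last by rewrite -natrD; congr _%:R; lia.
by move=> h; rewrite -natr1; apply: algebra2 h hO.
Qed.

End minkowski.

(** * The Gauss map and the area of the sphere *)

Lemma cvg_finite_sum {R : realType} (I : Type) (r : seq I) (f : I -> nat -> R) (l : I -> R) :
  (forall i, f i k @[k --> \oo] --> l i) ->
  (\sum_(i <- r) f i k) @[k --> \oo] --> \sum_(i <- r) l i.
Proof.
move=> h; elim: r => [|i r ih].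
  by rewrite big_nil; under eq_fun do rewrite big_nil; exact: cvg_cst.
by rewrite big_cons; under eq_fun do rewrite big_cons; exact: cvgD.
Qed.

Section gauss_integral.
Context {R : realType} {n : nat}.
Local Notation E := 'rV[R]_n.+1.
Local Notation leb := (lebesgue_rV n.+1).
Variable Omega : set E.
Hypotheses (O0 : Omega !=set0) (oO : open Omega) (bO : bounded_set Omega).
Hypothesis cO : convex_set Omega.
Local Notation K := (closure Omega).
Local Notation S := (boundary Omega).
Hypothesis sS : smooth_hypersurface S.
Variable mu : {measure set E -> \bar R}.
Hypothesis muS : is_area_measure S mu.
Local Notation gauss := (gauss Omega).

Let cK := compact_domain_closure bO.
Let K0 := domain_closure0 O0.
Let cvK := domain_closure_segment cO.

Variable F : E -> R.
Hypotheses (cF : continuous F) (F0 : forall x, 0 <= F x).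
Variable M : R.
Hypothesis hM : forall y, K y -> enorm y <= M.

Let M0 : 0 <= M.
Proof. by have [y Ky] := K0; apply: le_trans (enorm_ge0 y) (hM Ky). Qed.

Let mF : measurable_fun setT F.
Proof. by apply: continuous_on_open_measurable; [exact: openT|move=> y _; exact: cF]. Qed.

(** The bound covers all values of [outer_normal]: unit vectors off [K], and [0] on it. *)
Let bF : exists2 C : R, 0 <= C & F 0 <= C /\ forall x, enorm x = 1 -> F x <= C.
Proof.
have cs : compact (F @` sphere 1).
  apply: continuous_compact; last exact: compact_sphere.
  exact: continuous_subspaceT.
have [C [_ hC]] := @compact_bounded R R _ cs.
have h (x : E) : enorm x = 1 -> F x <= `|C| + 1.
  move=> x1; apply: le_trans (ler_norm _) _; apply: hC; last by exists x.
  by rewrite (le_lt_trans (ler_norm C))// ltrDl.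
exists (Num.max (F 0) (`|C| + 1)); first by rewrite le_max F0.
by split=> [|x x1]; rewrite le_max ?lexx// h ?orbT.
Qed.

Let C := sval (cid2 bF).
Let C0 : 0 <= C. Proof. by rewrite /C; case: cid2 => /=. Qed.
Let FC y : F (outer_normal K y) <= C.
Proof.
rewrite /C; case: cid2 => /= B _ [B0 hB].
have [Ky|Ky] := pselect (K y); last by have [_ n1 _] := outer_normalP cK K0 cvK Ky; exact: hB.
by rewrite /outer_normal (proj_id cK K0 cvK Ky) subrr scaler0.
Qed.

Let edist_le_enorm y : edist K y <= enorm y + M.
Proof.
have [p Kp] := K0; apply: le_trans (edist_le cK K0 cvK y Kp) _.
by apply: le_trans (enormD _ _) _; rewrite enormN lerD2l hM.
Qed.

Let enorm_le_edist y : enorm y <= edist K y + M.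
Proof.
rewrite -[in enorm y](subrK (proj K y) y); apply: le_trans (enormD _ _) _.
by rewrite lerD2l; apply: hM; exact: proj_in.
Qed.

(* The factors [t - d] and [d] make the rescaled weights converge everywhere, the
   origin and the unit sphere included, so that no null set has to be handled. *)
Let tube_weight t y : R := pospart (t - edist K y) * (edist K y * F (outer_normal K y)).

Let tube_weight_ge0 t y : 0 <= tube_weight t y.
Proof.
by rewrite /tube_weight mulr_ge0 ?mulr_ge0 ?F0 ?edist_ge0// /pospart le_max lexx.
Qed.

Let measurable_tube_weight t : measurable_fun setT (tube_weight t).
Proof.
have mK : measurable K by exact: measurable_domain_closure.
apply: measurable_funM.
  apply: measurable_maxr => //; apply: measurable_funB => //.
  exact: (measurable_edist O0 bO cO).
have -> : [set: E] = K `|` ~` K by rewrite setUCr.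
apply/measurable_funU => //; first exact: measurableC; split.
  apply: (@eq_measurable_fun _ _ E R K (fun=> 0)); last exact: measurable_cst.
  by move=> y /set_mem Ky; rewrite (edist_eq0 cK K0 cvK y).2// mul0r.
have oK : open (~` K) by apply: closed_openC; exact: closed_closure.
apply: measurable_funM; first by apply: (measurable_funS measurableT) => //; exact: (measurable_edist O0 bO cO).
apply: continuous_on_open_measurable => // y Ky.
apply: (@continuous_comp _ _ _ (outer_normal K) F); last exact: cF.
apply: (@for_continuousZ R _ _ (fun y => (edist K y)^-1) (fun y => y - proj K y)).
  apply: (@cvgV _ _ (nbhs y) _ (edist K) (edist K y)); last exact: (edist_continuous cK K0 cvK).
  by rewrite gt_eqF// edist_gt0.
by apply: continuousB; [exact: cvg_id|exact: (proj_continuous cK K0 cvK)].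
Qed.

(** Integrating [(t - s) s^(j+1)] over []0, t[] gives [t^(j+3) / ((j+2) (j+3))], which is where the
    two denominators come from. *)
Let A (j : nat) : R := curv_moment Omega mu (F \o gauss) j / (j + 2)%:R / (j + 3)%:R.

Let bFg : bounded_measurable S (F \o gauss).
Proof.
split.
  apply: (measurableT_comp mF); apply: measurable_to_rV_on => i.
  exact: (measurable_gauss O0 oO bO cO sS).
exists C => p Sp; rewrite ger0_norm ?F0// /C; case: cid2 => /= B _ [_ hB].
by apply: hB; have [] := gaussP oO cO sS Sp.
Qed.

Let integral_tube_weight (t : R) : 0 < t ->
  (\int[leb]_y (tube_weight t y)%:E = (\sum_(j < n.+1) A j * t ^+ (j + 3))%:E)%E.
Proof.
move=> t0; have mt : measurable (tube Omega t) by exact: (measurable_tube O0 bO cO).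
rewrite (_ : \int[leb]_y _ = \int[leb]_(y in tube Omega t) (tube_weight t y)%:E)%E; last first.
  rewrite [RHS]integral_mkcond; apply: eq_integral => y _; rewrite patchE.
  case: ifPn => // /negP ny; congr EFin; have [Ky|Ky] := pselect (K y).
    by rewrite /tube_weight (edist_eq0 cK K0 cvK y).2// mul0r mulr0.
  have yt : t <= edist K y.
    by rewrite leNgt; apply/negP => yt; apply: ny; apply: mem_set; split.
  by rewrite /tube_weight /pospart max_l ?mul0r// subr_le0.
pose c := F \o gauss.
have b1 := bounded_measurable_tube O0 oO bO cO sS 1 t bFg.
have b2 := bounded_measurable_tube O0 oO bO cO sS 2 t bFg.
pose h y := t * (c (proj K y) * edist K y ^+ 1) + -1 * (c (proj K y) * edist K y ^+ 2).
have bh : bounded_measurable (tube Omega t) h.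
  apply: bounded_measurableD; apply: bounded_measurableM => //; exact: bounded_measurable_cst.
have hE y : tube Omega t y -> tube_weight t y = h y.
  move=> [Ky yt]; have [_ gE] := proj_boundary O0 oO bO cO sS Ky.
  rewrite /tube_weight /h /c /= gE /pospart max_r ?subr_ge0 ?(ltW yt)//; ring.
rewrite (eq_integral (EFin \o h)); last by move=> y /set_mem /hE ->.
have ih : leb.-integrable (tube Omega t) (EFin \o h) by exact: (tube_integrable O0 bO cO).
rewrite -[LHS]fineK; last exact: integrable_fin_num.
congr EFin; rewrite -[LHS]/(\int[leb]_(y in tube Omega t) h y).
rewrite RintegralD//; last 2 first.
- by apply: (tube_integrable O0 bO cO); apply: bounded_measurableM => //; exact: bounded_measurable_cst.
- by apply: (tube_integrable O0 bO cO); apply: bounded_measurableM => //; exact: bounded_measurable_cst.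
rewrite !RintegralZl//; try exact: (tube_integrable O0 bO cO).
rewrite (tube_integral O0 oO bO cO sS muS 1 t0 bFg) (tube_integral O0 oO bO cO sS muS 2 t0 bFg).
rewrite !mulr_sumr -big_split; apply: eq_bigr => j _ /=.
rewrite /A /curv_moment /c (_ : (1 + j).+1 = (j + 2)%N); last by lia.
rewrite (_ : (2 + j).+1 = (j + 3)%N); last by lia.
have e3 : (j + 3)%:R = (j + 2)%:R + 1 :> R by rewrite natr1; congr _%:R; lia.
have p3 : t ^+ (j + 3) = t * t ^+ (j + 2) by rewrite -exprS; congr (_ ^+ _); lia.
have n2 : (j + 2)%:R + 1 != 0 :> R by rewrite -e3 pnatr_eq0; lia.
have n1 : (j + 2)%:R != 0 :> R by rewrite pnatr_eq0; lia.
rewrite p3 e3 /=; move: (Rintegral _ _ _) (j + 2)%:R n1 n2 (t ^+ _) => I a n1 n2 b.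
by field; rewrite n1 n2.
Qed.

(** The tube weight of radius [t = k.+1] at the point [t w], with its two length factors divided by
    [t]. *)
Let weight (k : nat) (w : E) : R :=
  pospart (1 - edist K (k.+1%:R *: w) / k.+1%:R) *
  (edist K (k.+1%:R *: w) / k.+1%:R * F (outer_normal K (k.+1%:R *: w))).

Let limit_weight (w : E) : R := pospart (1 - enorm w) * (enorm w * F ((enorm w)^-1 *: w)).

Let weightE k w : tube_weight k.+1%:R (k.+1%:R *: w) = k.+1%:R ^+ 2 * weight k w.
Proof.
rewrite /weight /tube_weight; have t0 : 0 < k.+1%:R :> R by rewrite ltr0Sn.
move: k.+1%:R t0 => t t0; move: (edist _ _) (F _) => d f.
have -> : pospart (t - d) = t * pospart (1 - d / t).
  by rewrite /pospart maxr_pMr ?(ltW t0)// mulr0 mulrBr mulr1 mulrCA divff ?mulr1// gt_eqF.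
by field; rewrite gt_eqF.
Qed.

(** A domain common to all [k]: since [|t w| <= d(t w) + M], a point with [|w| > M + 2] has
    [d(t w) >= t] for every [t >= 1], and the weight vanishes there. *)
Let D : set E := [set w | enorm w <= M + 2].
Let mD : measurable D. Proof. exact: measurable_enorm_le. Qed.

Let weight_out k w : ~ D w -> weight k w = 0.
Proof.
move=> /negP; rewrite -ltNge => Dw.
rewrite /weight /pospart max_l ?mul0r// subr_le0 ler_pdivlMr ?ltr0Sn// mul1r.
have := enorm_le_edist (k.+1%:R *: w); rewrite enormZ normr_nat.
have aux (d e t : R) : M + 2 < e -> 1 <= t -> t * e <= d + M -> t <= d.
  by move=> h1 h2 h3; have := M0; nra.
by apply: aux Dw _; rewrite ler1n.
Qed.

Let weight_ge0 k w : 0 <= weight k w.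
Proof.
by rewrite /weight !mulr_ge0 ?divr_ge0 ?edist_ge0// /pospart le_max lexx.
Qed.

Let measurable_weight k : measurable_fun setT (weight k).
Proof.
have k0 : k.+1%:R ^+ 2 != 0 :> R by rewrite expf_neq0// pnatr_eq0.
rewrite (_ : weight k = fun w => (k.+1%:R ^+ 2)^-1 * (tube_weight k.+1%:R \o (fun w : E => k.+1%:R *: w)) w).
  apply: measurable_funM => //.
  by apply: measurableT_comp; [exact: measurable_tube_weight|exact: measurable_scale].
by apply/funext => w /=; rewrite weightE mulKf.
Qed.

Let power_quotient (c a : R) (i j : nat) : c != 0 -> (j <= i)%N ->
  (c ^+ 2)^-1 * ((c ^+ i.+1)^-1 * (a * c ^+ (j + 3))) = a * c^-1 ^+ (i - j).
Proof.
move=> c0 ji; rewrite exprVn -{1}(subnK ji) -addSn !exprD [c ^+ (i - j).+1]exprS.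
have p0 m : c ^+ m != 0 by rewrite expf_neq0.
by field; rewrite c0 !p0.
Qed.

(** The tube integral grows like [t^(j+3)] in its [j]-th term, while scaling divides by [t^(n+1)]
    and normalization by [t^2]; only [j = n] will survive in the limit. *)
Let integral_weight k : (\int[leb]_(w in D) (weight k w)%:E =
  (\sum_(j < n.+1) A j * (k.+1%:R^-1) ^+ (n - j))%:E)%E.
Proof.
rewrite (_ : \int[leb]_(w in D) _ = \int[leb]_w (weight k w)%:E)%E; last first.
  rewrite [LHS]integral_mkcond; apply: eq_integral => w _; rewrite patchE.
  by case: ifPn => // /negP Dw; rewrite weight_out// => h; apply: Dw; exact: mem_set.
have t0 : 0 < k.+1%:R :> R by rewrite ltr0Sn.
have := integral_scale_eq t0 (measurable_tube_weight k.+1%:R) (tube_weight_ge0 _)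
  (fun w => esym (weightE k w)).
under eq_integral do rewrite EFinM.
rewrite ge0_integralZl//; last 2 first.
- by apply/measurable_EFinP; exact: measurable_weight.
- by move=> w _; rewrite lee_fin.
rewrite integral_tube_weight// -EFinM => h.
have k0 : k.+1%:R ^+ 2 != 0 :> R by rewrite expf_neq0// gt_eqF.
rewrite -[LHS]mul1e -[in LHS](mulVf k0) EFinM -muleA h -EFinM; congr EFin.
rewrite !mulr_sumr; apply: eq_bigr => j _.
by apply: power_quotient; [rewrite gt_eqF|rewrite -ltnS].
Qed.

Let harmonic_bound (V : normedModType R) (a : nat -> V) (l : V) (B : R) :
  (forall k, `|a k - l| <= B / k.+1%:R) -> a @ \oo --> l.
Proof.
move=> h; apply/subr_cvg0/norm_cvg0P/(squeeze_cvgr (f := fun=> 0) (h := fun k => B * harmonic k)).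
- by near=> k; rewrite normr_ge0 /=; exact: h.
- exact: cvg_cst.
- by rewrite -(mulr0 B); apply: cvgMl_tmp; exact: cvg_harmonic.
Unshelve. all: by end_near. Qed.

Let abs_ratio (d e t : R) : 0 < t -> `|d - t * e| <= M -> `|d / t - e| <= M / t.
Proof.
move=> t0 h; rewrite (_ : d / t - e = (d - t * e) / t); last by field; rewrite gt_eqF.
by rewrite normrM (ger0_norm (x := t^-1)) ?invr_ge0 ?(ltW t0)// ler_pM2r ?invr_gt0.
Qed.

Let edist_ratio_cvg w : edist K (k.+1%:R *: w) / k.+1%:R @[k --> \oo] --> enorm w.
Proof.
apply: (@harmonic_bound R _ _ M) => k; have k0 : 0 < k.+1%:R :> R by rewrite ltr0Sn.
have h1 := enorm_le_edist (k.+1%:R *: w); have h2 := edist_le_enorm (k.+1%:R *: w).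
rewrite enormZ normr_nat in h1 h2; apply: abs_ratio => //.
by rewrite ler_norml; apply/andP; split; lra.
Qed.

Let direction_cvg w : k.+1%:R^-1 *: (k.+1%:R *: w - proj K (k.+1%:R *: w)) @[k --> \oo] --> w.
Proof.
apply: (@harmonic_bound _ _ _ M) => k; have k0 : 0 < k.+1%:R :> R by rewrite ltr0Sn.
rewrite scalerBr scalerA mulVf ?gt_eqF// scale1r addrAC subrr add0r normrN normrZ.
rewrite ger0_norm ?invr_ge0 ?ler0n// mulrC ler_pM2r ?invr_gt0//.
by apply: le_trans (norm_le_enorm _) _; apply: hM; exact: proj_in.
Qed.

Let pospart_continuous : continuous (@pospart R).
Proof.
move=> x; apply/(continuous_epsP (V := R) (W := R)) => e e0; exists e => // y.
apply: le_lt_trans; have h1 := ler_norm (y - x); have h2 := ler_norm (x - y).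
rewrite distrC in h2; rewrite /pospart.
by have [|] := leP 0 y; have [|] := leP 0 x; rewrite ler_norml => *; apply/andP; split; lra.
Qed.

Let weight_cvg w : weight k w @[k --> \oo] --> limit_weight w.
Proof.
rewrite /weight /limit_weight.
set r := fun k => edist K (k.+1%:R *: w) / k.+1%:R.
have rw : r @ \oo --> enorm w by exact: edist_ratio_cvg.
have r0 k : 0 <= r k by rewrite divr_ge0 ?edist_ge0.
have pr : pospart (1 - r k) @[k --> \oo] --> pospart (1 - enorm w).
  apply: (@cvg_comp _ _ _ (fun k => 1 - r k) (@pospart R)); last exact: pospart_continuous.
  by apply: cvgB => //; exact: cvg_cst.
(* At the origin the normals need not converge, but the factor [d / t] tends to zero and [C] bounds
   [F]. *)
apply: cvgM => //; have [w0|w0] := eqVneq w 0.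
  have e0 : enorm w = 0 by rewrite w0 enorm0.
  rewrite e0 in rw *; rewrite mul0r.
  apply: (squeeze_cvgr (f := fun=> 0) (h := fun k => r k * C)).
  - by apply: nearW => k; rewrite -/(r k) mulr_ge0 ?r0 ?F0//= ler_wpM2l ?r0 ?FC.
  - exact: cvg_cst.
  - by rewrite -(mul0r C); apply: cvgM; [|exact: cvg_cst].
apply: cvgM => //; apply: (@cvg_comp _ _ _ (fun k => outer_normal K (k.+1%:R *: w)) F); last exact: cF.
rewrite (_ : (fun k => _) = fun k => (r k)^-1 *: (k.+1%:R^-1 *: (k.+1%:R *: w - proj K (k.+1%:R *: w)))).
  by apply: cvgZ; [apply: cvgV => //; rewrite enorm_eq0|exact: direction_cvg].
apply/funext => k; rewrite /r invf_div scalerA mulrAC divff ?mul1r// pnatr_eq0//.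
Qed.

Let majorant (w : E) : R := (enorm w + M) * C.

Lemma gauss_integral :
  leb.-integrable [set w | enorm w <= M + 2]
    (fun w => (pospart (1 - enorm w) * (enorm w * F ((enorm w)^-1 *: w)))%:E) /\
  \int[leb]_(w in [set w | enorm w <= M + 2])
    (pospart (1 - enorm w) * (enorm w * F ((enorm w)^-1 *: w))) =
  curv_moment Omega mu (F \o gauss) n / (n + 2)%:R / (n + 3)%:R.
Proof.
rewrite -/(A n) -/D.
have mw k : measurable_fun D (EFin \o weight k).
  by apply/measurable_EFinP; apply: (measurable_funS measurableT).
have wc w : D w -> (EFin \o weight k) w @[k --> \oo] --> (EFin \o limit_weight) w.
  by move=> _; apply: cvg_EFin; [exact: nearW|exact: weight_cvg].
have ml : measurable_fun D (EFin \o limit_weight) by exact: emeasurable_fun_cvg mw wc.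
have ig : leb.-integrable D (EFin \o majorant).
  apply: bounded_measurable_integrable => //.
    by apply: (lebesgue_enorm_bounded mD (M := M + 2)).
  apply: bounded_measurableM; last exact: bounded_measurable_cst.
  apply: bounded_measurableD; last exact: bounded_measurable_cst.
  split; last by exists (M + 2) => w Dw; rewrite ger0_norm ?enorm_ge0.
  apply: (measurable_funS measurableT) => //.
  by apply: continuous_on_open_measurable; [exact: openT|move=> y _; exact: enorm_continuous].
have wg w k : D w -> (`|(EFin \o weight k) w| <= (EFin \o majorant) w)%E.
  move=> Dw; rewrite /= lee_fin ger0_norm//.
  have k0 : 0 < k.+1%:R :> R by rewrite ltr0Sn.
  have r1 : edist K (k.+1%:R *: w) / k.+1%:R <= enorm w + M.
    rewrite ler_pdivrMr//; apply: le_trans (edist_le_enorm _) _.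
    by rewrite enormZ normr_nat mulrDl mulrC lerD2l ler_peMr// ler1n.
  rewrite /weight -[leRHS]mul1r ler_pM//.
  - by rewrite /pospart le_max lexx.
  - by rewrite mulr_ge0 ?divr_ge0 ?edist_ge0.
  - by rewrite /pospart ge_max ler01 gerBl divr_ge0 ?edist_ge0.
  - by rewrite ler_pM ?divr_ge0 ?edist_ge0.
have [il _ cvI] := dominated_convergence mD mw ml (aeW _ wc) ig (aeW _ wg).
have cvA : (\sum_(j < n.+1) A j * k.+1%:R^-1 ^+ (n - j))%:E @[k --> \oo] --> (A n)%:E.
  apply: cvg_EFin; first exact: nearW.
  have -> : A n = \sum_(j < n.+1) A j * 0 ^+ (n - j).
    rewrite big_ord_recr /= subnn mulr1 big1 ?add0r// => j _.
    by rewrite expr0n subn_eq0 leqNgt ltn_ord mulr0.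
  have h : (fun k => \sum_(j < n.+1) A j * k.+1%:R^-1 ^+ (n - j)) @ \oo -->
      \sum_(j < n.+1) A j * 0 ^+ (n - j).
    apply: cvg_finite_sum => j.
    apply: cvgMl_tmp.
    apply: (@cvg_comp _ _ _ (@harmonic R) (fun x => x ^+ (n - j))); first exact: cvg_harmonic.
    exact: exprn_continuous.
  exact: h.
have E : (\int[leb]_(w in D) (limit_weight w)%:E = (A n)%:E)%E.
  have {}cvI : (\sum_(j < n.+1) A j * k.+1%:R^-1 ^+ (n - j))%:E @[k --> \oo] -->
      (\int[leb]_(w in D) (limit_weight w)%:E)%E.
    by under eq_fun do rewrite -integral_weight.
  by rewrite -(cvg_lim _ cvI)// -(cvg_lim _ cvA).
by split=> //; rewrite /Rintegral -/limit_weight E.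
Qed.

End gauss_integral.

(** * The unit ball as body of comparison *)

Section unit_ball.
Context {R : realType} {n : nat}.
Local Notation E := 'rV[R]_n.+1.

Definition unit_ball : set E := [set x | enorm x < 1].
Local Notation B := unit_ball.

Lemma unit_ball0 : B !=set0. Proof. by exists 0; rewrite /unit_ball /= enorm0. Qed.

Lemma open_unit_ball : open B.
Proof.
apply: (@open_comp _ _ (@enorm R n.+1) [set t | t < 1]); last exact: open_lt.
by move=> x _; exact: enorm_continuous.
Qed.

Lemma bounded_unit_ball : bounded_set B.
Proof.
exists 1; split=> // M M1 x Bx; apply: (le_trans (norm_le_enorm x)).
exact: ltW (lt_trans Bx M1).
Qed.

Lemma convex_unit_ball : convex_set B.
Proof.
move=> x y l /set_mem Bx /set_mem By; apply/mem_set.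
have l0 : 0 <= l%:num by []; have l1 : l%:num <= 1 by [].
rewrite /unit_ball /= -[X in enorm X]/(l%:num *: x + (1 - l%:num) *: y).
apply: le_lt_trans (enormD _ _) _; rewrite !enormZ !ger0_norm ?subr_ge0//.
move: Bx By; rewrite /unit_ball /=; move: (enorm x) (enorm y) (l%:num) l0 l1 => a b t t0 t1 a1 b1.
have [->|tn0] := eqVneq t 0; first by rewrite mul0r subr0 mul1r add0r.
have tp : 0 < t by rewrite lt_neqAle eq_sym tn0.
have ta : t * a < t by rewrite gtr_pMr.
by nra.
Qed.

Lemma closure_unit_ball : closure B = [set x | enorm x <= 1].
Proof.
apply/seteqP; split=> x.
  have -> : [set x : E | enorm x <= 1] = closure [set x : E | enorm x <= 1].
    apply/closure_id; apply: (@closed_comp _ _ (@enorm R n.+1) [set t | t <= 1]); last exact: closed_le.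
    by move=> y _; exact: enorm_continuous.
  by apply: closure_subset => y /= /ltW.
move=> x1 P /nbhs_norm_ball[d d0 hd].
pose e := Num.min (1 / 2) (d / 2).
have e0 : 0 < e by rewrite lt_min !divr_gt0.
have e1 : e <= 1 / 2 by rewrite ge_min lexx.
have ed : e <= d / 2 by rewrite ge_min lexx orbT.
have e1' : 0 <= 1 - e by lra.
exists ((1 - e) *: x); split.
  rewrite /unit_ball /= enormZ ger0_norm//.
  by apply: le_lt_trans (ler_wpM2l e1' x1) _; rewrite mulr1; lra.
apply: hd; rewrite scalerBl scale1r addrAC subrr add0r normrN normrZ (gtr0_norm e0).
have : e * `|x| <= e * 1 by rewrite ler_wpM2l ?(ltW e0)// (le_trans (norm_le_enorm _)).
by lra.
Qed.

Lemma boundary_unit_ball : boundary B = sphere 1.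
Proof.
rewrite /boundary (interior_id B).1; last exact: open_unit_ball.
rewrite closure_unit_ball; apply/seteqP; split=> x; rewrite /unit_ball /sphere /=.
  by move=> [x1 /negP]; rewrite -leNgt => x2; apply/eqP; rewrite eq_le x1 x2.
by move=> ->; rewrite ltxx lexx.
Qed.

Let f (x : E) : R := dot x x - 1.

Let smooth_f U : open U -> smooth_on U f.
Proof.
move=> oU k; rewrite (_ : f = fun x => (\sum_i x ord0 i * x ord0 i) + (-1)); last first.
  by apply/funext => x; rewrite /f dotE.
apply: CkD => //; last exact: Ck_cst.
apply: Ck_sum => // i; apply: CkM => //; exact: (Ck_linear (coordf i)).
Qed.

Let radial_derive (x : E) : 'D_x f x = 2 * dot x x.
Proof.
have df : differentiable f (x + 0 *: x).
  by apply: (Ck_differentiable (smooth_f openT 1)).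
have h1 := line_is_derive df.
have h2 : is_derive (0 : R) (1 : R) (fun s : R => f (x + s *: x)) (2 * dot x x).
  apply: (@is_derive_quadratic _ _ _ _ (dot x x)) => y.
  rewrite /f !dotDl !dotDr !dotZl !dotZr; move: (dot x x) (dot_ge0 x) => a a0.
  rewrite [X in `|X|](_ : _ = a * (y - 0) ^+ 2); last by ring.
  by rewrite ger0_norm// mulr_ge0// sqr_ge0.
have := @derive_val _ _ _ _ _ _ _ h1; rewrite (@derive_val _ _ _ _ _ _ _ h2) => ->.
by rewrite scale0r addr0.
Qed.

Let open_nonzero : open [set x : E | x != 0].
Proof.
rewrite (_ : [set _ | _] = (@enorm R n.+1) @^-1` [set t | 0 < t]).
  apply: open_comp; last exact: open_gt.
  by move=> x _; exact: enorm_continuous.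
apply/seteqP; split=> x /=; first exact: enorm_gt0.
by move=> x0; rewrite -enorm_eq0 gt_eqF.
Qed.

Lemma smooth_unit_sphere : smooth_hypersurface (boundary B).
Proof.
rewrite boundary_unit_ball => p p1; exists [set x | x != 0], f; split.
  by rewrite /= -enorm_eq0 [enorm p]p1 oner_eq0.
split; [exact: open_nonzero|exact: smooth_f| |].
  move=> x /= x0; apply/eqP => g0; have := radial_derive x.
  rewrite -gradient_dot; last by apply: (Ck_differentiable (smooth_f openT 1)).
  by rewrite g0 dot0l => /esym/eqP; rewrite mulf_eq0 pnatr_eq0 /= dot_eq0 (negbTE x0).
have fE x : (f x = 0) <-> enorm x = 1.
  rewrite /f -enorm_sqr; split=> [/eqP|->]; last by rewrite expr1n subrr.
  by rewrite subr_eq0 sqrp_eq1 ?enorm_ge0// => /eqP.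
apply/seteqP; split=> x /= [h1 h2]; first by split=> //; apply/fE.
by split=> //; apply/fE.
Qed.

Let O0 := unit_ball0.
Let oO := open_unit_ball.
Let cO := convex_unit_ball.
Let sS := smooth_unit_sphere.

Lemma gauss_unit_ball p : sphere 1 p -> gauss B p = p.
Proof.
move=> p1; apply/esym/(gauss_unique O0 oO cO sS); [by rewrite boundary_unit_ball| |exact: p1].
move=> z; rewrite closure_unit_ball /= => z1; rewrite dotBl -enorm_sqr [enorm p]p1 expr1n subr_le0.
by apply: le_trans (dot_le z p) _; rewrite [enorm p]p1 mulr1.
Qed.

(** Along a chart of the sphere the Gauss map is the inclusion, so ['J phi = 'J phi *m M]. The frame
    consists of combinations of rows of ['J phi], whence [e = e *m M], and orthonormality reads off
    the curvatures. *)
Lemma principal_curvatures_unit_ball p : sphere 1 p -> principal_curvatures B p = const_mx 1.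
Proof.
move=> p1; have Sp : boundary B p by rewrite boundary_unit_ball.
have [W [g [i [V [h [Wp oW [oV sh] VS SV]]]]]] := graph_chart oO cO sS Sp.
have [Vx pE] := SV p Sp Wp.
have lp : local_parametrization (boundary B) V (fun x => ins i (h x) x).
  by apply: graph_parametrization => // x /VS[].
set phi := fun x => _ in lp; set x := del i p in Vx.
have px : phi x = p by exact/esym.
have [e [M [ee eN dg JM eM]]] := curvature_frame O0 oO cO sS lp Vx.
have gphi y : V y -> gauss B (phi y) = phi y.
  by move=> Vy; apply: gauss_unit_ball; rewrite -boundary_unit_ball; have [] := VS y Vy.
have JE : 'J phi x = 'J phi x *m M.
  by rewrite -JM; apply/esym; exact: (eq_open_jacobian oV Vx gphi dg).
have [_ _ _ rJ _] := lp.
have [hN _] := gaussP oO cO sS Sp; have NN := gauss_dot oO cO sS Sp.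
rewrite -px in hN NN.
have [C eE] := tangent_coordinates ee eN NN (rJ x Vx) (parametrization_normal lp Vx hN).
have : e = diag_mx (principal_curvatures B (phi x)) *m e by rewrite -eM {2}eE -mulmxA -JE.
move=> /(congr1 (mulmx^~ e^T)); rewrite -mulmxA ee mulmx1 px => D1.
apply/rowP => j; have := congr1 (fun A : 'M[R]_n => A j j) D1.
by rewrite !mxE eqxx !mulr1n => <-.
Qed.

Lemma sym_curv_unit_ball p : sphere 1 p -> sym_curv B n p = 1.
Proof.
move=> p1; rewrite /sym_curv /elementary_symmetric principal_curvatures_unit_ball//.
rewrite (bigD1 [set: 'I_n]%SET) ?cardsT ?card_ord//=.
rewrite [X in X + _]big1 => [|i _]; last by rewrite mxE.
rewrite big1 ?addr0// => A /andP[/eqP cA /negP[]]; apply/eqP/setP/subset_cardP; last by rewrite finset.subsetT.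
by rewrite cA cardsT card_ord.
Qed.

Variable theta : {measure set E -> \bar R}.
Hypothesis thetaS : is_area_measure (sphere 1) theta.

Lemma gauss_integral_unit_ball (F : E -> R) (M : R) : continuous F -> (forall x, 0 <= F x) ->
  1 <= M ->
  (lebesgue_rV n.+1).-integrable [set w | enorm w <= M + 2]
    (fun w => (pospart (1 - enorm w) * (enorm w * F ((enorm w)^-1 *: w)))%:E) /\
  \int[lebesgue_rV n.+1]_(w in [set w | enorm w <= M + 2])
    (pospart (1 - enorm w) * (enorm w * F ((enorm w)^-1 *: w))) =
  \int[theta]_(x in sphere 1) F x / (n + 2)%:R / (n + 3)%:R.
Proof.
move=> cF F0 M1; have muS : is_area_measure (boundary B) theta by rewrite boundary_unit_ball.
have [y|gi ->] := gauss_integral O0 oO bounded_unit_ball cO sS muS cF F0 (M := M).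
  by rewrite closure_unit_ball /= => /le_trans; exact.
split=> //.
congr (_ / _ / _); rewrite /curv_moment boundary_unit_ball; apply: eq_Rintegral => x /set_mem x1.
by rewrite sym_curv_unit_ball// mulr1 /= gauss_unit_ball.
Qed.

End unit_ball.

(** * Support functions and the equality case *)

Section support.
Context {R : realType} {n : nat}.
Local Notation E := 'rV[R]_n.+1.
Local Notation leb := (lebesgue_rV n.+1).

Lemma enorm_delta i : enorm (delta_mx ord0 i : E) = 1.
Proof.
rewrite /enorm dotE (bigD1 i)//= big1 ?addr0 => [|j ji]; last first.
  by rewrite !mxE (negbTE ji) mul0r.
by rewrite !mxE !eqxx mulr1 sqrtr1.
Qed.

Lemma closure_dot_le (A : set E) (x p : E) (c : R) :
  (forall z, A z -> dot z x <= c) -> closure A p -> dot p x <= c.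
Proof.
move=> h Ap; rewrite leNgt; apply/negP => cp.
have cd : continuous (fun z : E => dot z x).
  rewrite (_ : (fun _ => _) = fun z : E => \sum_i z ord0 i * x ord0 i); last first.
    by apply/funext => z; rewrite dotE.
  move=> z; apply: (@for_continuous_sum R E R _ _ xpredT) => i _.
  apply: for_continuousM; first exact: coordf_continuous.
  exact: for_continuous_cst.
have /open_nbhs_nbhs : open_nbhs p [set z | c < dot z x].
  by split=> //; apply: (@open_comp _ _ (fun z : E => dot z x) [set t | c < t]) => [z _|]; [exact: cd|exact: open_gt].
by move=> /Ap[z [/h /le_lt_trans zc /zc]]; rewrite ltxx.
Qed.

Lemma support_functionE (A : set E) (p x : E) : closure A p ->
  (forall z, A z -> dot z x <= dot p x) -> support_function A x = dot p x.
Proof.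
move=> Ap h; apply/eqP; rewrite eq_le; apply/andP; split.
  apply: ge_sup; last by move=> _ [z Az <-]; exact: h.
  by have [z [Az _]] := Ap setT filterT; exists (dot z x), z.
apply: closure_dot_le Ap => z Az; apply: ub_le_sup; last by exists z.
by exists (dot p x) => _ [y Ay <-]; exact: h.
Qed.

Lemma support_function_ge (A : set E) (M : R) (x z : E) :
  (forall y, A y -> enorm y <= M) -> closure A z -> dot z x <= support_function A x.
Proof.
move=> hM; apply: closure_dot_le => {}z Az; apply: ub_le_sup; last by exists z.
exists (M * enorm x) => _ [y Ay <-]; apply: le_trans (dot_le _ _) _.
by rewrite ler_wpM2r ?enorm_ge0// hM.
Qed.

Lemma support_function_continuous (A : set E) (M : R) : A !=set0 ->
  (forall y, A y -> enorm y <= M) -> continuous (support_function A).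
Proof.
move=> [a Aa] hM.
have M0 : 0 <= M by apply: le_trans (enorm_ge0 a) (hM a Aa).
have lip x y : support_function A x - support_function A y <= M * enorm (x - y).
  rewrite lerBlDl; apply: ge_sup; first by exists (dot a x), a.
  move=> _ [z Az <-]; rewrite -[x in dot z x](subrK y) addrC dotDr.
  have h := @support_function_ge A M y z hM (subset_closure Az).
  apply: lerD => //.
  by apply: le_trans (dot_le _ _) _; rewrite ler_wpM2r ?enorm_ge0// hM.
move=> x; apply/(continuous_epsP (V := E) (W := R)) => e e0.
have c0 : 0 < M * n.+1%:R + 1 by rewrite ltr_wpDl// mulr_ge0.
exists (e / (M * n.+1%:R + 1)) => [|y]; first by rewrite divr_gt0.
rewrite ltr_pdivlMr// => yx.
apply: (@le_lt_trans _ _ (M * (n.+1%:R * `|y - x|))); last first.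
  by have := normr_ge0 (y - x); move: yx; rewrite mulrDr mulr1; lra.
apply: (@le_trans _ _ (M * enorm (y - x))); last by rewrite ler_wpM2l// enorm_le_norm.
by rewrite ler_norml lip lerNl opprB enormB lip.
Qed.

Lemma support_function_eball (r : R) (x : E) : 0 <= r -> enorm x = 1 ->
  support_function (eball r) x = r.
Proof.
move=> r0 x1; have xx : dot (r *: x) x = r by rewrite dotZl -enorm_sqr x1 expr1n mulr1.
rewrite -[RHS]xx; apply: support_functionE.
  by apply: subset_closure; rewrite /eball /= enormZ x1 mulr1 ger0_norm.
by move=> z zr; rewrite xx; apply: le_trans (dot_le _ _) _; rewrite x1 mulr1.
Qed.

Lemma lebesgue_homothety (t : R) (c : E) (A : set E) : 0 < t -> measurable A ->
  measurable [set w : E | A (t^-1 *: w + c)] /\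
  leb [set w : E | A (t^-1 *: w + c)] = ((t ^+ n.+1)%:E * leb A)%E.
Proof.
move=> t0 mA; have mc : measurable [set y : E | A (y + c)].
  have mt : measurable_fun setT (fun y : E => y + c).
    rewrite (_ : (fun _ => _) = fun y : E => y *m 1%:M + c); first exact: measurable_rV_lin.
    by apply/funext => y; rewrite mulmx1.
  by have := mt measurableT A mA; rewrite setTI; apply.
have := lebesgue_rV_scale (c := t^-1) _ mc; rewrite invr_gt0 => /(_ t0).
rewrite (lebesgue_rV_translate c mA) exprVn invrK => <-; split=> //.
by have := @measurable_scale R n t^-1 measurableT _ mc; rewrite setTI; apply.
Qed.

Variable Omega : set E.
Hypotheses (O0 : Omega !=set0) (oO : open Omega) (bO : bounded_set Omega).
Hypothesis cO : convex_set Omega.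
Local Notation K := (closure Omega).
Local Notation S := (boundary Omega).

Let cK := compact_domain_closure bO.
Let K0 := domain_closure0 O0.
Let cvK := domain_closure_segment cO.

(** The point [z] is replaced by a nearby [z'] in [Omega], and the error is compensated by moving
    [x] to [x'], still in [Omega] because that set is open. *)
Lemma domain_closure_interior (x z : E) (t : R) : Omega x -> K z -> 0 <= t < 1 ->
  Omega (x + t *: (z - x)).
Proof.
move=> Ox Kz /andP[t0 t1]; have [d d0 hd] := open_norm_ball oO Ox.
have s0 : 0 < 1 - t by rewrite subr_gt0.
have [z' [Oz' zz']] : (Omega `&` [set z' | `|z' - z| < (1 - t) * d]) !=set0.
  by apply: Kz; apply: (norm_ball_nbhs (mulr_gt0 s0 d0)).
pose x' := x + (t / (1 - t)) *: (z - z').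
have Ox' : Omega x'.
  apply: hd; rewrite /x' addrAC subrr add0r normrZ distrC ger0_norm ?divr_ge0 ?(ltW s0)//.
  apply: (@le_lt_trans _ _ ((1 - t)^-1 * `|z' - z|)).
    by rewrite ler_wpM2r// ler_piMl ?invr_ge0 ?(ltW s0)// ltW.
  by rewrite mulrC ltr_pdivrMr// mulrC.
have -> : x + t *: (z - x) = x' + t *: (z' - x').
  rewrite /x'; apply/rowP => i; rewrite !mxE.
  by field; rewrite gt_eqF.
by apply: domain_segment => //; rewrite t0 ltW.
Qed.

(** Shrunk towards a point of [Omega] by a factor [t < 1], the closure lies in [Omega]; let [t] tend
    to one in the volume inequality. This links [I_(-1)], defined with [Omega], to integrals over
    the closure. *)
Lemma lebesgue_domain_closure : leb K = leb Omega.
Proof.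
have mK : measurable K by exact: measurable_domain_closure.
have mO : measurable Omega by exact: open_measurable_rV.
have [M M0 hM] := bounded_domain_closure bO.
have fK : (leb K < +oo)%E by exact: (lebesgue_enorm_bounded mK hM).
have OK : (leb Omega <= leb K)%E.
  by apply: le_measure; rewrite ?inE//; exact: subset_closure.
have fO : (leb Omega < +oo)%E by exact: le_lt_trans OK fK.
apply/eqP; rewrite eq_le OK andbT.
have [x Ox] := O0.
have shrink (t : R) : 0 < t < 1 -> ((t ^+ n.+1)%:E * leb K <= leb Omega)%E.
  move=> /andP[t0 t1]; pose c := (1 - t^-1) *: x.
  have [mW <-] := lebesgue_homothety c t0 mK.
  apply: le_measure; rewrite ?inE//.
  move=> w /= Kw; have -> : w = x + t *: ((t^-1 *: w + c) - x).
    rewrite /c; apply/rowP => i; rewrite !mxE; field; rewrite gt_eqF//.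
  by apply: domain_closure_interior => //; rewrite (ltW t0).
have aE : leb K = (fine (leb K))%:E by rewrite fineK// ge0_fin_numE.
have bE : leb Omega = (fine (leb Omega))%:E by rewrite fineK// ge0_fin_numE.
rewrite aE bE lee_fin; rewrite aE bE in shrink.
move: (fine (leb K)) (fine (leb Omega)) shrink => a b shrink.
rewrite leNgt; apply/negP => ba.
have ca : {for (1 : R), continuous (fun t : R => t ^+ n.+1 * a)}.
  apply: (@for_continuousM R R); first exact: exprn_continuous.
  exact: for_continuous_cst.
move/(continuous_epsP (V := R) (W := R)) : ca => /(_ (a - b)).
rewrite subr_gt0 => /(_ ba)[d d0 hd].
pose e := Num.min (1 / 2) (d / 2).
have e0 : 0 < e by rewrite lt_min !divr_gt0.
have e1 : e <= 1 / 2 by rewrite ge_min lexx.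
have ed : e <= d / 2 by rewrite ge_min lexx orbT.
have := hd (1 - e); rewrite addrAC subrr add0r normrN gtr0_norm// => h.
have {}h : `|(1 - e) ^+ n.+1 * a - 1 ^+ n.+1 * a| < a - b by apply: h; lra.
have := shrink (1 - e); rewrite lee_fin => h2.
have {}h2 : (1 - e) ^+ n.+1 * a <= b by apply: h2; apply/andP; split; lra.
move: h; rewrite expr1n mul1r ltr_norml => /andP[h3 _].
by move: h2 h3; move: (_ * a) => u; lra.
Qed.

Hypothesis sS : smooth_hypersurface S.

Lemma support_function_gauss p : S p -> support_function Omega (gauss Omega p) = supp_dist Omega p.
Proof.
move=> Sp; have [hN _] := gaussP oO cO sS Sp; have [Kp _] := (boundaryE oO p).1 Sp.
apply: support_functionE => // z Oz.
by rewrite -subr_le0 -dotBl; apply: hN; exact: subset_closure.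
Qed.

(** Moving radially outwards, or in any direction when [q = 0]. Thus a farthest point of the closure
    from the origin must lie on the boundary. *)
Lemma open_far (q : E) : Omega q -> exists2 q', Omega q' & enorm q < enorm q'.
Proof.
move=> Oq; have [d d0 hd] := open_norm_ball oO Oq.
have [q0|q0] := eqVneq q 0.
  pose v : E := delta_mx ord0 ord0.
  have v1 : enorm v = 1 by exact: enorm_delta.
  exists ((d / 2) *: v); last by rewrite q0 enorm0 enormZ v1 mulr1 gtr0_norm ?divr_gt0.
  apply: hd; rewrite q0 subr0; apply: le_lt_trans (norm_le_enorm _) _.
  by rewrite enormZ v1 mulr1 gtr0_norm ?divr_gt0//; lra.
have q1 := enorm_gt0 q0; pose e := d / (2 * enorm q).
have e0 : 0 < e by rewrite divr_gt0// mulr_gt0.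
exists (q + e *: q); last first.
  rewrite -{2}[q]scale1r -scalerDl enormZ gtr0_norm ?addr_gt0//.
  by rewrite mulrDl mul1r ltrDl mulr_gt0.
apply: hd; rewrite addrAC subrr add0r; apply: le_lt_trans (norm_le_enorm _) _.
rewrite enormZ gtr0_norm// /e invfM mulrA mulfVK ?gt_eqF//; lra.
Qed.

(** A constant support function puts the closure in the ball of radius [r]. A point outside the
    closure has scalar product [r] plus its distance with the normal at its projection, so its norm
    exceeds [r]; closure and closed ball agree. *)
Lemma boundary_sphereP (r : R) :
  (forall x, enorm x = 1 -> support_function Omega x = r) -> 0 < r /\ boundary Omega = sphere r.
Proof.
move=> ur; have [M _ hM] := bounded_domain_closure bO.
have OM y : Omega y -> enorm y <= M by move=> Oy; apply: hM; exact: subset_closure.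
have Kr0 z : z != 0 -> K z -> enorm z <= r.
  move=> z0 Kz; have z1 := enorm_gt0 z0; pose x' := (enorm z)^-1 *: z.
  have x1 : enorm x' = 1 by rewrite /x' enormZ ger0_norm ?invr_ge0 ?(ltW z1)// mulVf ?gt_eqF.
  have := support_function_ge x' OM Kz; rewrite (ur _ x1) /x' dotZr -enorm_sqr expr2 mulrA.
  by rewrite mulVf ?mul1r// gt_eqF.
have r0 : 0 < r.
  have [x Ox] := O0; have [w Ow xw] := open_far Ox.
  have w0 : 0 < enorm w by exact: le_lt_trans (enorm_ge0 x) xw.
  have w0' : w != 0 by rewrite -enorm_eq0 gt_eqF.
  exact: lt_le_trans w0 (Kr0 w w0' (subset_closure Ow)).
have Kr z : K z -> enorm z <= r.
  by have [->|z0] := eqVneq z 0; [rewrite enorm0 => _; exact: ltW|exact: Kr0].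
have Sr p : S p -> dot p (gauss Omega p) = r.
  move=> Sp; have [_ g1] := gaussP oO cO sS Sp.
  by rewrite -(ur _ g1) support_function_gauss.
have nKr x : ~ K x -> r < enorm x.
  move=> Kx; have [Sp gE] := proj_boundary O0 oO bO cO sS Kx.
  have xE := gauss_proj_ray O0 oO bO cO sS Kx.
  have [_ g1] := gaussP oO cO sS Sp.
  have : dot x (gauss Omega (proj K x)) = r + edist K x.
    by rewrite {1}xE dotDl dotZl -[dot (gauss _ _) _]enorm_sqr g1 expr1n mulr1 Sr.
  have := dot_le x (gauss Omega (proj K x)); rewrite g1 mulr1.
  by have := edist_gt0 cK K0 cvK Kx; lra.
split=> //; apply/seteqP; split=> p.
  move=> Sp; have [Kp _] := (boundaryE oO p).1 Sp; apply/eqP; rewrite eq_le Kr//=.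
  have [_ g1] := gaussP oO cO sS Sp.
  by rewrite -(Sr p Sp) (le_trans (dot_le _ _))// g1 mulr1.
move=> pr; apply/(boundaryE oO p); split.
  by apply: contrapT => /nKr; rewrite [enorm p]pr ltxx.
move=> Op; have [q Oq pq] := open_far Op.
by have := Kr q (subset_closure Oq); rewrite -[r]pr leNgt pq.
Qed.

(** A farthest point of the closure from the origin is on the boundary, hence on the sphere. This
    bounds the norm on [Omega] by [r], and the supremum is approached at [r *: x]. *)
Lemma support_function_sphere (r : R) (x : E) : boundary Omega = sphere r -> 0 < r ->
  enorm x = 1 -> support_function Omega x = r.
Proof.
move=> Sr r0 x1.
have xx : dot (r *: x) x = r by rewrite dotZl -enorm_sqr x1 expr1n mulr1.
have Krx : K (r *: x).
  suff : S (r *: x) by move=> /(boundaryE oO)[].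
  by rewrite Sr /sphere /= enormZ x1 mulr1 gtr0_norm.
rewrite -[RHS]xx; apply: support_functionE => // z Oz; rewrite xx.
apply: le_trans (dot_le z x) _; rewrite x1 mulr1 leNgt; apply/negP => rz.
have cf : {within K, continuous (fun a : E => - enorm a)}.
  apply: continuous_subspaceT => a.
  apply/(continuous_epsP (V := E) (W := R)) => e e0.
  have /(continuous_epsP (V := E) (W := R))/(_ e e0)[d d0 hd] := @enorm_continuous R n.+1 a.
  by exists d => // y /hd h; rewrite -opprD normrN.
have [q /set_mem Kq hq] := EVT_min_rV K0 cK cf.
have qmax y : K y -> enorm y <= enorm q by move=> Ky; rewrite -lerN2; apply: hq; exact: mem_set.
have Oq : ~ Omega q.
  move=> /open_far[q' Oq']; rewrite ltNge qmax//; exact: subset_closure.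
have : S q by apply/(boundaryE oO).
rewrite Sr /sphere /= => qr; have := qmax z (subset_closure Oz); rewrite qr leNgt rz//.
Qed.

End support.

(** * Integrals over the unit sphere *)

Section sphere_integral.
Context {R : realType} {n : nat}.
Local Notation E := 'rV[R]_n.+1.
Local Notation leb := (lebesgue_rV n.+1).
Variable theta : {measure set E -> \bar R}.
Hypothesis thetaS : is_area_measure (sphere 1) theta.

Lemma integral_pos_on_open (D : set E) (G : E -> R) (w : E) (e c : R) : measurable D ->
  leb.-integrable D (EFin \o G) -> (forall y, D y -> 0 <= G y) -> 0 < e -> 0 < c ->
  (forall y, `|y - w| < e -> D y /\ c <= G y) -> 0 < \int[leb]_(y in D) G y.
Proof.
move=> mD iG G0 e0 c0 hw.
pose e2 := e / 2; have e20 : 0 < e2 by rewrite divr_gt0.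
pose b : set E := box (w - const_mx e2) (w + const_mx e2).
have mb : measurable b by exact: measurable_box.
have bw y : b y -> D y /\ c <= G y.
  move=> by_; apply: hw; apply/norm_ltP => // i.
  by have := by_ i; rewrite !mxE ltr_norml => /andP[h1 h2]; apply/andP; split; rewrite /e2 in h1 h2; lra.
have mG := measurable_int _ iG.
have lb : leb b = ((2 * e2) ^+ n.+1)%:E.
  rewrite lebesgue_rV_box; congr EFin; rewrite -[in RHS](card_ord n.+1) -prodr_const.
  apply: eq_bigr => i _; rewrite !mxE max_r; first by ring.
  by rewrite opprB; lra.
suff : ((c * (2 * e2) ^+ n.+1)%:E <= \int[leb]_(y in D) (G y)%:E)%E.
  rewrite -lte_fin /Rintegral fineK; last exact: integrable_fin_num.
  by apply: lt_le_trans; rewrite lte_fin mulr_gt0// exprn_gt0// mulr_gt0.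
apply: (@le_trans _ _ (\int[leb]_(y in b) (G y)%:E)%E); last first.
  by apply: ge0_subset_integral => // y /bw[].
rewrite EFinM -lb -integral_cst//; apply: ge0_le_integral => //.
- by move=> y _; rewrite lee_fin ltW.
- by apply: measurable_funS mG => // y /bw[].
- by move=> y /bw[_]; rewrite lee_fin.
Qed.

(** The comparison formula for the unit ball turns the integral into a volume integral of a
    nonnegative function, which would be positive around [x / 2] if [F x] were nonzero. *)
Lemma sphere_integral_eq0 (F : E -> R) : continuous F -> (forall x, 0 <= F x) ->
  \int[theta]_(x in sphere 1) F x = 0 -> forall x, enorm x = 1 -> F x = 0.
Proof.
move=> cF F0 I0 x x1; apply/eqP/negPn/negP => Fx.
have Fx0 : 0 < F x by rewrite lt_neqAle eq_sym Fx F0.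
have [iG] := gauss_integral_unit_ball thetaS cF F0 (lexx 1).
rewrite I0 !mul0r; set D := [set w | _] in iG *.
pose G (w : E) := pospart (1 - enorm w) * (enorm w * F ((enorm w)^-1 *: w)); move=> IG.
(* Halfway to the sphere the factors [1 - |w|] and [|w|] are both [1 / 2]; nearby they stay above
   [1 / 4], and [F] of the direction above [F x / 2]. *)
pose w : E := (1 / 2) *: x.
have w1 : enorm w = 1 / 2 by rewrite enormZ x1 mulr1 ger0_norm ?divr_ge0.
have dw : (enorm w)^-1 *: w = x by rewrite w1 scalerA mulVf ?scale1r// gt_eqF// divr_gt0.
have cG : {for w, continuous (fun w => F ((enorm w)^-1 *: w))}.
  apply: (@continuous_comp _ _ _ (fun w : E => (enorm w)^-1 *: w) F); last exact: cF.
  apply: (@for_continuousZ R E E (fun y => (enorm y)^-1) id); last exact: cvg_id.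
  apply: (@cvgV _ _ (nbhs w) _ (@enorm R n.+1) (enorm w)); last exact: enorm_continuous.
  by rewrite w1 gt_eqF// divr_gt0.
have F2 : 0 < F x / 2 by rewrite divr_gt0.
have q0 : 0 < 1 / 4 :> R by rewrite divr_gt0.
move/(continuous_epsP (V := E) (W := R)) : cG => /(_ _ F2)[d d0 hd].
have /(continuous_epsP (V := E) (W := R))/(_ _ q0)[d' d'0 hd'] := @enorm_continuous R n.+1 w.
have mD : measurable D by exact: measurable_enorm_le.
have G0 y : D y -> 0 <= G y.
  by move=> _; rewrite /G !mulr_ge0 ?enorm_ge0// /pospart le_max lexx.
have : 0 < \int[leb]_(y in D) G y; last by rewrite IG ltxx.
apply: (@integral_pos_on_open D G w (Num.min d d') (1 / 4 * (1 / 4 * (F x / 2)))) => //.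
- by rewrite lt_min d0.
- by rewrite !mulr_gt0.
move=> y; rewrite lt_min => /andP[/hd h1 /hd' h2]; rewrite dw in h1; rewrite w1 in h2.
move: h1 h2; rewrite !ltr_norml => /andP[h1 _] /andP[h2 h3].
split; first by rewrite /D /=; lra.
rewrite /G /pospart max_r; last by lra.
have f1 : F x / 2 <= F ((enorm y)^-1 *: y) by lra.
have g2 : 1 / 4 <= enorm y by lra.
have g3 : 1 / 4 <= 1 - enorm y by lra.
by rewrite ler_pM// ?ler_pM// ?mulr_ge0// ltW.
Qed.

Lemma sphere_area_gt0 : 0 < fine (theta (sphere 1)).
Proof.
rewrite lt_neqAle fine_ge0 ?andbT// eq_sym; apply/eqP => h.
have ms : measurable (sphere 1 : set E).
  by apply: closed_measurable_rV; apply: compact_closed => //; exact: compact_sphere.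
have c1 : continuous (fun _ : E => 1 : R) by move=> y; exact: for_continuous_cst.
have := sphere_integral_eq0 c1 (fun _ => ler01).
rewrite Rintegral_cst// h mulr0 => /(_ erefl _ (enorm_delta ord0)) /eqP.
by rewrite oner_eq0.
Qed.

Variable Omega : set E.
Hypotheses (O0 : Omega !=set0) (oO : open Omega) (bO : bounded_set Omega).
Hypothesis cO : convex_set Omega.
Hypothesis sS : smooth_hypersurface (boundary Omega).
Variable mu : {measure set E -> \bar R}.
Hypothesis muS : is_area_measure (boundary Omega) mu.

(* The Gauss map pushes the measure [H_n dmu] forward to the area of the sphere. *)
Lemma sphere_integral (F : E -> R) : continuous F -> (forall x, 0 <= F x) ->
  \int[theta]_(x in sphere 1) F x = curv_moment Omega mu (F \o gauss Omega) n.
Proof.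
move=> cF F0; have [M _ hM] := bounded_domain_closure bO.
(* The maximum with [1] makes one domain of integration admissible for both [Omega] and the unit
   ball. *)
have hM' y : closure Omega y -> enorm y <= Num.max M 1 by move=> /hM yM; rewrite le_max yM.
have [_ IO] := gauss_integral O0 oO bO cO sS muS cF F0 hM'.
have M1 : 1 <= Num.max M 1 by rewrite le_max lexx orbT.
have [_] := gauss_integral_unit_ball thetaS cF F0 M1; rewrite IO.
have n2 : (n + 2)%:R != 0 :> R by rewrite pnatr_eq0; lia.
have n3 : (n + 3)%:R != 0 :> R by rewrite pnatr_eq0; lia.
by move=> /(mulIf (invr_neq0 n3)) /(mulIf (invr_neq0 n2)).
Qed.

End sphere_integral.

(** * Curvature integrals as moments of the support function *)

Section curvature_integrals.
Context {R : realType} {n : nat}.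
Local Notation E := 'rV[R]_n.+1.
Variable Omega : set E.
Hypotheses (O0 : Omega !=set0) (oO : open Omega) (bO : bounded_set Omega).
Hypothesis cO : convex_set Omega.
Local Notation S := (boundary Omega).
Hypothesis sS : smooth_hypersurface S.
Variable mu : {measure set E -> \bar R}.
Hypothesis muS : is_area_measure S mu.
Hypothesis n1 : (1 <= n)%N.
Local Notation I := (curvature_integral Omega mu).
Local Notation v := (supp_dist Omega).
Local Notation moment := (curv_moment Omega mu).

Let mS : measurable S.
Proof. by apply: closed_measurable_rV; exact: closed_boundary. Qed.

Lemma moment_integrable (c : E -> R) j : bounded_measurable S c ->
  mu.-integrable S (EFin \o (fun p => c p * sym_curv Omega j p)).
Proof.
move=> bc; apply: (area_integrable O0 oO bO cO sS muS); apply: bounded_measurableM => //.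
exact: (bounded_measurable_sym_curv O0 oO bO cO sS muS).
Qed.

Lemma curvature_integral_moment (k : nat) : I k = ('C(n, k)%:R)^-1 * moment (fun=> 1) k.
Proof.
rewrite /curvature_integral -RintegralZl//; last first.
  by apply: moment_integrable; exact: bounded_measurable_cst.
by apply: eq_Rintegral => p _; rewrite mul1r.
Qed.

(** Minkowski's formula at [j = n.-1], where [n - j] is one and the binomial coefficient [n] cancels
    the factor on the right. *)
Lemma curvature_integral_support : I (n%:Z - 1) = moment v n.
Proof.
rewrite (_ : n%:Z - 1 = n.-1); last by lia.
rewrite curvature_integral_moment.
have := minkowski_formula O0 oO bO cO sS muS n.-1; rewrite prednK// => h.
have nC : 'C(n, n.-1) = n by rewrite -subn1 bin_sub// bin1.
rewrite nC; have n0 : n%:R != 0 :> R by rewrite pnatr_eq0; lia.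
apply: (mulfI n0); rewrite mulrA divff// mul1r -h -natrB ?leq_pred//.
by rewrite (_ : (n - n.-1)%N = 1%N) ?mul1r//; lia.
Qed.

(** Minkowski's formula at [j = n - 2], together with [2 * 'C(n, 2) = n * n.-1]. For [n = 1] the
    integral is a multiple of the volume and [minkowski_volume] takes over. *)
Lemma curvature_integral_support_pred : n%:R * I (n%:Z - 2) = moment v n.-1.
Proof.
have [n2|n2] := leqP 2 n; last first.
  have nE : n = 1%N by lia.
  rewrite (_ : n%:Z - 2 = Negz 0); last by rewrite nE.
  rewrite /= -(lebesgue_domain_closure O0 oO bO cO) (minkowski_volume O0 oO bO cO sS muS).
  have nR : n%:R = 1 :> R by rewrite nE.
  have np : n.-1 = 0%N by lia.
  by rewrite nR mul1r np.
rewrite (_ : n%:Z - 2 = (n - 2)%N); last by lia.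
rewrite curvature_integral_moment bin_sub//.
have := minkowski_formula O0 oO bO cO sS muS (n - 2).
rewrite (_ : (n - 2).+1 = n.-1); last by lia.
rewrite -natrB ?leq_subr// (_ : (n - (n - 2))%N = 2%N); last by lia.
move: (moment _ _) (moment _ _) => a b h.
have C2 : 2 * 'C(n, 2)%:R = n%:R * n.-1%:R :> R.
  by rewrite -!natrM; congr _%:R; have := bin_ffact n 2; rewrite ffactnS ffactn1 mulnC.
have nn : n%:R != 0 :> R by rewrite pnatr_eq0; lia.
have np : n.-1%:R != 0 :> R by rewrite pnatr_eq0; lia.
have C0 : 'C(n, 2)%:R != 0 :> R by rewrite pnatr_eq0 -lt0n bin_gt0.
apply: (mulfI np); rewrite -h mulrA [n.-1%:R * _]mulrC -C2.
by field.
Qed.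

Lemma curvature_integral_ge0 (k : nat) : 0 <= I k.
Proof.
rewrite /curvature_integral Rintegral_ge0// => p Sp.
by rewrite mulr_ge0 ?invr_ge0//; exact: (sym_curv_ge0 O0 oO cO sS).
Qed.

Lemma integral_position_sqr :
  \int[mu]_(x in S) (mean_curvature Omega n x * enorm x ^+ 2) = moment (fun p => dot p p) n.
Proof.
by apply: eq_Rintegral => p _; rewrite /mean_curvature binn invr1 mul1r enorm_sqr mulrC.
Qed.

Lemma moment_sqr_diff (r : R) :
  moment (fun p => (v p - r) ^+ 2) n =
  moment (fun p => v p * v p) n - 2 * r * moment v n + r ^+ 2 * moment (fun=> 1) n.
Proof.
have bv := bounded_measurable_supp O0 oO bO cO sS.
have b1 : bounded_measurable S (fun _ : E => 1 : R) by exact: bounded_measurable_cst.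
have bvv := bounded_measurableM bv bv.
have bc (a : R) (h : E -> R) : bounded_measurable S h -> bounded_measurable S (fun p => a * h p).
  by move=> bh; apply: bounded_measurableM => //; exact: bounded_measurable_cst.
have ih (h : E -> R) : bounded_measurable S h ->
    mu.-integrable S (EFin \o (fun p => h p * sym_curv Omega n p)) by exact: moment_integrable.
have mD (h1 h2 : E -> R) : bounded_measurable S h1 -> bounded_measurable S h2 ->
    moment (fun p => h1 p + h2 p) n = moment h1 n + moment h2 n.
  move=> bh1 bh2; rewrite /curv_moment -RintegralD//; try exact: ih.
  by apply: eq_Rintegral => p _; rewrite mulrDl.
have mZ (a : R) (h : E -> R) : bounded_measurable S h -> moment (fun p => a * h p) n = a * moment h n.
  move=> bh; rewrite /curv_moment -RintegralZl//; last exact: ih.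
  by apply: eq_Rintegral => p _; rewrite mulrA.
rewrite (_ : (fun p => (v p - r) ^+ 2) =
    fun p => (v p * v p + (- (2 * r)) * v p) + r ^+ 2 * 1); last by apply/funext => p; ring.
rewrite mD ?mD ?mZ//; last 3 first.
- exact: bc.
- by apply: bounded_measurableD => //; exact: bc.
- exact: bc.
by rewrite mulNr.
Qed.

End curvature_integrals.

Unset Implicit Arguments.

(* mu is the area measure of the boundary of Omega, theta that of the unit
   sphere. *)
Theorem corollary1p2 (R : realType) (n : nat) (Omega : set 'rV[R]_n.+1)
    (mu theta : {measure set 'rV[R]_n.+1 -> \bar R}) :
  (1 <= n)%N ->
  Omega !=set0 -> open Omega -> bounded_set Omega -> convex_set Omega ->
  smooth_hypersurface (boundary Omega) ->
  is_area_measure (boundary Omega) mu ->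
  is_area_measure (sphere 1) theta ->
  let omega := fine (theta (sphere 1)) in
  let I := curvature_integral Omega mu in
  let lhs := n%:R * delta2 theta Omega (eball (I (n%:Z - 1) / omega)) ^+ 2 in
  let rhs :=
    \int[mu]_(x in boundary Omega) (mean_curvature Omega n x * enorm x ^+ 2)
    - n.+1%:R / omega * I (n%:Z - 1) ^+ 2 + n%:R * I (n%:Z - 2) in
  lhs <= rhs /\
  (lhs = rhs <-> exists2 r : R, 0 < r & boundary Omega = sphere r).
Proof.
move=> n1 O0 oO bO cO sS muS thetaS omega I lhs rhs.
have w0 : 0 < omega by exact: sphere_area_gt0 thetaS.
have IE : I (n%:Z - 1) = curv_moment Omega mu (supp_dist Omega) n.
  exact: (curvature_integral_support O0 oO bO cO sS muS n1).
(* A nonnegative radius is what makes the support function of [eball] equal to it on unit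
   vectors. *)
have I0 : 0 <= I (n%:Z - 1).
  by rewrite (_ : n%:Z - 1 = n.-1); [exact: (curvature_integral_ge0 O0 oO cO sS)|lia].
pose r := I (n%:Z - 1) / omega.
have r0 : 0 <= r by rewrite divr_ge0// ltW.
have [M _ hM] := bounded_domain_closure bO.
have OM y : Omega y -> enorm y <= M by move=> Oy; apply: hM; exact: subset_closure.
pose u := support_function Omega; pose F (x : 'rV[R]_n.+1) := (u x - r) ^+ 2.
have cF : continuous F.
  move=> x; rewrite /F; under eq_fun do rewrite expr2.
  have cu : {for x, continuous (fun x => u x - r)}.
    by apply: for_continuousD; [exact: support_function_continuous O0 OM x|exact: for_continuous_cst].
  exact: (for_continuousM cu cu).
have F0 x : 0 <= F x by exact: sqr_ge0.
pose W := \int[theta]_(x in sphere 1) F x.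
have W0 : 0 <= W by exact: Rintegral_ge0.
have lhsE : lhs = n%:R * W.
  rewrite /lhs /delta2 sqr_sqrtr; last by apply: Rintegral_ge0 => x _; exact: sqr_ge0.
  by congr (_ * _); apply: eq_Rintegral => x /set_mem x1; rewrite support_function_eball.
have ms : measurable (sphere 1 : set 'rV[R]_n.+1).
  by apply: closed_measurable_rV; apply: compact_closed => //; exact: compact_sphere.
have omegaE : curv_moment Omega mu (fun=> 1) n = omega.
  have c1 : continuous (fun _ : 'rV[R]_n.+1 => 1 : R) by move=> y; exact: for_continuous_cst.
  rewrite -[LHS](sphere_integral thetaS O0 oO bO cO sS muS c1 (fun _ => ler01)).
  by rewrite Rintegral_cst// mul1r.
(* The usual variance computation: [omega] is the moment of [1] and [omega * r] that of the support
   function, so the terms in [r] combine to [- I^2 / omega]. *)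
have WE : W = curv_moment Omega mu (fun p => supp_dist Omega p * supp_dist Omega p) n
    - I (n%:Z - 1) ^+ 2 / omega.
  rewrite /W (sphere_integral thetaS O0 oO bO cO sS muS cF F0).
  rewrite (_ : curv_moment _ _ _ _ = curv_moment Omega mu (fun p => (supp_dist Omega p - r) ^+ 2) n).
    rewrite (moment_sqr_diff O0 oO bO cO sS muS) omegaE -IE /r.
    by field; rewrite gt_eqF.
  apply: eq_Rintegral => p /set_mem Sp; rewrite /= /F /u.
  by rewrite (support_function_gauss oO cO sS Sp).
have rhsE : rhs = n.+1%:R * W.
  rewrite /rhs integral_position_sqr (curvature_integral_support_pred O0 oO bO cO sS muS n1).
  have := curvature_identity O0 oO bO cO sS muS n1; rewrite WE mulrBr => <-.
  by ring.
have n1R : n.+1%:R = n%:R + 1 :> R by rewrite natr1.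
split; first by rewrite lhsE rhsE n1R mulrDl mul1r lerDl.
have eqW : (lhs = rhs) <-> W = 0.
  by rewrite lhsE rhsE n1R mulrDl mul1r; split=> [h|->]; [lra|rewrite addr0].
apply: (iff_trans eqW); split=> [WZ|[r' r'0 Sr]].
  have uE x : enorm x = 1 -> support_function Omega x = r.
    move=> x1; have /eqP := sphere_integral_eq0 thetaS cF F0 WZ x1.
    by rewrite sqrf_eq0 subr_eq0 => /eqP.
  by have [? ?] := boundary_sphereP O0 oO bO cO sS uE; exists r.
have uE x : enorm x = 1 -> u x = r' by exact: support_function_sphere.
(* [r] is the mean of the support function for the measure [e_n dmu], and along the Gauss map that
   function is constantly [r']. *)
have rr : r = r'.
  rewrite /r IE -omegaE (_ : curv_moment _ _ _ n = r' * curv_moment Omega mu (fun=> 1) n).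
    by rewrite mulfK// omegaE gt_eqF.
  rewrite /curv_moment -RintegralZl.
  - apply: eq_Rintegral => p /set_mem Sp; rewrite mul1r; congr (_ * _).
    rewrite -(support_function_gauss oO cO sS Sp); apply: uE.
    by have [] := gaussP oO cO sS Sp.
  - by apply: closed_measurable_rV; exact: closed_boundary.
  - by apply: (moment_integrable O0 oO bO cO sS muS); exact: bounded_measurable_cst.
rewrite /W (_ : \int[theta]_(x in sphere 1) F x = \int[theta]_(x in sphere 1) 0).
  by rewrite Rintegral_cst// mul0r.
by apply: eq_Rintegral => x /set_mem x1; rewrite /F uE// rr subrr expr0n.
Qed.
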